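(* For every even integer $n\ge 6$ there exists a subgroup $G\subset \mathfrak{S}_n$ with $G\simeq C_2^2$ (where $C_2$ is the cyclic group of order two) such that $$\mathrm{H}^1(G,\mathrm{Pic}(\overline{\mathcal M}_{0,n}))\cong \mathbb{Z}/2 .$$ In particular: (i) for every subgroup of $\mathfrak{S}_n$ containing $G$, the corresponding action on $\overline{\mathcal M}_{0,n}$ (by permutation of the marked points) is not stably linearizable; (ii) for every field $F$ admitting a Galois extension $L/F$ with Galois group $\mathrm{Gal}(L/F)\simeq G$, there exists a form $X$ of $\overline{\mathcal M}_{0,n}$ over $F$ such that $X$ is not retract rational over $F$.
   Context: $\overline{\mathcal M}_{0,n}$ is the Deligne–Mumford–Knudsen moduli space of stable $n$-pointed curves of genus zero; $\mathfrak{S}_n$ acts on it by permuting the marked points, and hence acts on its (geometric) Picard group $\mathrm{Pic}(\overline{\mathcal M}_{0,n})$, a free abelian group of rank $2^{n-1}-\binom n2-1$. A generically free regular action of a finite group $G$ on a projective variety $X$ is linearizable if $X$ is $G$-equivariantly birational to $\mathbb{P}(V)$ for a linear representation $V$ of $G$; it is stably linearizable if $X\times\mathbb{P}^r$, with trivial action on the second factor, is linearizable for some $r$. A form of $\overline{\mathcal M}_{0,n}$ over $F$ is an $F$-variety that becomes isomorphic to $\overline{\mathcal M}_{0,n}$ over an algebraic closure of $F$. A variety $X$ over $F$ is retract rational over $F$ if the identity of some nonempty open subset of $X$ factors, as a composition of $F$-morphisms, through a nonempty open subset of some affine space over $F$. *)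

(* Defs.v *)
(* Varieties are handled in Chevalley's language: an integral separated scheme
   of finite type over a field is determined by the set of its local rings,
   seen as subrings of a field containing its function field.  Thus a point is
   a set [O : set K], a scheme is a set [X : set (set K)] of points, and the
   generic point is the function field itself. *)
From HB Require Import structures.
From mathcomp Require Import all_boot all_order all_algebra all_fingroup.
From mathcomp Require Import all_solvable all_field all_character.
From mathcomp Require Import fraction generic_quotient ring_quotient.
From mathcomp Require Import boolp classical_sets functions.
From mathcomp Require Import mpoly.

Set Implicit Arguments.
Unset Strict Implicit.
Unset Printing Implicit Defensive.

Import GRing.Theory.
Local Open Scope quotient_scope.
Local Open Scope classical_set_scope.
Local Open Scope ring_scope.

Section Points.
Variable K : fieldType.
Implicit Types (A P O V : set K) (X U : set (set K)).

Definition is_subring A :=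
  [/\ A 1, (forall x y, A x -> A y -> A (x - y))
         & (forall x y, A x -> A y -> A (x * y))].

Definition is_subfield A := is_subring A /\ (forall x, A x -> A x^-1).

Definition prime_ideal A P :=
  [/\ P `<=` A, P 0 /\ ~ P 1,
      (forall x y, P x -> P y -> P (x - y)),
      (forall a x, A a -> P x -> P (a * x))
    & (forall x y, A x -> A y -> P (x * y) -> P x \/ P y)].

Definition localization A P : set K :=
  [set x | exists a b, [/\ A a, A b, ~ P b & x = a / b]].

(* Spec A, as the set of its local rings. *)
Definition Aff A : set (set K) := [set localization A P | P in prime_ideal A].

Definition dominates O V := O `<=` V /\ (forall x, O x -> V x^-1 -> O x^-1).

Definition valuation_ring V := is_subring V /\ (forall x, V x \/ V x^-1).

(* Valuative criterion: a valuation ring has at most one centre. *)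
Definition separated X := forall O O' V, X O -> X O' -> valuation_ring V ->
  dominates O V -> dominates O' V -> O = O'.

Definition funfield X : set K := smallest is_subfield (\bigcup_(O in X) O).

(* Zariski topology: a basis of opens consists of the loci where finitely many
   rational functions are all regular. *)
Definition zopen X U := U `<=` X /\ forall O, U O ->
  exists s : seq K, [set` s] `<=` O /\
    forall O', X O' -> [set` s] `<=` O' -> U O'.

End Points.

Section OverField.
Variables (F K : fieldType) (i : F -> K).

Definition algebra_gen (S : set K) := smallest (@is_subring K) (range i `|` S).

Definition fg_algebra (A : set K) := exists s : seq K, A = algebra_gen [set` s].

(* An F-variety with function field exactly K. *)
Definition is_variety (X : set (set K)) :=
  separated X /\
  exists (m : nat) (A : 'I_m.+1 -> set K),
    (forall l, fg_algebra (A l) /\ localization (A l) [set 0] = setT) /\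
    X = \bigcup_l Aff (A l).

(* [Aff A] is then automatically open in X, X being separated. *)
Definition affine_open (X : set (set K)) (A : set K) :=
  fg_algebra A /\ Aff A `<=` X.

(* Closure of the image of the rational map (f_q)_(q in D) to (P^1)^D: in the
   chart where the coordinates q with [~~ s q] have been inverted, it is the
   spectrum of the algebra generated by the f_q^{+1} and f_q^{-1}. *)
Definition P1_closure (I : Type) (D : set I) (f : I -> K) : set (set K) :=
  \bigcup_(s in [set: I -> bool])
    Aff (algebra_gen [set (if s q then f q else (f q)^-1) | q in D]).

End OverField.

(* A morphism: the map on points, and the comorphism, a single map on rational
   functions of the target because the source is integral.  It is only
   meaningful on functions regular at some point of the image, so the
   morphism need not be dominant. *)
Record mor (K K' : fieldType) :=
  Mor { on_points : set K -> set K'; comor : K' -> K }.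

Section Morphisms.
Variables (F K K' : fieldType) (i : F -> K) (i' : F -> K').

Definition is_morphism (U : set (set K)) (V : set (set K')) (f : mor K K') :=
  [/\ (forall O, U O -> V (on_points f O)),
      (forall O, U O ->
         [/\ comor f @` on_points f O `<=` O,
             comor f 1 = 1,
             (forall x y, on_points f O x -> on_points f O y ->
                comor f (x - y) = comor f x - comor f y),
             (forall x y, on_points f O x -> on_points f O y ->
                comor f (x * y) = comor f x * comor f y)
           & (forall x, on_points f O x -> comor f x != 0 ->
                O (comor f x)^-1 -> on_points f O x^-1)]),
      (forall c, comor f (i' c) = i c)
    & (forall W, zopen V W -> zopen U (U `&` on_points f @^-1` W))].

End Morphisms.

(* g o f is the identity of U. *)
Definition retraction (K K' : fieldType) (U : set (set K))
    (f : mor K K') (g : mor K' K) :=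
  forall O, U O -> on_points g (on_points f O) = O /\
    forall x, O x -> comor f (comor g x) = x.

Definition isomorphic (F K K' : fieldType) (i : F -> K) (i' : F -> K')
    (X : set (set K)) (Y : set (set K')) :=
  exists (f : mor K K') (g : mor K' K),
    [/\ is_morphism i i' X Y f, is_morphism i' i Y X g,
        retraction X f g & retraction Y g f].

(* Rational functions: K(t_0, ..., t_(m-1)). *)
Notation ratfun K m := {fraction {mpoly K[m]}}.

Definition ratC (K : fieldType) (m : nat) (c : K) : ratfun K m :=
  FracField.tofrac (mpolyC m c).

Definition ratX (K : fieldType) (m : nat) (l : 'I_m) : ratfun K m :=
  FracField.tofrac (mpolyX K U_(l)%MM).

(* Apply h to the coefficients and send t_l to v l. *)
Definition ratsubst (K E : fieldType) (m : nat) (h : K -> E) (v : 'I_m -> E)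
    (x : ratfun K m) : E :=
  mmap h v \n_(repr x) / mmap h v \d_(repr x).

Definition affine_space (F : fieldType) (m : nat) : set (set (ratfun F m)) :=
  Aff (range (@FracField.tofrac {mpoly F[m]})).
Arguments affine_space : clear implicits.

(* X x P^r, in K(t_0, ..., t_r) with t_0, ..., t_r homogeneous coordinates. *)
Definition times_proj (F K : fieldType) (i : F -> K) (X : set (set K))
    (r : nat) : set (set (ratfun K r.+1)) :=
  \bigcup_(A in affine_open i X) \bigcup_l
    Aff (smallest (@is_subring _)
      (@ratC K r.+1 @` A `|` range (fun j => ratX K j / ratX K l))).

Arguments times_proj {F K} i X r : rename.

(* P^d = Spec F x P^d. *)
Definition proj_space (F : fieldType) (d : nat) : set (set (ratfun F d.+1)) :=
  times_proj (@id F) [set setT] d.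
Arguments proj_space : clear implicits.

Definition retract_rational (F K : fieldType) (i : F -> K) (X : set (set K)) :=
  exists (U : set (set K)) (m : nat) (V : set (set (ratfun F m)))
         (f : mor K (ratfun F m)) (g : mor (ratfun F m) K),
    [/\ zopen X U /\ U !=set0,
        zopen (affine_space F m) V /\ V !=set0,
        is_morphism i (@ratC F m) U V f,
        is_morphism (@ratC F m) i V U g
      & retraction U f g].

(* [a g] and [b g] are right actions of G by field automorphisms over F; g
   induces the bijection O |-> (a g)^{-1}(O) on points. *)
Definition equivariantly_birational (F K K' : fieldType)
    (i : F -> K) (i' : F -> K') (gT : finGroupType) (G : {group gT})
    (a : gT -> K -> K) (b : gT -> K' -> K')
    (X : set (set K)) (Y : set (set K')) :=
  exists (U : set (set K)) (W : set (set K'))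
         (f : mor K K') (f' : mor K' K),
    [/\ [/\ zopen X U, U !=set0
           & forall g O, g \in G -> U O -> U (a g @^-1` O)],
        [/\ zopen Y W, W !=set0
           & forall g O, g \in G -> W O -> W (b g @^-1` O)],
        is_morphism i i' U W f /\ is_morphism i' i W U f',
        retraction U f f' /\ retraction W f' f
      & forall g O, g \in G -> U O ->
          on_points f (a g @^-1` O) = b g @^-1` on_points f O /\
          forall x, on_points f (a g @^-1` O) x ->
            comor f (b g x) = a g (comor f x)].

(* Action of a linear representation V on the homogeneous coordinates of
   P(V). *)
Definition lin_act (F : fieldType) (gT : finGroupType) (G : {group gT})
    (d : nat) (rV : mx_representation F G d.+1) (g : gT)
    : ratfun F d.+1 -> ratfun F d.+1 :=
  ratsubst (@ratC F d.+1)
    (fun l => \sum_(j < d.+1) ratC d.+1 (rV g l j) * ratX F j).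

Definition linearizable (F K : fieldType) (i : F -> K) (gT : finGroupType)
    (G : {group gT}) (a : gT -> K -> K) (X : set (set K)) :=
  exists (d : nat) (rV : mx_representation F G d.+1),
    equivariantly_birational i (@ratC F d.+1) G a (lin_act rV)
      X (proj_space F d).

(* G acts trivially on the factor P^r. *)
Definition stably_linearizable (F K : fieldType) (i : F -> K)
    (gT : finGroupType) (G : {group gT}) (a : gT -> K -> K) (X : set (set K)) :=
  exists r : nat,
    linearizable (@ratC K r.+1 \o i) G
      (fun g => ratsubst (@ratC K r.+1 \o a g) (@ratX K r.+1))
      (times_proj i X r).

(* Base change along F -> Fb, by means of the compositum Kb of K and Fb. *)
Definition base_change (F Fb K Kb : fieldType) (i : F -> K) (j : Fb -> Kb)
    (theta : K -> Kb) (X : set (set K)) : set (set Kb) :=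
  \bigcup_(A in affine_open i X) Aff (algebra_gen j (theta @` A)).

(* Injectivity of Fb (x)_F K -> Kb. *)
Definition linearly_disjoint (F Fb K Kb : fieldType) (i : F -> K)
    (j : Fb -> Kb) (theta : K -> Kb) :=
  forall (m : nat) (x : 'I_m -> K),
    (forall c : 'I_m -> F, \sum_l i (c l) * x l = 0 -> forall l, c l = 0) ->
    (forall c : 'I_m -> Fb, \sum_l j (c l) * theta (x l) = 0 ->
       forall l, c l = 0).

(* The multiplicative group of K, written additively. *)
Record nonzero (K : fieldType) := Nonzero { nzval :> K; _ : nzval != 0 }.
HB.instance Definition _ (K : fieldType) := [isSub for @nzval K].
HB.instance Definition _ (K : fieldType) := [Choice of nonzero K by <:].

Section NonzeroZmod.
Variable K : fieldType.
Implicit Types x y : nonzero K.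

Lemma nzvalP x : nzval x != 0. Proof. by case: x. Qed.

Fact nz1_subproof : (1 : K) != 0. Proof. exact: oner_neq0. Qed.
Fact nzM_subproof x y : nzval x * nzval y != 0.
Proof. by rewrite mulf_neq0 ?nzvalP. Qed.
Fact nzV_subproof x : (nzval x)^-1 != 0.
Proof. by rewrite invr_eq0 nzvalP. Qed.

Definition nz1 := Nonzero nz1_subproof.
Definition nzM x y := Nonzero (nzM_subproof x y).
Definition nzV x := Nonzero (nzV_subproof x).

Fact nzMA : associative nzM. Proof. by move=> x y z; apply/val_inj/mulrA. Qed.
Fact nzMC : commutative nzM. Proof. by move=> x y; apply/val_inj/mulrC. Qed.
Fact nz1M : left_id nz1 nzM. Proof. by move=> x; apply/val_inj/mul1r. Qed.
Fact nzVM : left_inverse nz1 nzV nzM.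
Proof. by move=> x; apply: val_inj; rewrite /= mulVf ?nzvalP. Qed.

HB.instance Definition _ := GRing.isZmodule.Build (nonzero K) nzMA nzMC nz1M nzVM.

Lemma nzvalD x y : nzval (x + y) = nzval x * nzval y. Proof. by []. Qed.
Lemma nzvalB x y : nzval (x - y) = nzval x / nzval y. Proof. by []. Qed.
Lemma nzval0 : nzval (0 : nonzero K) = 1. Proof. by []. Qed.
End NonzeroZmod.

Record model (K : fieldType) :=
  Model { pts :> set (set K); ptsP : forall O, pts O -> is_subring O }.

Section Picard.
Variables (K : fieldType) (X : model K).
Implicit Types D E : set K -> nonzero K.

Lemma subfield_funfield : is_subfield (funfield X).
Proof.
split; first split.
- by move=> A [[[A1 _ _] _] _].
- move=> x y Xx Xy A AX; have [[_ AB _] _] := AX.1.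
  by apply: AB; [apply: Xx|apply: Xy].
- move=> x y Xx Xy A AX; have [[_ _ AM] _] := AX.1.
  by apply: AM; [apply: Xx|apply: Xy].
- by move=> x Xx A AX; apply: AX.1.2; apply: Xx.
Qed.

Definition unit_at (O : set K) (x : K) := O x /\ O x^-1.

Lemma unit_at1 O : pts X O -> unit_at O 1.
Proof. by move=> /ptsP[O1 _ _]; rewrite /unit_at invr1. Qed.

Lemma unit_atM O x y : pts X O -> unit_at O x -> unit_at O y -> unit_at O (x * y).
Proof.
move=> /ptsP[_ _ OM] [Ox Oxv] [Oy Oyv]; split; first exact: OM.
by rewrite invfM; apply: OM.
Qed.

Lemma unit_atV O x : unit_at O x -> unit_at O x^-1.
Proof. by case=> *; split; rewrite ?invrK. Qed.

(* Cartier divisors, i.e. sections of the sheaf K*/O*: D O is a local equation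
   at the point O, the values of D off X being irrelevant.  X being integral,
   every line bundle is O(D) for some D, and two of them are isomorphic iff
   they differ by a principal divisor. *)
Definition cartier_prop D := forall O, pts X O -> funfield X (D O) /\
  exists U, [/\ zopen X U, U O
              & forall O', U O' -> unit_at O' (nzval (D O') / nzval (D O))].

Definition principal_prop D := exists f : nonzero K,
  funfield X f /\ forall O, pts X O -> unit_at O (nzval (D O) / nzval f).

Definition cartier : {pred (set K -> nonzero K)} :=
  fun D => `[< cartier_prop D >].

Lemma zopenI (U V : set (set K)) :
  zopen X U -> zopen X V -> zopen X (U `&` V).
Proof.
move=> [UX Uo] [VX Vo]; split; first by move=> O [/UX].
move=> O [/Uo[s [sO sU]] /Vo[t [tO tV]]]; exists (s ++ t); split.
  by move=> x /=; rewrite mem_cat => /orP[/sO|/tO].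
move=> O' XO' stO'; split; [apply: sU|apply: tV] => // x /= xs;
by apply: stO'; rewrite /= mem_cat xs ?orbT.
Qed.

Lemma zopenT : zopen X X.
Proof. by split=> // O XO; exists [::]; split=> // x. Qed.

Fact cartier_closed : zmod_closed cartier.
Proof.
have [[F1 FB FM] FV] := subfield_funfield.
split.
  apply/asboolP => O XO; split; first exact: F1.
  exists X; split=> //; first exact: zopenT.
  by move=> O' XO'; rewrite nzval0 divr1; apply: unit_at1.
move=> D E /asboolP cD /asboolP cE; apply/asboolP => O XO.
have [FD [U [oU UO DU]]] := cD O XO; have [FE [V [oV VO EV]]] := cE O XO.
split; first by rewrite nzvalB; apply: FM => //; apply: FV.
exists (U `&` V); split=> //; first exact: zopenI.
move=> O' [UO' VO'].
have XO' : pts X O' by apply: oU.1.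
have -> : nzval ((D - E) O') / nzval ((D - E) O) =
    (nzval (D O') / nzval (D O)) * (nzval (E O') / nzval (E O))^-1.
  rewrite (_ : (D - E) O' = D O' - E O') // (_ : (D - E) O = D O - E O) //.
  by rewrite !nzvalB !invfM !invrK mulrACA.
by apply: (unit_atM XO'); [exact: DU|apply: unit_atV; exact: EV].
Qed.

HB.instance Definition _ := GRing.isZmodClosed.Build _ cartier cartier_closed.

Record cartier_div := CartierDiv { cdiv :> set K -> nonzero K;
                                   _ : cdiv \in cartier }.
HB.instance Definition _ := [isSub for @cdiv].
HB.instance Definition _ := [Choice of cartier_div by <:].
HB.instance Definition _ := [SubChoice_isSubZmodule of cartier_div by <:].

Definition principal : {pred cartier_div} :=
  fun D : cartier_div => `[< principal_prop D >].

Fact principal_closed : zmod_closed principal.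
Proof.
have [[F1 FB FM] FV] := subfield_funfield.
split.
  apply/asboolP; exists 0; split; first exact: F1.
  by move=> O XO; rewrite nzval0 divr1; apply: unit_at1.
move=> D E /asboolP[f [Ff Df]] /asboolP[h [Fh Eh]]; apply/asboolP.
exists (f - h); split; first by rewrite nzvalB; apply: FM => //; apply: FV.
move=> O XO.
have -> : nzval (cdiv (D - E) O) / nzval (f - h) =
    (nzval (D O) / nzval f) * (nzval (E O) / nzval h)^-1.
  rewrite (_ : cdiv (D - E) O = cdiv D O - cdiv E O) //.
  by rewrite !nzvalB !invfM !invrK mulrACA.
by apply: (unit_atM XO); [exact: Df|apply: unit_atV; exact: Eh].
Qed.

HB.instance Definition _ := GRing.isZmodClosed.Build _ principal principal_closed.

Definition Pic := {ideal_quot principal}.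
HB.instance Definition _ := GRing.Zmodule.on Pic.

End Picard.
Arguments cartier {K} X.
Arguments principal {K} X.

Record autom (K : fieldType) (X : model K) := Autom {
  aut_map :> {rmorphism K -> K};
  aut_bij : bijective aut_map;
  aut_pts : forall O, pts X (aut_map @^-1` O) <-> pts X O }.

Section PicardAction.
Variables (K : fieldType) (X : model K) (a : autom X).

Fact aut_nz_subproof (x : nonzero K) : a (nzval x) != 0.
Proof. by rewrite fmorph_eq0 nzvalP. Qed.
Definition aut_nz x := Nonzero (aut_nz_subproof x).

(* Pullback of divisors: the field automorphism a sends the local ring at the
   point a^{-1}(O) onto O. *)
Definition aut_fun (D : set K -> nonzero K) : set K -> nonzero K :=
  fun O => aut_nz (D (a @^-1` O)).

Lemma aut_funfield x : funfield X x -> funfield X (a x).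
Proof.
move=> Fx A [Af AX].
have : (a @^-1` A) x.
  apply: Fx; split.
    case: Af => -[A1 AB AM] AV; split; first split; rewrite /preimage /=.
    - by rewrite rmorph1.
    - by move=> y z Ay Az; rewrite rmorphB; apply: AB.
    - by move=> y z Ay Az; rewrite rmorphM; apply: AM.
    - by move=> y Ay; rewrite fmorphV; apply: AV.
  move=> y [O XO Oy]; apply: AX; exists (a @` O); last by exists y.
  apply/(aut_pts a); rewrite (_ : _ @^-1` _ = O) //.
  apply/seteqP; split=> [z [w Ow /fmorph_inj <-] //|z Oz]; by exists z.
by [].
Qed.

Lemma aut_unit_at O x : unit_at (a @^-1` O) x -> unit_at O (a x).
Proof. by case=> u v; split; rewrite -?fmorphV. Qed.

Fact aut_cartier_subproof (D : cartier_div X) :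
  aut_fun (cdiv D) \in cartier X.
Proof.
have /asboolP cD := valP D.
apply/asboolP => O XO.
have XaO : pts X (a @^-1` O) by apply/(aut_pts a).
have [FD [U [[UX Uo] UO DU]]] := cD _ XaO.
split; first exact: aut_funfield.
exists [set O' | pts X O' /\ U (a @^-1` O')]; split=> //.
  split=> [O' []//|O' [XO' UO']].
  have [s [sO' sU]] := Uo _ UO'.
  exists [seq a x | x <- s]; split.
    by move=> _ /mapP[x xs ->]; apply: sO'.
  move=> O'' XO'' sO''; split=> //; apply: sU; first exact/(aut_pts a).
  by move=> x xs; apply: sO''; apply: map_f.
move=> O' [XO' UO'].
by rewrite /= -fmorphV -rmorphM; apply: aut_unit_at; apply: DU.
Qed.

Definition aut_cartier (D : cartier_div X) := CartierDiv (aut_cartier_subproof D).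

Fact aut_cartierB : zmod_morphism aut_cartier.
Proof.
move=> D E; apply/val_inj/funext => O; apply/val_inj => /=.
by rewrite rmorphM fmorphV.
Qed.

Lemma aut_principal D : D \in principal X -> aut_cartier D \in principal X.
Proof.
move=> /asboolP[f [Ff Df]]; apply/asboolP; exists (aut_nz f); split.
  exact: aut_funfield.
move=> O XO; rewrite /= -fmorphV -rmorphM; apply: aut_unit_at; apply: Df.
exact/(aut_pts a).
Qed.

Definition pic_act (x : Pic X) : Pic X :=
  \pi_({ideal_quot principal X}) (aut_cartier (repr x)).

Fact pic_act_pi (D : cartier_div X) :
  pic_act (\pi_({ideal_quot principal X}) D) = \pi_({ideal_quot principal X}) (aut_cartier D).
Proof.
apply/eqP; rewrite /pic_act -Quotient.idealrBE -aut_cartierB.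
by apply: aut_principal; rewrite Quotient.idealrBE reprK.
Qed.

Fact pic_actB : zmod_morphism pic_act.
Proof.
move=> x y; elim/quotW: x => D; elim/quotW: y => E.
by rewrite -[X in pic_act X]raddfB !pic_act_pi aut_cartierB raddfB.
Qed.

HB.instance Definition _ :=
  GRing.isZmodMorphism.Build (Pic X) (Pic X) pic_act pic_actB.

End PicardAction.

(* First cohomology of a finite group acting on M on the right, hence the
   crossed homomorphism identity c (g h) = (c g)^h + c h; turning M into a left
   module by means of g |-> g^-1 gives the usual group. *)
Section Cohomology.
Variables (gT : finGroupType) (M : zmodType) (act : gT -> {additive M -> M}).

Definition cocycle : {pred {ffun gT -> M}} :=
  fun c => [forall g, forall h, c (g * h)%g == act h (c g) + c h].

Fact cocycle_closed : zmod_closed cocycle.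
Proof.
split; first by apply/forallP=> g; apply/forallP=> h; rewrite !ffunE raddf0 addr0.
move=> c e /forallP cc /forallP ce; apply/forallP=> g; apply/forallP=> h.
rewrite !ffunE (eqP (forallP (cc g) h)) (eqP (forallP (ce g) h)).
by rewrite raddfB opprD addrACA.
Qed.
HB.instance Definition _ := GRing.isZmodClosed.Build _ cocycle cocycle_closed.

Record cocycles := Cocycle { cocycle_val :> {ffun gT -> M};
                             _ : cocycle_val \in cocycle }.
HB.instance Definition _ := [isSub for @cocycle_val].
HB.instance Definition _ := [Choice of cocycles by <:].
HB.instance Definition _ := [SubChoice_isSubZmodule of cocycles by <:].

Definition coboundary : {pred cocycles} :=
  fun c => `[< exists m : M, forall g, c g = act g m - m >].

Fact coboundary_closed : zmod_closed coboundary.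
Proof.
split.
  by apply/asboolP; exists 0 => g; rewrite raddf0 subr0 ffunE.
move=> c e /asboolP[m cm] /asboolP[p ep]; apply/asboolP; exists (m - p) => g.
rewrite (_ : cocycle_val (c - e) g = c g - e g); last by rewrite !ffunE.
by rewrite cm ep [act g (m - p)]raddfB !opprD !opprK addrACA.
Qed.
HB.instance Definition _ :=
  GRing.isZmodClosed.Build _ coboundary coboundary_closed.

Definition H1 := {ideal_quot coboundary}.
HB.instance Definition _ := GRing.Zmodule.on H1.
End Cohomology.

Section Transport.
Variables (K : fieldType) (a b : {rmorphism K -> K}).
Hypotheses (aK : cancel a b) (bK : cancel b a).

Lemma preim_subring (A : set K) : is_subring A -> is_subring (a @^-1` A).
Proof.
case=> A1 AB AM; split; rewrite /preimage /=; first by rewrite rmorph1.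
  by move=> x y Ax Ay; rewrite rmorphB; apply: AB.
by move=> x y Ax Ay; rewrite rmorphM; apply: AM.
Qed.

Lemma preim_Aff (A O : set K) :
  Aff A O -> Aff (a @^-1` A) (a @^-1` O).
Proof.
case=> P [PA [P0 P1] PB PM Pp] <-; exists (a @^-1` P).
  split; rewrite /preimage /=; rewrite ?rmorph0 ?rmorph1 //.
  - by move=> x /PA.
  - by move=> x y Px Py; rewrite rmorphB; apply: PB.
  - by move=> x y Ax Py; rewrite rmorphM; apply: PM.
  - by move=> x y Ax Ay; rewrite rmorphM; apply: Pp.
apply/seteqP; split=> x [c [d [Ac Ad Pd xE]]].
  by exists (a c), (a d); split=> //; rewrite xE fmorph_div.
exists (b c), (b d); split; rewrite /preimage /= ?bK //.
by rewrite -[x]aK xE fmorph_div.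
Qed.

End Transport.

Lemma preim_smallest_subring (K : fieldType) (a b : {rmorphism K -> K})
    (S : set K) : cancel a b -> cancel b a ->
  a @^-1` smallest (@is_subring K) S = smallest (@is_subring K) (a @^-1` S).
Proof.
move=> aK bK; apply/seteqP; split=> x Sx A [sA SA].
  have := Sx (b @^-1` A); rewrite /preimage /= aK; apply; split.
    exact: preim_subring.
  by move=> y Sy; apply: SA; rewrite /preimage /= bK.
apply: (Sx (a @^-1` A)); split; first exact: preim_subring.
by move=> y; apply: SA.
Qed.

Lemma is_subring_localization (K : fieldType) (A P : set K) :
  is_subring A -> prime_ideal A P -> is_subring (localization A P).
Proof.
move=> [A1 AB AM] [PA [P0 P1] PB PM Pp].
have nP x y : A x -> A y -> ~ P x -> ~ P y -> ~ P (x * y).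
  by move=> Ax Ay Px Py /(Pp _ _ Ax Ay)[].
have nz x : ~ P x -> x != 0 by move=> Px; apply/eqP => x0; apply: Px; rewrite x0.
split; first by exists 1, 1; rewrite divr1.
  move=> _ _ [c [d [Ac Ad Pd ->]]] [e [f [Ae Af Pf ->]]].
  exists (c * f - e * d), (d * f); split; auto.
  by rewrite -mulNr addf_div ?nz // mulNr.
move=> _ _ [c [d [Ac Ad Pd ->]]] [e [f [Ae Af Pf ->]]].
by exists (c * e), (d * f); split; auto; rewrite mulf_div.
Qed.

Lemma is_subring_smallest (K : fieldType) (S : set K) :
  is_subring (smallest (@is_subring K) S).
Proof.
split; first by move=> A [[]].
  move=> x y Sx Sy A AS; have [[_ AB _] _] := AS.
  by apply: AB; [apply: Sx|apply: Sy].
move=> x y Sx Sy A AS; have [[_ _ AM] _] := AS.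
by apply: AM; [apply: Sx|apply: Sy].
Qed.

(* k(x_1, ..., x_n) contains the function field of M_{0,n}, which is generated
   by the cross-ratios of the x_i, and S_n acts by permuting the x_i. *)
Section M0n.
Variables (k : fieldType) (n : nat).

Definition cross_ratio (q : 'I_n * 'I_n * 'I_n * 'I_n) : ratfun k n :=
  let: (a, b, c, d) := q in
  ((ratX k a - ratX k c) * (ratX k b - ratX k d)) /
  ((ratX k a - ratX k d) * (ratX k b - ratX k c)).

Definition distinct4 : set ('I_n * 'I_n * 'I_n * 'I_n) :=
  [set q | let: (a, b, c, d) := q in uniq [:: a; b; c; d]].

(* The moduli space of stable n-pointed curves of genus zero, embedded in a
   product of copies of P^1 = \bar M_{0,4} by the forgetful maps to
   \bar M_{0,4}, i.e. by the cross-ratios of the quadruples of distinct marked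
   points (Gerritzen-Herrlich-van der Put): the closure of M_{0,n} in this
   product. *)
Definition M0nbar_pts : set (set (ratfun k n)) :=
  P1_closure (@ratC k n) distinct4 cross_ratio.

(* A right action: perm_vars t (perm_vars s x) = perm_vars (s * t) x, since
   (s * t) l = t (s l). *)
Definition perm_vars (s : 'S_n) : ratfun k n -> ratfun k n :=
  ratsubst (@ratC k n) (fun l => ratX k (s l)).

Local Notation "x %:F" := (@FracField.tofrac {mpoly k[n]} x).

Lemma frac_repr (x : ratfun k n) :
  x = (\n_(repr x))%:F / (\d_(repr x))%:F.
Proof.
rewrite -[LHS]reprK; case: (repr x) => -[u v] /= v0.
apply: (@mulIf _ (v%:F)); first by rewrite tofrac_eq0.
rewrite divfK ?tofrac_eq0 //.
rewrite !piE /FracField.mulf /=; apply/eqP; rewrite piE /= FracField.equivfE.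
by rewrite !(numden_Ratio, mulr1) ?oner_neq0 // mulrC.
Qed.

Lemma mmap_perm (s : 'S_n) p :
  mmap (@ratC k n) (fun l => ratX k (s l)) p = (msym s p)%:F.
Proof.
rewrite /msym /mmap rmorph_sum; apply: eq_bigr => m _.
rewrite rmorphM; congr (_ * _); rewrite /mmap1 rmorph_prod.
by apply: eq_bigr => l _; rewrite rmorphXn.
Qed.

Lemma msym_eq0 (s : 'S_n) (p : {mpoly k[n]}) : (msym s p == 0) = (p == 0).
Proof.
apply/eqP/eqP => [r0|->]; last exact: msym0.
by apply/mpolyP => m; rewrite -[m](mpermK s) -mcoeff_sym r0 !mcoeff0.
Qed.

Lemma perm_varsE (s : 'S_n) p q : q != 0 ->
  perm_vars s (p%:F / q%:F) = (msym s p)%:F / (msym s q)%:F.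
Proof.
move=> q0; rewrite /perm_vars /ratsubst !mmap_perm.
set r := repr _.
have d0 : \d_r != 0 by exact: denom_ratioP.
apply/eqP; rewrite eqr_div ?tofrac_eq0 ?msym_eq0 //.
rewrite -!tofracM -!msymM tofrac_eq.
suff -> : \n_r * q = p * \d_r by [].
apply/eqP; rewrite -tofrac_eq !tofracM -eqr_div ?tofrac_eq0 //.
by rewrite -frac_repr.
Qed.

Fact perm_varsB (s : 'S_n) : zmod_morphism (perm_vars s).
Proof.
move=> x y; rewrite [x]frac_repr [y]frac_repr.
move: (denom_ratioP (repr x)) (denom_ratioP (repr y)).
move: (\n_(repr x)) (\d_(repr x)) (\n_(repr y)) (\d_(repr y)) => p q u v q0 v0.
rewrite -mulNr -tofracN addf_div ?tofrac_eq0 // -!tofracM -tofracD.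
rewrite !perm_varsE ?mulf_neq0 // -mulNr -tofracN.
rewrite [RHS]addf_div ?tofrac_eq0 ?msym_eq0 //.
by rewrite -!tofracM -tofracD -msymN -!msymM -msymD.
Qed.

Fact perm_varsM (s : 'S_n) : monoid_morphism (perm_vars s).
Proof.
split.
  by rewrite -[1 in LHS]divr1 -tofrac1 perm_varsE ?oner_neq0 // msym1 divr1.
move=> x y; rewrite [x]frac_repr [y]frac_repr.
move: (denom_ratioP (repr x)) (denom_ratioP (repr y)).
move: (\n_(repr x)) (\d_(repr x)) (\n_(repr y)) (\d_(repr y)) => p q u v q0 v0.
rewrite mulf_div -!tofracM !perm_varsE ?mulf_neq0 //.
by rewrite mulf_div -!tofracM -!msymM.
Qed.

HB.instance Definition _ (s : 'S_n) :=
  GRing.isZmodMorphism.Build _ _ (perm_vars s) (perm_varsB s).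
HB.instance Definition _ (s : 'S_n) :=
  GRing.isMonoidMorphism.Build _ _ (perm_vars s) (perm_varsM s).

Lemma perm_varsC (s : 'S_n) (c : k) : perm_vars s (ratC n c) = ratC n c.
Proof.
rewrite -[in LHS](divr1 (ratC n c)) -tofrac1 perm_varsE ?oner_neq0 //.
by rewrite msym1 tofrac1 divr1 /msym mmapC.
Qed.

Lemma perm_varsX (s : 'S_n) (l : 'I_n) : perm_vars s (ratX k l) = ratX k (s l).
Proof.
rewrite -[in LHS](divr1 (ratX k l)) -tofrac1 perm_varsE ?oner_neq0 //.
by rewrite msym1 tofrac1 divr1 /msym mmapX mmap1U.
Qed.

Lemma msymVK (s : 'S_n) (p : {mpoly k[n]}) : msym s^-1%g (msym s p) = p.
Proof.
by apply/mpolyP => m; rewrite !mcoeff_sym mpermK.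
Qed.

Lemma perm_varsVK (s : 'S_n) : cancel (perm_vars s) (perm_vars s^-1%g).
Proof.
move=> x; rewrite [x]frac_repr; move: (denom_ratioP (repr x)).
move: (\n_(repr x)) (\d_(repr x)) => p q q0.
by rewrite !perm_varsE ?msym_eq0 // !msymVK.
Qed.

Lemma perm_varsKV (s : 'S_n) : cancel (perm_vars s^-1%g) (perm_vars s).
Proof. by move=> x; have := perm_varsVK s^-1%g x; rewrite invgK. Qed.

Fact M0nbar_subring O : M0nbar_pts O -> is_subring O.
Proof.
case=> s _ [P pP <-]; apply: is_subring_localization pP.
exact: is_subring_smallest.
Qed.

Definition M0nbar := Model M0nbar_subring.

Lemma perm_vars_cross_ratio (s : 'S_n) a b c d :
  perm_vars s (cross_ratio (a, b, c, d)) = cross_ratio (s a, s b, s c, s d).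
Proof. by rewrite /cross_ratio fmorph_div !rmorphM !rmorphB /= !perm_varsX. Qed.

Lemma perm_vars_pts (s : 'S_n) O : M0nbar_pts O ->
  M0nbar_pts (perm_vars s @^-1` O).
Proof.
case=> t _ AO.
pose act (q : 'I_n * 'I_n * 'I_n * 'I_n) :=
  let: (a, b, c, d) := q in (s a, s b, s c, s d).
pose actV (q : 'I_n * 'I_n * 'I_n * 'I_n) := let: (a, b, c, d) := q in
  (s^-1 a, s^-1 b, s^-1 c, s^-1 d)%g.
have actVK q : act (actV q) = q by case: q => -[[a b] c] d; rewrite /= !permKV.
have distinct_act q : distinct4 q <-> distinct4 (act q).
  case: q => -[[a b] c] d; rewrite /distinct4 /= !inE.
  by rewrite !(inj_eq perm_inj).
have crE q : perm_vars s (cross_ratio q) = cross_ratio (act q).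
  by case: q => -[[a b] c] d; apply: perm_vars_cross_ratio.
exists (t \o act) => //.
have := preim_Aff (@perm_varsVK s) (@perm_varsKV s) AO.
congr (Aff _ _); rewrite (preim_smallest_subring _ (@perm_varsVK s) (@perm_varsKV s)).
congr (smallest _ _); apply/seteqP; split=> x.
  case=> [[c _ xE]|[q Dq xE]].
    by left; exists c => //; rewrite -[x](perm_varsVK s) -xE perm_varsC.
  right; exists (actV q); first by apply/distinct_act; rewrite actVK.
  rewrite /= actVK -[x](perm_varsVK s) -xE.
  by case: ifP => _; rewrite ?fmorphV -[in RHS](actVK q) -crE /= perm_varsVK.
case=> [[c _ <-]|[q Dq <-]].
  by left; exists c => //=; rewrite perm_varsC.
right; exists (act q); first exact: (proj1 (distinct_act q) Dq).
by rewrite /preimage /= (fun_if (perm_vars s)) fmorphV /= crE.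
Qed.

Fact perm_vars_bij (s : 'S_n) : bijective (perm_vars s).
Proof. exact: Bijective (@perm_varsVK s) (@perm_varsKV s). Qed.

Fact perm_vars_aut (s : 'S_n) O :
  pts M0nbar (perm_vars s @^-1` O) <-> pts M0nbar O.
Proof.
split; last exact: perm_vars_pts.
move=> /(@perm_vars_pts s^-1%g); congr (M0nbar_pts _).
by apply/seteqP; split=> x; rewrite /preimage /= perm_varsKV.
Qed.

Definition M0nbar_aut (s : 'S_n) : autom M0nbar :=
  @Autom _ M0nbar (perm_vars s) (perm_vars_bij s) (perm_vars_aut s).

End M0n.

Definition pic_M0nbar_act (k : fieldType) (n : nat) (G : {group 'S_n})
    (g : [subg G]) : {additive Pic (M0nbar k n) -> Pic (M0nbar k n)} :=
  pic_act (M0nbar_aut k (sgval g)).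

(* sigma : F -> Fb is meant to be an algebraic closure, and K to be the
   function field of X. *)
Definition is_form (F Fb K : fieldType) (sigma : F -> Fb) (i : F -> K)
    (X : set (set K)) (n : nat) :=
  exists (Kb : fieldType) (j : {rmorphism Fb -> Kb}) (theta : {rmorphism K -> Kb}),
    [/\ theta \o i =1 j \o sigma, linearly_disjoint i j theta
      & isomorphic j (@ratC Fb n) (base_change i j theta X) (M0nbar Fb n)].

(* Main.v *)
(* M_(0,n) is the spectrum of a factorial ring whose units are, up to constants,
   the monomials in the differences x_i - x_j of multidegree 0 in the points.
   Hence Pic is the quotient of the permutation module on the boundary divisors
   by the lattice U of these monomials, and U is the kernel of the degree map
   from the permutation module on pairs of points to Z^n, whose image is the
   lattice of vectors of even sum.  Let G be generated by s = (0 1)(2 3) and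
   t = (0 1)(4 5)(6 7)...  A cocycle with values in Pic is measured by a vector
   of Z^n; G-invariant vectors have even sum because all orbits of G are even,
   so the parity of the sum is well defined, and it classifies the cocycle.

   The nontrivial class is carried by a unit Theta inverted by s and by t, of
   the form rho * st(rho): no rational function mu makes both mu * s(mu) and
   t(mu) / (mu * Theta) constant.  In a polynomial ring on which G acts by ring
   automorphisms, unique factorization always yields such a mu, built from the
   prime factors of Theta.  A stable linearization, or a retraction of a twisted
   form onto an open subset of an affine space, would transport Theta to a
   polynomial ring and bring mu back.

   The form of (ii) is the descent of the compactification along the action of
   Gal(L/F) = G on both the constants and the marked points.  It is covered by
   the spectra of the invariants of L[1/(f_q - c) : q], with f_q the cross-ratios
   and c ranging over more elements of F than there are quadruples q.  The field
   F has that many elements since G is not cyclic. *)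
Require Import Defs.
From HB Require Import structures.
From mathcomp Require Import all_boot all_order all_algebra all_fingroup.
From mathcomp Require Import all_solvable all_field.
From mathcomp Require Import mxrepresentation.
From mathcomp Require Import fraction generic_quotient.
From mathcomp Require Import boolp classical_sets functions.
From mathcomp Require Import mpoly ring zify.

Set Implicit Arguments.
Unset Strict Implicit.
Unset Printing Implicit Defensive.
Import Order.TTheory GRing.Theory Num.Theory.
Local Open Scope classical_set_scope.
Local Open Scope ring_scope.

(** * Unique factorization *)

(** The compactification is given only as a closure in a product of projective lines, so its
    divisors have to be produced by hand. For each cyclic ordering of the marked points, the
    dihedral coordinates generate a ring that Nagata's lemma shows to be factorial: inverting the
    coordinates of the chords gives the ring of M_(0,n), and each chord defines one divisor, along
    which an interval of consecutive points collides. A point of the closure determines a rooted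
    tree on the marked points, and a planar ordering of its leaves gives a chart containing the
    point. Divisors thus become integer-valued functions on a set of valuations.

    A cocycle of integer-valued functions on a G-set always splits, by rounding its average down;
    only the passage to functions modulo units can obstruct. The divisors D_ij where just two points
    collide control that passage, since a unit is determined up to a constant by its orders along
    them. Writing a class whose degrees are those of the coboundary of delta_0 by means of D_04 and
    D_02 leaves a defect in the cocycle relation; Theta is the unit having this defect along all the
    D_ij. *)

Lemma frac_reprE (R : idomainType) (x : {fraction R}) :
  x = FracField.tofrac \n_(repr x) / FracField.tofrac \d_(repr x).
Proof.
rewrite -[LHS]reprK; case: (repr x) => -[u v] /= v0.
apply: (@mulIf _ (FracField.tofrac v)); first by rewrite tofrac_eq0.
rewrite divfK ?tofrac_eq0 //.
rewrite !piE /FracField.mulf /=; apply/eqP; rewrite piE /= FracField.equivfE.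
by rewrite !(numden_Ratio, mulr1) ?oner_neq0 // mulrC.
Qed.

Lemma fracE (R : idomainType) (x : {fraction R}) :
  exists a b : R, b != 0 /\ x = FracField.tofrac a / FracField.tofrac b.
Proof.
exists (\n_(repr x)), (\d_(repr x)); split; [exact: denom_ratioP|exact: frac_reprE].
Qed.

Lemma tofrac_inj (R : idomainType) : injective (@FracField.tofrac R).
Proof. by move=> a b /eqP; rewrite tofrac_eq => /eqP. Qed.

Section Ufd.
Variable R : idomainType.
Implicit Types (a b c p q u : R) (s : seq R).

Definition divides a b := exists c, b = c * a.
Definition prime_elt p :=
  [/\ p != 0, ~ divides p 1
    & forall a b, divides p (a * b) -> divides p a \/ divides p b].
Definition is_ufd := forall a, a != 0 ->
  exists u s, [/\ divides u 1, (forall p, p \in s -> prime_elt p)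
                & a = u * \prod_(p <- s) p].

Lemma divides_mull a b c : divides a b -> divides a (c * b).
Proof. by case=> d ->; exists (c * d); rewrite mulrA. Qed.

Lemma divides_mulr a b c : divides a b -> divides a (b * c).
Proof. by rewrite mulrC; apply: divides_mull. Qed.

Lemma divides_add a b c : divides a b -> divides a c -> divides a (b + c).
Proof. by case=> d -> [e ->]; exists (d + e); rewrite mulrDl. Qed.

Lemma divides_sub a b c : divides a b -> divides a c -> divides a (b - c).
Proof. by case=> d -> [e ->]; exists (d - e); rewrite mulrBl. Qed.

Lemma divides_trans a b c : divides a b -> divides b c -> divides a c.
Proof. by case=> d -> [e ->]; exists (e * d); rewrite mulrA. Qed.

Lemma divides_refl a : divides a a.
Proof. by exists 1; rewrite mul1r. Qed.

Lemma prime_divides_prod p s : prime_elt p -> divides p (\prod_(q <- s) q) ->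
  exists2 q, q \in s & divides p q.
Proof.
move=> [p0 pN1 pP]; elim: s => [|q s IHs]; first by rewrite big_nil.
rewrite big_cons => /pP[pq|/IHs[r rs pr]].
  by exists q; rewrite // mem_head.
by exists r; rewrite // inE rs orbT.
Qed.

Lemma prime_associate p q : prime_elt p -> prime_elt q -> divides p q -> divides q p.
Proof.
move=> [p0 pN1 _] [q0 qN1 qP] [c qE].
have /qP[qc|//] : divides q (c * p) by rewrite -qE; exact: divides_refl.
case: qc => d cE; case: pN1; exists d.
apply: (mulIf q0); rewrite mul1r {1}qE cE; ring.
Qed.
End Ufd.

Section UfdPoly.
Variable R : idomainType.
Implicit Types (f g h : {poly R}) (p : R).

Lemma divides_polyC p f : divides p%:P f <-> forall i, divides p f`_i.
Proof.
split=> [[g ->] i|pf]; first by exists g`_i; rewrite coefMC.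
have cf i : {c | f`_i = c * p} by apply: cid; exact: pf.
exists (\poly_(i < size f) sval (cf i)); apply/polyP => i.
rewrite coefMC coef_poly; case: ltnP => [_|fi]; first exact: (svalP (cf i)).
by rewrite mul0r nth_default.
Qed.

(** Gauss's lemma. A prime dividing [f * g] divides the product of the leading coefficients, hence
    one of them; the leading term of that factor can then be removed, so the induction runs on the
    sum of the sizes. *)
Lemma prime_polyC p : prime_elt p -> prime_elt p%:P.
Proof.
move=> [p0 pN1 pP]; split; first by rewrite polyC_eq0.
  by move=> /divides_polyC/(_ 0); rewrite coef1.
move=> f g; have [N] := ubnP (size f + size g).
elim: N f g => // N IHN f g; rewrite ltnS => szN pfg.
have [->|f0] := eqVneq f 0; first by left; exists 0; rewrite mul0r.
have [->|g0] := eqVneq g 0; first by right; exists 0; rewrite mul0r.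
have red h : h != 0 -> divides p (lead_coef h) ->
   exists h', [/\ (size h' < size h)%N & divides p%:P (h - h')].
  move=> h0 [c hc]; have [l szh] : exists l, size h = l.+1.
    by case: (size h) (size_poly_gt0 h) => [|l _]; [rewrite h0|exists l].
  exists (h - lead_coef h *: 'X^l); split.
    rewrite szh ltnS; apply/leq_sizeP => j.
    rewrite leq_eqVlt coefB coefZ coefXn => /predU1P[<-|ltj].
      by rewrite eqxx mulr1 lead_coefE szh subrr.
    by rewrite gtn_eqF // mulr0 subr0 nth_default // szh.
  rewrite opprB addrC subrK hc; exists (c *: 'X^l).
  by rewrite -!mul_polyC polyCM; ring.
have : divides p (lead_coef f * lead_coef g).
  by rewrite -lead_coefM; move/divides_polyC: pfg; apply.
case/pP => [/(red _ f0)|/(red _ g0)] [h [szh ph]].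
- have pfh : divides p%:P (h * g).
    by rewrite (_ : h * g = f * g - (f - h) * g); [apply: divides_sub => //; exact: divides_mulr|ring].
  case: (IHN _ _ _ pfh); [|move=> pph|by right].
    by apply: leq_trans szN; rewrite ltn_add2r.
  by left; rewrite -(subrK h f); apply: divides_add.
- have pfh : divides p%:P (f * h).
    by rewrite (_ : f * h = f * g - f * (g - h)); [apply: divides_sub => //; exact: divides_mull|ring].
  case: (IHN _ _ _ pfh); [|by left|move=> pph].
    by apply: leq_trans szN; rewrite ltn_add2l.
  by right; rewrite -(subrK h g); apply: divides_add.
Qed.

Hypothesis Rufd : is_ufd R.

Lemma prime_factor (a : R) : a != 0 -> ~ divides a 1 ->
  exists2 p, prime_elt p & divides p a.
Proof.
move=> a0 aN1; have [u [[|p s] [u1 ps aE]]] := Rufd a0.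
  by case: aN1; rewrite aE big_nil mulr1.
exists p; first by apply: ps; rewrite mem_head.
by rewrite aE big_cons mulrCA; exists (u * \prod_(j <- s) j); rewrite mulrC.
Qed.

Definition primitive f := forall p, prime_elt p -> ~ divides p%:P f.

(** Each prime pulled out of [f] is also removed from the factorization of its leading coefficient,
    which bounds the number of steps. *)
Lemma content_factor f : f != 0 ->
  exists s g, [/\ (forall p, p \in s -> prime_elt p), primitive g
                & f = (\prod_(p <- s) p)%:P * g].
Proof.
move=> f0; have lc0 : lead_coef f != 0 by rewrite lead_coef_eq0.
have [u [t [u1 pt lcE]]] := Rufd lc0.
have [N] := ubnP (size t); elim: N f f0 lc0 u t u1 pt lcE => // N IHN f f0 lc0 u t u1 pt lcE.
rewrite ltnS => szt.
have [[p pp pf]|nf] := pselect (exists2 p, prime_elt p & divides p%:P f); last first.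
  exists [::], f; split=> //; first by move=> p pp pf; apply: nf; exists p.
  by rewrite big_nil mul1r.
have plc : divides p (u * \prod_(q <- t) q).
  by rewrite -lcE; move/divides_polyC: pf; apply.
have [p0 pN1 pP] := pp.
case/pP: plc => [pu|/(prime_divides_prod pp)[q qt pq]].
  by case: pN1; apply: divides_trans u1.
have [d pE] := prime_associate pp (pt _ qt) pq.
case: pf => g fE.
have g0 : g != 0 by apply: contraNneq f0 => g0; rewrite fE g0 mul0r.
have lcg : lead_coef f = lead_coef g * p by rewrite fE lead_coefM lead_coefC.
have [e qE] := pq.
have dlc : lead_coef g = (u * e) * \prod_(r <- rem q t) r.
  apply: (mulIf p0); rewrite -lcg lcE (big_rem q) //= qE; ring.
have de : d * e = 1.
  apply: (mulIf p0); rewrite mul1r {2}pE qE; ring.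
have [||||s [h [ps ph hE]]] := IHN g g0 _ _ _ _ _ dlc.
- by rewrite lead_coef_eq0.
- case: u1 => v uv; exists (v * d).
  by rewrite mulrACA -uv mul1r.
- by move=> r /mem_rem; apply: pt.
- by rewrite size_rem //; apply: leq_trans szt; rewrite prednK //; case: (t) qt.
exists (p :: s), h; split=> //.
  by move=> r; rewrite inE => /predU1P[->|/ps].
by rewrite big_cons fE hE polyCM; ring.
Qed.

Local Notation "f ^F" := (map_poly (@FracField.tofrac R) f) (at level 8).

Lemma clear_denom (F : {poly {fraction R}}) :
  exists r f, r != 0 /\ (r%:P)^F * F = f^F.
Proof.
elim/poly_ind: F => [|F c [r [f [r0 fE]]]].
  by exists 1, 0; rewrite oner_eq0 rmorph0 mulr0.
have [a [b [b0 cE]]] := fracE c.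
exists (r * b), (b *: f * 'X + (r * a)%:P); split; first exact: mulf_neq0.
have aE : FracField.tofrac a = FracField.tofrac b * c.
  by rewrite cE mulrCA divff ?tofrac_eq0 // mulr1.
rewrite -mul_polyC !(rmorphD, rmorphM) /= -fE map_polyX !map_polyC /= aE !rmorphM /=.
move: (polyC _) (polyC _) (polyC _) => x y z; ring.
Qed.

(** The scalar is cancelled one prime at a time: by Gauss's lemma each prime divides [h] or [f], and
    primitivity excludes [f]. *)
Lemma prime_cancel f (r : R) g h : r != 0 -> primitive f ->
  r%:P * g = h * f -> exists k, g = k * f.
Proof.
move=> r0 pf; have [u [s [u1 ps ->]]] := Rufd r0.
elim: s ps g h => [|p s IHs] ps g h.
  rewrite big_nil mulr1 => E; have [v uv] := u1; exists (v%:P * h).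
  by rewrite -mulrA -E mulrA -polyCM -uv mul1r.
rewrite big_cons mulrCA polyCM -mulrA => E.
have pp : prime_elt p by apply: ps; rewrite mem_head.
have [_ _ /(_ h f)] := prime_polyC pp.
case=> [|[k hE]|/(pf p pp)//].
  by rewrite -E; apply: divides_mulr; exact: divides_refl.
apply: (IHs _ g k) => [q qs|]; first by apply: ps; rewrite inE qs orbT.
apply: (mulfI (x := p%:P)); first by rewrite polyC_eq0; have [] := pp.
by rewrite E hE; ring.
Qed.

(** Irreducibility is carried to the fraction field, where Euclid's lemma holds: a factorization
    there is cleared of denominators, whose primes are then distributed over the two factors without
    changing their degrees. Divisibility over the fraction field comes back by [prime_cancel]. *)
Lemma irreducible_prime f : (1 < size f)%N -> primitive f ->
  (forall g h, f = g * h -> size g = 1%N \/ size h = 1%N) -> prime_elt f.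
Proof.
move=> szf pf irr; have f0 : f != 0 by apply: contraTneq szf => ->; rewrite size_poly0.
split=> //.
  move=> [c E]; have := congr1 (fun g : {poly R} => size g) E.
  rewrite size_poly1; have [->|c0] := eqVneq c 0; first by rewrite mul0r size_poly0.
  rewrite size_mul // => /eqP; case: (size c) (size_poly_gt0 c) => [|k _].
    by rewrite c0.
  by move/eqP; move: szf; lia.
have irrF : irreducible_poly f^F.
  split; first by rewrite size_map_inj_poly ?rmorph0 //; exact: tofrac_inj.
  move=> Q szQ QF.
  have [H FE] : exists H, f^F = H * Q by move: QF => /dvdpP.
  have [r [q [r0 qE]]] := clear_denom Q; have [t [h [t0 hE]]] := clear_denom H.
  have E : (r * t)%:P * f = h * q.
    apply: (map_inj_poly (@tofrac_inj R) (rmorph0 _)).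
    rewrite polyCM !rmorphM /= -qE -hE FE.
    by move: (map_poly _ r%:P) (map_poly _ t%:P) => x y; ring.
  have Q0 : Q != 0.
    apply/eqP => Q0; case/eqP: f0; apply: (map_inj_poly (@tofrac_inj R) (rmorph0 _)).
    by rewrite FE Q0 mulr0 rmorph0.
  have [q' [h' [q's h's fE]]] : exists q' h' : {poly R}, [/\ size q' = size q, size h' = size h & f = h' * q'].
    have rt0 : r * t != 0 by rewrite mulf_neq0.
    clear -E rt0 Rufd; have [u [s [u1 ps Es]]] := Rufd rt0.
    move: E; rewrite {rt0} Es; elim: s ps q h => [|p s IHs] ps q h.
      rewrite big_nil mulr1 => E; have [v uv] := u1.
      have v0 : v != 0 by apply/eqP => v0; move: uv; rewrite v0 mul0r => /eqP; rewrite oner_eq0.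
      exists q, (v%:P * h); split=> //; first by rewrite mul_polyC size_scale.
      by rewrite -mulrA -E mulrA -polyCM -uv mul1r.
    rewrite big_cons mulrCA polyCM -mulrA => E.
    have pp : prime_elt p by apply: ps; rewrite mem_head.
    have p0 : p != 0 by have [] := pp.
    have ps' q1 : q1 \in s -> prime_elt q1 by move=> q1s; apply: ps; rewrite inE q1s orbT.
    have [_ _ /(_ h q)] := prime_polyC pp.
    case=> [|[k hE]|[k qE]].
    - by rewrite -E; apply: divides_mulr; exact: divides_refl.
    - have [|q' [h' [<- h's fE]]] := IHs ps' q k.
        by apply: (mulfI (x := p%:P)); rewrite ?polyC_eq0 // E hE; ring.
      by exists q', h'; split=> //; rewrite hE mulrC mul_polyC size_scale.
    - have [|q' [h' [q's <- fE]]] := IHs ps' k h.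
        by apply: (mulfI (x := p%:P)); rewrite ?polyC_eq0 // E qE; ring.
      by exists q', h'; split=> //; rewrite qE mulrC mul_polyC size_scale.
  have szq : size q = size Q.
    by rewrite -(size_map_inj_poly (@tofrac_inj R) (rmorph0 _)) -qE map_polyC mul_polyC size_scale // tofrac_eq0.
  have [h1|q1] := irr _ _ fE; last by move: szQ; rewrite -szq -q's q1.
  have szf' : size f = size Q.
    have h'0 : h' != 0 by rewrite -size_poly_eq0 h1.
    have q'0 : q' != 0 by rewrite -size_poly_eq0 q's szq size_poly_eq0.
    by rewrite fE size_mul // h1 q's szq.
  rewrite -(dvdp_size_eqp QF).
  by rewrite size_map_inj_poly ?rmorph0 ?szf' //; exact: tofrac_inj.
move=> a b [c abE].
have : f^F %| (a^F * b^F) by rewrite -rmorphM abE rmorphM dvdp_mull.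
have key d : f^F %| d^F -> divides f d.
  case/dvdpP => Q QE; have [r [q [r0 qE]]] := clear_denom Q.
  have [//|k ->] := @prime_cancel f r d q r0 pf; last by exists k.
  apply: (map_inj_poly (@tofrac_inj R) (rmorph0 _)).
  by rewrite !rmorphM /= -qE QE mulrA.
have [fa _|nfa] := boolP (f^F %| a^F); first by left; exact: key.
rewrite Gauss_dvdpr; first by move=> fb; right; exact: key.
rewrite coprimep_def; apply/negPn/negP => sz1; move: nfa; rewrite -(eqp_dvdl _ (irrF.2 _ sz1 (dvdp_gcdl _ _))).
by rewrite dvdp_gcdr.
Qed.

(** Induction on the size: once the content is removed, a primitive polynomial is a unit, a product
    of two factors of positive degree, or prime. *)
Lemma ufd_poly : is_ufd {poly R}.
Proof.
move=> f; have [N] := ubnP (size f); elim: N f => // N IHN f; rewrite ltnS => szf f0.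
have [s [g [ps pg fE]]] := content_factor f0.
have g0 : g != 0 by apply: contraNneq f0 => g0; rewrite fE g0 mulr0.
suff [u [t [u1 pt gE]]] : exists (u : {poly R}) (t : seq {poly R}), [/\ divides u 1, (forall q : {poly R}, q \in t -> prime_elt q)
                & g = u * \prod_(q <- t) (q : {poly R})].
  exists u, ([seq p%:P | p <- s] ++ t); split=> // [p|].
    by rewrite mem_cat => /orP[/mapP[q qs ->]|/pt//]; apply/prime_polyC/ps.
  by rewrite big_cat big_map fE gE rmorph_prod /=; ring.
have szg : size g = size f.
  rewrite fE mul_polyC size_scale //; rewrite -(polyC_eq0 (\prod_(p <- s) p)).
  by apply: contraNneq f0 => E; rewrite fE E mul0r.
have [szg1|szg1] := leqP (size g) 1.
  exists g, [::]; split=> //; last by rewrite big_nil mulr1.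
  have gE := size1_polyC szg1; have g00 : g`_0 != 0.
    by apply: contraNneq g0 => E; rewrite gE E.
  apply: contrapT => gN1; have [|p pp pg0] := prime_factor g00.
    by move=> [c cE]; apply: gN1; exists c%:P; rewrite [g]gE -polyCM -cE.
  by apply: (pg p pp); rewrite gE; case: pg0 => c ->; exists c%:P; rewrite polyCM.
have [[a [b [gE sza szb]]]|irr] := pselect (exists a b, [/\ g = a * b, size a <> 1%N & size b <> 1%N]).
  have a0 : a != 0 by apply: contraNneq g0 => E; rewrite gE E mul0r.
  have b0 : b != 0 by apply: contraNneq g0 => E; rewrite gE E mulr0.
  have szab : size g = (size a + size b).-1 by rewrite gE size_mul.
  have := size_poly_gt0 a; have := size_poly_gt0 b; rewrite a0 b0 => sb sa.
  have [|u [t [u1 pt aE]]] := IHN a _ a0; first by lia.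
  have [|v [r [v1 pr bE]]] := IHN b _ b0; first by lia.
  exists (u * v), (t ++ r); split.
  - by case: u1 v1 => u' uE [v' vE]; exists (u' * v'); rewrite mulrACA -uE -vE mulr1.
  - by move=> p; rewrite mem_cat => /orP[/pt|/pr].
  - by rewrite gE aE bE big_cat /=; ring.
exists 1, [:: g]; split; first exact: divides_refl.
  move=> p; rewrite inE => /eqP ->; apply: irreducible_prime => // a b gE.
  have [->|/eqP sa] := eqVneq (size a) 1%N; first by left.
  have [->|/eqP sb] := eqVneq (size b) 1%N; first by right.
  by case: irr; exists a, b.
by rewrite big_seq1 mul1r.
Qed.
End UfdPoly.

Lemma ufd_iso (R S : idomainType) (f : {rmorphism R -> S}) (g : {rmorphism S -> R}) :
  cancel f g -> cancel g f -> is_ufd R -> is_ufd S.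
Proof.
move=> fK gK Rufd a a0; have ga0 : g a != 0 by rewrite -(rmorph0 g) (inj_eq (can_inj gK)).
have [u [s [[v uv] ps gaE]]] := Rufd _ ga0.
have dvdf x y : divides (f x) y <-> divides x (g y).
  split=> [[c ->]|[c E]]; first by exists (g c); rewrite rmorphM fK.
  by exists (f c); rewrite -rmorphM -E gK.
exists (f u), [seq f p | p <- s]; split.
- by exists (f v); rewrite -rmorphM -uv rmorph1.
- move=> _ /mapP[p /ps[p0 pN1 pP] ->]; split.
  + by rewrite -(rmorph0 f) (inj_eq (can_inj fK)).
  + by rewrite dvdf rmorph1.
  + by move=> x y; rewrite !dvdf rmorphM; apply: pP.
- by rewrite big_map -rmorph_prod -rmorphM -gaE gK.
Qed.

Lemma mpoly_morph_ext (R : comNzRingType) (n : nat) (S : nzRingType)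
    (f g : {rmorphism {mpoly R[n]} -> S}) :
  (forall c, f c%:MP = g c%:MP) -> (forall i, f 'X_i = g 'X_i) -> f =1 g.
Proof.
move=> fgC fgX p; rewrite [p]mpolyE !rmorph_sum; apply: eq_bigr => m _.
rewrite -mul_mpolyC !rmorphM fgC; congr (_ * _); rewrite mpolyXE_id !rmorph_prod.
by apply: eq_bigr => i _; rewrite !rmorphXn fgX.
Qed.

(** Induction through the isomorphism [muni] with univariate polynomials over the ring in one
    variable less. *)
Lemma ufd_mpoly (k : fieldType) n : is_ufd {mpoly k[n]}.
Proof.
elim: n => [|n IHn].
  move=> p p0; exists p, [::]; split=> //; last by rewrite big_nil mulr1.
  have pE : p = (p@_0)%:MP.
    apply/mpolyP => m; rewrite mcoeffC; have -> : m = 0%MM by apply/mnmP => -[].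
    by rewrite eqxx mulr1.
  have c0 : p@_0 != 0 by apply: contraNneq p0 => E; rewrite pE E mpolyC0.
  by exists (p@_0)^-1%:MP; rewrite [X in _ * X]pE -mpolyCM mulVf.
pose psi : {rmorphism {poly {mpoly k[n]}} -> {mpoly k[n.+1]}} :=
  horner_eval ('X_ord_max : {mpoly k[n.+1]}) \o map_poly (@mwiden n k).
have muniX (i : 'I_n) : muni ('X_(widen_ord (leqnSn n) i) : {mpoly k[n.+1]}) = ('X_i)%:P.
  rewrite /muni mmapX mmap1U; case: splitP => //= [j E|j E].
    by congr ('X__)%:P; apply/val_inj.
  by have := ltn_ord i; rewrite E ltnNge leq_addr.
have muniM : muni ('X_ord_max : {mpoly k[n.+1]}) = 'X.
  rewrite /muni mmapX mmap1U; case: splitP => //= j E.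
  by have := ltn_ord j; rewrite -E ltnn.
have psiC p : psi p%:P = mwiden p by rewrite /= map_polyC /horner_eval hornerC.
have psiX : psi 'X = 'X_ord_max by rewrite /= map_polyX /horner_eval hornerX.
have K1 : cancel psi (@muni n k).
  move=> p; elim/poly_ind: p => [|p c IHp]; first by rewrite !rmorph0.
  rewrite rmorphD rmorphM psiX psiC rmorphD rmorphM /= muniM IHp; congr (_ + _).
  apply: (@mpoly_morph_ext _ _ _ (@muni n k \o @mwiden n k) polyC) => [d|i] /=.
    by rewrite mwidenC muniC.
  by rewrite mwidenX mnmwiden1 muniX.
have K2 : cancel (@muni n k) psi.
  apply: (@mpoly_morph_ext _ _ _ (psi \o @muni n k) idfun) => [d|i].
    by rewrite /= muniC map_polyC /horner_eval hornerC /= mwidenC.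
  case: (unliftP ord_max i) => [j ->|->]; last by rewrite -[RHS]psiX /= muniM.
  have -> : lift ord_max j = widen_ord (leqnSn n) j by apply/val_inj; rewrite /= /bump leqNgt ltn_ord.
  by rewrite /= muniX map_polyC /horner_eval hornerC /= mwidenX mnmwiden1.
exact: (ufd_iso K1 K2 (ufd_poly IHn)).
Qed.

(** * Krull rings *)

Section FactorialSystem.
Variable K : fieldType.
Implicit Types (E A : set K) (V : set (K -> int)) (v w : K -> int).

(** Only the multiplicative half of a valuation; the ultrametric inequality is recovered from the
    ring where it is needed. The values at 0 and off [E] are fixed so that valuations can be
    compared as functions, and sets of valuations by equality. *)
Definition divval E v :=
  [/\ v 0 = 0, (forall x, ~ E x -> v x = 0)
    & forall x y, E x -> E y -> x != 0 -> y != 0 -> v (x * y) = v x + v y].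

Definition uniformizer E V v p :=
  [/\ E p, p != 0, v p = 1 & forall w, V w -> w != v -> w p = 0].

(* The discrete valuations V of a Krull ring A with fraction field E, each of
   which has a uniformizer with no other zero or pole: A is factorial. *)
Record factorial E A V : Prop := Factorial {
  fac_field : is_subfield E;
  fac_val : forall v, V v -> divval E v;
  fac_sub : A `<=` E;
  fac_ring : forall x, E x -> x != 0 -> (A x <-> forall v, V v -> 0 <= v x);
  fac_fin : forall x, E x -> x != 0 ->
    exists s : seq (K -> int), forall v, V v -> v x != 0 -> v \in s;
  fac_par : forall v, V v -> exists p, uniformizer E V v p }.

Lemma subfield1 E : is_subfield E -> E 1. Proof. by case=> -[]. Qed.
Lemma subfield0 E : is_subfield E -> E 0.
Proof. by case=> -[E1 EB _] _; rewrite -(subrr 1); apply: EB. Qed.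
Lemma subfieldB E x y : is_subfield E -> E x -> E y -> E (x - y).
Proof. by case=> -[_ EB _] _; apply: EB. Qed.
Lemma subfieldM E x y : is_subfield E -> E x -> E y -> E (x * y).
Proof. by case=> -[_ _ EM] _; apply: EM. Qed.
Lemma subfieldV E x : is_subfield E -> E x -> E x^-1.
Proof. by case=> _; apply. Qed.
Lemma subfieldX E x m : is_subfield E -> E x -> E (x ^+ m).
Proof.
move=> sE Ex; elim: m => [|m IHm]; first by rewrite expr0; apply: subfield1.
by rewrite exprS; apply: subfieldM.
Qed.
Lemma subfieldXz E x (z : int) : is_subfield E -> E x -> E (x ^ z).
Proof. by move=> sE Ex; case: z => m; [|apply: subfieldV => //]; apply: subfieldX. Qed.

Lemma divval1 E v : is_subfield E -> divval E v -> v 1 = 0.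
Proof.
move=> sE [_ _ vM]; have E1 := subfield1 sE.
by have := vM _ _ E1 E1 (oner_neq0 _) (oner_neq0 _); rewrite mulr1; lia.
Qed.

Lemma divvalV E v x : is_subfield E -> divval E v -> v x^-1 = - v x.
Proof.
move=> sE vv; have [v0 vE vM] := vv.
have [->|x0] := eqVneq x 0; first by rewrite invr0 v0.
have [Ex|nEx] := pselect (E x); last first.
  rewrite !vE // => /(subfieldV sE); rewrite invrK; exact: nEx.
have := vM _ _ Ex (subfieldV sE Ex) x0; rewrite invr_eq0 => /(_ x0).
by rewrite divff // (divval1 sE vv); lia.
Qed.

Lemma divvalM E v x y : divval E v -> E x -> E y -> x != 0 -> y != 0 ->
  v (x * y) = v x + v y.
Proof. by case=> _ _; apply. Qed.

Lemma divvalF E v x y : is_subfield E -> divval E v -> E x -> E y ->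
  x != 0 -> y != 0 -> v (x / y) = v x - v y.
Proof.
move=> sE vv Ex Ey x0 y0; rewrite (divvalM vv) ?invr_eq0 //; last exact: subfieldV.
by rewrite (divvalV _ sE).
Qed.

Lemma divvalX E v x m : is_subfield E -> divval E v -> E x -> x != 0 ->
  v (x ^+ m) = v x *+ m.
Proof.
move=> sE vv Ex x0; elim: m => [|m IHm]; first by rewrite expr0 (divval1 sE).
by rewrite exprS (divvalM vv) ?expf_neq0 ?IHm ?mulrS //; apply: subfieldX.
Qed.

Lemma divvalXz E v x (z : int) : is_subfield E -> divval E v -> E x -> x != 0 ->
  v (x ^ z) = v x * z.
Proof.
move=> sE vv Ex x0; case: z => m; first by rewrite -exprnP (divvalX _ sE) // -mulr_natr natz.
by rewrite NegzE -exprnN (divvalV _ sE vv) (divvalX _ sE) // -mulr_natr natz mulrN.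
Qed.

Section Theory.
Variables (E A : set K) (V : set (K -> int)).
Hypothesis fac : factorial E A V.
Let sE : is_subfield E. Proof. exact: fac_field fac. Qed.

Lemma fac_unit x : E x -> x != 0 -> (A x /\ A x^-1 <-> forall v, V v -> v x = 0).
Proof.
move=> Ex x0; have Ev := subfieldV sE Ex; have xV0 : x^-1 != 0 by rewrite invr_eq0.
rewrite !(fac_ring fac) //; split=> [[xge xle] v Vv|vx0].
  by have := xge _ Vv; have := xle _ Vv; rewrite (divvalV _ sE (fac_val fac Vv)); lia.
by split=> v Vv; rewrite ?(divvalV _ sE (fac_val fac Vv)) vx0 ?oppr0.
Qed.

(** Any finitely supported family of multiplicities is realized by a product of powers of
    uniformizers. The last clause places this product in every multiplicative group containing the
    uniformizers used; it serves later to show that such a product is a unit in a larger ring. *)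
Lemma fac_realize_seq (e : (K -> int) -> int) (s : seq (K -> int)) :
  uniq s -> (forall v, v \in s -> V v) ->
  exists y, [/\ E y, y != 0, (forall v, V v -> v y = if v \in s then e v else 0)
    & forall P : K -> Prop, P 1 -> (forall a b, P a -> P b -> P (a * b)) ->
      (forall a, P a -> P a^-1) ->
      (forall v p, v \in s -> e v != 0 -> uniformizer E V v p -> P p) -> P y].
Proof.
elim: s => [|v s IHs] /= => [_ _|/andP[vs us] sV].
  exists 1; split=> //; [exact: subfield1|exact: oner_neq0|].
  by move=> v Vv; apply: divval1 (fac_val fac Vv).
have [|y [Ey y0 yv yP]] := IHs us; first by move=> w ws; apply: sV; rewrite inE ws orbT.
have Vv : V v by apply: sV; rewrite mem_head.
have [p up] := fac_par fac Vv; have [Ep p0 vp pw] := up.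
exists (p ^ (e v) * y); split.
- by apply: subfieldM => //; apply: subfieldXz.
- by rewrite mulf_neq0 // expfz_neq0.
- move=> w Vw; have vw := fac_val fac Vw.
  rewrite (divvalM vw) ?expfz_neq0 //; last exact: subfieldXz.
  rewrite (divvalXz _ sE vw) // yv // inE.
  have [->|wv] := eqVneq w v; first by rewrite (negPf vs) vp mul1r addr0.
  by rewrite pw // mul0r add0r.
- move=> P P1 PM PV Pp; have PX a m : P a -> P (a ^+ m).
    by move=> Pa; elim: m => [|m IHm]; rewrite ?expr0 // exprS; apply: PM.
  apply: (PM (p ^ e v) y).
    have [->|ev0] := eqVneq (e v) 0; first by [].
    have {}Pp : P p by apply: Pp up; rewrite ?mem_head.
    by case: (e v) => m; [|apply: PV]; apply: PX.
  by apply: yP => // w q ws ew uq; apply: (Pp w) => //; rewrite inE ws orbT.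
Qed.

Lemma fac_realize (x : K) (e : (K -> int) -> int) : E x -> x != 0 ->
  exists y, [/\ E y, y != 0, (forall v, V v -> v y = if v x != 0 then e v else 0)
    & forall P : K -> Prop, P 1 -> (forall a b, P a -> P b -> P (a * b)) ->
      (forall a, P a -> P a^-1) ->
      (forall v p, V v -> v x != 0 -> uniformizer E V v p -> P p) -> P y].
Proof.
move=> Ex x0; have [s sP] := fac_fin fac Ex x0.
pose t := undup [seq v <- s | `[< V v >] && (v x != 0)].
have tP v : v \in t = `[< V v >] && (v x != 0).
  rewrite mem_undup mem_filter; case: asboolP => //= Vv.
  by case: eqP => //= /eqP vx; rewrite sP.
have [|v|y [Ey y0 yv yP]] := @fac_realize_seq e t.
- exact: undup_uniq.
- by rewrite tP => /andP[/asboolP].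
exists y; split=> // [v Vv|P P1 PM PV Pp].
  by rewrite yv // tP; case: asboolP.
by apply: yP => // v p; rewrite tP => /andP[/asboolP Vv vx] _; apply: Pp.
Qed.

(** The denominator is given the value |w x| at every [w], which cancels the poles of [x] and is 0
    at [v] itself. *)
Lemma fac_frac v x : V v -> E x -> x != 0 -> v x = 0 ->
  exists a b, [/\ A a, A b, a != 0, b != 0 & [/\ v a = 0, v b = 0 & x = a / b]].
Proof.
move=> Vv Ex x0 vx; have [b [Eb b0 bv _]] := fac_realize (fun w => `|w x|) Ex x0.
exists (x * b), b; rewrite mulf_neq0 // mulfK //.
have vb : v b = 0 by rewrite bv // vx eqxx.
have Exb := subfieldM sE Ex Eb.
split=> //; last by rewrite (divvalM (fac_val fac Vv)) // vx vb.
  apply/(fac_ring fac) => //; first by rewrite mulf_neq0.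
  by move=> w Vw; rewrite (divvalM (fac_val fac Vw)) // bv //; case: eqP => /=; lia.
by apply/(fac_ring fac) => // w Vw; rewrite bv //; case: eqP => /=; lia.
Qed.

Lemma uniformizer_ring v p : V v -> uniformizer E V v p -> A p.
Proof.
move=> Vv [Ep p0 vp pw]; apply/(fac_ring fac) => // w Vw.
by have [->|wv] := eqVneq w v; rewrite ?vp // pw.
Qed.

Lemma uniformizer_div v p x : V v -> uniformizer E V v p -> A x -> x != 0 ->
  (A (x / p) <-> 0 < v x).
Proof.
move=> Vv [Ep p0 vp pw] Ax x0; have Ex := fac_sub fac Ax.
have Exp : E (x / p) by apply: subfieldM => //; apply: subfieldV.
rewrite (fac_ring fac) ?mulf_neq0 ?invr_eq0 //; split=> [/(_ v Vv)|vx w Vw].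
  by rewrite (divvalF sE (fac_val fac Vv)) // vp; lia.
rewrite (divvalF sE (fac_val fac Vw)) //.
have [->|wv] := eqVneq w v; first by rewrite vp; lia.
by rewrite pw // subr0; move/(fac_ring fac Ex x0): Ax; apply.
Qed.
End Theory.

(** A Krull ring determines its valuations. A uniformizer [p] of [v] is not a unit, so some [v'] is
    positive on it; if [q] is a uniformizer of [v'], then [p / q] is in [A] and [v q = 1]. Elements
    that are units at [v'] are units at [v], so the two functions agree. *)
Lemma factorial_subset E A V V' : factorial E A V -> factorial E A V' -> V `<=` V'.
Proof.
move=> fac fac' v Vv; have sE := fac_field fac.
have [p up] := fac_par fac Vv; have [Ep p0 vp pw] := up.
have Ap := uniformizer_ring fac Vv up.
have [v' [V'v' v'p]] : exists v', V' v' /\ 0 < v' p.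
  apply: contrapT => nv'; have : A p^-1.
    apply: (proj2 (proj2 (fac_unit fac' Ep p0) _)) => w V'w.
    have := proj1 (fac_ring fac' Ep p0) Ap _ V'w.
    by rewrite le_eqVlt => /predU1P[<-//|wp]; case: nv'; exists w.
  move/(fac_ring fac (subfieldV sE Ep)); rewrite invr_eq0 => /(_ p0 v Vv).
  by rewrite (divvalV _ sE (fac_val fac Vv)) vp.
have [q uq] := fac_par fac' V'v'; have [Eq q0 vq qw] := uq.
have Aq := uniformizer_ring fac' V'v' uq.
have Apq : A (p / q) by apply/(uniformizer_div fac' V'v' uq).
have Epq := fac_sub fac Apq; have pq0 : p / q != 0 by rewrite mulf_neq0 ?invr_eq0.
have vv := fac_val fac Vv; have vv' := fac_val fac' V'v'.
have vpq : v (p / q) = 0 /\ v q = 1.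
  have := divvalF sE vv Ep Eq p0 q0.
  have := proj1 (fac_ring fac Epq pq0) Apq _ Vv.
  have := proj1 (fac_ring fac Eq q0) Aq _ Vv; rewrite vp.
  have [vq0|] := eqVneq (v q) 0; last by lia.
  have /(uniformizer_div fac Vv up Apq pq0) : 0 < v (p / q).
    by rewrite (divvalF sE vv) // vp vq0.
  rewrite mulrAC divff // mul1r => /(fac_ring fac' (subfieldV sE Eq)).
  by rewrite invr_eq0 => /(_ q0 _ V'v'); rewrite (divvalV _ sE vv') vq.
(* Otherwise [x / p], and with it [x / q], would lie in [A], against [v' (x / q) = -1]. *)
have key x : A x -> x != 0 -> v' x = 0 -> v x = 0.
  move=> Ax x0 v'x; have Ex := fac_sub fac Ax.
  have := proj1 (fac_ring fac Ex x0) Ax _ Vv; rewrite le_eqVlt => /predU1P[<-//|vx].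
  have /(uniformizer_div fac Vv up Ax x0) Axp : 0 < v x by [].
  have : 0 <= v' (x / p * (p / q)).
    have Exp := fac_sub fac Axp; have xp0 : x / p != 0 by rewrite mulf_neq0 ?invr_eq0.
    rewrite (divvalM vv') // addr_ge0 //.
      exact: (proj1 (fac_ring fac' Exp xp0) Axp).
    exact: (proj1 (fac_ring fac' Epq pq0) Apq).
  by rewrite mulrA divfK // (divvalF sE vv') // v'x vq.
suff -> : v = v' by [].
apply/funext => x; have [v0 vE _] := vv; have [v'0 v'E _] := vv'.
have [->|x0] := eqVneq x 0; first by rewrite v0 v'0.
have [Ex|nEx] := pselect (E x); last by rewrite vE ?v'E.
pose y := x * q ^ (- v' x); have Ey : E y by apply: subfieldM => //; apply: subfieldXz.
have qz0 : q ^ (- v' x) != 0 by rewrite expfz_neq0.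
have y0 : y != 0 by rewrite mulf_neq0.
have v'y : v' y = 0.
  by rewrite (divvalM vv') ?(divvalXz _ sE vv') ?vq //; [lia|exact: subfieldXz].
have [a [b [Aa Ab a0 b0 [va vb yE]]]] := fac_frac fac' V'v' Ey y0 v'y.
have : v y = 0.
  by rewrite yE (divvalF sE vv) ?(key a) ?(key b) //; [exact: (fac_sub fac)|exact: (fac_sub fac)].
rewrite (divvalM vv) ?(divvalXz _ sE vv) //; last exact: subfieldXz.
by case: vpq => _ ->; lia.
Qed.

Lemma factorial_unique E A V V' : factorial E A V -> factorial E A V' -> V = V'.
Proof. by move=> f f'; apply/seteqP; split; [apply: (factorial_subset f f')|apply: (factorial_subset f' f)]. Qed.

(** The valuations of A[1/d] are those at which [d] is a unit; a power of [d] clears the finitely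
    many remaining poles. *)
Lemma factorial_localize E A V (d : K) : factorial E A V -> E d -> d != 0 -> A d ->
  factorial E [set x | E x /\ exists N, A (x * d ^+ N)] [set v | V v /\ v d = 0].
Proof.
move=> fac Ed d0 Ad; have sE := fac_field fac.
have Ad0 w : V w -> 0 <= w d by move/(fac_ring fac Ed d0): Ad; apply.
split=> // [v [/(fac_val fac)]//|x []//|x Ex x0|x Ex x0|v [Vv vd]].
- split=> [[_ [N AN]] v [Vv vd]|xge].
    have vv := fac_val fac Vv; have EdN := subfieldX N sE Ed.
    move/(fac_ring fac): AN => /(_ (subfieldM sE Ex EdN)).
    rewrite mulf_neq0 ?expf_neq0 // => /(_ isT _ Vv).
    by rewrite (divvalM vv) ?expf_neq0 // (divvalX _ sE) // vd mul0rn addr0.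
  split=> //; have [s sP] := fac_fin fac Ex x0.
  pose N := \sum_(v <- s) `|v x|%N; exists N.
  have EdN := subfieldX N sE Ed.
  apply/(fac_ring fac); [exact: subfieldM|by rewrite mulf_neq0 ?expf_neq0|].
  move=> v Vv; have vv := fac_val fac Vv.
  rewrite (divvalM vv) ?expf_neq0 // (divvalX _ sE) //.
  have := Ad0 v Vv; rewrite le_eqVlt => /predU1P[vd|vd].
    by rewrite -vd mul0rn addr0; apply: xge.
  have [->|vx] := eqVneq (v x) 0; first by rewrite add0r mulrn_wge0 // ltW.
  have : (`|v x| <= N)%N by rewrite /N (big_rem v) ?sP //= leq_addr.
  by rewrite -mulr_natr; nia.
- by have [s sP] := fac_fin fac Ex x0; exists s => v [Vv _]; apply: sP.
- have [p [Ep p0 vp pw]] := fac_par fac Vv; exists p; split=> // w [Vw _]; exact: pw.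
Qed.

(* Nagata's lemma: the v c are the u c-adic valuations, and C = A[1/u]. *)
Lemma factorial_nagata (I : finType) E A C V (u : I -> K) (v : I -> K -> int) :
  factorial E C V -> is_subring A -> A `<=` C ->
  (forall c, divval E (v c)) -> (forall c, A (u c) /\ C (u c)^-1) ->
  (forall c c', v c (u c') = (c == c')%:R) ->
  (forall c x, A x -> x != 0 -> 0 <= v c x) ->
  (forall c x, A x -> x != 0 -> 0 < v c x -> A (x / u c)) ->
  (forall x, C x -> exists f : I -> nat, A (x * \prod_c u c ^+ f c)) ->
  factorial E A (V `|` range v).
Proof.
move=> fac [A1 AB AM] AC vv uAC vu vge vdiv Cu; have sE := fac_field fac.
have u0 c : u c != 0.
  apply/eqP => u0; have := vu c c; rewrite u0 eqxx; case: (vv c) => -> _ _.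
  by [].
have uE c : E (u c) by apply/(fac_sub fac)/AC; have [] := uAC c.
have Vu w c : V w -> w (u c) = 0.
  by move=> Vw; move: w Vw; apply/(fac_unit fac) => //; have [/AC ? ?] := uAC c.
have pE f : E (\prod_c u c ^+ f c).
  by elim/big_ind: _ => [|a b|c _]; [exact: subfield1|exact: subfieldM|exact: subfieldX].
have p0 f : \prod_c u c ^+ f c != 0 by apply/prodf_neq0 => c _; rewrite expf_neq0.
have pv (f : I -> nat) c : v c (\prod_c' u c' ^+ f c') = (f c)%:Z.
  transitivity (\sum_c' v c (u c' ^+ f c')).
    have: [/\ E (\prod_c' u c' ^+ f c'), \prod_c' u c' ^+ f c' != 0
       & v c (\prod_c' u c' ^+ f c') = \sum_c' v c (u c' ^+ f c')]; last by case.
    elim/big_rec2: _ => [|c' s y _ [Ey y0 ys]].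
      by split; [exact: subfield1|exact: oner_neq0|exact: divval1 (vv c)].
    have uX := subfieldX (f c') sE (uE c'); have uX0 : u c' ^+ f c' != 0 by rewrite expf_neq0.
    by split; [exact: subfieldM|exact: mulf_neq0|rewrite (divvalM (vv c)) // ys].
  rewrite (bigD1 c) //= big1 ?addr0 => [|c' c'c].
    by rewrite (divvalX _ sE (vv c)) // vu eqxx -[RHS]natz.
  by rewrite (divvalX _ sE (vv c)) // vu eq_sym (negPf c'c) mul0rn.
split=> //.
- by move=> w [/(fac_val fac)//|[c _ <-]].
- by move=> x /AC/(fac_sub fac).
- move=> x Ex x0; split=> [Ax w [Vw|[c _ <-]]|xge].
  + by move/AC/(fac_ring fac Ex x0): Ax; apply.
  + exact: vge.
  have Cx : C x by apply/(fac_ring fac Ex x0) => w Vw; apply: xge; left.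
  have [f] := Cu x Cx; have [N] := ubnP (\sum_c f c)%N.
  elim: N f => // N IHN f; rewrite ltnS => fN Axf.
  have [/existsP[c fc]|/existsPn f0] := boolP [exists c, (0 < f c)%N]; last first.
    by move: Axf; rewrite big1 ?mulr1 // => c _; have := f0 c; rewrite lt0n negbK => /eqP ->.
  pose g c' := (f c' - (c' == c))%N.
  have fg : \prod_c' u c' ^+ f c' = (\prod_c' u c' ^+ g c') * u c.
    rewrite (bigD1 c) // [in RHS](bigD1 c) //= /g eqxx subn1 mulrAC -exprSr prednK //.
    by congr (_ * _); apply: eq_bigr => c' /negPf ->; rewrite subn0.
  apply: (IHN g).
    apply: leq_trans fN; rewrite (bigD1 c) // [leqRHS](bigD1 c) //= /g eqxx subn1 -addSn prednK //.
    by rewrite leq_add2l leq_sum // => c' /negPf ->; rewrite subn0.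
  have := vdiv c _ Axf; rewrite mulf_neq0 // => /(_ isT).
  rewrite (divvalM (vv c)) // pv fg mulrA mulfK //; apply.
  by have : 0 <= v c x by [apply: xge; right; exists c]; lia.
- move=> x Ex x0; have [s sP] := fac_fin fac Ex x0.
  exists (s ++ [seq v c | c <- enum I]) => w [Vw|[c _ <-]] wx.
    by rewrite mem_cat sP.
  by rewrite mem_cat map_f ?orbT // mem_enum.
- move=> w [Vw|[c _ <-]]; last first.
    exists (u c); split=> //; first by rewrite vu eqxx.
    move=> w' [Vw' _|[c' _ <-] cc']; first exact: Vu.
    by rewrite vu; case: eqP => // ec; rewrite ec eqxx in cc'.
  have [p [Ep pn0 wp pw]] := fac_par fac Vw.
  (* A uniformizer for [C] may still have zeros or poles along the [u c]. The product [f] of powers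
     of the [u c] corrects this without touching the valuations in [V], since the [u c] are units of
     [C]. *)
  have [f [fE f0 fv fV]] : exists f, [/\ E f, f != 0, (forall c, v c f = - v c p) & forall w, V w -> w f = 0].
    exists (\prod_c u c ^ (- v c p)).
    have H (P : K -> Prop) : (forall c, P (u c ^ (- v c p))) -> P 1 -> (forall a b, P a -> P b -> P (a * b)) ->
      P (\prod_c u c ^ (- v c p)) by move=> H1 H2 H3; elim/big_ind: _.
    have fE : E (\prod_c u c ^ (- v c p)) /\ \prod_c u c ^ (- v c p) != 0.
      apply: (H (fun x => E x /\ x != 0)) => [c||a b [Ea a0] [Eb b0]].
      - by rewrite expfz_neq0 //; split=> //; apply: subfieldXz.
      - by rewrite oner_neq0; split=> //; apply: subfield1.
      - by rewrite mulf_neq0 //; split=> //; apply: subfieldM.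
    have fS w' : divval E w' -> w' (\prod_c u c ^ (- v c p)) = \sum_c w' (u c) * (- v c p).
      move=> vw'; suff [_ _ ->] : [/\ E (\prod_c u c ^ (- v c p)), \prod_c u c ^ (- v c p) != 0 &
         w' (\prod_c u c ^ (- v c p)) = \sum_c w' (u c) * (- v c p)] by [].
      elim/big_rec2: _ => [|c' s y _ [Ey y0 ys]].
        by split; [exact: subfield1|exact: oner_neq0|exact: divval1 vw'].
      have uX := subfieldXz (- v c' p) sE (uE c'); have uX0 : u c' ^ (- v c' p) != 0 by rewrite expfz_neq0.
      split; [exact: subfieldM|exact: mulf_neq0|].
      by rewrite (divvalM vw') // ys (divvalXz _ sE vw').
    case: fE => fE f0; split=> // [c|w' Vw'].
      rewrite fS // (bigD1 c) //= vu eqxx mul1r big1 ?addr0 // => c' c'c.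
      by rewrite vu eq_sym (negPf c'c) mul0r.
    rewrite fS ?big1 // => [c _|]; first by rewrite Vu ?mul0r.
    exact: (fac_val fac).
  exists (p * f); split; rewrite ?mulf_neq0 //; first exact: subfieldM.
    by rewrite (divvalM (fac_val fac Vw)) // wp fV.
  move=> w' [Vw'|[c _ <-]] w'w; last by rewrite (divvalM (vv c)) // fv addrN.
  by rewrite (divvalM (fac_val fac Vw')) // fV // pw // addr0.
Qed.
End FactorialSystem.

Section Push.
Variables (T K : fieldType) (i : {rmorphism T -> K}).

(** The valuation carried to the image of [i], and 0 elsewhere as [divval] demands. *)
Definition push_val (v : T -> int) (x : K) : int :=
  if pselect (exists t, i t = x) is left tx then v (sval (cid tx)) else 0.

Lemma push_valE v t : push_val v (i t) = v t.
Proof.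
rewrite /push_val; case: pselect => [tx|[]]; last by exists t.
by congr v; apply: (fmorph_inj i); exact: (svalP (cid tx)).
Qed.

Lemma push_valN v x : ~ range i x -> push_val v x = 0.
Proof. by move=> nx; rewrite /push_val; case: pselect => // -[t tx]; case: nx; exists t. Qed.

Lemma range_subfield : is_subfield (range i).
Proof.
split; first split.
- by exists 1; rewrite ?rmorph1.
- by move=> _ _ [x _ <-] [y _ <-]; exists (x - y); rewrite ?rmorphB.
- by move=> _ _ [x _ <-] [y _ <-]; exists (x * y); rewrite ?rmorphM.
- by move=> _ [x _ <-]; exists x^-1; rewrite ?fmorphV.
Qed.

Lemma push_divval v : divval setT v -> divval (range i) (push_val v).
Proof.
move=> [v0 _ vM]; split; first by rewrite -(rmorph0 i) push_valE.
  by move=> x; apply: push_valN.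
move=> _ _ [x _ <-] [y _ <-]; rewrite !fmorph_eq0 => x0 y0.
by rewrite -rmorphM !push_valE vM.
Qed.

Lemma push_factorial A V : factorial setT A V ->
  factorial (range i) (i @` A) (push_val @` V).
Proof.
move=> fac; split; first exact: range_subfield.
- by move=> _ [v Vv <-]; apply/push_divval/(fac_val fac).
- by move=> _ [x _ <-]; exists x.
- move=> _ [x _ <-]; rewrite fmorph_eq0 => x0; split.
    move=> [y Ay /fmorph_inj yx] _ [v Vv <-]; rewrite push_valE; subst y.
    by move/(fac_ring fac I x0): Ay; apply.
  move=> xge; exists x => //; apply/(fac_ring fac I x0) => v Vv.
  by rewrite -push_valE; apply: xge; exists v.
- move=> _ [x _ <-]; rewrite fmorph_eq0 => x0; have [s sP] := fac_fin fac I x0.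
  exists (map push_val s) => _ [v Vv <-]; rewrite push_valE => vx.
  by rewrite map_f // sP.
- move=> _ [v Vv <-]; have [p [_ p0 vp pw]] := fac_par fac Vv.
  exists (i p); split; [by exists p|by rewrite fmorph_eq0|by rewrite push_valE|].
  by move=> _ [w Vw <-] wv; rewrite push_valE; apply: pw => //; apply: contraNneq wv => ->.
Qed.
End Push.

(** * Prime-adic valuations of a factorial ring *)

Section UfdFactorial.
Variable R : idomainType.
Hypothesis Rufd : is_ufd R.
Implicit Types (a b p q : R).
Local Notation "x %:F" := (@FracField.tofrac R x).

Definition ord_spec p a (e : nat) := exists2 b, a = p ^+ e * b & ~ divides p b.

Lemma ord_exists p a : prime_elt p -> a != 0 -> exists e, ord_spec p a e.
Proof.
move=> pp a0; have [u [s [u1 ps aE]]] := Rufd a0; have [p0 pN1 pP] := pp.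
have [N] := ubnP (size s); elim: N a a0 u s u1 ps aE => // N IHN a a0 u s u1 ps aE sN.
have [pa|npa] := pselect (divides p a); last by exists 0%N, a; rewrite ?expr0 ?mul1r.
have : divides p (u * \prod_(q <- s) q) by rewrite -aE.
case/pP => [pu|/(prime_divides_prod pp)[q qs pq]].
  by case: pN1; apply: divides_trans u1.
have [c qE] := pq; have [d pE] := prime_associate pp (ps _ qs) pq.
have cd : c * d = 1 by apply: (mulIf p0); rewrite mul1r {2}pE qE; ring.
have aE' : a = p * (u * c * \prod_(r <- rem q s) r).
  by rewrite aE (big_rem q) //= qE; ring.
have [||||e [b bE pb]] := IHN _ _ (u * c) (rem q s) _ _ (erefl _).
- by apply: contraNneq a0 => E; rewrite aE' E mulr0.
- by case: u1 => v vE; exists (v * d); rewrite mulrACA -vE mul1r mulrC.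
- by move=> r /mem_rem; apply: ps.
- by rewrite size_rem //; case: (s) qs sN.
by exists e.+1, b; rewrite // exprS -mulrA -bE.
Qed.

Lemma ord_unique p a e f : p != 0 -> ord_spec p a e -> ord_spec p a f -> e = f.
Proof.
move=> p0; wlog ef : e f / (e <= f)%N => [H oe of_|[b -> pb] [c E pc]].
  by case/orP: (leq_total e f) => ef; [exact: H|symmetry; exact: H].
move: ef; rewrite leq_eqVlt => /predU1P[//|ef]; case: pb.
exists (p ^+ (f - e.+1) * c); apply: (mulfI (expf_neq0 e p0)); rewrite E.
by rewrite -mulrAC -exprSr subnSK // mulrA -exprD subnKC // ltnW.
Qed.

Definition ordp p a : nat :=
  if pselect (exists e, ord_spec p a e) is left e then sval (cid e) else 0%N.

Lemma ordpP p a : prime_elt p -> a != 0 -> ord_spec p a (ordp p a).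
Proof.
move=> pp a0; rewrite /ordp; case: pselect => [e|/(_ (ord_exists pp a0))//].
exact: (svalP (cid e)).
Qed.

Lemma ordpM p a b : prime_elt p -> a != 0 -> b != 0 ->
  ordp p (a * b) = (ordp p a + ordp p b)%N.
Proof.
move=> pp a0 b0; have [p0 _ pP] := pp.
have [c aE pc] := ordpP pp a0; have [d bE pd] := ordpP pp b0.
apply: (ord_unique p0 (ordpP pp (mulf_neq0 a0 b0))).
by exists (c * d); [rewrite {1}aE {1}bE exprD; ring|move/pP => []].
Qed.

Lemma ordp_gt0 p a : prime_elt p -> a != 0 -> (0 < ordp p a)%N <-> divides p a.
Proof.
move=> pp a0; have [b aE pb] := ordpP pp a0; split=> [|pa].
  case: (ordp p a) aE => // e -> _; exists (p ^+ e * b); rewrite exprS; ring.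
by rewrite lt0n; apply/eqP => o0; apply: pb; rewrite o0 expr0 mul1r in aE; rewrite -aE.
Qed.

Definition fnum (x : {fraction R}) : R := sval (cid (fracE x)).
Definition fden (x : {fraction R}) : R := sval (cid (svalP (cid (fracE x)))).
Lemma fnumdenP x : fden x != 0 /\ x = (fnum x)%:F / (fden x)%:F.
Proof. exact: (svalP (cid (svalP (cid (fracE x))))). Qed.

Definition frac_ord p (x : {fraction R}) : int :=
  if x == 0 then 0 else (ordp p (fnum x))%:Z - (ordp p (fden x))%:Z.

Lemma frac_ordE p a b : prime_elt p -> a != 0 -> b != 0 ->
  frac_ord p (a%:F / b%:F) = (ordp p a)%:Z - (ordp p b)%:Z.
Proof.
move=> pp a0 b0; rewrite /frac_ord mulf_eq0 invr_eq0 !tofrac_eq0 (negPf a0) (negPf b0) /=.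
have [] := fnumdenP (a%:F / b%:F); move: (fnum _) (fden _) => c d d0 xE.
have E : c * b = a * d.
  apply: tofrac_inj; rewrite !tofracM; apply/eqP; rewrite -eqr_div ?tofrac_eq0 //.
  by rewrite xE.
have c0 : c != 0.
  apply: contraTneq (mulf_neq0 a0 d0) => c0; by rewrite -E c0 mul0r eqxx.
have := congr1 (ordp p) E; rewrite !ordpM //; lia.
Qed.

(** Makes the set of functions [frac_ord p] a set of primes up to units, as the uniformizers of
    [factorial] require. *)
Lemma frac_ord_assoc p q : prime_elt p -> prime_elt q -> divides p q ->
  frac_ord p = frac_ord q.
Proof.
move=> pp pq dpq; have dqp := prime_associate pp pq dpq.
have oE a : a != 0 -> ordp p a = ordp q a.
  move=> a0; have [b aE pb] := ordpP pp a0; have [q0 qN1 _] := pq.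
  apply: (ord_unique q0 _ (ordpP pq a0)).
  case: dqp => c pE; case: dpq => d qE.
  exists (c ^+ ordp p a * b); first by rewrite {1}aE {1}pE exprMn; ring.
  have cd : d * c = 1.
    apply: (mulIf q0); rewrite mul1r {2}qE pE; ring.
  case=> e E; apply: pb; exists (d ^+ ordp p a * e * d).
  have bE : b = d ^+ ordp p a * (c ^+ ordp p a * b) by rewrite mulrA -exprMn cd expr1n mul1r.
  rewrite [LHS]bE E qE; ring.
apply/funext => x; rewrite /frac_ord; case: eqP => // /eqP x0.
have [] := fnumdenP x; move: (fnum _) (fden _) => c d d0 xE.
by rewrite !oE //; apply: contraNneq x0 => c0; rewrite xE c0 tofrac0 mul0r.
Qed.

Lemma frac_ord_div (p : R) : prime_elt p -> divval setT (frac_ord p).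
Proof.
move=> pp; split; [by rewrite /frac_ord eqxx|by move=> x []|].
move=> x y _ _; have [a [b [b0 ->]]] := fracE x; have [c [d [d0 ->]]] := fracE y.
rewrite !mulf_eq0 !negb_or !invr_eq0 !tofrac_eq0 => /andP[a0 _] /andP[c0 _].
by rewrite mulf_div -!tofracM !frac_ordE ?mulf_neq0 // !ordpM //; lia.
Qed.

Lemma frac_ord_tofrac p a : prime_elt p -> a != 0 -> frac_ord p a%:F = ordp p a.
Proof.
move=> pp a0; rewrite -[a%:F]divr1 -tofrac1 frac_ordE ?oner_neq0 //.
suff -> : ordp p 1 = 0%N by rewrite subr0.
have /eqP := ordpM pp (oner_neq0 R) (oner_neq0 R).
by rewrite mul1r -[X in X == _]addn0 eqn_add2l eq_sym => /eqP.
Qed.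

Lemma prime_uniformizer p : prime_elt p -> uniformizer (setT : set {fraction R})
  [set v | exists2 p, prime_elt p & v = frac_ord p] (frac_ord p) p%:F.
Proof.
move=> pp; have [p0 pN1 pP] := pp; split=> //.
- by rewrite tofrac_eq0.
- rewrite frac_ord_tofrac //; congr Posz; apply: (ord_unique p0 (ordpP pp p0)).
  by exists 1; rewrite ?expr1 ?mulr1.
move=> _ [q pq ->] qp; rewrite frac_ord_tofrac //; apply/eqP; rewrite eqz_nat.
have [//|] := posnP (ordp q p); move=> /(ordp_gt0 pq p0) /(frac_ord_assoc pq pp) E.
by rewrite E eqxx in qp.
Qed.
Lemma ufd_factorial : factorial (setT : set {fraction R})
  (range (@FracField.tofrac R)) [set v | exists2 p, prime_elt p & v = frac_ord p].
Proof.
have sT : is_subfield (setT : set {fraction R}) by [].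
split=> //.
- by move=> _ [p pp ->]; apply: frac_ord_div.
- move=> x _ x0; split.
    move=> [a _ ax] _ [p pp ->]; rewrite -ax frac_ord_tofrac //.
    by rewrite -(tofrac_eq0 a) ax.
  have [a [b [b0 xE]]] := fracE x; have [u [s [[v uv] ps bE]]] := Rufd b0.
  move=> xge; elim: s ps a b b0 bE xE => [|q s IHs] ps a b b0 bE xE.
    exists (a * v) => //; rewrite xE bE big_nil mulr1 tofracM.
    have u0 : u%:F != 0 by apply: contraNneq b0 => /eqP; rewrite tofrac_eq0 bE => /eqP ->; rewrite mul0r.
    by apply: (mulIf u0); rewrite divfK // -mulrA -tofracM -uv tofrac1 mulr1.
  have pq : prime_elt q by apply: ps; rewrite mem_head.
  have [q0 _ _] := pq.
  have a0 : a != 0 by apply: contraNneq x0 => a0; rewrite xE a0 tofrac0 mul0r.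
  have b'0 : u * \prod_(r <- s) r != 0.
    by apply: contraNneq b0 => E; rewrite bE big_cons mulrCA E mulr0.
  have bE' : b = q * (u * \prod_(r <- s) r) by rewrite bE big_cons mulrCA.
  have age : 0 <= (ordp q a)%:Z - (ordp q b)%:Z.
    by rewrite -frac_ordE // -xE; apply: xge; exists q.
  have ob := proj2 (ordp_gt0 pq b0).
  have /(ordp_gt0 pq a0)[a' aE] : (0 < ordp q a)%N.
    by have := ob (ex_intro _ _ (etrans bE' (mulrC _ _))); lia.
  apply: (IHs _ a' (u * \prod_(r <- s) r)) => //.
    by move=> r rs; apply: ps; rewrite inE rs orbT.
  by rewrite xE aE bE' [q * _]mulrC !tofracM -mulf_div divff ?mulr1 // tofrac_eq0.
- move=> x _ x0; have [a [b [b0 xE]]] := fracE x.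
  have a0 : a != 0 by apply: contraNneq x0 => a0; rewrite xE a0 tofrac0 mul0r.
  have [u [s [u1 ps aE]]] := Rufd a0; have [v [t [v1 pt bE]]] := Rufd b0.
  exists [seq frac_ord q | q <- s ++ t] => _ [p pp ->]; rewrite xE frac_ordE // => o0.
  have [p0 pN1 pP] := pp.
  have key c w r : c != 0 -> divides w 1 -> (forall q, q \in r -> prime_elt q) ->
      c = w * \prod_(q <- r) q -> (0 < ordp p c)%N -> frac_ord p \in [seq frac_ord q | q <- r].
    move=> c0 w1 pr cE /(ordp_gt0 pp c0); rewrite cE => /pP[pw|/(prime_divides_prod pp)[q qr pq]].
      by case: pN1; apply: divides_trans w1.
    by apply/mapP; exists q; rewrite // (frac_ord_assoc pp (pr _ qr)).
  rewrite map_cat mem_cat; apply/orP.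
  have [oa|oa] := posnP (ordp p a); last by left; apply: (key a u s).
  by right; apply: (key b v t) => //; rewrite lt0n; apply: contraNneq o0 => ->; rewrite oa.
by move=> _ [p pp ->]; exists p%:F; exact: prime_uniformizer.
Qed.
End UfdFactorial.

(** * Maps out of a field of fractions *)

Section FracLift.
Variables (R : idomainType) (E : fieldType) (f : {rmorphism R -> E}).
Hypothesis f_inj : injective f.

Definition frac_lift_fun (x : {fraction R}) : E := f (fnum x) / f (fden x).

Let f_neq0 a : a != 0 -> f a != 0.
Proof. by rewrite -(rmorph0 f) (inj_eq f_inj). Qed.

Lemma frac_lift_funE a b : b != 0 ->
  frac_lift_fun (FracField.tofrac a / FracField.tofrac b) = f a / f b.
Proof.
move=> b0; have [] := fnumdenP (FracField.tofrac a / FracField.tofrac b).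
rewrite /frac_lift_fun; move: (fnum _) (fden _) => c d d0 E0.
apply/eqP; rewrite eqr_div ?f_neq0 // -!rmorphM (inj_eq f_inj) -tofrac_eq !tofracM.
by rewrite -eqr_div ?tofrac_eq0 // E0.
Qed.

Fact frac_lift_zmod : zmod_morphism frac_lift_fun.
Proof.
move=> x y; have [a [b [b0 ->]]] := fracE x; have [c [d [d0 ->]]] := fracE y.
rewrite -mulNr -tofracN addf_div ?tofrac_eq0 // -!tofracM -tofracD.
rewrite !frac_lift_funE ?mulf_neq0 // -mulNr addf_div ?f_neq0 //.
by rewrite rmorphD !rmorphM rmorphN.
Qed.

Fact frac_lift_monoid : monoid_morphism frac_lift_fun.
Proof.
split.
  have := frac_lift_funE 1 (oner_neq0 R); rewrite tofrac1 divr1 => ->.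
  by rewrite rmorph1 divr1.
move=> x y; have [a [b [b0 ->]]] := fracE x; have [c [d [d0 ->]]] := fracE y.
rewrite mulf_div -!tofracM !frac_lift_funE ?mulf_neq0 //.
by rewrite mulf_div !rmorphM.
Qed.

HB.instance Definition _ := GRing.isZmodMorphism.Build _ _ frac_lift_fun frac_lift_zmod.
HB.instance Definition _ := GRing.isMonoidMorphism.Build _ _ frac_lift_fun frac_lift_monoid.

Definition frac_lift : {rmorphism {fraction R} -> E} := frac_lift_fun.

Lemma frac_liftE a : frac_lift (FracField.tofrac a) = f a.
Proof.
rewrite -[FracField.tofrac a]divr1 -tofrac1 [LHS]frac_lift_funE ?oner_neq0 //.
by rewrite rmorph1 divr1.
Qed.

Lemma frac_lift_numden x : f (\n_(repr x)) / f (\d_(repr x)) = frac_lift x.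
Proof.
have d0 : \d_(repr x) != 0 by exact: denom_ratioP.
by rewrite [in RHS](frac_reprE x) [RHS](frac_lift_funE _ d0).
Qed.
End FracLift.

(* Values of a fraction at a point where a denominator does not vanish. *)
Section Evaluation.
Variables (R : idomainType) (E : fieldType) (h : {rmorphism R -> E}).

Definition evaluates (x : {fraction R}) (e : E) :=
  exists a b, [/\ h b != 0, x = FracField.tofrac a / FracField.tofrac b & e = h a / h b].

Let den_neq0 b : h b != 0 -> b != 0.
Proof. by apply: contraNneq => ->; rewrite rmorph0. Qed.

Lemma evaluates_tofrac a : evaluates (FracField.tofrac a) (h a).
Proof. by exists a, 1; rewrite rmorph1 tofrac1 oner_neq0 !divr1. Qed.

Lemma evaluates_uniq x e e' : evaluates x e -> evaluates x e' -> e = e'.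
Proof.
move=> [a [b [b0 -> ->]]] [c [d [d0 /eqP E0 ->]]]; apply/eqP.
move: E0; rewrite !eqr_div ?tofrac_eq0 ?den_neq0 // -!tofracM tofrac_eq => /eqP E0.
by rewrite -!rmorphM E0.
Qed.

Lemma evaluatesD x y e f : evaluates x e -> evaluates y f -> evaluates (x + y) (e + f).
Proof.
move=> [a [b [b0 -> ->]]] [c [d [d0 -> ->]]].
exists (a * d + c * b), (b * d); rewrite rmorphM mulf_neq0 //.
by rewrite !addf_div ?tofrac_eq0 ?den_neq0 // tofracD !tofracM rmorphD !rmorphM.
Qed.

Lemma evaluatesM x y e f : evaluates x e -> evaluates y f -> evaluates (x * y) (e * f).
Proof.
move=> [a [b [b0 -> ->]]] [c [d [d0 -> ->]]].
by exists (a * c), (b * d); rewrite rmorphM mulf_neq0 // !mulf_div !tofracM !rmorphM.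
Qed.

Lemma evaluatesV x e : e != 0 -> evaluates x e -> evaluates x^-1 e^-1.
Proof.
move=> e0 [a [b [b0 -> eE]]]; exists b, a; rewrite !invf_div eE invf_div; split=> //.
by apply: contraNneq e0 => a0; rewrite eE a0 mul0r.
Qed.

Lemma evaluates_mpoly (k : fieldType) m (f : k -> {fraction R}) (f' : k -> E)
  (z : 'I_m -> {fraction R}) (z' : 'I_m -> E) (p : {mpoly k[m]}) :
  (forall c, evaluates (f c) (f' c)) -> (forall l, evaluates (z l) (z' l)) ->
  evaluates (mmap f z p) (mmap f' z' p).
Proof.
move=> fP zP; rewrite /mmap.
have ev1 : evaluates 1 1 by have := evaluates_tofrac 1; rewrite tofrac1 rmorph1.
have ev0 : evaluates 0 0 by have := evaluates_tofrac 0; rewrite tofrac0 rmorph0.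
elim/big_ind2: _ => // [x e y f0 xe yf|mm _]; first exact: evaluatesD.
apply: evaluatesM => //; rewrite /mmap1; elim/big_ind2: _ => // [x e y f0 xe yf|l _].
  exact: evaluatesM.
elim: (mm l) => [|q IHq]; rewrite ?expr0 // !exprS; exact: evaluatesM.
Qed.
End Evaluation.

Section RatMorph.
Variables (k : fieldType) (m : nat).

Fact ratC_zmod : zmod_morphism (@ratC k m).
Proof. by move=> x y; rewrite /ratC raddfB rmorphB. Qed.
Fact ratC_monoid : monoid_morphism (@ratC k m).
Proof. by split=> [|x y]; rewrite /ratC ?mpolyC1 ?tofrac1 // mpolyCM tofracM. Qed.
HB.instance Definition _ := GRing.isZmodMorphism.Build _ _ (@ratC k m) ratC_zmod.
HB.instance Definition _ := GRing.isMonoidMorphism.Build _ _ (@ratC k m) ratC_monoid.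

Lemma mmap_tofrac (p : {mpoly k[m]}) : mmap (@ratC k m) (@ratX k m) p = FracField.tofrac p.
Proof.
apply: (@mpoly_morph_ext _ _ _ (mmap (@ratC k m) (@ratX k m)) (@FracField.tofrac _)) => [c|i] /=.
  by rewrite mmapC.
by rewrite mmapX mmap1U.
Qed.

Lemma ratsubstE (E : fieldType) (h : {rmorphism k -> E}) (v : 'I_m -> E)
  (inj : injective (mmap h v : {mpoly k[m]} -> E)) x :
  ratsubst h v x = frac_lift inj x.
Proof. exact: (frac_lift_numden inj). Qed.

Lemma rat_morph_ext (E : fieldType) (f g : {rmorphism ratfun k m -> E}) :
  (forall c, f (ratC m c) = g (ratC m c)) -> (forall l, f (ratX k l) = g (ratX k l)) ->
  f =1 g.
Proof.
move=> fgC fgX x; have [a [b [_ ->]]] := fracE x.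
have key : f \o @FracField.tofrac _ =1 g \o @FracField.tofrac _.
  exact: (@mpoly_morph_ext _ _ _ (f \o @FracField.tofrac _) (g \o @FracField.tofrac _)).
by rewrite !fmorph_div; congr (_ / _); apply: key.
Qed.
End RatMorph.

Lemma moebius_solve (E : fieldType) (z r : E) : r != 0 -> r - 1 != 0 -> z + r - 1 != 0 ->
  (z * r / (z + r - 1) - r) * (1 - 0) != 0 /\
  z = (z * r / (z + r - 1) - 0) * (1 - r) * ((z * r / (z + r - 1) - r) * (1 - 0))^-1.
Proof.
move=> r0 r1 zr.
have E0 : z * r / (z + r - 1) - r = (r * (1 - r)) / (z + r - 1) by field.
have r1' : 1 - r != 0 by rewrite -oppr_eq0 opprB.
by rewrite E0 subr0 mulr1; split; [rewrite !mulf_neq0 ?invr_eq0|field; rewrite r0 r1' zr].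
Qed.

Lemma moebius_sub (E : fieldType) (c xi xj x0 xoo : E) : xi - xoo != 0 -> xj - xoo != 0 ->
  c * (xi - x0) / (xi - xoo) - c * (xj - x0) / (xj - xoo) =
  c * (x0 - xoo) * (xi - xoo)^-1 * (xj - xoo)^-1 * (xi - xj).
Proof. by move=> i0 j0; field; rewrite i0 j0. Qed.

Lemma moebius_oo (E : fieldType) (c b : E) : c != 0 -> b != 0 -> -1 = c * b^-1 * - c^-1 * b.
Proof. by move=> c0 b0; field; rewrite c0 b0. Qed.

(** * Affine coordinates on M_(0,n) *)

Section Brackets.
Variables (k : fieldType) (m0 : nat).
Local Notation m := m0.+1.
Local Notation n := m0.+4.
Local Notation T := (ratfun k m).
Local Notation K := (ratfun k n).
Local Notation pt0 := (inord 0 : 'I_n).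
Local Notation pt1 := (inord m.+1 : 'I_n).
Local Notation ptoo := (inord m.+2 : 'I_n).

Lemma pt0E : pt0 = 0%N :> nat. Proof. by rewrite inordK. Qed.
Lemma pt1E : pt1 = m.+1 :> nat. Proof. by rewrite inordK. Qed.
Lemma ptooE : ptoo = m.+2 :> nat. Proof. by rewrite inordK. Qed.

(* Homogeneous coordinates of the marked points, normalised to 0 at the first
   one and to 1 and infinity at the last two. *)
Definition coordT (i : 'I_n) : T :=
  if i == 0%N :> nat then 0 else if insub i.-1 is Some l then ratX k l else 1.
Definition cowT (i : 'I_n) : T := if i == m.+2 :> nat then 0 else 1.
Definition brT (i j : 'I_n) : T := coordT i * cowT j - coordT j * cowT i.
Definition brK (i j : 'I_n) : K := ratX k i - ratX k j.

Lemma coordT0 : coordT pt0 = 0. Proof. by rewrite /coordT pt0E. Qed.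
Lemma coordT1 : coordT pt1 = 1. Proof. by rewrite /coordT pt1E /= insubF //= ltnn. Qed.
Lemma coordToo : coordT ptoo = 1.
Proof. by rewrite /coordT ptooE /= insubF //= ltnNge leqnSn. Qed.
Lemma coordTX (l : 'I_m) : coordT (inord l.+1) = ratX k l.
Proof.
rewrite /coordT inordK; last by have := ltn_ord l; lia.
by rewrite /= (insubT (fun i => i < m)%N (ltn_ord l)) /=; congr ratX; apply/val_inj.
Qed.

Lemma point_cases (i : 'I_n) :
  [\/ i = pt0, i = pt1, i = ptoo | exists l : 'I_m, i = inord l.+1].
Proof.
have := ltn_ord i; case: (ltngtP i 0%N) => // [i0 ltin|i0 _]; last first.
  by apply: Or41; apply/val_inj; rewrite /= i0 pt0E.
have [im|mi] := ltnP i m.+1.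
  have il : (i.-1 < m)%N by lia.
  by apply: Or44; exists (Ordinal il); apply/val_inj; rewrite /= inordK; lia.
have [im|mi'] := eqVneq (i : nat) m.+1.
  by apply: Or42; apply/val_inj; rewrite /= im pt1E.
by apply: Or43; apply/val_inj; rewrite /= ptooE; lia.
Qed.

Lemma ratX_inj (l : nat) : injective (@ratX k l).
Proof.
move=> i j /tofrac_inj /mpolyP/(_ U_(i)%MM); rewrite !mcoeffX eqxx eq_sym.
have [E _|_ /eqP] := eqVneq U_(i)%MM U_(j)%MM; last by rewrite oner_eq0.
by have := congr1 (fun q : 'X_{1..l} => q j) E; rewrite !mnm1E eqxx; case: eqP.
Qed.
Lemma ratX_neqC (l : nat) (i : 'I_l) c : ratX k i != ratC l c.
Proof.
apply/eqP => /tofrac_inj /mpolyP/(_ U_(i)%MM); rewrite mcoeffX mcoeffC eqxx mnm1_eq0 mulr0.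
by move/eqP; rewrite oner_eq0.
Qed.

Lemma brT_anti i j : brT j i = - brT i j. Proof. by rewrite /brT opprB. Qed.
Lemma brK_anti i j : brK j i = - brK i j. Proof. by rewrite /brK opprB. Qed.
Lemma brK_neq0 i j : i != j -> brK i j != 0.
Proof. by move=> ij; rewrite subr_eq0 (inj_eq (@ratX_inj n)). Qed.

Lemma cowT_oo : cowT ptoo = 0. Proof. by rewrite /cowT ptooE eqxx. Qed.
Lemma cowT_fin i : i != ptoo -> cowT i = 1.
Proof. by rewrite /cowT -val_eqE /= ptooE; case: eqP. Qed.

(** The affine coordinate of the point [i] once [pt0], [pt1] and [ptoo] are moved to 0, 1 and
    infinity. *)
Definition zeta (i : 'I_n) : K :=
  (brK i pt0 * brK pt1 ptoo) / (brK i ptoo * brK pt1 pt0).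

Lemma pt0_neq1 : pt0 != pt1. Proof. by rewrite -val_eqE /= pt0E pt1E. Qed.
Lemma pt0_neqoo : pt0 != ptoo. Proof. by rewrite -val_eqE /= pt0E ptooE. Qed.
Lemma pt1_neqoo : pt1 != ptoo. Proof. by rewrite -val_eqE /= pt1E ptooE; lia. Qed.

Definition iota_poly : {mpoly k[m]} -> K :=
  mmap (@ratC k n) (fun l => zeta (inord l.+1)).
HB.instance Definition _ := GRing.RMorphism.on iota_poly.

(* A point of M_(0,n) over k(X) with the given cross-ratios. *)
Lemma iota_poly_inj : injective iota_poly.
Proof.
apply: raddf_inj => p p0.
pose r : T := ratX k ord0.
have r0 : r != 0 by rewrite -(rmorph0 (@ratC k m)) ratX_neqC.
have r1 : r - 1 != 0 by rewrite subr_eq0 -(rmorph1 (@ratC k m)) ratX_neqC.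
have zr (l : 'I_m) : ratX k l + r - 1 != 0.
  apply/eqP => E; have : FracField.tofrac ('X_l + 'X_ord0 - 1 : {mpoly k[m]}) = 0.
    by rewrite tofracB tofracD tofrac1.
  move=> /eqP; rewrite tofrac_eq0 => /eqP /mpolyP/(_ 0%MM).
  rewrite mcoeffB mcoeffD !mcoeffX mcoeff1 mcoeff0 !mnm1_eq0 eqxx add0r sub0r.
  by move/eqP; rewrite oppr_eq0 oner_eq0.
(* The variables of [K] are affine, so the last point cannot be put at infinity: it goes to [r], and
   z r / (z + r - 1) is the preimage of z under the Moebius map that fixes 0 and 1 and sends [r] to
   infinity. *)
pose pos (i : 'I_n) : T := if i == pt0 then 0 else if i == pt1 then 1 else
  if i == ptoo then r else coordT i * r / (coordT i + r - 1).
pose h : {rmorphism {mpoly k[n]} -> T} := mmap (@ratC k m) pos.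
have hX i : h 'X_i = pos i by rewrite /= mmapX mmap1U.
have evB i j : evaluates h (brK i j) (pos i - pos j).
  have -> : pos i - pos j = h ('X_i - 'X_j) by rewrite -!hX rmorphB.
  by rewrite /brK /ratX -tofracB; exact: evaluates_tofrac.
have pos0 : pos pt0 = 0 by rewrite /pos eqxx.
have pos1 : pos pt1 = 1 by rewrite /pos eq_sym (negPf pt0_neq1) eqxx.
have posoo : pos ptoo = r.
  by rewrite /pos !(eq_sym ptoo) (negPf pt0_neqoo) (negPf pt1_neqoo) eqxx.
have posX (l : 'I_m) : pos (inord l.+1) = ratX k l * r / (ratX k l + r - 1).
  have lE : (inord l.+1 : 'I_n) = l.+1 :> nat by rewrite inordK; have := ltn_ord l; lia.
  rewrite /pos -!val_eqE /= lE pt0E pt1E ptooE coordTX /=.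
  by rewrite !ltn_eqF //; have := ltn_ord l; lia.
have evz (l : 'I_m) : evaluates h (zeta (inord l.+1)) (ratX k l).
  have [d0 zE] := moebius_solve r0 r1 (zr l).
  have -> : ratX k l = (pos (inord l.+1) - pos pt0) * (pos pt1 - pos ptoo)
     * ((pos (inord l.+1) - pos ptoo) * (pos pt1 - pos pt0))^-1.
    by rewrite pos0 pos1 posoo posX; exact: zE.
  apply: evaluatesM; first exact: evaluatesM.
  apply: evaluatesV; last exact: evaluatesM.
  by rewrite pos0 pos1 posoo posX; exact: d0.
have := @evaluates_mpoly _ _ h k m _ (@ratC k m) _ _ p _ evz.
move=> /(_ (@ratC k n)); rewrite -/(iota_poly p) p0 mmap_tofrac => ev.
have /ev ev' : forall c, evaluates h (ratC n c) (ratC m c).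
  by move=> c; have := evaluates_tofrac h c%:MP; rewrite [h _]mmapC.
have := evaluates_tofrac h 0; rewrite tofrac0 rmorph0 => /(evaluates_uniq ev') /eqP.
by rewrite tofrac_eq0 => /eqP.
Qed.

Definition iota : {rmorphism T -> K} := frac_lift iota_poly_inj.

Lemma iotaC c : iota (ratC m c) = ratC n c.
Proof. by rewrite /iota /ratC frac_liftE [LHS]mmapC. Qed.

Lemma iotaX l : iota (ratX k l) = zeta (inord l.+1).
Proof. by rewrite /iota /ratX frac_liftE [LHS]mmapX mmap1U. Qed.

Lemma zeta0 : zeta pt0 = 0. Proof. by rewrite /zeta /brK subrr !mul0r. Qed.
Lemma zeta1 : zeta pt1 = 1.
Proof.
rewrite /zeta [X in X / _]mulrC; apply: divff.
apply: mulf_neq0; apply: brK_neq0; first exact: pt1_neqoo.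
rewrite eq_sym; exact: pt0_neq1.
Qed.

Lemma iota_coordT i : i != ptoo -> iota (coordT i) = zeta i.
Proof.
case: (point_cases i) => [->|->|->|[l ->]]; rewrite ?eqxx //.
- by rewrite coordT0 rmorph0 zeta0.
- by rewrite coordT1 rmorph1 zeta1.
- by rewrite coordTX iotaX.
Qed.

(** A Moebius map only rescales homogeneous coordinates, so the two families of brackets differ by
    one factor for each point and a common factor. Monomials of multidegree 0 do not see these
    factors. *)
Lemma iota_brT : exists (c : K) (lam : 'I_n -> K),
  [/\ c != 0, (forall i, lam i != 0)
    & forall i j, iota (brT i j) = c * lam i * lam j * brK i j].
Proof.
have b0oo : brK pt0 ptoo != 0 by apply: brK_neq0; exact: pt0_neqoo.
have b1oo : brK pt1 ptoo != 0 by apply: brK_neq0; exact: pt1_neqoo.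
have b10 : brK pt1 pt0 != 0 by apply: brK_neq0; rewrite eq_sym; exact: pt0_neq1.
have zE0 i : zeta i = (brK pt1 ptoo / brK pt1 pt0) * brK i pt0 / brK i ptoo.
  by rewrite /zeta invfM; ring.
have : exists kap : K, kap != 0 /\ forall i, zeta i = kap * brK i pt0 / brK i ptoo.
  exists (brK pt1 ptoo / brK pt1 pt0); split; last exact: zE0.
  apply: mulf_neq0; [exact: b1oo|rewrite invr_eq0; exact: b10].
case=> kap [kap0 zE].
pose c := kap * brK pt0 ptoo.
have c0 : c != 0 by apply: mulf_neq0; [exact: kap0|exact: b0oo].
pose lam i := if i == ptoo then - c^-1 else (brK i ptoo)^-1.
exists c, lam; split; [exact: c0|move=> i|move=> i j].
  rewrite /lam; have [_|ioo] := eqVneq i ptoo; first by rewrite oppr_eq0 invr_eq0; exact: c0.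
  by rewrite invr_eq0; exact: brK_neq0.
wlog ioo : i j / i != ptoo.
  move=> H; have [ioo|] := eqVneq i ptoo; last exact: H.
  have [joo|joo] := eqVneq j ptoo.
    by rewrite ioo joo /brT /brK !subrr rmorph0 mulr0.
  rewrite brT_anti rmorphN (H j i joo) brK_anti; ring.
rewrite /brT (cowT_fin ioo) mulr1.
have [->|joo] := eqVneq j ptoo.
  rewrite cowT_oo mulr0 sub0r coordToo rmorphN rmorph1 /lam eqxx (negPf ioo).
  exact: moebius_oo c0 (brK_neq0 ioo).
rewrite (cowT_fin joo) mulr1 rmorphB /= !iota_coordT // !zE /lam (negPf ioo) (negPf joo).
exact: moebius_sub (brK_neq0 ioo) (brK_neq0 joo).
Qed.
End Brackets.

(** * The open part *)

Section SubringFacts.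
Variables (E : fieldType) (A : set E).
Hypothesis sA : is_subring A.
Lemma subring1 : A 1. Proof. by case: sA. Qed.
Lemma subringB x y : A x -> A y -> A (x - y). Proof. by case: sA => _ + _; apply. Qed.
Lemma subringM x y : A x -> A y -> A (x * y). Proof. by case: sA => _ _; apply. Qed.
Lemma subring0 : A 0. Proof. by rewrite -(subrr 1); apply: subringB; exact: subring1. Qed.
Lemma subringN x : A x -> A (- x).
Proof. by move=> Ax; rewrite -sub0r; apply: subringB; [exact: subring0|]. Qed.
Lemma subringD x y : A x -> A y -> A (x + y).
Proof. by move=> Ax Ay; rewrite -[y]opprK; apply: subringB; [|exact: subringN]. Qed.
Lemma subringX x q : A x -> A (x ^+ q).
Proof. by move=> Ax; elim: q => [|q IHq]; rewrite ?expr0 ?exprS; [exact: subring1|exact: subringM]. Qed.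
Lemma subring_sum I (r : seq I) (P : pred I) (F : I -> E) :
  (forall i, P i -> A (F i)) -> A (\sum_(i <- r | P i) F i).
Proof. by move=> AF; elim/big_ind: _; [exact: subring0|exact: subringD|]. Qed.
Lemma subring_prod I (r : seq I) (P : pred I) (F : I -> E) :
  (forall i, P i -> A (F i)) -> A (\prod_(i <- r | P i) F i).
Proof. by move=> AF; elim/big_ind: _; [exact: subring1|exact: subringM|]. Qed.
Lemma subring_mmap (k : nzRingType) m (f : k -> E) (z : 'I_m -> E) (p : {mpoly k[m]}) :
  (forall c, A (f c)) -> (forall l, A (z l)) -> A (mmap f z p).
Proof.
move=> Af Az; rewrite /mmap; apply: subring_sum => mm _; apply: subringM => //.
by rewrite /mmap1; apply: subring_prod => l _; apply: subringX.
Qed.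
End SubringFacts.

Lemma gen_subring (F K : fieldType) (i : F -> K) S : is_subring (algebra_gen i S).
Proof. exact: is_subring_smallest. Qed.
Lemma gen_const (F K : fieldType) (i : F -> K) S c : algebra_gen i S (i c).
Proof. by move=> A [_ SA]; apply: SA; left; exists c. Qed.
Lemma gen_mem (F K : fieldType) (i : F -> K) S x : S x -> algebra_gen i S x.
Proof. by move=> Sx A [_ SA]; apply: SA; right. Qed.
Lemma gen_sub (F K : fieldType) (i : F -> K) S (A : set K) :
  is_subring A -> (forall c, A (i c)) -> S `<=` A -> algebra_gen i S `<=` A.
Proof. by move=> sA iA SA x; apply; split=> // y [[c _ <-]|/SA]. Qed.

(** * Monomials in the brackets and their degrees *)

Section Monomials.
Variable n : nat.
Implicit Types (e f : 'I_n * 'I_n -> int).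

(** Exponents sit on ordered pairs; for an antisymmetric bracket only [e (i, j) + e (j, i)] matters
    up to sign. *)
Definition mon (E : fieldType) (br : 'I_n -> 'I_n -> E) e : E :=
  \prod_(p | p.1 != p.2) br p.1 p.2 ^ e p.
Definition degree e (i : 'I_n) : int := \sum_(j | j != i) (e (i, j) + e (j, i)).
Definition balanced e := forall i, degree e i = 0.
Definition edge (a b : 'I_n) : 'I_n * 'I_n -> int := fun p => (p == (a, b))%:R.
Definition cr_exp (q : 'I_n * 'I_n * 'I_n * 'I_n) : 'I_n * 'I_n -> int :=
  let: (a, b, c, d) := q in
  fun p => edge a c p + edge b d p - edge a d p - edge b c p.

Section OneBracket.
Variables (E : fieldType) (br : 'I_n -> 'I_n -> E).
Hypothesis br0 : forall i j, i != j -> br i j != 0.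

Lemma mon_neq0 e : mon br e != 0.
Proof. by apply/prodf_neq0 => p p12; rewrite expfz_neq0 // br0. Qed.
Lemma monD e f : mon br (fun p => e p + f p) = mon br e * mon br f.
Proof. by rewrite /mon -big_split /=; apply: eq_bigr => p p12; rewrite expfzDr // br0. Qed.
Lemma monN e : mon br (fun p => - e p) = (mon br e)^-1.
Proof. by rewrite /mon -prodfV; apply: eq_bigr => p _; rewrite invr_expz. Qed.
Lemma monB e f : mon br (fun p => e p - f p) = mon br e / mon br f.
Proof. by rewrite monD monN. Qed.
Lemma mon0 : mon br (fun=> 0) = 1.
Proof. by rewrite /mon big1 // => p _; rewrite expr0z. Qed.
Lemma mon_edge a b : a != b -> mon br (edge a b) = br a b.
Proof.
move=> ab; rewrite /mon (bigD1 (a, b)) //= /edge eqxx expr1z big1 ?mulr1 // => p.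
by case/andP=> _ /negPf ->; rewrite expr0z.
Qed.
Lemma mon_cr a b c d : uniq [:: a; b; c; d] ->
  mon br (cr_exp (a, b, c, d)) = (br a c * br b d) / (br a d * br b c).
Proof.
rewrite /= !inE !negb_or => /and4P[/and3P[ab ac ad] /andP[bc bd] cd _].
by rewrite /cr_exp !monB monD !mon_edge // invfM mulrA.
Qed.
Lemma mon_val (F : set E) (v : E -> int) e : is_subfield F -> divval F v ->
  (forall i j, i != j -> F (br i j)) ->
  v (mon br e) = \sum_(p | p.1 != p.2) e p * v (br p.1 p.2).
Proof.
move=> sF vv Fbr.
suff [_ _ ->] : [/\ F (mon br e), mon br e != 0 &
    v (mon br e) = \sum_(p | p.1 != p.2) e p * v (br p.1 p.2)] by [].
rewrite /mon; elim/big_rec2: _ => [|p s y p12 [Fy y0 ys]].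
  by split; [exact: subfield1|exact: oner_neq0|exact: divval1 vv].
have b0 := br0 p12; have Fb := Fbr _ _ p12.
have bz : br p.1 p.2 ^ e p != 0 by rewrite expfz_neq0.
have Fz := subfieldXz (e p) sF Fb.
split; [exact: subfieldM|exact: mulf_neq0|].
by rewrite (divvalM vv) // ys (divvalXz _ sF vv) // mulrC.
Qed.
End OneBracket.

Lemma degreeD e f i : degree (fun p => e p + f p) i = degree e i + degree f i.
Proof. by rewrite /degree -big_split /=; apply: eq_bigr => j _; rewrite addrACA. Qed.
Lemma degreeN e i : degree (fun p => - e p) i = - degree e i.
Proof. by rewrite /degree -sumrN; apply: eq_bigr => j _; rewrite opprD. Qed.
Lemma degreeB e f i : degree (fun p => e p - f p) i = degree e i - degree f i.
Proof. by rewrite degreeD degreeN. Qed.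
Lemma degree_edge a b i : a != b -> degree (edge a b) i = (i == a)%:R + (i == b)%:R.
Proof.
move=> ab; rewrite /degree big_split /=; congr (_ + _).
  have [->|ia] := eqVneq i a.
    rewrite (bigD1 b) 1?eq_sym //= /edge eqxx big1 ?addr0 // => j /andP[_ jb].
    by rewrite xpair_eqE eqxx (negPf jb).
  by rewrite big1 // => j _; rewrite /edge xpair_eqE (negPf ia).
have [->|ib] := eqVneq i b.
  rewrite (bigD1 a) //= /edge eqxx big1 ?addr0 // => j /andP[_ ja].
  by rewrite xpair_eqE (negPf ja).
by rewrite big1 // => j _; rewrite /edge xpair_eqE (negPf ib) andbF.
Qed.
Lemma balanced_cr a b c d : uniq [:: a; b; c; d] -> balanced (cr_exp (a, b, c, d)).
Proof.
rewrite /= !inE !negb_or => /and4P[/and3P[ab ac ad] /andP[bc bd] cd _] i.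
rewrite /cr_exp degreeB degreeB degreeD !degree_edge //; ring.
Qed.
Lemma balancedD e f : balanced e -> balanced f -> balanced (fun p => e p + f p).
Proof. by move=> be bf i; rewrite degreeD be bf. Qed.
Lemma balancedN e : balanced e -> balanced (fun p => - e p).
Proof. by move=> be i; rewrite degreeN be oppr0. Qed.

Lemma sum_degree e : \sum_i degree e i = (\sum_(p | p.1 != p.2) e p) *+ 2.
Proof.
rewrite /degree (eq_bigr _ (fun i _ => big_split _ _ _ _ _)) big_split mulr2n /=.
congr (_ + _); first by rewrite pair_big_dep /=; apply: eq_big => -[i j] //=; rewrite eq_sym.
rewrite (exchange_big_dep xpredT) //= pair_big_dep /=.
by apply: eq_big => -[i j].
Qed.

(** [lam i] occurs with exponent [degree e i], and [c] with half the sum of all the degrees. *)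
Lemma mon_scale (E : fieldType) (br br' : 'I_n -> 'I_n -> E) (c : E) (lam : 'I_n -> E) e :
  c != 0 -> (forall i, lam i != 0) -> (forall i j, br i j = c * lam i * lam j * br' i j) ->
  balanced e -> mon br e = mon br' e.
Proof.
move=> c0 l0 brE be.
have e0 : \sum_(p | p.1 != p.2) e p = 0.
  have /eqP := sum_degree e; rewrite big1 // eq_sym => /eqP.
  by rewrite mulr2n; lia.
have prodz (I : finType) (P : pred I) (x : E) (F : I -> int) : x != 0 ->
    \prod_(i | P i) x ^ F i = x ^ (\sum_(i | P i) F i).
  by move=> x0; apply/esym; apply: (big_morph (fun z => x ^ z)) => // a b; rewrite expfzDr.
have mE : mon br e = (\prod_(p : 'I_n * 'I_n | p.1 != p.2) c ^ e p) *
   ((\prod_(p : 'I_n * 'I_n | p.1 != p.2) lam p.1 ^ e p) *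
   (\prod_(p : 'I_n * 'I_n | p.1 != p.2) lam p.2 ^ e p)) * mon br' e.
  rewrite /mon -!big_split /=; apply: eq_bigr => p _.
  by rewrite brE !expfzMl mulrA.
rewrite mE prodz // e0 expr0z mul1r; set X := (X in X * _).
suff -> : X = 1 by rewrite mul1r.
rewrite {}/X.
have -> : \prod_(p : 'I_n * 'I_n | p.1 != p.2) lam p.1 ^ e p =
    \prod_i \prod_(j | j != i) lam i ^ e (i, j).
  by rewrite pair_big_dep /=; apply: eq_big => -[i j] //=; rewrite eq_sym.
have -> : \prod_(p : 'I_n * 'I_n | p.1 != p.2) lam p.2 ^ e p =
    \prod_i \prod_(j | j != i) lam i ^ e (j, i).
  rewrite [RHS](exchange_big_dep xpredT) //= pair_big_dep /=.
  by apply: eq_big => -[i j].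
rewrite -big_split /= big1 // => i _; rewrite -big_split /=.
rewrite (eq_bigr (fun j => lam i ^ (e (i, j) + e (j, i)))); last first.
  by move=> j _; rewrite expfzDr.
by rewrite prodz // -[\sum_(_ | _) _]/(degree e i) be expr0z.
Qed.

Lemma mon_perm (E E' : fieldType) (br : 'I_n -> 'I_n -> E) (br' : 'I_n -> 'I_n -> E')
    (g : {rmorphism E -> E'}) (s : 'S_n) e :
  (forall i j, g (br i j) = br' (s i) (s j)) ->
  g (mon br e) = mon br' (fun p => e (s^-1%g p.1, s^-1%g p.2)).
Proof.
move=> gE; rewrite rmorph_prod /=.
rewrite [RHS](reindex (fun p : 'I_n * 'I_n => (s p.1, s p.2))) /=; last first.
  exists (fun p => (s^-1%g p.1, s^-1%g p.2)) => -[i j] _ /=; by rewrite ?permK ?permKV.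
apply: eq_big => [[i j]|[i j] _] /=; first by rewrite (inj_eq perm_inj).
by rewrite !permK fmorphXz gE.
Qed.
End Monomials.

Lemma zeta_sub_alg (E : fieldType) (x y z t w : E) : x - w != 0 -> y - w != 0 ->
  x - z != 0 -> z - w != 0 -> t - w != 0 -> t - z != 0 -> x - y != 0 ->
  ((x - z) * (t - w) / ((x - w) * (t - z)) - (y - z) * (t - w) / ((y - w) * (t - z)))^-1 =
  ((x - z) * (t - w) / ((x - w) * (t - z)))^-1 * ((y - w) * (z - x) / ((y - x) * (z - w))).
Proof.
move=> xw yw xz zw tw tz xy.
have -> : (x - z) * (t - w) / ((x - w) * (t - z)) - (y - z) * (t - w) / ((y - w) * (t - z)) =
  (t - w) * (z - w) * (x - y) / ((t - z) * (x - w) * (y - w)) by field; rewrite yw tz xw.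
have yx : y - x != 0 by rewrite -opprB oppr_eq0.
by field; rewrite !(xw, yw, xz, zw, tw, tz, xy, yx).
Qed.

(** * The coordinate ring of M_(0,n) *)

Section OpenPart.
Variables (k : fieldType) (m0 : nat).
Local Notation m := m0.+1.
Local Notation n := m0.+4.
Local Notation T := (ratfun k m).
Local Notation K := (ratfun k n).
Local Notation pt0 := (inord 0 : 'I_n).
Local Notation pt1 := (inord m.+1 : 'I_n).
Local Notation ptoo := (inord m.+2 : 'I_n).
Local Notation brT := (@brT k m0).
Local Notation brK := (@brK k m0).
Local Notation iota := (@iota k m0).
Local Notation "x %:F" := (@FracField.tofrac _ x).

Lemma coordT_inj i j : i != ptoo -> j != ptoo -> coordT k i = coordT k j -> i = j.
Proof.
have X1 (l : 'I_m) : ratX k l != 1 by rewrite -(rmorph1 (@ratC k m)) ratX_neqC.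
have X0 (l : 'I_m) : ratX k l != 0 by rewrite -(rmorph0 (@ratC k m)) ratX_neqC.
case: (point_cases i) => [->|->|->|[l ->]]; case: (point_cases j) => [->|->|->|[l' ->]];
  rewrite ?eqxx // ?coordT0 ?coordT1 ?coordTX // => _ _ /eqP.
- by rewrite eq_sym oner_eq0.
- by rewrite eq_sym (negPf (X0 _)).
- by rewrite oner_eq0.
- by rewrite eq_sym (negPf (X1 _)).
- by rewrite (negPf (X0 _)).
- by rewrite (negPf (X1 _)).
- by move=> /eqP /ratX_inj ->.
Qed.

Lemma brT_neq0 i j : i != j -> brT i j != 0.
Proof.
wlog ioo : i j / i != ptoo.
  move=> H ij; have [ioo|ioo] := eqVneq i ptoo; last exact: H.
  by rewrite brT_anti oppr_eq0 H 1?eq_sym // -ioo.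
move=> ij; rewrite /brT (cowT_fin _ ioo) mulr1.
have [->|joo] := eqVneq j ptoo; first by rewrite cowT_oo mulr0 sub0r coordToo oppr_eq0 oner_neq0.
by rewrite (cowT_fin _ joo) mulr1 subr_eq0; apply: contraNneq ij => /coordT_inj ->.
Qed.

Lemma iota_mon e : balanced e -> iota (mon brT e) = mon brK e.
Proof.
move=> be; have [c [lam [c0 l0 brE]]] := iota_brT k m0.
rewrite -(mon_scale c0 l0 (br := fun i j => iota (brT i j)) brE be).
by rewrite /mon rmorph_prod; apply: eq_bigr => p _; exact: fmorphXz.
Qed.

(** The function field of M_(0,n) inside the field of rational functions of the points; it is purely
    transcendental, generated by coordinates [zeta]. *)
Definition ffield : set K := range iota.
Lemma ffield_subfield : is_subfield ffield. Proof. exact: range_subfield. Qed.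
Lemma ffield_mon e : balanced e -> ffield (mon brK e).
Proof. by move=> be; exists (mon brT e); rewrite ?iota_mon. Qed.
Lemma ffield_const c : ffield (ratC n c). Proof. by exists (ratC m c); rewrite ?iotaC. Qed.

Lemma cross_ratioE a b c d :
  cross_ratio k (a, b, c, d) = (brK a c * brK b d) / (brK a d * brK b c).
Proof. by []. Qed.

Lemma cross_ratio_mon q : distinct4 q -> cross_ratio k q = mon brK (cr_exp q).
Proof. by case: q => -[[a b] c] d uq; rewrite cross_ratioE mon_cr //; exact: brK_neq0. Qed.

Definition cr_ring : set K := algebra_gen (@ratC k n) [set cross_ratio k q | q in @distinct4 n].

Lemma cr_ring_cr a b c d : uniq [:: a; b; c; d] -> cr_ring (cross_ratio k (a, b, c, d)).
Proof. by move=> u; apply: gen_mem; exists (a, b, c, d). Qed.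

Definition discT : T := \prod_(p : 'I_n * 'I_n | p.1 != p.2) brT p.1 p.2.
Definition polyT : set T := range (@FracField.tofrac {mpoly k[m]}).
Lemma polyT_subring : is_subring polyT.
Proof.
split; first by exists 1; rewrite ?tofrac1.
  by move=> _ _ [x _ <-] [y _ <-]; exists (x - y); rewrite ?tofracB.
by move=> _ _ [x _ <-] [y _ <-]; exists (x * y); rewrite ?tofracM.
Qed.

Lemma polyT_brT i j : polyT (brT i j).
Proof.
have sP := polyT_subring; have P0 := subring0 sP; have P1 := subring1 sP.
have Pc i' : polyT (coordT k i').
  case: (point_cases i') => [->|->|->|[l ->]].
  - by rewrite coordT0. - by rewrite coordT1. - by rewrite coordToo.
  - by rewrite coordTX; exists 'X_l.
have Pw i' : polyT (cowT k i') by rewrite /cowT; case: ifP.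
by apply: (subringB sP); apply: (subringM sP).
Qed.

Lemma discT_neq0 : discT != 0.
Proof. by apply/prodf_neq0 => p /brT_neq0. Qed.
Lemma polyT_disc : polyT discT.
Proof. by apply: (subring_prod polyT_subring) => p _; exact: polyT_brT. Qed.

Definition openT : set T := [set x | setT x /\ exists N, polyT (x * discT ^+ N)].

Lemma openT_poly x : polyT x -> openT x.
Proof. by move=> Px; split=> //; exists 0%N; rewrite expr0 mulr1. Qed.

Lemma openT_subring : is_subring openT.
Proof.
have sP := polyT_subring; have PD q := subringX sP q polyT_disc.
split; first by apply: openT_poly; exact: subring1.
  move=> x y [_ [N Nx]] [_ [M My]]; split=> //; exists (N + M)%N.
  rewrite mulrBl exprD mulrA [discT ^+ N * _]mulrC mulrA.
  by apply: (subringB sP); apply: (subringM sP) => //; exact: PD.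
move=> x y [_ [N Nx]] [_ [M My]]; split=> //; exists (N + M)%N.
by rewrite exprD mulrACA; apply: (subringM sP).
Qed.

Lemma openT_brTV i j : i != j -> openT (brT i j)^-1.
Proof.
move=> ij; split=> //; exists 1%N; rewrite expr1 /discT (bigD1 (i, j)) //= mulKf ?brT_neq0 //.
by apply: (subring_prod polyT_subring) => p _; exact: polyT_brT.
Qed.

Lemma cr_ring_zeta i : i != ptoo -> cr_ring (zeta k i).
Proof.
have sC : is_subring cr_ring by exact: gen_subring.
have [->|i0] := eqVneq i pt0; first by rewrite zeta0 => _; exact: subring0.
have [->|i1] := eqVneq i pt1; first by rewrite zeta1 => _; exact: subring1.
move=> ioo; rewrite -[zeta k i]/(cross_ratio k (i, pt1, pt0, ptoo)).
apply: cr_ring_cr; rewrite /= !inE !negb_or i0 i1 ioo (pt0_neqoo _) (pt1_neqoo _).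
by rewrite eq_sym (pt0_neq1 _).
Qed.

Lemma brKE i j : brK i j = ratX k i - ratX k j. Proof. by []. Qed.

(** This makes the discriminant invertible in the ring of cross-ratios: the inverse of a difference
    of coordinates is again a product of cross-ratios. *)
Lemma zeta_sub i j : i != j -> i != pt0 -> i != ptoo -> j != pt0 -> j != ptoo ->
  (zeta k i - zeta k j)^-1 = (zeta k i)^-1 * cross_ratio k (j, pt0, ptoo, i).
Proof.
move=> ij i0 ioo j0 joo.
have bioo := brK_neq0 k ioo; have bjoo := brK_neq0 k joo; have bi0 := brK_neq0 k i0.
have b0oo := brK_neq0 k (pt0_neqoo m0); have b1oo := brK_neq0 k (pt1_neqoo m0).
have b10 : brK pt1 pt0 != 0 by apply: brK_neq0; rewrite eq_sym; exact: pt0_neq1.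
have bij := brK_neq0 k ij.
rewrite /zeta cross_ratioE; move: bioo bjoo bi0 b0oo b1oo b10 bij; rewrite !brKE.
move: (ratX k i) (ratX k j) (ratX k pt0) (ratX k pt1) (ratX k ptoo).
move=> x y z t w; exact: zeta_sub_alg.
Qed.

Lemma cr_ring_zetaV i : i != pt0 -> i != ptoo -> cr_ring (zeta k i)^-1.
Proof.
have sC : is_subring cr_ring by exact: gen_subring.
have [->|i1] := eqVneq i pt1; first by rewrite zeta1 invr1 => _ _; exact: (subring1 sC).
move=> i0 ioo; have -> : (zeta k i)^-1 = cross_ratio k (i, pt1, ptoo, pt0).
  by rewrite /zeta invf_div.
apply: cr_ring_cr; rewrite /= !inE !negb_or i0 i1 ioo (pt1_neqoo _).
by rewrite !(eq_sym _ pt0) (pt0_neq1 _) (pt0_neqoo _).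
Qed.

Lemma cr_ring_brTV i j : i != j -> cr_ring (iota (brT i j))^-1.
Proof.
have sC : is_subring cr_ring by exact: gen_subring.
have sN x : cr_ring x^-1 -> cr_ring (- x)^-1.
  by move=> Cx; rewrite invrN; exact: (subringN sC).
wlog ioo : i j / i != ptoo.
  move=> H ij; have [ioo|ioo] := eqVneq i ptoo; last exact: H.
  by rewrite brT_anti rmorphN; apply: (sN); apply: H; rewrite 1?eq_sym // -ioo.
have [-> _|joo] := eqVneq j ptoo.
  rewrite /brT (cowT_fin _ ioo) cowT_oo mulr0 sub0r coordToo mulr1 rmorphN rmorph1 invrN1.
  by apply: (subringN sC); exact: (subring1 sC).
move=> ij; rewrite /brT (cowT_fin _ ioo) (cowT_fin _ joo) !mulr1 rmorphB /= !iota_coordT //.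
have [i0|i0] := eqVneq i pt0.
  by rewrite i0 zeta0 sub0r; apply: (sN); apply: cr_ring_zetaV; rewrite // eq_sym -i0.
have [->|j0] := eqVneq j pt0; first by rewrite zeta0 subr0; exact: cr_ring_zetaV.
rewrite zeta_sub //; apply: (subringM sC); first exact: cr_ring_zetaV.
apply: cr_ring_cr; rewrite /= !inE !negb_or j0 joo (pt0_neqoo _) !(eq_sym _ i) i0 ioo ij.
by [].
Qed.

(** Both inclusions are checked on generators. M_(0,n) is thus the complement of a hyperplane
    arrangement in affine space, whence its factoriality. *)
Lemma openT_image : iota @` openT = cr_ring.
Proof.
have sC : is_subring cr_ring by exact: gen_subring.
have iP x : polyT x -> cr_ring (iota x).
  move=> [p _ <-]; rewrite /iota frac_liftE.
  rewrite -[X in cr_ring X]/(mmap (@ratC k n) (fun l => zeta k (inord l.+1)) p).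
  apply: (subring_mmap sC) => [c|l].
    exact: gen_const.
  apply: cr_ring_zeta; rewrite -val_eqE /= inordK ?ptooE; have := ltn_ord l; lia.
have iDV : cr_ring (iota discT)^-1.
  rewrite /discT rmorph_prod -prodfV /=; apply: (subring_prod sC) => p; exact: cr_ring_brTV.
apply/seteqP; split.
  move=> _ [x [_ [N Nx]] <-]; have -> : x = x * discT ^+ N * discT^-1 ^+ N.
    by rewrite exprVn mulfK // expf_neq0 // discT_neq0.
  rewrite rmorphM rmorphXn fmorphV; apply: (subringM sC); first exact: iP.
  exact: (subringX sC).
apply: gen_sub.
- have [O1 OB OM] := openT_subring; split.
  + by exists 1; rewrite ?rmorph1.
  + by move=> _ _ [x Ox <-] [y Oy <-]; exists (x - y); [exact: OB|rewrite rmorphB].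
  + by move=> _ _ [x Ox <-] [y Oy <-]; exists (x * y); [exact: OM|rewrite rmorphM].
- move=> c; exists (ratC m c); last by rewrite iotaC.
  by apply: openT_poly; exists c%:MP.
- move=> _ [q dq <-]; exists (mon brT (cr_exp q)); last first.
    by rewrite cross_ratio_mon // iota_mon //; case: q dq => -[[a b] c] d /balanced_cr.
  case: q dq => -[[a b] c] d uq; rewrite mon_cr //; last exact: brT_neq0.
  have sO := openT_subring.
  move: uq; rewrite /= /distinct4 /= !inE !negb_or => /and4P[/and3P[ab ac ad] /andP[bc bd] cd _].
  have Ob i j : openT (brT i j) by apply: openT_poly; exact: polyT_brT.
  rewrite invfM; apply: (subringM sO); first by apply: (subringM sO).
  by apply: (subringM sO); exact: openT_brTV.
Qed.

Definition polyT_vals : set (T -> int) :=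
  [set v | exists2 p : {mpoly k[m]}, prime_elt p & v = frac_ord p].
Definition openT_vals : set (T -> int) := [set v | polyT_vals v /\ v discT = 0].
Definition open_vals : set (K -> int) := push_val iota @` openT_vals.

Lemma openT_factorial : factorial setT openT openT_vals.
Proof.
apply: factorial_localize => //; [exact/ufd_factorial/ufd_mpoly|exact: discT_neq0|exact: polyT_disc].
Qed.

Lemma open_factorial : factorial ffield cr_ring open_vals.
Proof. by rewrite -openT_image; apply: push_factorial; exact: openT_factorial. Qed.

Lemma cr_ring_unit_mon e : balanced e -> forall v, open_vals v -> v (mon brK e) = 0.
Proof.
move=> be _ [v Vv <-]; rewrite -iota_mon // push_valE.
have fo := openT_factorial.
rewrite (mon_val brT_neq0 e (fac_field fo) (fac_val fo Vv)) // big1 // => p p12.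
move: v Vv; suff H : forall v, openT_vals v -> v (brT p.1 p.2) = 0 by move=> v Vv; rewrite H ?mulr0.
apply/(fac_unit fo) => //; first exact: brT_neq0.
by split; [apply: openT_poly; exact: polyT_brT|exact: openT_brTV].
Qed.
End OpenPart.

(** * Valuation rings of a Krull ring *)

Section ValuationRings.
Variables (K : fieldType) (E A : set K) (V : set (K -> int)).
Hypotheses (fac : factorial E A V) (sA : is_subring A).
Let sE : is_subfield E. Proof. exact: fac_field fac. Qed.

Definition vring (v : K -> int) : set K := [set x | E x /\ (x = 0 \/ 0 <= v x)].
Definition vcenter (v : K -> int) : set K := [set x | A x /\ (x = 0 \/ 0 < v x)].

Lemma vcenterE v p x : V v -> uniformizer E V v p -> A x -> vcenter v x <-> A (x / p).
Proof.
move=> Vv up Ax; have [->|x0] := eqVneq x 0.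
  rewrite mul0r; have A0 := subring0 sA.
  by split=> [_|_]; [exact: A0|split; [exact: A0|left]].
rewrite (uniformizer_div fac Vv up) //; split=> [[_ [/eqP|//]]|vx]; first by rewrite (negPf x0).
by split=> //; right.
Qed.

Lemma vcenter_prime v : V v -> prime_ideal A (vcenter v).
Proof.
move=> Vv; have [p up] := fac_par fac Vv; have [Ep p0 vp _] := up.
have vv := fac_val fac Vv; have [v0 _ _] := vv.
split.
- by move=> x [].
- split; first by split; [exact: subring0|left].
  by move=> [_ [/eqP|]]; rewrite ?oner_eq0 // (divval1 sE vv).
- move=> x y cx cy; have Ax := cx.1; have Ay := cy.1.
  apply/(vcenterE Vv up); first exact: (subringB sA).
  by rewrite mulrBl; apply: (subringB sA); apply/(vcenterE Vv up).
- move=> a x Aa cx; have Ax := cx.1; apply/(vcenterE Vv up); first exact: (subringM sA).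
  by rewrite -mulrA; apply: (subringM sA) => //; apply/(vcenterE Vv up).
- move=> x y Ax Ay [_ [/eqP|vxy]].
    by rewrite mulf_eq0 => /orP[] /eqP ->; [left|right]; split; rewrite ?Ax ?Ay //; (try exact: subring0); left.
  have xy0 : x * y != 0 by apply: contraTneq vxy => ->; rewrite v0 ltxx.
  move: (xy0); rewrite mulf_eq0 negb_or => /andP[x0 y0].
  move: vxy; rewrite (divvalM vv (fac_sub fac Ax) (fac_sub fac Ay) x0 y0) => vxy.
  have := proj1 (fac_ring fac (fac_sub fac Ax) x0) Ax _ Vv.
  rewrite le_eqVlt => /predU1P[vx|vx]; last by left; split=> //; right.
  by right; split=> //; right; rewrite -vx add0r in vxy.
Qed.

Lemma localization_vcenter v : V v -> localization A (vcenter v) = vring v.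
Proof.
move=> Vv; have vv := fac_val fac Vv; have [v0 _ _] := vv; apply/seteqP; split=> x.
  move=> [a [b [Aa Ab nb ->]]]; have b0 : b != 0.
    by apply/eqP => b0; apply: nb; split=> //; left.
  have Ea := fac_sub fac Aa; have Eb := fac_sub fac Ab.
  split; first by apply: subfieldM => //; apply: subfieldV.
  have [->|a0] := eqVneq a 0; first by left; rewrite mul0r.
  right; rewrite (divvalF sE vv) //.
  have := proj1 (fac_ring fac Ea a0) Aa _ Vv; have := proj1 (fac_ring fac Eb b0) Ab _ Vv.
  have [->|vb] := eqVneq (v b) 0; first by rewrite subr0.
  by move=> vb0; case: nb; split=> //; right; rewrite lt_neqAle eq_sym vb.
move=> [Ex [->|vx]].
  exists 0, 1; rewrite mul0r; split=> //; [exact: subring0|exact: subring1|].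
  by move=> [_ [/eqP|]]; rewrite ?oner_eq0 // (divval1 sE vv).
have [->|x0] := eqVneq x 0.
  exists 0, 1; rewrite mul0r; split=> //; [exact: subring0|exact: subring1|].
  by move=> [_ [/eqP|]]; rewrite ?oner_eq0 // (divval1 sE vv).
have [p up] := fac_par fac Vv; have [Ep p0 vp pw] := up.
have Ap := uniformizer_ring fac Vv up.
have pz0 : p ^ (v x) != 0 by rewrite expfz_neq0.
have Epz : E (p ^ (v x)) by apply: subfieldXz.
have Ey : E (x / p ^ (v x)) by apply: subfieldM => //; apply: subfieldV.
have y0 : x / p ^ (v x) != 0 by rewrite mulf_neq0 ?invr_eq0.
have vy : v (x / p ^ (v x)) = 0.
  by rewrite (divvalF sE vv) // (divvalXz _ sE vv) // vp mul1r subrr.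
have [a [b [Aa Ab a0 b0 [va vb yE]]]] := fac_frac fac Vv Ey y0 vy.
exists (a * p ^ (v x)), b; split=> //.
- case: (v x) vx => // q _; apply: (subringM sA) => //; exact: (subringX sA).
- by move=> [_ [/eqP|]]; rewrite ?(negPf b0) // vb.
- by rewrite -[LHS](divfK pz0) yE mulrAC.
Qed.

Lemma vring_subring v : V v -> is_subring (vring v).
Proof.
move=> Vv; rewrite -localization_vcenter //; apply: is_subring_localization => //.
exact: vcenter_prime.
Qed.
End ValuationRings.

(** The bound [N] replaces a minimum because the value at 0 is 0 by convention, so zero has to be
    set apart. *)
Definition ultrametric (K : fieldType) (E : set K) (v : K -> int) :=
  forall x y (N : int), E x -> E y -> x - y != 0 ->
  x = 0 \/ N <= v x -> y = 0 \/ N <= v y -> N <= v (x - y).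

(** Dividing by the N-th power of a uniformizer reduces the inequality to stability of the valuation
    ring under subtraction. *)
Lemma fac_ultrametric (K : fieldType) (E A : set K) V v : factorial E A V -> is_subring A -> V v ->
  ultrametric E v.
Proof.
move=> fac sA Vv x y N Ex Ey xy0 vx vy; have sE := fac_field fac; have vv := fac_val fac Vv.
have [p [Ep p0 vp pw]] := fac_par fac Vv.
have pz0 : p ^ N != 0 by rewrite expfz_neq0.
have Epz : E (p ^ N) by apply: subfieldXz.
have key z : E z -> z = 0 \/ N <= v z -> vring E v (z / p ^ N).
  move=> Ez vz; split; first by apply: subfieldM => //; apply: subfieldV.
  have [->|z0] := eqVneq z 0; first by left; rewrite mul0r.
  right; rewrite (divvalF sE vv) // (divvalXz _ sE vv) // vp mul1r subr_ge0.
  by case: vz => // /eqP; rewrite (negPf z0).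
have := subringB (vring_subring fac sA Vv) (key _ Ex vx) (key _ Ey vy).
rewrite -mulrBl => -[_ [/eqP|]]; first by rewrite mulf_eq0 invr_eq0 (negPf xy0) (negPf pz0).
by rewrite (divvalF sE vv) ?(divvalXz _ sE vv) ?vp ?mul1r ?subr_ge0 //; exact: subfieldB.
Qed.

Lemma vring_ultra (K : fieldType) (E : set K) v : is_subfield E -> divval E v -> ultrametric E v ->
  is_subring (vring E v).
Proof.
move=> sE vv vu; split.
- by split; [exact: subfield1|right; rewrite (divval1 sE vv)].
- move=> x y [Ex vx] [Ey vy]; split; first exact: subfieldB.
  by have [->|xy0] := eqVneq (x - y) 0; [left|right; apply: vu].
- move=> x y [Ex vx] [Ey vy]; split; first exact: subfieldM.
  have [->|x0] := eqVneq x 0; first by left; rewrite mul0r.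
  have [->|y0] := eqVneq y 0; first by left; rewrite mulr0.
  case: vx => [/eqP|vx]; first by rewrite (negPf x0).
  case: vy => [/eqP|vy]; first by rewrite (negPf y0).
  by right; rewrite (divvalM vv) // addr_ge0.
Qed.

Lemma divides_prod_factor (R : idomainType) (f g u : R) (s : seq R) : divides u 1 ->
  (forall p, p \in s -> prime_elt p) -> f * g = u * \prod_(p <- s) p ->
  exists u' t, [/\ divides u' 1, {subset t <= s} & f = u' * \prod_(p <- t) p].
Proof.
move=> u1; elim: s f g => [|p s IHs] f g ps E.
  exists f, [::]; split=> //; last by rewrite big_nil mulr1.
  case: u1 => v vu; exists (v * g).
  by rewrite big_nil mulr1 in E; rewrite vu -E; ring.
have pp : prime_elt p by apply: ps; rewrite mem_head.
have [p0 pN1 pP] := pp.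
have ps' q : q \in s -> prime_elt q by move=> qs; apply: ps; rewrite inE qs orbT.
have E' : f * g = u * (p * \prod_(q <- s) q) by rewrite E big_cons.
have /pP[[h fE]|[h gE]] : divides p (f * g).
- by rewrite E big_cons; exists (u * \prod_(j <- s) j); ring.
- have [|u' [t [u'1 ts hE]]] := IHs h g ps'.
    by apply: (mulfI p0); rewrite [RHS]mulrCA -E' fE; ring.
  exists u', (p :: t); split=> // [q|]; last by rewrite fE hE big_cons; ring.
  by rewrite !inE => /predU1P[->|/ts->]; rewrite ?eqxx ?orbT.
- have [|u' [t [u'1 ts hE]]] := IHs f h ps'.
    by apply: (mulfI p0); rewrite [RHS]mulrCA -E' gE; ring.
  by exists u', t; split=> // q /ts qs; rewrite inE qs orbT.
Qed.

(** * Units of the open part *)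

Section LinearForms.
Variables (k : fieldType) (m : nat).
Implicit Types (p q D : {mpoly k[m]}).

Lemma mmap_congr D (z z' : 'I_m -> {mpoly k[m]}) p :
  (forall j, divides D (z j - z' j)) ->
  divides D (mmap (@mpolyC m k) z p - mmap (@mpolyC m k) z' p).
Proof.
move=> zz'.
have cD0 x : divides D (x - x) by rewrite subrr; exists 0; rewrite mul0r.
have cDM x x' y y' : divides D (x - y) -> divides D (x' - y') -> divides D (x * x' - y * y').
  move=> d d'; have -> : x * x' - y * y' = x * (x' - y') + (x - y) * y' by ring.
  by apply: divides_add; [exact: divides_mull|exact: divides_mulr].
rewrite /mmap; elim/big_ind2: _ => // [x x' y y' d d'|mm _].
  by rewrite opprD addrACA; apply: divides_add.
apply: (cDM _ _ _ _ (cD0 _)); rewrite /mmap1; elim/big_ind2: _ => // [x x' y y' d d'|j _].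
  exact: (cDM _ _ _ _ d d').
by elim: (mm j) => [|q IHq]; rewrite ?expr0 // !exprS; apply: (cDM _ _ _ _ (zz' j) IHq).
Qed.

Lemma mmap_id p : mmap (@mpolyC m k) (fun j => 'X_j) p = p.
Proof.
rewrite -[RHS]comp_mpoly_id /comp_mpoly /mmap; apply: eq_bigr => mm _.
by congr (_ * _); apply: mmap1_eq => j; rewrite tnth_mktuple.
Qed.

(** As [a] is unchanged by the substitution of [a] for the l-th variable, the kernel of this
    substitution is generated by ['X_l - a], and its target is a domain. *)
Lemma linear_form_prime (l : 'I_m) (a : {mpoly k[m]}) :
  mmap (@mpolyC m k) (fun j => if j == l then a else 'X_j) a = a -> 'X_l != a ->
  prime_elt ('X_l - a).
Proof.
set z := fun j => _ => phia la.
pose phi : {rmorphism {mpoly k[m]} -> {mpoly k[m]}} := mmap (@mpolyC m k) z.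
have phil : phi 'X_l = a by rewrite /= mmapX mmap1U /z eqxx.
have phiE : phi a = a by [].
have dphi f : divides ('X_l - a) (f - phi f).
  rewrite -{1}(mmap_id f); apply: mmap_congr => j; rewrite /z.
  have [->|_] := eqVneq j l; first exact: divides_refl.
  by exists 0; rewrite mul0r subrr.
have dE f : divides ('X_l - a) f <-> phi f = 0.
  split=> [[g ->]|f0]; first by rewrite rmorphM rmorphB phil phiE subrr mulr0.
  by have := dphi f; rewrite f0 subr0.
split; first by rewrite subr_eq0.
  by move=> /dE /eqP; rewrite rmorph1 oner_eq0.
by move=> f g /dE /eqP; rewrite rmorphM mulf_eq0 => /orP[] /eqP /dE; [left|right].
Qed.
End LinearForms.

Section OpenUnits.
Variables (k : fieldType) (m0 : nat).
Local Notation m := m0.+1.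
Local Notation n := m0.+4.
Local Notation T := (ratfun k m).
Local Notation K := (ratfun k n).
Local Notation pt0 := (inord 0 : 'I_n).
Local Notation pt1 := (inord m.+1 : 'I_n).
Local Notation ptoo := (inord m.+2 : 'I_n).
Local Notation brT := (@brT k m0).
Local Notation brK := (@brK k m0).
Local Notation iota := (@iota k m0).
Local Notation discT := (@discT k m0).
Local Notation openT := (@openT k m0).
Local Notation "x %:F" := (@FracField.tofrac _ x).

Definition monomialT : set T :=
  [set x | exists c e, [/\ c != 0, balanced e & x = ratC m c * mon brT e]].

Lemma monomialTC c : c != 0 -> monomialT (ratC m c).
Proof.
move=> c0; exists c, (fun=> 0); split=> //; last by rewrite mon0 mulr1.
by move=> i; rewrite /degree big1 // => j _; rewrite addr0.
Qed.

Lemma monomialTM x y : monomialT x -> monomialT y -> monomialT (x * y).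
Proof.
move=> [c [e [c0 be ->]]] [d [f [d0 bf ->]]]; exists (c * d), (fun p => e p + f p).
split; [exact: mulf_neq0|exact: balancedD|].
by rewrite rmorphM (monD (@brT_neq0 k m0)) mulrACA.
Qed.

Lemma monomialTV x : monomialT x -> monomialT x^-1.
Proof.
move=> [c [e [c0 be ->]]]; exists c^-1, (fun p => - e p); split.
- by rewrite invr_eq0.
- exact: balancedN.
- by rewrite fmorphV monN invfM.
Qed.

Lemma brT_oo i : i != ptoo -> brT i ptoo = -1.
Proof. by move=> ioo; rewrite /brT (cowT_fin _ ioo) cowT_oo mulr0 sub0r coordToo mulr1. Qed.

Lemma brT_10 : brT pt1 pt0 = 1.
Proof.
rewrite /brT coordT1 coordT0 mul0r subr0 mul1r cowT_fin //; exact: pt0_neqoo.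
Qed.

Lemma monomialT_brT i j : i != j -> monomialT (brT i j).
Proof.
have N1 : monomialT (-1).
  by rewrite -(rmorph1 (@ratC k m)) -rmorphN; apply: monomialTC; rewrite oppr_eq0 oner_neq0.
have b0 := @brT_neq0 k m0.
wlog ioo : i j / i != ptoo.
  move=> H ij; have [ioo|ioo] := eqVneq i ptoo; last exact: H.
  rewrite brT_anti -mulN1r; apply: monomialTM => //; apply: H; by rewrite 1?eq_sym // -ioo.
have [-> _|joo ij] := eqVneq j ptoo; first by rewrite brT_oo.
have n0 := pt0_neqoo m0; have n1 := pt1_neqoo m0.
have n10 : pt1 != pt0 by rewrite eq_sym; exact: pt0_neq1.
(* Brackets with [ptoo] and the bracket of [pt1], [pt0] are 1 or -1, so they can be inserted freely
   to bring every degree to 0. *)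
pose e := fun p => (edge i j p + edge pt1 ptoo p + edge pt0 ptoo p) -
  (edge i ptoo p + edge j ptoo p + edge pt1 pt0 p).
exists 1, e; split; first exact: oner_neq0.
  by move=> a; rewrite /e degreeB !degreeD !degree_edge //; ring.
rewrite rmorph1 mul1r /e (monB b0) !(monD b0) !mon_edge // !brT_oo // brT_10.
by rewrite !mulrN1 opprK mulr1 opprK divr1.
Qed.

Lemma coordT_poly i : exists2 q : {mpoly k[m]}, coordT k i = q%:F &
  [\/ i = pt0 /\ q = 0, i = pt1 /\ q = 1, i = ptoo | exists2 l : 'I_m, i = inord l.+1 & q = 'X_l].
Proof.
case: (point_cases i) => [->|->|->|[l ->]].
- by exists 0; [rewrite coordT0 tofrac0|apply: Or41].
- by exists 1; [rewrite coordT1 tofrac1|apply: Or42].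
- by exists 1; [rewrite coordToo tofrac1|apply: Or43].
- by exists 'X_l; [rewrite coordTX|apply: Or44; exists l].
Qed.

Lemma prime_eltN (R : idomainType) (p : R) : prime_elt p -> prime_elt (- p).
Proof.
have dN (x : R) : divides (- p) x <-> divides p x.
  by split=> -[c ->]; exists (- c); ring.
move=> [p0 p1 pP]; split; [by rewrite oppr_eq0|by move/dN|].
by move=> a b /dN /pP[/dN pa|/dN pb]; [left|right].
Qed.

Lemma brT_prime i j : i != j ->
  exists2 q : {mpoly k[m]}, brT i j = q%:F & divides q 1 \/ prime_elt q.
Proof.
have dN1 : divides (-1 : {mpoly k[m]}) 1 by exists (-1); rewrite mulrNN mulr1.
have d1 : divides (1 : {mpoly k[m]}) 1 by exact: divides_refl.
have key (l : 'I_m) (a : {mpoly k[m]}) : 'X_l != a -> [\/ a = 0, a = 1 | exists2 l', l' != l & a = 'X_l'] ->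
   prime_elt ('X_l - a).
  move=> la ha; apply: linear_form_prime => //; case: ha => [->|->|[l' l'l ->]].
  - by rewrite raddf0.
  - exact: rmorph1.
  - by rewrite mmapX mmap1U (negPf l'l).
move=> ij; have [ioo|ioo] := eqVneq i ptoo.
  exists 1; last by left.
  by rewrite tofrac1 brT_anti ioo brT_oo ?opprK // eq_sym -ioo.
have [joo|joo] := eqVneq j ptoo.
  by exists (-1); [rewrite joo brT_oo // rmorphN rmorph1|left].
have [q qE qc] := coordT_poly i; have [r rE rc] := coordT_poly j.
have bE : brT i j = (q - r)%:F.
  by rewrite /brT (cowT_fin _ ioo) (cowT_fin _ joo) !mulr1 qE rE tofracB.
have qr : q != r by apply: contraTneq (brT_neq0 k ij) => qr; rewrite bE qr subrr tofrac0 eqxx.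
exists (q - r) => //.
case: qc rc => [[iE q0]|[iE q1]|/eqP|[l iE ql]]; rewrite ?(negPf ioo) //;
 case=> [[jE r0]|[jE r1]|/eqP|[l' jE rl]]; rewrite ?(negPf joo) //.
- by rewrite q0 r0 eqxx in qr.
- by rewrite q0 r1 sub0r; left.
- right; rewrite -opprB; apply: prime_eltN; rewrite rl; apply: key; first by rewrite -rl eq_sym.
  by apply: Or31.
- by rewrite q1 r0 subr0; left.
- by rewrite q1 r1 eqxx in qr.
- right; rewrite -opprB; apply: prime_eltN; rewrite rl; apply: key; first by rewrite -rl eq_sym.
  by apply: Or32.
- by right; rewrite ql; apply: key; [rewrite -ql|apply: Or31].
- by right; rewrite ql; apply: key; [rewrite -ql|apply: Or32].
- right; rewrite ql; apply: key; first by rewrite -ql.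
  by apply: Or33; exists l' => //; apply: contraNneq qr => E; rewrite ql rl E.
Qed.

Lemma unitp_const (u : {mpoly k[m]}) : divides u 1 -> exists2 c, c != 0 & u = c%:MP.
Proof.
move=> [v vu]; have /andP[/eqP uE _] := mpoly_intro_unit (esym vu).
exists (u@_0)%MM => //; apply/eqP => u0; move: vu; rewrite uE u0 mpolyC0 mulr0.
by move/eqP; rewrite oner_eq0.
Qed.

(** Up to powers of the discriminant, the unit and its inverse are polynomials [f] and [g] whose
    product is a power of the discriminant, that is, a product of brackets. By unique factorization
    [f] is one too, up to a constant. *)
Lemma openT_unit_mon t : t != 0 -> (forall v, openT_vals v -> v t = 0) -> monomialT t.
Proof.
move=> t0 /(fac_unit (openT_factorial k m0) I t0) [[_ [N [f _ fE]]] [_ [M [g _ gE]]]].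
have [dq dqP] : exists q : 'I_n * 'I_n -> {mpoly k[m]}, forall p, p.1 != p.2 ->
    brT p.1 p.2 = (q p)%:F /\ (divides (q p) 1 \/ prime_elt (q p)).
  have H p : exists q : {mpoly k[m]}, p.1 != p.2 -> brT p.1 p.2 = q%:F /\ (divides q 1 \/ prime_elt q).
    have [p12|p12] := eqVneq p.1 p.2; first by exists 0.
    by have [q qE qP] := brT_prime p12; exists q.
  by exists (fun p => sval (cid (H p))) => p; exact: (svalP (cid (H p))).
pose s0 := [seq dq p | p : 'I_n * 'I_n <- enum [pred p : 'I_n * 'I_n | p.1 != p.2]].
have s0P q : q \in s0 -> monomialT q%:F /\ (divides q 1 \/ prime_elt q).
  case/mapP => p; rewrite mem_enum inE => p12 ->; have [<- qp] := dqP _ p12.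
  by split=> //; exact: monomialT_brT.
have discE : discT = (\prod_(q <- s0) q)%:F.
  rewrite /discT rmorph_prod /= big_map big_enum /=; apply: eq_bigr => p p12.
  by have [] := dqP p p12.
have unitE u : divides u 1 -> monomialT u%:F.
  by move=> /unitp_const[c c0 ->]; exact: monomialTC.
have key (r : seq {mpoly k[m]}) : (forall q, q \in r -> divides q 1 \/ prime_elt q) ->
    exists u s, [/\ divides u 1, (forall p, p \in s -> prime_elt p), {subset s <= r} &
      \prod_(q <- r) q = u * \prod_(q <- s) q].
  elim: r => [|q r IHr] rP.
    by exists 1, [::]; split=> //; [exact: divides_refl|rewrite !big_nil mulr1].
  have [|u [s [u1 ps sr E]]] := IHr; first by move=> p pr; apply: rP; rewrite inE pr orbT.
  case: (rP q (mem_head _ _)) => [q1|qp].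
    exists (q * u), s; split=> //; last by rewrite big_cons E mulrA.
      by case: q1 u1 => v vE [w wE]; exists (v * w); rewrite mulrACA -vE -wE mulr1.
    by move=> p /sr pr; rewrite inE pr orbT.
  exists u, (q :: s); split=> //.
  - by move=> p; rewrite inE => /predU1P[->|/ps].
  - by move=> p; rewrite !inE => /predU1P[->|/sr->]; rewrite ?eqxx ?orbT.
  - by rewrite !big_cons E mulrCA.
have [u [s [u1 ps ss E]]] := key s0 (fun q qs => (s0P q qs).2).
have monD : monomialT discT.
  rewrite discE E tofracM; apply: monomialTM; first exact: unitE.
  rewrite rmorph_prod /=; elim: s ss {ps E} => [|q s IHs] ss.
    by rewrite big_nil -(rmorph1 (@ratC k m)); apply: monomialTC; exact: oner_neq0.
  rewrite big_cons; apply: monomialTM; first by have [] := s0P q (ss _ (mem_head _ _)).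
  by apply: IHs => p ps; apply: ss; rewrite inE ps orbT.
have monX x q : monomialT x -> monomialT (x ^+ q).
  move=> Mx; elim: q => [|q IHq]; last by rewrite exprS; exact: monomialTM.
  by rewrite expr0 -(rmorph1 (@ratC k m)); apply: monomialTC; exact: oner_neq0.
have fgE : f * g = u ^+ (N + M) * \prod_(q <- flatten (nseq (N + M) s)) q.
  apply: tofrac_inj; rewrite tofracM fE gE mulrACA divff // mul1r -exprD discE -tofracXn.
  congr (_%:F); rewrite E exprMn; congr (_ * _).
  by elim: (N + M)%N => [|q IHq]; rewrite /= ?big_nil ?expr0 // big_cat /= exprS IHq.
have [|q|u' [r [u'1 rs fr]]] := divides_prod_factor _ _ fgE.
- elim: (N + M)%N => [|q IHq]; first by rewrite expr0; exact: divides_refl.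
  by case: u1 IHq => v vE [w wE]; exists (v * w); rewrite exprS mulrACA -vE -wE mulr1.
- by case/flattenP => s' /nseqP[-> _] /ps.
have -> : t = f%:F * discT ^- N by rewrite fE mulfK // expf_neq0 // discT_neq0.
apply: monomialTM; last by apply: monomialTV; exact: monX.
rewrite fr tofracM; apply: monomialTM; first exact: unitE.
have {}rs : {subset r <= s0}.
  by move=> q /rs /flattenP[s' /nseqP[-> _] /ss].
rewrite rmorph_prod /=; elim: r rs {fr} => [|q r IHr] rs.
  by rewrite big_nil -(rmorph1 (@ratC k m)); apply: monomialTC; exact: oner_neq0.
rewrite big_cons; apply: monomialTM; first by have [] := s0P q (rs _ (mem_head _ _)).
by apply: IHr => p pr; apply: rs; rewrite inE pr orbT.
Qed.

Lemma unit_mon x : ffield x -> x != 0 -> (forall v, open_vals v -> v x = 0) ->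
  exists c e, [/\ c != 0, balanced e & x = ratC n c * mon brK e].
Proof.
move=> [t _ <-]; rewrite fmorph_eq0 => t0 vt.
have [|c [e [c0 be ->]]] := openT_unit_mon t0.
  by move=> v Vv; rewrite -(push_valE iota v t); apply: vt; exists v.
by exists c, e; split=> //; rewrite rmorphM iotaC iota_mon.
Qed.
End OpenUnits.

Lemma ufd_field (F : fieldType) : is_ufd F.
Proof.
move=> a a0; exists a, [::]; split=> //; last by rewrite big_nil mulr1.
by exists a^-1; rewrite mulVf.
Qed.

Lemma divides_polyX (F : fieldType) (f : {poly F}) : divides 'X f <-> f`_0 = 0.
Proof.
split=> [[g ->]|f0]; first by rewrite coefMX.
have [q ->] : exists q, f = q * 'X; last by exists q.
elim/poly_ind: f f0 => [|p c IHp]; first by exists 0; rewrite mul0r.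
by rewrite coefD coefMX coefC /= add0r => ->; exists p; rewrite polyC0 addr0.
Qed.

Lemma prime_polyX (F : fieldType) : prime_elt ('X : {poly F}).
Proof.
split; first by rewrite polyX_eq0.
  by move=> /divides_polyX /eqP; rewrite coef1 oner_eq0.
move=> f g /divides_polyX /eqP; rewrite coefM big_ord_recl big_ord0 addr0 subnn mulf_eq0.
by case/orP => /eqP /divides_polyX; [left|right].
Qed.

Lemma coef0_linear (F : fieldType) (a b : F) : b != 0 -> (a%:P * 'X - b%:P)`_0 != 0.
Proof.
move=> b0; have -> : (a%:P * 'X - b%:P)`_0 = - b by rewrite -horner_coef0 !hornerE.
by rewrite oppr_eq0.
Qed.

(** * Valuations of colliding points *)

Section Contraction.
Variables (k : fieldType) (m0 : nat) (r : nat).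
Local Notation m := m0.+1.
Local Notation n := m0.+4.
Local Notation T := (ratfun k m).
Local Notation pt0 := (inord 0 : 'I_n).
Local Notation pt1 := (inord m.+1 : 'I_n).
Local Notation ptoo := (inord m.+2 : 'I_n).
Local Notation brT := (@brT k m0).
Local Notation "x %:F" := (@FracField.tofrac _ x).

(* The points 0, ..., r are scaled by a parameter, so that they collide with
   the origin. *)
Definition contract_poly : {mpoly k[m]} -> {poly T} :=
  mmap (polyC \o @ratC k m)
    (fun l : 'I_m => if (l < r)%N then (ratX k l)%:P * 'X else (ratX k l)%:P).
HB.instance Definition _ := GRing.RMorphism.on contract_poly.

Lemma contract_poly1 p : (contract_poly p).[1] = p%:F.
Proof.
have := @mpoly_morph_ext _ _ _ (horner_eval (1 : T) \o contract_poly) (@FracField.tofrac _).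
apply=> [c|l]; rewrite /= /horner_eval /contract_poly.
  by rewrite mmapC /= hornerC.
rewrite mmapX mmap1U; case: ifP => _; first by rewrite hornerM hornerX mulr1 hornerC.
by rewrite hornerC.
Qed.

Lemma contract_polyC c : contract_poly c%:MP = (ratC m c)%:P.
Proof. by rewrite /contract_poly mmapC. Qed.
Lemma contract_polyX l : contract_poly 'X_l =
  if (l < r)%N then (ratX k l)%:P * 'X else (ratX k l)%:P.
Proof. by rewrite /contract_poly mmapX mmap1U. Qed.

Definition contract_pre : {mpoly k[m]} -> {fraction {poly T}} :=
  @FracField.tofrac {poly T} \o contract_poly.
HB.instance Definition _ := GRing.RMorphism.on contract_pre.

Lemma contract_pre_inj : injective contract_pre.
Proof.
move=> p q /tofrac_inj pq; apply: tofrac_inj.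
by rewrite -!contract_poly1 pq.
Qed.

Definition contract : {rmorphism T -> {fraction {poly T}}} := frac_lift contract_pre_inj.

Lemma contractC c : contract (ratC m c) = (ratC m c)%:P%:F.
Proof. by rewrite /contract [in LHS]/ratC frac_liftE -contract_polyC. Qed.

Lemma contractX l : contract (ratX k l) =
  if (l < r)%N then (ratX k l)%:P%:F * 'X%:F else (ratX k l)%:P%:F.
Proof.
rewrite /contract {1}/ratX frac_liftE.
transitivity ((contract_poly 'X_l)%:F); first by [].
by rewrite contract_polyX; case: ifP => _; rewrite ?tofracM.
Qed.

Lemma contract_coordT i : (r <= m)%N -> contract (coordT k i) =
  if (i <= r)%N then (coordT k i)%:P%:F * 'X%:F else (coordT k i)%:P%:F.
Proof.
move=> rm; case: (point_cases i) => [->|->|->|[l ->]].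
- by rewrite coordT0 rmorph0 polyC0 tofrac0 mul0r if_same.
- by rewrite coordT1 rmorph1 polyC1 tofrac1 pt1E ltnNge rm.
- have -> : (ptoo <= r)%N = false by rewrite ptooE; lia.
  by rewrite coordToo rmorph1 polyC1 tofrac1.
- rewrite coordTX contractX inordK //; have := ltn_ord l; lia.
Qed.

Lemma contract_cowT i : contract (cowT k i) = (cowT k i)%:P%:F.
Proof.
rewrite /cowT; case: ifP => _; first by rewrite rmorph0 polyC0 tofrac0.
by rewrite rmorph1 polyC1 tofrac1.
Qed.

Let polyT_ufd : is_ufd {poly T}.
Proof. apply: ufd_poly; exact: ufd_field. Qed.

Lemma frac_ord_unit (f : {poly T}) : f`_0 != 0 -> frac_ord 'X f%:F = 0.
Proof.
move=> f0; have fn0 : f != 0 by apply: contraNneq f0 => ->; rewrite coef0.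
rewrite (frac_ord_tofrac polyT_ufd (prime_polyX T) fn0).
have [->//|] := posnP (ordp 'X f).
by move/(ordp_gt0 polyT_ufd (prime_polyX T) fn0)/divides_polyX/eqP; rewrite (negPf f0).
Qed.

Lemma frac_ordX : frac_ord ('X : {poly T}) 'X%:F = 1.
Proof.
have pX := prime_polyX T; have X0 : ('X : {poly T}) != 0 by rewrite polyX_eq0.
rewrite (frac_ord_tofrac polyT_ufd pX X0); congr Posz.
apply: (ord_unique X0 (ordpP polyT_ufd pX X0)).
by exists 1; [rewrite expr1 mulr1|case: pX].
Qed.

Lemma frac_ord_ultra : ultrametric setT (frac_ord ('X : {poly T})).
Proof.
have sP : is_subring (range (@FracField.tofrac {poly T})).
  split; first by exists 1; rewrite ?tofrac1.
    by move=> _ _ [x _ <-] [y _ <-]; exists (x - y); rewrite ?tofracB.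
  by move=> _ _ [x _ <-] [y _ <-]; exists (x * y); rewrite ?tofracM.
apply: (fac_ultrametric (ufd_factorial polyT_ufd) sP).
by exists 'X => //; exact: prime_polyX.
Qed.

(** Here [c] embeds [T] as constants, [f] is the contraction and [v] the order at the parameter
    [X]. *)
Lemma contraction_data : (r <= m)%N ->
  exists (E : fieldType) (f c : {rmorphism T -> E}) (X : E) (v : E -> int),
  [/\ divval setT v, ultrametric setT v, (forall t, t != 0 -> v (c t) = 0)
    & (forall a b, b != 0 -> v (c a * X - c b) = 0)] /\
  [/\ X != 0, v X = 1, (forall s, f (ratC m s) = c (ratC m s)),
     (forall i, f (coordT k i) = if (i <= r)%N then c (coordT k i) * X else c (coordT k i))
   & (forall i, f (cowT k i) = c (cowT k i))].
Proof.
move=> rm; exists {fraction {poly T}}, contract, (@FracField.tofrac {poly T} \o polyC), 'X%:F.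
exists (frac_ord 'X); split; split.
- exact: (frac_ord_div polyT_ufd (prime_polyX T)).
- exact: frac_ord_ultra.
- move=> t t0; apply: frac_ord_unit; rewrite coefC eqxx; exact: t0.
- move=> a b b0.
  have -> : (@FracField.tofrac {poly T} \o polyC) a * 'X%:F - (@FracField.tofrac {poly T} \o polyC) b
     = (a%:P * 'X - b%:P)%:F by rewrite tofracB tofracM.
  apply: frac_ord_unit; exact: coef0_linear.
- by rewrite tofrac_eq0 polyX_eq0.
- exact: frac_ordX.
- exact: contractC.
- by move=> i; exact: contract_coordT.
- exact: contract_cowT.
Qed.
End Contraction.

(** [w] is the order of vanishing along the divisor where the points 0, ..., r collide. [F] consists
    of the functions on which the contraction does not depend on the parameter; [w] is trivial on
    it. It contains the brackets of points outside the cluster, the origin standing for the cluster,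
    and the ratios of brackets inside the cluster. *)
Lemma contraction_val (k : fieldType) (m0 r : nat) : (r <= m0.+1)%N ->
  exists (w : ratfun k m0.+1 -> int) (F : set (ratfun k m0.+1)),
  [/\ divval setT w, ultrametric setT w, is_subfield F & forall t, F t -> t != 0 -> w t = 0] /\
  [/\ (forall c, F (ratC m0.+1 c)),
      (forall i j : 'I_m0.+4, i != j -> w (brT k i j) = ((i <= r)%N && (j <= r)%N)%:R),
      (forall i j : 'I_m0.+4, (i == inord 0) || (r < i)%N -> (j == inord 0) || (r < j)%N ->
         F (brT k i j)),
      (forall a b c d : 'I_m0.+4, [&& a <= r, b <= r, c <= r & d <= r]%N -> c != d ->
         F (brT k a b / brT k c d))
    & (forall i : 'I_m0.+4, F (brT k i (inord m0.+3)))].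
Proof.
move=> rm; have [E [f [c [X [v [[vv vu vc vcX] [X0 vX fC fco fcow]]]]]]] := contraction_data k rm.
have [_ _ vM] := vv.
pose F := [set t | f t = c t]; exists (v \o f), F.
have sF : is_subfield F.
  split; first split; rewrite /F /=; first by rewrite !rmorph1.
  - by move=> x y xE yE; rewrite !rmorphB xE yE.
  - by move=> x y xE yE; rewrite !rmorphM xE yE.
  - by move=> x xE; rewrite !fmorphV xE.
have bin (i j : 'I_m0.+4) : (i <= r)%N -> (j <= r)%N -> f (brT k i j) = c (brT k i j) * X.
  move=> ir jr; rewrite /brT !rmorphB !rmorphM /= !fco ir jr !fcow; ring.
have bout (i j : 'I_m0.+4) : (i == inord 0) || (r < i)%N -> (j == inord 0) || (r < j)%N ->
    F (brT k i j).
  have cE (i' : 'I_m0.+4) : (i' == inord 0) || (r < i')%N -> f (coordT k i') = c (coordT k i').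
    move=> /orP[/eqP ->|]; first by rewrite coordT0 !rmorph0.
    by rewrite fco ltnNge => /negPf ->.
  by move=> ir jr; rewrite /F /= /brT !rmorphB !rmorphM /= !cE // !fcow.
have boo (i : 'I_m0.+4) : F (brT k i (inord m0.+3)).
  have [->|ioo] := eqVneq i (inord m0.+3); first by rewrite /F /= /brT subrr !rmorph0.
  by rewrite /F /= brT_oo // !rmorphN !rmorph1.
have wF t : F t -> t != 0 -> v (f t) = 0 by move=> -> t0; apply: vc.
split; split=> //.
- split=> [|x []//|x y _ _ x0 y0] /=; first by rewrite rmorph0; case: vv.
  by rewrite rmorphM vM // fmorph_eq0.
- move=> x y N _ _ xy0 vx vy /=; rewrite rmorphB; apply: vu => //.
  + by rewrite -rmorphB fmorph_eq0.
  + by case: vx => [->|]; [left; rewrite rmorph0|right].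
  + by case: vy => [->|]; [left; rewrite rmorph0|right].
- move=> i j; wlog ij : i j / (i < j)%N.
    move=> H inj; case: (ltngtP i j) => [ij|ji|/val_inj E0]; first exact: H.
      rewrite andbC -(H j i ji) 1?eq_sym // brT_anti /= rmorphN -mulN1r vM //.
      + have v1 : v 1 = 0 by rewrite -(rmorph1 c) vc ?oner_neq0.
        have N0 : (-1 : E) != 0 by rewrite oppr_eq0 oner_neq0.
        have vN : v (-1) = 0.
          have := vM (-1) (-1) I I N0 N0; rewrite mulrNN mulr1 v1; move: (v (-1)) => z; lia.
        by rewrite vN add0r.
      + by rewrite oppr_eq0 oner_neq0.
      + by rewrite fmorph_eq0 brT_neq0 // eq_sym.
    by rewrite E0 eqxx in inj.
  move=> inj; have b0 := brT_neq0 k inj.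
  have [jr|rj] := leqP j r; last first.
    rewrite andbF; have [ir|ri] := leqP i r; last first.
      by apply: wF => //; apply: bout; rewrite ?ri ?rj orbT.
    have [joo|joo] := eqVneq j (inord m0.+3); first by apply: wF; rewrite // joo; exact: boo.
    have ioo : i != inord m0.+3 by rewrite -val_eqE /= ptooE; have := ltn_ord j; lia.
    rewrite /= /brT (cowT_fin _ ioo) (cowT_fin _ joo) !mulr1 rmorphB /= !fco.
    rewrite ir leqNgt rj /=; apply: vcX; apply/eqP => E0.
    by move: rj; rewrite (coordT_inj joo (pt0_neqoo _) (etrans E0 (esym (coordT0 k m0)))) pt0E.
  have ir : (i <= r)%N by exact: leq_trans (ltnW ij) jr.
  by rewrite ir /= bin // vM ?fmorph_eq0 // vc // vX.
- move=> a b c' d /and4P[ar br cr dr] cd; rewrite /F /= !fmorph_div !bin //.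
  by rewrite invfM [X in _ * X]mulrC mulrA mulfK.
Qed.

(** * Dihedral charts *)

Lemma factorial_transport (K : fieldType) (h h' : {rmorphism K -> K}) (E A : set K) V :
  cancel h h' -> cancel h' h -> (forall x, E x -> E (h x)) -> (forall x, E x -> E (h' x)) ->
  factorial E A V -> factorial E (h' @^-1` A) [set v \o h' | v in V].
Proof.
move=> hK h'K Eh Eh' fac; have sE := fac_field fac; split=> //.
- move=> _ [v /(fac_val fac)[v0 vN vM] <-]; split=> /=; first by rewrite rmorph0.
    by move=> x Ex; apply: vN => /Eh; rewrite h'K.
  by move=> x y Ex Ey x0 y0; rewrite rmorphM vM ?fmorph_eq0 //; apply: Eh'.
- by move=> x /(fac_sub fac)/Eh; rewrite h'K.
- move=> x Ex x0; rewrite /preimage /= (fac_ring fac) ?fmorph_eq0 //; last exact: Eh'.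
  by split=> [P _ [v Vv <-]|P v Vv]; [apply: P|apply: (P (v \o h')); exists v].
- move=> x Ex x0; have [||s sP] := fac_fin fac (x := h' x); first exact: Eh'.
    by rewrite fmorph_eq0.
  by exists [seq v \o h' | v <- s] => _ [v Vv <-] vx; apply: map_f; apply: sP.
move=> _ [v Vv <-]; have [p [Ep p0 vp wp]] := fac_par fac Vv.
exists (h p); split; rewrite ?fmorph_eq0 //=; [exact: Eh|by rewrite hK|].
move=> _ [w Vw <-] wv; rewrite /= hK; apply: wp => //.
by apply: contra_neq wv => ->.
Qed.

Section Dihedral.
Variables (k K : fieldType) (i0 : {rmorphism k -> K}) (n0 : nat).
Local Notation n := n0.+4.
Variable br : 'I_n -> 'I_n -> K.
Hypothesis br_anti : forall i j, br j i = - br i j.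
Hypothesis br_neq0 : forall i j, i != j -> br i j != 0.
Hypothesis br_pluecker : forall a b c d,
  br a b * br c d - br a c * br b d + br a d * br b c = 0.

Definition pt (x : nat) : 'I_n := inord (x %% n).
Definition B (x y : nat) : K := br (pt x) (pt y).
(** [ZY] and [RR] are the two cross-ratios of four points in cyclic order that add up to 1 and lie
    between 0 and 1 for real points. [U i j] is the dihedral coordinate of the chord from i to j. *)
Definition ZY (a b c d : nat) : K := (B a d * B b c) / (B a c * B b d).
Definition RR (a b c d : nat) : K := (B a b * B c d) / (B a c * B b d).
Definition U (i j : nat) : K := ZY i i.+1 j j.+1.
Definition sorted4 a b c d := [&& a < b, b < c, c < d & d < n]%N.
(* Index [n] stands for the point [0]. *)
Definition wsorted4 a b c d := [&& a < b, b < c, c < d, d <= n & (0 < a) || (d < n)]%N.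
(** The ring of the chart of a cyclic ordering, generated here by all the [RR] rather than by the
    dihedral coordinates; every [ZY], hence every [U] of a chord, belongs to it. *)
Definition dih_ring : set K :=
  algebra_gen i0 [set x | exists a b c d, sorted4 a b c d /\ x = RR a b c d].

Lemma ptE x : pt x = (x %% n)%N :> nat.
Proof. by rewrite inordK // ltn_mod. Qed.
Lemma pt_add x : pt (x + n) = pt x.
Proof. by apply/val_inj; rewrite /= !ptE modnDr. Qed.
Lemma pt_ord (i : 'I_n) : pt i = i.
Proof. by apply/val_inj; rewrite /= ptE modn_small. Qed.
Lemma ptn : pt n = pt 0. Proof. by rewrite -(pt_add 0). Qed.
Lemma pt_neq x y : (x < y)%N -> (y < x + n)%N -> pt x != pt y.
Proof.
move=> xy yx; rewrite -val_eqE /= !ptE eq_sym eqn_mod_dvd ?(ltnW xy) //.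
by apply/negP => /dvdn_leq; lia.
Qed.
Lemma B_neq0 x y : (x < y)%N -> (y < x + n)%N -> B x y != 0.
Proof. by move=> xy yx; apply/br_neq0/pt_neq. Qed.
Lemma B_anti x y : B y x = - B x y. Proof. exact: br_anti. Qed.

Lemma wsorted_sorted a b c d : sorted4 a b c d -> wsorted4 a b c d.
Proof. by rewrite /sorted4 /wsorted4; lia. Qed.
Lemma ZY_neq0 a b c d : wsorted4 a b c d -> ZY a b c d != 0.
Proof.
rewrite /wsorted4 => W; rewrite /ZY mulf_neq0 ?invr_eq0 ?mulf_neq0 //; apply: B_neq0; lia.
Qed.
Lemma RR_ZY a b c d : wsorted4 a b c d -> 1 - RR a b c d = ZY a b c d.
Proof.
rewrite /wsorted4 => W; have Bn : B a c * B b d != 0 by rewrite mulf_neq0 //; apply: B_neq0; lia.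
rewrite /RR /ZY -[1](divff Bn) -mulrBl; congr (_ / _); rewrite /B.
by rewrite -[LHS]addr0 -(br_pluecker (pt a) (pt b) (pt c) (pt d)); ring.
Qed.
(** Moving the point 0 to the end of the cyclic order exchanges the two kinds of cross-ratio. *)
Lemma RR_ZY0 b c d : wsorted4 b c d n -> RR 0 b c d = ZY b c d n.
Proof.
rewrite /wsorted4 => W; rewrite /RR /ZY.
have Bn x : B x n = - B 0 x by rewrite -B_anti /B ptn.
by rewrite !Bn !(mulrN, mulNr) invrN mulrN opprK (mulrC (B b d)).
Qed.
Local Ltac bracket_field := rewrite /wsorted4 => W; rewrite /RR /ZY;
  field; do ?(apply/andP; split); apply: B_neq0; lia.
Lemma ZY_split1 a e b c d : (a < e)%N -> (e < b)%N -> wsorted4 a b c d ->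
  ZY a b c d = ZY a e c d * ZY e b c d.
Proof. move=> ae eb; bracket_field. Qed.
Lemma ZY_split2 a b c e d : (c < e)%N -> (e < d)%N -> wsorted4 a b c d ->
  ZY a b c d = ZY a b c e * ZY a b e d.
Proof. move=> ce ed; bracket_field. Qed.
Lemma RR_split a b e c d : (b < e)%N -> (e < c)%N -> wsorted4 a b c d ->
  RR a b c d = RR a b e d * RR a e c d.
Proof. move=> ce ed; bracket_field. Qed.
Lemma RR_split0 a b c d : (0 < a)%N -> sorted4 a b c d ->
  RR a b c d = RR 0 b c d * ZY 0 a b c.
Proof. move=> a0 /wsorted_sorted; bracket_field. Qed.
Lemma RR_split_oo a b c d : (d < n.-1)%N -> sorted4 a b c d ->
  RR a b c d = ZY b c d n.-1 * RR a b c n.-1.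
Proof. move=> a0 /wsorted_sorted; bracket_field. Qed.

Lemma dih_ring_RR a b c d : sorted4 a b c d -> dih_ring (RR a b c d).
Proof. by move=> H; apply: gen_mem; exists a, b, c, d. Qed.
Lemma dih_ring_subring : is_subring dih_ring. Proof. exact: gen_subring. Qed.
Lemma dih_ring_ZY a b c d : wsorted4 a b c d -> dih_ring (ZY a b c d).
Proof.
case: (ltngtP d n) => [dn|dn|->] W; last 1 first.
- rewrite -RR_ZY0 //; apply: dih_ring_RR; move: W; rewrite /wsorted4 /sorted4; lia.
- rewrite -RR_ZY //; apply: (subringB dih_ring_subring); first exact: subring1 dih_ring_subring.
  by apply: dih_ring_RR; move: W; rewrite /wsorted4 /sorted4; lia.
by move: W; rewrite /wsorted4; lia.
Qed.

(** [U r n.-1] is an equation of the divisor where 0, ..., r collide, along which [RR a b c d]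
    vanishes when r separates b from c. The splitting rules push a, b, c, d to 0, r, r+1, n-1 one
    index at a time, each at the cost of a factor in the ring. *)
Lemma RR_factor r a b c d : sorted4 a b c d -> (b <= r < c)%N ->
  exists2 y, dih_ring y & RR a b c d = U r n.-1 * y.
Proof.
move=> S /andP[br_ rc]; have sA := dih_ring_subring.
have W := wsorted_sorted S; move: (S); rewrite /sorted4 => S'.
have [y1 Ay1 ->] : exists2 y, dih_ring y & RR a b c d = RR a r c d * y.
  have [->|br'] := eqVneq b r; first by exists 1; [exact: subring1|rewrite mulr1].
  exists (RR a b r d); first by apply: dih_ring_RR; rewrite /sorted4; lia.
  by rewrite (@RR_split a b r c d) // 1?mulrC //; lia.
have [y2 Ay2 ->] : exists2 y, dih_ring y & RR a r c d = RR a r r.+1 d * y.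
  have [->|cr] := eqVneq c r.+1; first by exists 1; [exact: subring1|rewrite mulr1].
  exists (RR a r.+1 c d); first by apply: dih_ring_RR; rewrite /sorted4; lia.
  by rewrite (@RR_split a r r.+1 c d) // ?/wsorted4; lia.
have [y3 Ay3 ->] : exists2 y, dih_ring y & RR a r r.+1 d = RR 0 r r.+1 d * y.
  have [->|a0] := eqVneq a 0%N; first by exists 1; [exact: subring1|rewrite mulr1].
  exists (ZY 0 a r r.+1); first by apply: dih_ring_ZY; rewrite /wsorted4; lia.
  by rewrite RR_split0 // ?/sorted4; lia.
have [y4 Ay4 ->] : exists2 y, dih_ring y & RR 0 r r.+1 d = U r n.-1 * y.
  have -> : U r n.-1 = RR 0 r r.+1 n.-1.
    by rewrite /U RR_ZY0 // /wsorted4; lia.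
  have [->|a0] := eqVneq d n.-1; first by exists 1; [exact: subring1|rewrite mulr1].
  exists (ZY r r.+1 d n.-1); first by apply: dih_ring_ZY; rewrite /wsorted4; lia.
  by rewrite mulrC; apply: RR_split_oo; rewrite /sorted4; lia.
exists (y4 * (y3 * (y2 * y1))); last by rewrite !mulrA.
by do !apply: (subringM sA).
Qed.

(** Chords of an n-gon whose sides are the marked points: (i, j) cuts off the points i+1, ..., j, at
    least two of them, and leaves at least two. *)
Definition chord (i j : nat) := [&& i.+1 < j, j < n & (0 < i) || (j < n.-1)]%N.
Lemma chord_wsorted i j : chord i j -> wsorted4 i i.+1 j j.+1.
Proof. by rewrite /chord /wsorted4; lia. Qed.

(** [ZY a b c d] telescopes into the product of the [U i j] with i in [a, b) and j in [c, d). *)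
Lemma ZY_inv (L : set K) : is_subring L -> (forall i j, chord i j -> L (U i j)^-1) ->
  forall a b c d, wsorted4 a b c d -> L (ZY a b c d)^-1.
Proof.
move=> sL LU a b c d; have [N] := ubnP (b - a + (d - c))%N.
elim: N a b c d => // N IH a b c d abN W; move: (W); rewrite /wsorted4 => W'.
have [ba|ba] := eqVneq b a.+1; last first.
  have [ab1 ab2] : (a < b.-1 /\ b.-1 < b)%N by lia.
  rewrite (ZY_split1 ab1 ab2 W) invfM.
  by apply: (subringM sL); apply: IH; rewrite /wsorted4; lia.
have [dc|dc] := eqVneq d c.+1; last first.
  have [cd1 cd2] : (c < d.-1 /\ d.-1 < d)%N by lia.
  rewrite (ZY_split2 cd1 cd2 W) invfM.
  by apply: (subringM sL); apply: IH; rewrite /wsorted4; lia.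
by rewrite ba dc; apply: LU; rewrite /chord; lia.
Qed.

Definition CR (p q r s : nat) : K := (B p r * B q s) / (B p s * B q r).

(** The values of a cross-ratio under the permutations of its four points. *)
Definition six (x : K) : seq K :=
  [:: x; x^-1; 1 - x; (1 - x)^-1; - (x / (1 - x)); - ((1 - x) / x)].

Lemma CR_min p q r s : (p < q)%N -> (p < r)%N -> (p < s)%N -> (q < n)%N -> (r < n)%N -> (s < n)%N ->
  uniq [:: q; r; s] ->
  exists a b c d, sorted4 a b c d /\ CR p q r s \in six (RR a b c d).
Proof.
move=> pq pr ps qn rn sn; rewrite /= !inE => U3.
have Bn a b : (a != b)%N -> (a < n)%N -> (b < n)%N -> B a b != 0.
  move=> ab an bn; apply: br_neq0; rewrite -val_eqE /= !ptE !modn_small //.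
have nz : [/\ [/\ B p q != 0, B p r != 0 & B p s != 0],
    B q r != 0, B q s != 0 & B r s != 0] by split; try split; apply: Bn; lia.
case: nz => -[pq0 pr0 ps0] qr0 qs0 rs0.
have [qr|rq|E] := ltngtP q r; last by lia.
- have [rs|sr|E] := ltngtP r s; last by lia.
    have S : sorted4 p q r s by rewrite /sorted4; lia.
    exists p, q, r, s; split=> //; rewrite /six RR_ZY ?wsorted_sorted // !inE.
    by rewrite (_ : CR _ _ _ _ = (ZY p q r s)^-1) ?eqxx ?orbT // /ZY invf_div.
  have [qs|sq|E] := ltngtP q s; last by lia.
    have S : sorted4 p q s r by rewrite /sorted4; lia.
    by exists p, q, s, r; split=> //; rewrite /six RR_ZY ?wsorted_sorted // !inE eqxx !orbT.
  have S : sorted4 p s q r by rewrite /sorted4; lia.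
  exists p, s, q, r; split=> //; rewrite /six RR_ZY ?wsorted_sorted // !inE.
  suff -> : CR p q r s = - (ZY p s q r / RR p s q r) by rewrite eqxx !orbT.
  rewrite /ZY /RR /CR (B_anti q s) (B_anti r s); field.
  by rewrite ?oppr_eq0 pq0 ps0 qr0 rs0.
- have [qs|sq|E] := ltngtP q s; last by lia.
    have S : sorted4 p r q s by rewrite /sorted4; lia.
    exists p, r, q, s; split=> //; rewrite /six RR_ZY ?wsorted_sorted // !inE.
    suff -> : CR p q r s = - (RR p r q s / ZY p r q s) by rewrite eqxx !orbT.
    rewrite /ZY /RR /CR (B_anti q r); field.
    by rewrite ?oppr_eq0 pq0 ps0 qr0 rs0.
  have [rs|sr|E] := ltngtP r s; last by lia.
    have S : sorted4 p r s q by rewrite /sorted4; lia.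
    exists p, r, s, q; split=> //; rewrite /six !inE.
    rewrite (_ : CR _ _ _ _ = RR p r s q) ?eqxx // /CR /RR (B_anti q s) (B_anti q r).
    by rewrite !mulrN invrN mulrNN.
  have S : sorted4 p s r q by rewrite /sorted4; lia.
  exists p, s, r, q; split=> //; rewrite /six !inE.
  rewrite (_ : CR _ _ _ _ = (RR p s r q)^-1) ?eqxx ?orbT //.
  by rewrite /CR /RR (B_anti q s) (B_anti q r) invf_div !mulrN invrN mulrNN.
Qed.

Lemma CR_sym p q r s : CR p q r s = CR q p s r.
Proof. by rewrite /CR; congr (_ / _); rewrite mulrC. Qed.
Lemma CR_sym2 p q r s : CR p q r s = CR r s p q.
Proof.
rewrite /CR (B_anti p r) (B_anti q s) (B_anti q r) (B_anti p s) !(mulNr, mulrN) !opprK.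
by rewrite (mulrC (B q r)).
Qed.

(** A cross-ratio is invariant under the double transpositions of its arguments, so the smallest
    index can be brought to the front. *)
Lemma CR_cases p q r s : (p < n)%N -> (q < n)%N -> (r < n)%N -> (s < n)%N ->
  uniq [:: p; q; r; s] ->
  exists a b c d, sorted4 a b c d /\ CR p q r s \in six (RR a b c d).
Proof.
move=> pn qn rn sn; rewrite /= !inE => U4.
have [N1|] := boolP [&& p < q, p < r & p < s]%N; first by apply: CR_min; rewrite //= ?inE; lia.
have [N2 _|] := boolP [&& q < p, q < r & q < s]%N.
  by rewrite CR_sym; apply: CR_min; rewrite //= ?inE; lia.
have [N3 _ _|N3 N2 N1] := boolP [&& r < p, r < q & r < s]%N.
  by rewrite CR_sym2; apply: CR_min; rewrite //= ?inE; lia.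
by rewrite CR_sym CR_sym2; apply: CR_min; rewrite //= ?inE; lia.
Qed.

Section CrossRatios.
Variable L : set K.
Hypotheses (sL : is_subring L) (AL : dih_ring `<=` L).
Hypothesis LU : forall i j, chord i j -> L (U i j)^-1.

Lemma RR_inv a b c d : sorted4 a b c d -> L (RR a b c d)^-1.
Proof.
move=> S; move: (S); rewrite /sorted4 => S'.
have L0 p q r : (0 < p)%N -> (p < q)%N -> (q < r)%N -> (r < n)%N -> L (RR 0 p q r)^-1.
  by move=> p0 pq qr rn; rewrite RR_ZY0; [apply: (ZY_inv sL LU)|]; rewrite /wsorted4; lia.
have [a0|a0] := posnP a; first by rewrite a0; apply: L0; lia.
rewrite (RR_split0 a0 S) invfM; apply: (subringM sL); first by apply: L0; lia.
by apply: (ZY_inv sL LU); rewrite /wsorted4; lia.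
Qed.
Lemma CR_mem p q r s : (p < n)%N -> (q < n)%N -> (r < n)%N -> (s < n)%N ->
  uniq [:: p; q; r; s] -> L (CR p q r s).
Proof.
move=> pn qn rn sn U4; have [a [b [c [d [S]]]]] := CR_cases pn qn rn sn U4.
have LR : L (RR a b c d) by apply: AL; exact: dih_ring_RR.
have LRV := RR_inv S.
have LZ : L (ZY a b c d) by apply: AL; apply: dih_ring_ZY; exact: wsorted_sorted.
have LZV : L (ZY a b c d)^-1 by apply: (ZY_inv sL LU); exact: wsorted_sorted.
rewrite /six RR_ZY ?wsorted_sorted // !inE.
by do 5?[case/orP]; move/eqP=> -> //; apply: (subringN sL); exact: (subringM sL).
Qed.
End CrossRatios.

Lemma dih_ring_RRw a b c d : wsorted4 a b c d -> dih_ring (RR a b c d).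
Proof.
move=> W; have sA := dih_ring_subring; rewrite -[RR _ _ _ _](subKr 1) RR_ZY //.
by apply: (subringB sA); [exact: subring1|exact: dih_ring_ZY].
Qed.

Definition rotn (t : nat) : 'S_n := (perm (@ordS_inj n) ^+ t)%g.
Lemma rotnE t (x : 'I_n) : rotn t x = ((x + t) %% n)%N :> nat.
Proof.
rewrite /rotn; elim: t => [|t IH]; first by rewrite expg0 perm1 addn0 modn_small.
by rewrite expgSr permM permE /= IH -addn1 modnDml addn1 addnS.
Qed.
Lemma rotn_pt t x : rotn t (pt x) = pt (x + t).
Proof. by apply/val_inj; rewrite /= rotnE !ptE modnDml. Qed.
Lemma rotnV s t : (s + t)%N = n -> (rotn s)^-1%g = rotn t.
Proof.
move=> st; apply: (mulgI (rotn s)); rewrite mulgV /rotn -expgD st; apply/permP => x.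
by rewrite perm1 -/(rotn n); apply/val_inj; rewrite /= rotnE modnDr modn_small.
Qed.

(** * Factoriality of the dihedral chart *)

Section Charts.
Variables (E C : set K) (V : set (K -> int)) (g : 'S_n -> {rmorphism K -> K}).
Hypothesis sE : is_subfield E.
Hypothesis E_mon : forall e, balanced e -> E (mon br e).
Hypothesis E_const : forall c, E (i0 c).
Hypothesis g_br : forall s i j, g s (br i j) = br (s i) (s j).
Hypothesis g_const : forall s c, g s (i0 c) = i0 c.
Hypothesis gM : forall s t x, g (s * t)%g x = g t (g s x).
Hypothesis gK : forall s, cancel (g s) (g s^-1%g).
Hypothesis gE : forall s x, E x -> E (g s x).
Hypothesis fac : factorial E C V.
Hypothesis sC : is_subring C.
Hypothesis C_const : forall c, C (i0 c).
Hypothesis C_cr : forall a b c d, uniq [:: a; b; c; d] ->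
  C ((br a c * br b d) / (br a d * br b c)).
Hypothesis C_min : forall L, is_subring L -> (forall c, L (i0 c)) ->
  (forall a b c d, uniq [:: a; b; c; d] -> L ((br a c * br b d) / (br a d * br b c))) ->
  C `<=` L.
Variables (w : nat -> K -> int) (F : nat -> set K).
Hypothesis w_div : forall r, (0 < r < n0.+2)%N -> divval E (w r).
Hypothesis w_ultra : forall r, (0 < r < n0.+2)%N -> ultrametric E (w r).
Hypothesis w_mon : forall r e, (0 < r < n0.+2)%N -> balanced e ->
  w r (mon br e) = \sum_(p | p.1 != p.2) e p * ((p.1 <= r) && (p.2 <= r))%N%:R.
Hypothesis F_field : forall r, (0 < r < n0.+2)%N -> is_subfield (F r).
Hypothesis F_w : forall r x, (0 < r < n0.+2)%N -> F r x -> x != 0 -> w r x = 0.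
Hypothesis F_const : forall r c, (0 < r < n0.+2)%N -> F r (i0 c).
Hypothesis F_RR : forall r a b c d, (0 < r < n0.+2)%N -> sorted4 a b c d ->
  [|| d <= r, r < a, (a == 0) && (r < b) | (c <= r) && (d == n.-1)]%N -> F r (RR a b c d).

Lemma sum_edge (a b : 'I_n) (f : 'I_n * 'I_n -> int) : a != b ->
  \sum_(p | p.1 != p.2) edge a b p * f p = f (a, b).
Proof.
move=> ab; rewrite (bigD1 (a, b)) //= /edge eqxx mul1r big1 ?addr0 // => p /andP[_ /negPf ->].
by rewrite mul0r.
Qed.
Lemma cr_exp_sum a b c d (f : 'I_n * 'I_n -> int) : uniq [:: a; b; c; d] ->
  \sum_(p | p.1 != p.2) cr_exp (a, b, c, d) p * f p =
  f (a, c) + f (b, d) - f (a, d) - f (b, c).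
Proof.
rewrite /= !inE !negb_or => /and4P[/and3P[_ ac ad] /andP[bc bd] _ _].
rewrite -!sum_edge // -!sumrN -!big_split /=; apply: eq_bigr => p _.
by rewrite !(mulrDl, mulNr).
Qed.
Lemma pt_eq x y : (x < n)%N -> (y < n)%N -> (pt x == pt y) = (x == y).
Proof. by move=> xn yn; rewrite -val_eqE /= !ptE !modn_small. Qed.
Lemma uniq_pt a b c d : (a < n)%N -> (b < n)%N -> (c < n)%N -> (d < n)%N ->
  uniq [:: a; b; c; d] -> uniq [:: pt a; pt b; pt c; pt d].
Proof. by move=> an bn cn dn; rewrite /= !inE !pt_eq. Qed.
Lemma RR_mon a b c d : sorted4 a b c d -> RR a b c d = mon br (cr_exp (pt a, pt d, pt b, pt c)).
Proof.
rewrite /sorted4 => S; rewrite mon_cr //; last by apply: uniq_pt; rewrite /= ?inE; lia.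
by rewrite /RR -/(B _ _) -/(B _ _) -/(B _ _) -/(B d b) (B_anti c d) (B_anti b d) !mulrN invrN mulrNN.
Qed.
Lemma balanced_RR a b c d : sorted4 a b c d -> balanced (cr_exp (pt a, pt d, pt b, pt c)).
Proof. by rewrite /sorted4 => S; apply/balanced_cr/uniq_pt; rewrite /= ?inE; lia. Qed.
Lemma E_RR a b c d : sorted4 a b c d -> E (RR a b c d).
Proof. by move=> S; rewrite RR_mon //; apply/E_mon/balanced_RR. Qed.
Lemma dih_ring_E : dih_ring `<=` E.
Proof.
apply: gen_sub => [|c|_ [a [b [c [d [S ->]]]]]]; [by case: sE|exact: E_const|exact: E_RR].
Qed.
Lemma dih_ring_C : dih_ring `<=` C.
Proof.
apply: gen_sub => // _ [a [b [c [d [S ->]]]]].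
have U4 : uniq [:: pt a; pt d; pt b; pt c].
  by move: S; rewrite /sorted4 => S; apply: uniq_pt; rewrite /= ?inE; lia.
by rewrite RR_mon // mon_cr //; exact: C_cr.
Qed.
Lemma w_RR r a b c d : (0 < r < n0.+2)%N -> sorted4 a b c d ->
  w r (RR a b c d) = (((b <= r) && (r < c))%N)%:R.
Proof.
move=> rn S; rewrite RR_mon // w_mon //; last exact: balanced_RR.
move: S; rewrite /sorted4 => S.
rewrite cr_exp_sum ?uniq_pt //= ?inE; try lia.
by rewrite !ptE !modn_small; lia.
Qed.
Lemma w_ge0 r x : (0 < r < n0.+2)%N -> dih_ring x -> x = 0 \/ 0 <= w r x.
Proof.
move=> rn Ax; have sV := vring_ultra sE (w_div rn) (w_ultra rn).
suff /(_ x Ax)[//] : dih_ring `<=` vring E (w r).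
apply: gen_sub => // [c|_ [a [b [c [d [S ->]]]]]].
  split; first exact: E_const.
  by have [->|c0] := eqVneq (i0 c) 0; [left|right; rewrite (F_w rn) //; exact: F_const].
by split; [exact: E_RR|right; rewrite w_RR // ler0n].
Qed.

Lemma U_RR r : (0 < r < n0.+2)%N -> U r n.-1 = RR 0 r r.+1 n.-1.
Proof. by move=> rn; rewrite RR_ZY0 // /wsorted4; lia. Qed.
Lemma U_base_neq0 r : (0 < r < n0.+2)%N -> U r n.-1 != 0.
Proof. by move=> rn; apply: ZY_neq0; rewrite /wsorted4; lia. Qed.

(** Decomposition modulo the equation of the divisor: a part in [F r], where [w r] is trivial, plus
    a multiple of [U r n.-1]. It is stable under ring operations, so it only has to be found for
    generators. *)
Definition split_base r x := exists x0 y,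
  [/\ dih_ring x0, F r x0, dih_ring y & x = x0 + U r n.-1 * y].
Lemma split_base_subring r : (0 < r < n0.+2)%N -> is_subring (split_base r).
Proof.
move=> rn; have sA := dih_ring_subring; have [sF _] := F_field rn.
have AU : dih_ring (U r n.-1) by apply: dih_ring_ZY; rewrite /wsorted4; lia.
split.
- by exists 1, 0; rewrite mulr0 addr0; split; [exact: subring1|exact: subring1|exact: subring0|].
- move=> _ _ [x0 [y [Ax Fx Ay ->]]] [x1 [z [Ax1 Fx1 Az ->]]].
  exists (x0 - x1), (y - z); split; [exact: (subringB sA)|exact: (subringB sF)|exact: (subringB sA)|].
  by rewrite mulrBr opprD addrACA.
move=> _ _ [x0 [y [Ax Fx Ay ->]]] [x1 [z [Ax1 Fx1 Az ->]]].
exists (x0 * x1), (x0 * z + y * x1 + U r n.-1 * (y * z)); split.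
- exact: (subringM sA).
- exact: (subringM sF).
- apply: (subringD sA); last by apply: (subringM sA) => //; exact: (subringM sA).
  by apply: (subringD sA); exact: (subringM sA).
by ring.
Qed.
(** A generator with b <= r < c is a multiple of the equation. It lies in [F r] when all its indices
    are on one side of r, when 0 is its only index in the cluster, or when n-1 is its only index
    outside. The others are products of such elements by [RR_split0] and [RR_split_oo]. *)
Lemma split_base_RR r a b c d : (0 < r < n0.+2)%N -> sorted4 a b c d -> split_base r (RR a b c d).
Proof.
move=> rn S; have sA := dih_ring_subring; have sB := split_base_subring rn.
have fixed a' b' c' d' : sorted4 a' b' c' d' ->
    [|| d' <= r, r < a', (a' == 0) && (r < b') | (c' <= r) && (d' == n.-1)]%N ->
    split_base r (RR a' b' c' d').
  move=> S' H; exists (RR a' b' c' d'), 0; rewrite mulr0 addr0.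
  by split; [exact: dih_ring_RR|exact: F_RR|exact: subring0|].
have mid a' b' c' d' : sorted4 a' b' c' d' -> (b' <= r < c')%N -> split_base r (RR a' b' c' d').
  move=> S' H; have [y Ay ->] := RR_factor S' H; exists 0, y; rewrite add0r.
  by split=> //; [exact: subring0|by have [sF _] := F_field rn; exact: subring0].
have midZ a' b' c' d' : sorted4 a' b' c' d' -> (b' <= r < c')%N -> split_base r (ZY a' b' c' d').
  move=> S' H; rewrite -RR_ZY ?wsorted_sorted //.
  by apply: (subringB sB); [exact: subring1|exact: mid].
move: (S); rewrite /sorted4 => S'.
have [dr|rd] := leqP d r; first by apply: fixed; rewrite ?dr.
have [cr|rc] := leqP c r.
  have [dn|dn] := eqVneq d n.-1; first by apply: fixed => //; rewrite cr dn eqxx !orbT.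
  rewrite (RR_split_oo _ S); last by lia.
  by apply: (subringM sB); [apply: midZ|apply: fixed]; rewrite /sorted4; lia.
have [br'|rb] := leqP b r; first by apply: mid; rewrite ?br'.
have [ar|ra] := leqP a r; last by apply: fixed; rewrite ?ra ?orbT.
have [a0|a0] := posnP a; first by apply: fixed => //; rewrite a0 rb !orbT.
rewrite (RR_split0 a0 S).
by apply: (subringM sB); [apply: fixed|apply: midZ]; rewrite /sorted4; lia.
Qed.
(** The part of [x] in [F r] must be zero: otherwise its value is 0, whereas [x] and the other part
    have positive value. *)
Lemma w_reduce r x : (0 < r < n0.+2)%N -> dih_ring x -> x != 0 -> 0 < w r x ->
  dih_ring (x / U r n.-1).
Proof.
move=> rn Ax x0 wx; have sA := dih_ring_subring.
have : split_base r x.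
  move: x Ax {x0 wx}; apply: gen_sub; first exact: split_base_subring.
    move=> c; exists (i0 c), 0; rewrite mulr0 addr0.
    by split; [exact: gen_const|exact: F_const|exact: subring0|].
  by move=> _ [a [b [c [d [S ->]]]]]; apply: split_base_RR.
move=> [y0 [y [Ay0 Fy Ay xE]]]; have u0 := U_base_neq0 rn.
have AU : dih_ring (U r n.-1) by apply: dih_ring_ZY; rewrite /wsorted4; lia.
have [y00|y00] := eqVneq y0 0; first by rewrite xE y00 add0r mulrAC divff // mul1r.
have yE : x - U r n.-1 * y = y0 by rewrite xE addrK.
have: 1 <= w r y0; last by rewrite F_w.
rewrite -yE; apply: (w_ultra rn); rewrite ?yE //.
- exact: dih_ring_E.
- by apply: dih_ring_E; apply: (subringM sA).
- by right; lia.
have [->|yn] := eqVneq y 0; first by left; rewrite mulr0.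
right; rewrite (divvalM (w_div rn)) //; try exact: dih_ring_E.
rewrite U_RR // w_RR //; last by rewrite /sorted4; lia.
by have [/eqP|wy] := w_ge0 rn Ay; [rewrite (negPf yn)|rewrite leqnn ltnSn; lia].
Qed.

Lemma g_B s x y : g s (B x y) = br (s (pt x)) (s (pt y)). Proof. exact: g_br. Qed.
Lemma g1 x : g 1%g x = x.
Proof. by apply: (fmorph_inj (g 1%g)); rewrite -gM mulg1. Qed.
(** A shift by one keeps the indices in order, except that n-1 becomes n, the other name of 0; this
    is the case that [wsorted4] admits. *)
Lemma dih_ring_rotn t x : dih_ring x -> dih_ring (g (rotn t) x).
Proof.
have rot1 (s : 'S_n) y : (forall x, s (pt x) = pt x.+1) -> dih_ring y -> dih_ring (g s y).
  move=> sE1 Ay; move: y Ay; apply: (@gen_sub _ _ i0 _ (g s @^-1` dih_ring)).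
  - by apply: preim_subring; exact: dih_ring_subring.
  - by move=> c; rewrite /preimage /= g_const; exact: gen_const.
  move=> _ [a [b [c [d [S ->]]]]]; rewrite /preimage /= /RR fmorph_div !rmorphM !g_B !sE1.
  by apply: (dih_ring_RRw (a := a.+1)); move: S; rewrite /sorted4 /wsorted4; lia.
elim: t => [|t IH] Ax; first by rewrite /rotn expg0 g1.
rewrite /rotn expgSr gM; apply: rot1 (IH Ax) => y.
by have := rotn_pt 1 y; rewrite /rotn expg1 addn1.
Qed.

Definition chordT := {p : 'I_n * 'I_n | chord p.1 p.2}.
Implicit Types c : chordT.
Definition chord_u c : K := U (val c).1 (val c).2.
Definition chord_rank c : nat := ((val c).2 - (val c).1).-1.
(** The rotation bringing the points cut off by the chord to 0, ..., [chord_rank c]. *)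
Definition chord_rot c : 'S_n := rotn (n - (val c).1.+1).
Definition chord_val c : K -> int := w (chord_rank c) \o g (chord_rot c).
Definition inside c (x : 'I_n) := ((val c).1 < x <= (val c).2)%N.

Lemma chord_rankP c : (0 < chord_rank c < n0.+2)%N.
Proof. by case: c => -[i j] /= H; rewrite /chord_rank /=; move: H; rewrite /chord /=; lia. Qed.
Lemma chord_rot_in c x : (chord_rot c x <= chord_rank c)%N = inside c x.
Proof.
rewrite /chord_rot rotnE /inside /chord_rank; case: c => -[i j] /= H.
move: H; rewrite /chord /= => H; have xn := ltn_ord x; have jn := ltn_ord j.
have [xi|ix] := leqP x i; first by rewrite modn_small; lia.
by rewrite (_ : x + _ = x - i.+1 + n)%N ?modnDr ?modn_small; lia.
Qed.
Lemma chord_rotV c : (chord_rot c)^-1%g = rotn (val c).1.+1.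
Proof. by apply: rotnV; have := ltn_ord (val c).1; lia. Qed.

Lemma chord_val_div c : divval E (chord_val c).
Proof.
have [v0 vN vM] := w_div (chord_rankP c); rewrite /chord_val; split=> /=; first by rewrite rmorph0.
  by move=> x Ex; apply: vN => /(gE (chord_rot c)^-1%g); rewrite gK.
by move=> x y Ex Ey x0 y0; rewrite rmorphM vM ?fmorph_eq0 //; apply: gE.
Qed.
Lemma chord_val_mon c e : balanced e -> chord_val c (mon br e) =
  \sum_(p | p.1 != p.2) e p * (inside c p.1 && inside c p.2)%:R.
Proof.
move=> be; rewrite /chord_val /= (mon_perm (br' := br) (s := chord_rot c)); last exact: g_br.
rewrite w_mon ?chord_rankP //; last first.
  move=> i; rewrite -[RHS](be ((chord_rot c)^-1%g i)) /degree /=.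
  rewrite [RHS](reindex_inj (@perm_inj _ (chord_rot c)^-1%g)) /=.
  by apply: eq_bigl => j; rewrite (inj_eq perm_inj).
have hinj : injective (fun p : 'I_n * 'I_n => (chord_rot c p.1, chord_rot c p.2)).
  by move=> [x y] [x' y'] [/perm_inj-> /perm_inj->].
rewrite (reindex_inj hinj) /=; apply: eq_big => [[x y]|[x y] _] /=; first by rewrite (inj_eq perm_inj).
by rewrite !permK !chord_rot_in.
Qed.
Lemma chord_val_ge0 c x : dih_ring x -> x != 0 -> 0 <= chord_val c x.
Proof.
move=> Ax x0; have [/eqP|//] := w_ge0 (chord_rankP c) (dih_ring_rotn _ Ax : dih_ring (g (chord_rot c) x)).
by rewrite fmorph_eq0 (negPf x0).
Qed.
Lemma chord_uE c : g (chord_rot c)^-1%g (U (chord_rank c) n.-1) = chord_u c.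
Proof.
rewrite /chord_u /U /ZY fmorph_div !rmorphM !g_B chord_rotV !rotn_pt.
case: c => -[i j] /=; rewrite /chord_rank /chord /= => H.
have -> : pt (n.-1.+1 + i.+1) = pt i.+1 by rewrite addnC pt_add.
have -> : pt (n.-1 + i.+1) = pt i by rewrite (_ : (_ + _)%N = i + n)%N ?pt_add //; lia.
have -> : ((j - i).-1 + i.+1 = j)%N by lia.
have -> : ((j - i).-1.+1 + i.+1 = j.+1)%N by lia.
have jn := ltn_ord j; rewrite -!/(B _ _).
have nz : [/\ B i j != 0 & B i.+1 j.+1 != 0] by split; apply: B_neq0; lia.
case: nz => nz1 nz2; rewrite (B_anti i j) (B_anti i.+1 j.+1) (B_anti i j.+1) (B_anti i.+1 j).
by rewrite mulrNN (mulrNN (B i j)) (mulrC (B i.+1 j)).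
Qed.
Lemma chord_reduce c x : dih_ring x -> x != 0 -> 0 < chord_val c x -> dih_ring (x / chord_u c).
Proof.
move=> Ax x0 vx; rewrite -chord_uE -[x](gK (chord_rot c)) -fmorph_div chord_rotV.
apply: dih_ring_rotn; apply: w_reduce => //; [exact: chord_rankP|exact: dih_ring_rotn|].
by rewrite fmorph_eq0.
Qed.
Lemma chord_u_mon c : exists e, [/\ balanced e, chord_u c = mon br e &
  forall f : 'I_n * 'I_n -> int, \sum_(p | p.1 != p.2) e p * f p =
    let: (i, j) := val c in
    f (i, pt j.+1) + f (pt i.+1, j) - f (i, j) - f (pt i.+1, pt j.+1)].
Proof.
case: c => -[i j] H; rewrite /chord_u /=; move: H; rewrite /chord /= => H.
have jn := ltn_ord j.
have U4 : uniq [:: i; pt i.+1; pt j.+1; j].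
  rewrite -[i]pt_ord -[j]pt_ord !ptE !(modn_small (ltn_ord _)).
  by rewrite /= !inE !negb_or !(eq_sym (pt j.+1)) !pt_neq; lia.
exists (cr_exp (i, pt i.+1, pt j.+1, j)); split.
- exact: balanced_cr.
- by rewrite mon_cr // /U /ZY /B !pt_ord.
by move=> f; rewrite cr_exp_sum.
Qed.
(** With (i', j') the chord [c'], the order is minus the product of the jumps of the indicator
    function [inside c] from i' to i'+1 and from j' to j'+1. Such jumps occur only at the two ends
    of [c], with opposite signs. *)
Lemma chord_val_u c c' : chord_val c (chord_u c') = (c == c')%:R.
Proof.
have [e [be -> es]] := chord_u_mon c'; rewrite chord_val_mon // es.
case: c c' {e be es} => -[i j] H [[i' j'] H']; rewrite /inside -val_eqE /= xpair_eqE -!val_eqE /=.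
rewrite !ptE; move: H H'; rewrite /chord /= => H H'; have jn := ltn_ord j; have jn' := ltn_ord j'.
rewrite (modn_small (_ : i'.+1 < n)%N); last by lia.
have [jE|jE] := eqVneq j'.+1 n.
  rewrite jE modnn; case: (ltngtP i i') (ltngtP j j') => ? [] ? //=; lia.
rewrite (modn_small (_ : j'.+1 < n)%N); lia.
Qed.
Lemma chord_u_neq0 c : chord_u c != 0.
Proof. by apply: ZY_neq0; case: c => -[i j] /= /chord_wsorted. Qed.
Lemma chord_u_ring c : dih_ring (chord_u c).
Proof. by apply: dih_ring_ZY; case: c => -[i j] /= /chord_wsorted. Qed.
Lemma chord_u_inv c : C (chord_u c)^-1.
Proof.
case: c => -[i j] H; rewrite /chord_u /=; move: H; rewrite /chord /= => H.
have jn := ltn_ord j; rewrite /U /ZY invf_div /B !pt_ord; apply: C_cr.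
rewrite -[i]pt_ord -[j]pt_ord !ptE !(modn_small (ltn_ord _)).
by rewrite /= !inE !negb_or !pt_neq; lia.
Qed.
Definition dih_loc : set K :=
  [set x | exists f : chordT -> nat, dih_ring (x * \prod_c chord_u c ^+ f c)].
Lemma dih_loc_subring : is_subring dih_loc.
Proof.
have sA := dih_ring_subring.
have pA (f : chordT -> nat) : dih_ring (\prod_c chord_u c ^+ f c).
  by apply: (subring_prod sA) => c _; apply: (subringX sA); exact: chord_u_ring.
have pM (f h : chordT -> nat) : \prod_c chord_u c ^+ (f c + h c) =
    \prod_c chord_u c ^+ f c * \prod_c chord_u c ^+ h c.
  by rewrite -big_split; apply: eq_bigr => c _; rewrite exprD.
split.
- by exists (fun=> 0%N); rewrite mul1r.
- move=> x y [f fx] [h hy]; exists (fun c => f c + h c)%N; rewrite pM mulrBl.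
  apply: (subringB sA); first by rewrite mulrA; exact: (subringM sA).
  by rewrite [X in y * X]mulrC mulrA; exact: (subringM sA).
move=> x y [f fx] [h hy]; exists (fun c => f c + h c)%N; rewrite pM mulrACA.
exact: (subringM sA).
Qed.
Lemma C_dih_loc : C `<=` dih_loc.
Proof.
have sA := dih_ring_subring.
have AL : dih_ring `<=` dih_loc.
  by move=> x Ax; exists (fun=> 0%N); rewrite big1 ?mulr1.
have LU i j : chord i j -> dih_loc (U i j)^-1.
  move=> H; move: (H); rewrite /chord => H'.
  have Hi : (i < n)%N by lia.
  have Hj : (j < n)%N by lia.
  pose c0 : chordT := exist _ (Ordinal Hi, Ordinal Hj) H.
  exists (fun c => (c == c0) : nat); rewrite (bigD1 c0) //= eqxx big1 ?mulr1 => [|c /negPf->] //.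
  rewrite (_ : chord_u c0 = U i j) // expr1 mulVf; first exact: (subring1 sA).
  exact: (chord_u_neq0 c0).
apply: C_min; [exact: dih_loc_subring|by move=> c; apply: AL; exact: gen_const|].
move=> a b c d; have := @CR_mem _ dih_loc_subring AL LU a b c d.
by rewrite /CR /B !pt_ord; apply.
Qed.

(** Nagata's lemma, the elements to invert being the coordinates of the chords. *)
Theorem dih_charts : [/\ factorial E dih_ring (V `|` range chord_val),
  (forall c x, dih_ring x -> x != 0 -> 0 < chord_val c x -> dih_ring (x / chord_u c))
  & C `<=` dih_loc].
Proof.
split; [|exact: chord_reduce|exact: C_dih_loc].
apply: (factorial_nagata (u := chord_u) fac dih_ring_subring dih_ring_C).
- exact: chord_val_div.
- by move=> c; split; [exact: chord_u_ring|exact: chord_u_inv].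
- exact: chord_val_u.
- by move=> c x; exact: chord_val_ge0.
- exact: chord_reduce.
exact: C_dih_loc.
Qed.
End Charts.
End Dihedral.

Lemma pluecker (R : fieldType) (x y z t : R) :
  (x - y) * (z - t) - (x - z) * (y - t) + (x - t) * (y - z) = 0.
Proof. by ring. Qed.

Lemma image_subfield (E E' : fieldType) (f : {rmorphism E -> E'}) (F : set E) :
  is_subfield F -> is_subfield (f @` F).
Proof.
move=> [[F1 FB FM] FV]; split; first split.
- by exists 1; rewrite ?rmorph1.
- by move=> _ _ [x Fx <-] [y Fy <-]; exists (x - y); rewrite ?rmorphB //; exact: FB.
- by move=> _ _ [x Fx <-] [y Fy <-]; exists (x * y); rewrite ?rmorphM //; exact: FM.
by move=> _ [x Fx <-]; exists x^-1; rewrite ?fmorphV //; exact: FV.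
Qed.

(** * The dihedral charts of the compactification *)

Section Instance.
Variables (k : fieldType) (m0 : nat).
Local Notation m := m0.+1.
Local Notation n := m0.+4.
Local Notation T := (ratfun k m).
Local Notation K := (ratfun k n).
Local Notation pt0 := (inord 0 : 'I_n).
Local Notation pt1 := (inord m.+1 : 'I_n).
Local Notation ptoo := (inord m.+2 : 'I_n).
Local Notation brT := (@brT k m0).
Local Notation brK := (@brK k m0).
Local Notation iota := (@iota k m0).
Local Notation ffield := (@ffield k m0).
Local Notation cr_ring := (@cr_ring k m0).
Local Notation open_vals := (@open_vals k m0).
Local Notation constK := (@ratC k n : {rmorphism k -> K}).

Definition pv (s : 'S_n) : {rmorphism K -> K} := perm_vars s.
Lemma pv_br s i j : pv s (brK i j) = brK (s i) (s j).
Proof. by rewrite /brK rmorphB /= !perm_varsX. Qed.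
Lemma pvC s c : pv s (ratC n c) = ratC n c. Proof. exact: perm_varsC. Qed.
Lemma pvM s t x : pv (s * t)%g x = pv t (pv s x).
Proof.
apply: (rat_morph_ext (f := pv (s * t)%g) (g := pv t \o pv s)) => [c|l] /=; rewrite ?pvC //.
by rewrite /pv /= !perm_varsX permM.
Qed.
Lemma pvVK s : cancel (pv s) (pv s^-1%g). Proof. exact: perm_varsVK. Qed.
Lemma pvKV s : cancel (pv s^-1%g) (pv s). Proof. exact: perm_varsKV. Qed.

Lemma brK_pluecker a b c d : brK a b * brK c d - brK a c * brK b d + brK a d * brK b c = 0.
Proof.
by rewrite /brK; exact: pluecker. Qed.
Lemma cr_ring_br a b c d : uniq [:: a; b; c; d] ->
  cr_ring ((brK a c * brK b d) / (brK a d * brK b c)).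
Proof. by move=> U4; rewrite -cross_ratioE; exact: cr_ring_cr. Qed.
Lemma cr_ring_min L : is_subring L -> (forall c, L (constK c)) ->
  (forall a b c d, uniq [:: a; b; c; d] -> L ((brK a c * brK b d) / (brK a d * brK b c))) ->
  cr_ring `<=` L.
Proof.
move=> sL Lc Lcr; apply: gen_sub => // _ [[[[a b] c] d] U4 <-].
by rewrite cross_ratioE; exact: Lcr.
Qed.
Lemma ffield_min (L : set K) : is_subfield L -> (forall c, L (constK c)) ->
  (forall a b c d, uniq [:: a; b; c; d] -> L ((brK a c * brK b d) / (brK a d * brK b c))) ->
  ffield `<=` L.
Proof.
move=> sL Lc Lcr _ [t _ <-].
have CL : cr_ring `<=` L by apply: cr_ring_min => //; case: sL.
have Lp (p : {mpoly k[m]}) : L (iota (FracField.tofrac p)).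
  rewrite frac_liftE /iota_poly; apply: subring_mmap; [by case: sL|exact: Lc|].
  by move=> l; apply: CL; apply: cr_ring_zeta; rewrite -val_eqE /= ptooE inordK; have := ltn_ord l; lia.
have [a [b [b0 ->]]] := fracE t; rewrite fmorph_div.
by apply: (subfieldM sL) => //; exact: (subfieldV sL).
Qed.
Lemma pv_ffield s x : ffield x -> ffield (pv s x).
Proof.
move: x; have [sr sv] := ffield_subfield k m0; apply: (@ffield_min (pv s @^-1` ffield)).
- split; first exact: preim_subring.
  by move=> x; rewrite /preimage /= fmorphV; exact: sv.
- by move=> c; rewrite /preimage /= pvC; exact: ffield_const.
move=> a b c d U4; rewrite /preimage /= fmorph_div !rmorphM !pv_br -mon_cr.
- by apply/ffield_mon/balanced_cr; rewrite (map_inj_uniq (@perm_inj _ s) [:: a; b; c; d]).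
- exact: brK_neq0.
by rewrite (map_inj_uniq (@perm_inj _ s) [:: a; b; c; d]).
Qed.
Lemma pv_cr_ring s x : cr_ring x -> cr_ring (pv s x).
Proof.
move: x; apply: (@cr_ring_min (pv s @^-1` cr_ring)).
- by apply: preim_subring; exact: gen_subring.
- by move=> c; rewrite /preimage /= pvC; exact: gen_const.
move=> a b c d U4; rewrite /preimage /= fmorph_div !rmorphM !pv_br.
by apply: cr_ring_br; rewrite (map_inj_uniq (@perm_inj _ s) [:: a; b; c; d]).
Qed.
(** Permutations preserve the ring of cross-ratios, and a Krull ring determines its valuations. *)
Lemma open_vals_pv s : [set v \o pv s | v in open_vals] = open_vals.
Proof.
have H := factorial_transport (@pvKV s) (@pvVK s) (@pv_ffield s^-1%g) (@pv_ffield s)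
  (open_factorial k m0).
apply: (factorial_unique _ (open_factorial k m0)); move: H; congr factorial.
apply/seteqP; split=> x; rewrite /preimage /=; last exact: pv_cr_ring.
by move=> /(@pv_cr_ring s^-1%g); rewrite pvVK.
Qed.
Lemma open_vals_stable s v : open_vals v -> open_vals (v \o pv s).
Proof. by move=> Vv; rewrite -(open_vals_pv s); exists v. Qed.

(** The condition on r is placed under the existential, with a dummy pair out of range, so that
    [contr_w] and [contr_F] are functions of every r. *)
Lemma contraction_K r : exists wF : (K -> int) * set K, (0 < r < m0.+2)%N ->
  [/\ divval ffield wF.1, ultrametric ffield wF.1, is_subfield wF.2
    & forall x, wF.2 x -> x != 0 -> wF.1 x = 0] /\
  [/\ forall e, balanced e -> wF.1 (mon brK e) =
        \sum_(p | p.1 != p.2) e p * ((p.1 <= r) && (p.2 <= r))%N%:R,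
      forall c, wF.2 (constK c)
    & forall a b c d, sorted4 m0 a b c d ->
      [|| d <= r, r < a, (a == 0) && (r < b) | (c <= r) && (d == n.-1)]%N ->
      wF.2 (RR brK a b c d)].
Proof.
have [rn|] := boolP (0 < r < m0.+2)%N; last by exists (fun=> 0, setT).
have [|w [F [[wd wu sF Fw] [Fc wbr Fbr Fle Foo]]]] := @contraction_val k m0 r; first by lia.
have sT : is_subfield (setT : set T) by [].
exists (push_val iota w, iota @` F) => _; split; split; cbn [fst snd].
- exact: push_divval.
- move=> _ _ N [x _ <-] [y _ <-] xy0 Hx Hy; rewrite -rmorphB push_valE; apply: wu => //.
  + by apply: contraNneq xy0 => xy; rewrite -rmorphB xy rmorph0.
  + by case: Hx => [/eqP|]; [rewrite fmorph_eq0 => /eqP; left|rewrite push_valE; right].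
  + by case: Hy => [/eqP|]; [rewrite fmorph_eq0 => /eqP; left|rewrite push_valE; right].
- exact: (image_subfield iota sF).
- by move=> _ [x Fx <-]; rewrite fmorph_eq0 push_valE; exact: Fw.
- move=> e be; rewrite -iota_mon // push_valE (mon_val (@brT_neq0 k m0) _ sT wd) //.
  by apply: eq_bigr => p pne; rewrite wbr.
- by move=> c; exists (ratC m c); rewrite ?iotaC.
move=> a b c d S H; rewrite RR_mon //; try solve [exact: brK_anti|exact: brK_neq0].
rewrite -iota_mon; last exact: balanced_RR.
rewrite -RR_mon //; try solve [exact: brT_anti|exact: brT_neq0].
move: S; rewrite /sorted4 => S.
have pE x : (x < n)%N -> pt m0 x = x :> nat by move=> xn; rewrite ptE modn_small.
apply: imageP; rewrite /RR /B; case/or4P: H => H.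
- rewrite -mulf_div; apply: (subfieldM sF); apply: Fle; rewrite ?pE ?pt_eq; lia.
- have FF x y : (r < x < n)%N -> (r < y < n)%N -> F (brT (pt m0 x) (pt m0 y)).
    by move=> rx ry; apply: Fbr; rewrite pE; lia.
  by do ?[apply: (subfieldM sF)|apply: (subfieldV sF)|apply: FF]; lia.
- have FF x y : (x == 0)%N || (r < x)%N -> (y == 0)%N || (r < y)%N -> (x < n)%N -> (y < n)%N ->
      F (brT (pt m0 x) (pt m0 y)).
    move=> rx ry xn yn; apply: Fbr; rewrite pE //; case/orP: rx ry => rx /orP[] ry;
      by rewrite ?rx ?ry ?orbT // -val_eqE /= ?pt0E ?pE ?(eqP rx) ?(eqP ry) ?eqxx.
  by do ?[apply: (subfieldM sF)|apply: (subfieldV sF)|apply: FF]; lia.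
have /andP[cr /eqP dE] := H.
have -> : pt m0 d = ptoo by apply/val_inj; rewrite /= pE ?ptooE; lia.
rewrite -mulf_div; apply: (subfieldM sF); first by apply: Fle; rewrite ?pE ?pt_eq; lia.
by apply: (subfieldM sF); [|apply: (subfieldV sF)]; exact: Foo.
Qed.
Definition contr_w r : K -> int := (sval (cid (contraction_K r))).1.
Definition contr_F r : set K := (sval (cid (contraction_K r))).2.
Lemma contrP r : (0 < r < m0.+2)%N ->
  [/\ divval ffield (contr_w r), ultrametric ffield (contr_w r), is_subfield (contr_F r)
    & forall x, contr_F r x -> x != 0 -> contr_w r x = 0] /\
  [/\ forall e, balanced e -> contr_w r (mon brK e) =
        \sum_(p | p.1 != p.2) e p * ((p.1 <= r) && (p.2 <= r))%N%:R,
      forall c, contr_F r (constK c)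
    & forall a b c d, sorted4 m0 a b c d ->
      [|| d <= r, r < a, (a == 0) && (r < b) | (c <= r) && (d == n.-1)]%N ->
      contr_F r (RR brK a b c d)].
Proof. exact: (svalP (cid (contraction_K r))). Qed.

Local Notation base := (dih_ring constK brK).
(** The chart of the cyclic ordering s 0, s 1, ..., s (n-1). *)
Definition chart (s : 'S_n) : set K := pv s^-1%g @^-1` base.
Definition cval (s : 'S_n) (c : chordT m0) : K -> int :=
  chord_val pv contr_w c \o pv s^-1%g.
Definition cu (s : 'S_n) (c : chordT m0) : K := pv s (chord_u brK c).

Let w_mon r e : (0 < r < m0.+2)%N -> balanced e -> contr_w r (mon brK e) =
  \sum_(p | p.1 != p.2) e p * ((p.1 <= r) && (p.2 <= r))%N%:R.
Proof. by move=> /contrP[_ [H _ _]]; exact: H. Qed.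

Lemma base_charts : [/\ factorial ffield base (open_vals `|` range (chord_val pv contr_w)),
  (forall c x, base x -> x != 0 -> 0 < chord_val pv contr_w c x -> base (x / chord_u brK c))
  & cr_ring `<=` dih_loc constK brK].
Proof.
refine (@dih_charts k K constK m0 brK (@brK_anti k m0) (@brK_neq0 k m0) brK_pluecker
  ffield cr_ring open_vals pv (ffield_subfield k m0) (@ffield_mon k m0) (@ffield_const k m0)
  pv_br pvC pvM pvVK pv_ffield (open_factorial k m0) (@gen_subring k K (@ratC k n) _) (@gen_const k K (@ratC k n) _)
  cr_ring_br cr_ring_min contr_w contr_F _ _ _ _ _ _ _).
- by move=> r /contrP[[]].
- by move=> r /contrP[[]].
- exact: w_mon.
- by move=> r /contrP[[]].
- by move=> r x /contrP[[_ _ _ H] _]; exact: H.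
- by move=> r c /contrP[_ [_ H _]]; exact: H.
by move=> r a b c d /contrP[_ [_ _ H]]; exact: H.
Qed.
Lemma chart_subring s : is_subring (chart s).
Proof. by apply: preim_subring; exact: dih_ring_subring. Qed.
Lemma chart_const s c : chart s (constK c).
Proof. by rewrite /chart /preimage /= pvC; exact: gen_const. Qed.
Lemma chart_factorial s : factorial ffield (chart s) (open_vals `|` range (cval s)).
Proof.
have := factorial_transport (@pvVK s) (@pvKV s) (@pv_ffield s) (@pv_ffield s^-1%g)
  (let: And3 H _ _ := base_charts in H).
congr factorial; rewrite image_setU open_vals_pv; congr (_ `|` _).
by apply/seteqP; split=> [_ [_ [c _ <-] <-]|_ [c _ <-]]; [exists c|exists (chord_val pv contr_w c)].
Qed.
Lemma balanced_perm (s : 'S_n) e : balanced e -> balanced (fun p => e (s p.1, s p.2)).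
Proof.
move=> be i; rewrite -(be (s i)) /degree /= [RHS](reindex_inj (@perm_inj _ s)) /=.
by apply: eq_bigl => j; rewrite (inj_eq perm_inj).
Qed.
Lemma pv_mon s e : pv s (mon brK e) = mon brK (fun p => e (s^-1%g p.1, s^-1%g p.2)).
Proof. by apply: mon_perm; exact: pv_br. Qed.
Lemma cval_mon s c e : balanced e -> cval s c (mon brK e) =
  \sum_(p | p.1 != p.2) e p * (inside c (s^-1%g p.1) && inside c (s^-1%g p.2))%:R.
Proof.
move=> be; rewrite /cval /= pv_mon invgK (chord_val_mon pv_br w_mon); last exact: balanced_perm.
have hinj : injective (fun p : 'I_n * 'I_n => (s^-1%g p.1, s^-1%g p.2)).
  by move=> [x y] [x' y'] [/perm_inj-> /perm_inj->].
rewrite [LHS](reindex_inj hinj) /=; apply: eq_big => [[x y]|[x y] _] /=.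
  by rewrite (inj_eq perm_inj).
by rewrite !permKV.
Qed.
Lemma cval_u s c c' : cval s c (cu s c') = (c == c')%:R.
Proof. by rewrite /cval /cu /= pvVK (chord_val_u (@brK_neq0 k m0) pv_br w_mon). Qed.
Lemma cu_mon s c : exists2 e, balanced e & cu s c = mon brK e.
Proof.
have [e [be E _]] := chord_u_mon (@brK_neq0 k m0) c; rewrite /cu E pv_mon.
by exists (fun p => e (s^-1%g p.1, s^-1%g p.2)); first exact: balanced_perm.
Qed.
Lemma cval_reduce s c x : chart s x -> x != 0 -> 0 < cval s c x -> chart s (x / cu s c).
Proof.
rewrite /chart /preimage /= fmorph_div /cu pvVK => Ax x0 vx.
have [_ H _] := base_charts; apply: H; [exact: Ax| |exact: vx].
by rewrite fmorph_eq0.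
Qed.
Lemma cu_neq0 s c : cu s c != 0.
Proof. by rewrite fmorph_eq0; apply: chord_u_neq0; exact: brK_neq0. Qed.
Lemma chart_cu s c : chart s (cu s c).
Proof.
rewrite /chart /preimage /= /cu pvVK.
exact: (@chord_u_ring k K constK m0 brK (@brK_anti k m0) (@brK_neq0 k m0) brK_pluecker c).
Qed.
Lemma cr_ring_cuV s c : cr_ring (cu s c)^-1.
Proof. by rewrite -fmorphV; apply: pv_cr_ring; apply: chord_u_inv; exact: cr_ring_br. Qed.
Lemma cr_ring_loc s x : cr_ring x ->
  exists f : chordT m0 -> nat, chart s (x * \prod_c cu s c ^+ f c).
Proof.
move=> /(@pv_cr_ring s^-1%g) Cx; have [_ _ /(_ _ Cx)[f Hf]] := base_charts.
exists f; rewrite /chart /preimage /= rmorphM rmorph_prod.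
by under [X in _ * X]eq_bigr do rewrite rmorphXn /cu /= pvVK.
Qed.
End Instance.

(** * Local rings of the compactification *)

Section LocalRings.
Variable K : fieldType.
Implicit Types (A B O L : set K) (x y : K).
Definition runit O x := [/\ x != 0, O x & O x^-1].
Definition local_ring O := is_subring O /\ forall x, O x -> runit O x \/ runit O (1 - x).
Definition maxid O := [set x | O x /\ ~ runit O x].

Lemma runitV O x : runit O x -> runit O x^-1.
Proof. by case=> x0 Ox Oxv; split; rewrite ?invr_eq0 ?invrK. Qed.
Lemma runitN O x : is_subring O -> runit O (- x) -> runit O x.
Proof.
move=> sO [x0 Ox Oxv]; rewrite -[x]opprK; split; rewrite ?opprK; first by rewrite oppr_eq0 in x0.
  by rewrite -[x]opprK; exact: (subringN sO).
by rewrite -[x^-1]opprK -invrN; exact: (subringN sO).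
Qed.
Lemma runitM O x y : is_subring O -> runit O x -> runit O y -> runit O (x * y).
Proof.
move=> sO [x0 Ox Oxv] [y0 Oy Oyv]; split; [exact: mulf_neq0|exact: (subringM sO)|].
by rewrite invfM; exact: (subringM sO).
Qed.
Lemma runit_factor O x y : is_subring O -> O x -> O y -> runit O (x * y) -> runit O x.
Proof.
move=> sO Ox Oy [xy0 _ Oxyv]; move: xy0; rewrite mulf_eq0 negb_or => /andP[x0 y0]; split=> //.
have -> : x^-1 = y * (x * y)^-1 by rewrite invfM mulrCA divff ?mulr1.
exact: (subringM sO).
Qed.
Lemma maxid_mul O x y : is_subring O -> O x -> maxid O y -> maxid O (x * y).
Proof.
move=> sO Ox [Oy Ny]; split; first exact: (subringM sO).
by rewrite mulrC => /(runit_factor sO Oy Ox).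
Qed.
Lemma maxid_prime O B : local_ring O -> is_subring B -> B `<=` O ->
  prime_ideal B (B `&` maxid O).
Proof.
move=> [sO lO] sB BO; split.
- by move=> x [].
- split; last by move=> [_ [_]]; apply; split; rewrite ?oner_neq0 ?invr1 //; exact: (subring1 sO).
  split; first exact: (subring0 sB).
  by split; [exact: (subring0 sO)|case; rewrite eqxx].
- move=> x y [Bx [Ox Nx]] [By [Oy Ny]]; split; first exact: (subringB sB).
  split=> [|[u0 Ou Ouv]]; first exact: (subringB sO).
  have := lO (x / (x - y)) (subringM sO Ox Ouv).
  have -> : 1 - x / (x - y) = (- y) / (x - y).
    by rewrite -[1](divff u0) -mulrBl addrAC subrr sub0r.
  case=> [/(runit_factor sO Ox Ouv)//|].
  move/(runit_factor sO (subringN sO Oy) Ouv) => [y0 _ yv]; apply: Ny; split=> //.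
    by rewrite oppr_eq0 in y0.
  by rewrite -[y^-1]opprK -invrN; exact: (subringN sO).
- by move=> a x Ba [Bx mx]; split; [exact: (subringM sB)|apply: maxid_mul => //; exact: BO].
move=> x y Bx By [_ [_ Nxy]]; have [ux|] := pselect (runit O x).
  right; split=> //; split=> [|uy]; first exact: BO.
  by apply: Nxy; exact: runitM.
by left; split=> //; split=> //; exact: BO.
Qed.
Lemma Aff_local A O : is_subring A -> Aff A O ->
  [/\ local_ring O, A `<=` O & O = localization A (A `&` maxid O)].
Proof.
move=> sA [P pP <-]; have sO := is_subring_localization sA pP.
have [PA [P0 P1] PB PM Pp] := pP.
have AO : A `<=` localization A P.
  by move=> a Aa; exists a, 1; split=> //; [exact: (subring1 sA)|rewrite divr1].
have nz x : ~ P x -> x != 0 by move=> Px; apply/eqP => x0; apply: Px; rewrite x0.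
have uA a : A a -> ~ P a -> runit (localization A P) a.
  move=> Aa Pa; split; [exact: nz|exact: AO|].
  by exists 1, a; split=> //; [exact: (subring1 sA)|rewrite div1r].
have uF a b : A a -> A b -> ~ P a -> ~ P b -> runit (localization A P) (a / b).
  by move=> Aa Ab Pa Pb; apply: runitM => //; [exact: uA|apply: runitV; exact: uA].
split=> //.
  split=> // _ [a [b [Aa Ab Pb ->]]].
  have [Pa|Pa] := pselect (P a); last by left; exact: uF.
  right; rewrite -[1](divff (nz _ Pb)) -mulrBl; apply: uF => //; first exact: (subringB sA).
  have PNa : P (- a) by rewrite -sub0r; exact: (PB _ _ P0 Pa).
  by move=> Pba; apply: Pb; have := PB _ _ Pba PNa; rewrite opprK subrK.
congr localization; apply/seteqP; split=> a.
  move=> Pa; have Aa := PA _ Pa; split=> //; split; first exact: AO.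
  move=> [a0 _ [c [d [Ac Ad Pd E]]]]; have d0 := nz _ Pd; apply: Pd.
  suff -> : d = c * a by exact: PM.
  by rewrite -[c](divfK d0) -E mulrAC mulVf // mul1r.
by move=> [Aa [_ Na]]; apply: contra_notP Na => Pa; exact: uA.
Qed.
(** The rings need to be compared on one side only: once [A] lies in the localization of [B], so
    does [O], because an element of [A] invertible in [O] is a quotient of elements of [B]
    invertible in [O]. *)
Lemma local_eq A O B : local_ring O -> O = localization A (A `&` maxid O) -> A `<=` O ->
  is_subring B -> B `<=` O -> A `<=` localization B (B `&` maxid O) -> Aff B O.
Proof.
move=> lO OA AO sB BO AB; exists (B `&` maxid O); first exact: maxid_prime.
have sO : is_subring O by case: lO.
have uB b : B b -> ~ (B `&` maxid O) b -> runit O b.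
  by move=> Bb Nb; apply: contra_notP Nb => Nb; split=> //; split=> //; exact: BO.
apply/seteqP; split=> [_ [a [b [Ba Bb Nb ->]]]|x].
  by have [_ _ Ob] := uB b Bb Nb; apply: (subringM sO) => //; exact: BO.
rewrite {1}OA => -[a [b [/AB[a1 [a2 [Ba1 Ba2 Na2 ->]]] Ab Nb ->]]].
have ub : runit O b.
  by apply: contra_notP Nb => Nb; split=> //; split=> //; exact: AO.
have [b1 [b2 [Bb1 Bb2 Nb2 bE]]] := AB _ Ab.
have ua2 := uB _ Ba2 Na2; have ub2 := uB _ Bb2 Nb2.
have ub1 : runit O b1.
  have -> : b1 = b * b2 by rewrite bE divfK //; case: ub2.
  exact: runitM.
exists (a1 * b2), (a2 * b1); split; try exact: (subringM sB).
  by move=> [_ [_]]; apply; exact: runitM.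
by rewrite bE invf_div mulf_div.
Qed.
(** One of [x] and [1 - x] is a unit of the local ring, which decides for each value whether it or
    its inverse is regular. When the value is regular its denominator is a unit of [O], so the value
    is already in [L]. *)
Lemma six_local O L x y : local_ring O -> is_subring L -> L x ->
  (forall z, L z -> runit O z -> L z^-1) -> O x -> x != 0 -> 1 - x != 0 -> y \in six x ->
  (O y \/ O y^-1) /\ (O y -> L y).
Proof.
move=> [sO lO] sL Lx LV Ox x0 x1 H.
have O1x : O (1 - x) by apply: (subringB sO) => //; exact: (subring1 sO).
have L1x : L (1 - x) by apply: (subringB sL) => //; exact: (subring1 sL).
have uV z : O z -> z != 0 -> O z^-1 -> runit O z by [].
move: H; rewrite /six !inE; do 5?[case/orP]; move/eqP->.
- by split; [left|].
- by rewrite invrK; split; [right|move=> Oxv; apply: LV].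
- by split; [left|].
- by rewrite invrK; split; [right|move=> Oxv; apply: LV].
- have E : 1 - - (x / (1 - x)) = (1 - x)^-1 by rewrite opprK -{1}(divff x1) -mulrDl subrK div1r.
  split; last first.
    move=> Oy; apply: (subringN sL); apply: (subringM sL) => //; apply: LV => //; apply: uV => //.
    by rewrite -E; apply: (subringB sO) => //; exact: (subring1 sO).
  case: (lO x Ox) => -[_ _ uv].
    by right; rewrite invrN invf_div; apply: (subringN sO); exact: (subringM sO).
  by left; apply: (subringN sO); exact: (subringM sO).
have E : 1 - - ((1 - x) / x) = x^-1 by rewrite opprK -{1}(divff x0) -mulrDl addrC subrK div1r.
split; last first.
  move=> Oy; apply: (subringN sL); apply: (subringM sL) => //; apply: LV => //; apply: uV => //.
  by rewrite -E; apply: (subringB sO) => //; exact: (subring1 sO).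
case: (lO x Ox) => -[_ _ uv].
  by left; apply: (subringN sO); exact: (subringM sO).
by right; rewrite invrN invf_div; apply: (subringN sO); exact: (subringM sO).
Qed.

Lemma localization_sub O A x : is_subring A -> A x -> localization A (A `&` maxid O) x.
Proof.
move=> sA Ax; exists x, 1; split=> //; [exact: (subring1 sA)| |by rewrite divr1].
move=> [_ [O1]]; apply; split; rewrite ?oner_neq0 ?invr1 //.
Qed.
Lemma localizationV O A z : local_ring O -> is_subring A -> A `<=` O ->
  localization A (A `&` maxid O) z -> runit O z -> localization A (A `&` maxid O) z^-1.
Proof.
move=> [sO lO] sA AO [a [b [Aa Ab Nb zE]]] uz.
have ub : runit O b by apply: contra_notP Nb => Nb; split=> //; split=> //; exact: AO.
exists b, a; split=> //; last by rewrite zE invf_div.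
have -> : a = z * b by rewrite zE divfK //; case: ub.
by move=> [_ [_]]; apply; exact: runitM.
Qed.
End LocalRings.

Lemma six_map (E E' : fieldType) (f : {rmorphism E -> E'}) x : map f (six x) = six (f x).
Proof. by rewrite /six /= !(rmorphN, fmorph_div, fmorphV, rmorphB, rmorph1). Qed.

(** * Planar orderings of the leaves of a rooted tree *)

Section TreeOrder.
Variable I : eqType.
Implicit Types (l : seq I) (x y : I).
Fixpoint before l x y :=
  if l is z :: l' then (x == z) && (y \in l') || before l' x y else false.
Lemma before_mem l x y : before l x y -> x \in l /\ y \in l.
Proof.
elim: l => //= z l IH /orP[/andP[/eqP-> yl]|/IH[xl yl]].
  by rewrite !inE eqxx yl orbT.
by rewrite !inE xl yl !orbT.
Qed.
Lemma before_cat l1 l2 x y : before (l1 ++ l2) x y =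
  [|| before l1 x y, before l2 x y | (x \in l1) && (y \in l2)].
Proof.
elim: l1 => [|z l1 IH] /=; first by rewrite orbF.
rewrite IH mem_cat inE.
by case: (x == z); case: (y \in l1); case: (y \in l2); case: (x \in l1);
  case: (before l1 x y); case: (before l2 x y).
Qed.
Lemma before_nth x0 l i j : (i < j)%N -> (j < size l)%N -> before l (nth x0 l i) (nth x0 l j).
Proof.
elim: l i j => [|z l IH] [|i] [|j] //= ij jl; last by rewrite IH ?orbT.
by rewrite eqxx mem_nth.
Qed.
Lemma before_anti l x y : uniq l -> before l x y -> before l y x -> False.
Proof.
elim: l => //= z l IH /andP[zl Ul].
move=> /orP[/andP[/eqP-> yl]|xy] /orP[/andP[/eqP yz xl]|yx]; last exact: IH xy yx.
- by rewrite xl in zl.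
- by have [_ zl'] := before_mem yx; rewrite zl' in zl.
by have [_] := before_mem xy; rewrite yz (negPf zl).
Qed.
Lemma last_split (P : I -> Prop) l : (exists2 x, x \in l & P x) ->
  exists l1 c l2, [/\ l = rcons l1 c ++ l2, P c & forall x, x \in l2 -> ~ P x].
Proof.
elim/last_ind: l => [[] //|l z IH [x]]; rewrite mem_rcons inE => xl Px.
have [Pz|Nz] := pselect (P z); first by exists l, z, [::]; rewrite cats0.
have [|l1 [c [l2 [-> Pc Nl2]]]] := IH.
  by exists x => //; case/orP: xl => // /eqP xz; rewrite -xz in Nz.
exists l1, c, (rcons l2 z); split=> //; first by rewrite rcons_cat.
by move=> y; rewrite mem_rcons inE => /orP[/eqP->//|/Nl2].
Qed.

(* [T a b c] reads [ab|c]: in a rooted tree, [a] and [b] meet before either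
   meets [c]. *)
Variables (T : I -> I -> I -> Prop) (D : pred I).
Hypothesis T_uniq : forall a b c, T a b c -> uniq [:: a; b; c].
Hypothesis T_sym : forall a b c, T a b c -> T b a c.
Hypothesis T_excl : forall a b c, T a b c -> T a c b -> False.
Hypothesis T_trans : forall a b c e, D e -> T a b c -> e \notin [:: a; b; c] -> T a b e \/ T a e c.
(** In a planar ordering no leaf stands between two leaves that meet before meeting it. *)
Definition tree_sorted l := forall a b c, before l a b -> before l b c -> ~ T a c b.

(** The candidate is replaced by another leaf exactly when the latter meets [e] first; [T_trans] and
    [T_excl] show that nothing passed over is closer. *)
Lemma closest e l : l != [::] -> {subset l <= D} ->
  exists2 c, c \in l & forall b, b \in l -> ~ T e b c.
Proof.
elim: l => // z [|y l] IH _ lD.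
  exists z; first by rewrite inE.
  by move=> b; rewrite inE => /eqP-> /T_uniq; rewrite /= !inE eqxx andbF.
have [||c cl Hc] := IH; [by []|by move=> x xl; apply: lD; rewrite inE xl orbT|].
have [zc|zc] := pselect (T e z c).
  exists z; first by rewrite inE eqxx.
  move=> b; rewrite inE => /orP[/eqP->|bl] Hb.
    by have := T_uniq Hb; rewrite /= !inE eqxx andbF.
  have [bc|bc] := eqVneq b c; first by rewrite bc in Hb; exact: (T_excl Hb zc).
  have U1 := T_uniq Hb; have U2 := T_uniq zc.
  have [||H|H] := T_trans (e := c) _ Hb.
  - by apply: lD; rewrite inE cl orbT.
  - move: U1 U2; rewrite /= !inE !negb_or => /and3P[/andP[eb ez] bz _] /and3P[/andP[_ ec] zc' _].
    by rewrite (eq_sym c e) ec (eq_sym c b) bc (eq_sym c z) zc'.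
  - exact: Hc H.
  exact: T_excl zc H.
exists c; first by rewrite inE cl orbT.
by move=> b; rewrite inE => /orP[/eqP->|/Hc].
Qed.

(** The new leaf goes just after the last of the leaves closest to it, [c]. Every later z then
    satisfies [T e c z], and nothing is closer to [e] than [c]; so a bad triple through [e] yields a
    bad triple through [c], already in [l], or a direct contradiction. *)
Lemma tree_insert e l : uniq (e :: l) -> {subset e :: l <= D} -> tree_sorted l ->
  exists2 l', perm_eq l' (e :: l) & tree_sorted l'.
Proof.
move=> U sD gl; have [l0|l0] := eqVneq l [::].
  by exists [:: e]; [rewrite l0|move=> a b c; rewrite /= andbF].
have [|c0 c0l c0P] := closest e l0; first by move=> x xl; apply: sD; rewrite inE xl orbT.
have [l1 [c [l2 [lE cP l2P]]]] := last_split (P := fun c => forall b, b \in l -> ~ T e b c)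
  (ex_intro2 _ _ c0 c0l c0P).
pose l1' := rcons l1 c.
exists (l1' ++ e :: l2); first by rewrite lE perm_catC /= perm_cons perm_catC.
have cl : c \in l by rewrite lE mem_cat mem_rcons inE eqxx.
have lD x : x \in l -> D x by move=> xl; apply: sD; rewrite inE xl orbT.
have eD : D e by apply: sD; rewrite inE eqxx.
have el : e \notin l by case/andP: U.
have Ul : uniq l by case/andP: U.
have l12 x : x \in l1' -> x \notin l2.
  move=> x1; move: Ul; rewrite lE cat_uniq => /and3P[_ /hasPn N _].
  by apply/negP => /N; rewrite /= x1.
have in1 x : x \in l1' -> x \in l by rewrite lE mem_cat => ->.
have in2 x : x \in l2 -> x \in l by rewrite lE mem_cat orbC => ->.
have ne x : x \in l -> x != e by move=> xl; apply: contraNneq el => <-.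
have bl1 x y : before l1' x y -> before l x y by rewrite lE before_cat => ->.
have bl2 x y : before l2 x y -> before l x y by rewrite lE before_cat => ->; rewrite orbT.
have bl12 x y : x \in l1' -> y \in l2 -> before l x y.
  by rewrite lE before_cat => -> ->; rewrite !orbT.
have c_far z : z \in l2 -> T e c z.
  move=> z2; have /existsNP[b /not_implyP[bl /contrapT Hb]] := l2P z z2.
  have [<-//|bc] := eqVneq b c.
  have cz : c != z by apply: contraTneq z2 => <-; apply: l12; rewrite mem_rcons inE eqxx.
  have := T_trans (lD _ cl) Hb; rewrite !inE !negb_or (ne _ cl) (eq_sym c b) bc cz.
  by case=> // H; case: (cP b bl H).
have bc x : x \in l1' -> x != c -> before l x c.
  rewrite /l1' mem_rcons inE => /orP[->//|x1] _; apply: bl1.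
  by rewrite /l1' -cats1 before_cat x1 inE eqxx !orbT.
have c2 z : z \in l2 -> before l c z by move=> z2; apply: bl12 => //; rewrite mem_rcons inE eqxx.
have step x y : before (l1' ++ e :: l2) x y ->
    [\/ before l x y, x \in l1' /\ y = e | x = e /\ y \in l2].
  rewrite before_cat /= => /or3P[/bl1|/orP[/andP[/eqP-> y2]|/bl2]|/andP[x1]].
  - by constructor 1.
  - by constructor 3.
  - by constructor 1.
  by rewrite inE => /orP[/eqP->|y2]; [constructor 2|constructor 1; exact: bl12].
move=> x y z xy yz H; have U3 := T_uniq H.
have [xy'|[x1 ye]|[xe y2]] := step _ _ xy.
- have [yz'|[y1 ze]|[ye _]] := step _ _ yz; first exact: gl xy' yz' H.
    have [xl yl] := before_mem xy'; rewrite ze in H U3.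
    have Nx : ~ T e x c := cP x xl.
    have [yc|yc] := eqVneq y c; first by apply: Nx; rewrite -yc; exact: T_sym.
    have ycb := bc y y1 yc.
    have xc : x != c by apply/eqP => xc; rewrite xc in xy'; exact: before_anti Ul xy' ycb.
    have Uc : c \notin [:: e; x; y] by rewrite !inE !negb_or (ne _ cl) (eq_sym c x) xc (eq_sym c y) yc.
    have Uc' : c \notin [:: x; e; y] by move: Uc; rewrite !inE !negb_or => /and3P[-> -> ->].
    have [//|H1] := T_trans (lD _ cl) (T_sym H) Uc.
    have [/T_sym//|H2] := T_trans (lD _ cl) H Uc'.
    exact: gl xy' ycb H2.
  by have [_] := before_mem xy'; rewrite ye (negPf el).
- have [yz'|[]|[_ z2]] := step _ _ yz.
  + by have [] := before_mem yz'; rewrite ye (negPf el).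
  + by rewrite ye => /in1; rewrite (negPf el).
  rewrite ye in H U3; have Hc := c_far z z2.
  have [xc|xc] := eqVneq x c.
    by rewrite xc in H; apply: (T_excl (T_sym Hc)); exact: H.
  have xl := in1 _ x1; have zl := in2 _ z2.
  have cz : c != z by apply: contraTneq z2 => <-; apply: l12; rewrite mem_rcons inE eqxx.
  have Uc : c \notin [:: x; z; e] by rewrite !inE !negb_or (ne _ cl) (eq_sym c x) xc cz.
  have Uc' : c \notin [:: z; x; e] by move: Uc; rewrite !inE !negb_or => /and3P[-> -> ->].
  have [H1|H1] := T_trans (lD _ cl) H Uc; first exact: gl (bc _ x1 xc) (c2 _ z2) H1.
  have [/T_sym H2|H2] := T_trans (lD _ cl) (T_sym H) Uc'.
    exact: gl (bc _ x1 xc) (c2 _ z2) H2.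
  exact: (T_excl (T_sym Hc) (T_sym H2)).
rewrite xe in H U3.
have [yz'|[y1 _]|[ye _]] := step _ _ yz.
- have z2 : z \in l2.
    move: yz'; rewrite lE before_cat => /or3P[/before_mem[/l12]|/before_mem[]//|/andP[]//].
    by rewrite y2.
  have cz := c_far z z2; have cy := c_far y y2.
  have ny x' : x' \in l2 -> c != x'.
    by move=> x2; apply: contraTneq x2 => <-; apply: l12; rewrite mem_rcons inE eqxx.
  have Uc : c \notin [:: z; e; y] by rewrite !inE !negb_or (ne _ cl) !ny.
  have [H1|H1] := T_trans (lD _ cl) (T_sym H) Uc.
    by apply: (cP z (in2 _ z2)); exact: T_sym.
  exact: gl (c2 _ y2) yz' (T_sym H1).
- by have := l12 _ y1; rewrite y2.
by have := in2 _ y2; rewrite ye (negPf el).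
Qed.

Lemma tree_order l : uniq l -> {subset l <= D} -> exists2 l', perm_eq l' l & tree_sorted l'.
Proof.
elim: l => [|e l IH] U sD; first by exists [::].
have [||l' pl gl] := IH; [by case/andP: U|by move=> x xl; apply: sD; rewrite inE xl orbT|].
have [||l'' pl' gl'] := @tree_insert e l' _ _ gl.
- by rewrite /= (perm_mem pl) (perm_uniq pl).
- by move=> x; rewrite inE (perm_mem pl) => H; apply: sD; rewrite inE.
by exists l''; rewrite // (permPl pl') perm_cons.
Qed.
End TreeOrder.

Lemma cr_split_alg (K : fieldType) (ac bd bc ae be ad : K) :
  ae != 0 -> be != 0 -> ad != 0 -> bc != 0 ->
  ac * bd / (ad * bc) = (ac * be / (ae * bc)) * (ae * bd / (ad * be)).
Proof. by move=> *; field; do ?(apply/andP; split). Qed.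
Lemma cr_swap_alg (K : fieldType) (ab ac ad bc bd cd : K) :
  ab != 0 -> ac != 0 -> ad != 0 -> bc != 0 -> bd != 0 -> cd != 0 ->
  ab * cd - ac * bd + ad * bc = 0 ->
  let x := ab * - cd / (ac * - bd) in
  [/\ - ab * - cd / (bc * - ad) = - (x / (1 - x)), x != 0 & 1 - x != 0].
Proof.
move=> ab0 ac0 ad0 bc0 bd0 cd0 P /=.
have E : 1 - ab * - cd / (ac * - bd) = (ad * bc) / (ac * bd).
  have -> : ad * bc = ac * bd - ab * cd by rewrite -[RHS]addr0 -P; ring.
  by field; rewrite ?oppr_eq0 ac0 bd0.
rewrite E; split.
- by field; do ?(apply/andP; split); rewrite ?oppr_eq0.
- by rewrite !mulf_neq0 ?invr_eq0 ?mulf_neq0 ?oppr_eq0.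
by rewrite !mulf_neq0 ?invr_eq0 ?mulf_neq0.
Qed.

(** * The dihedral charts cover the compactification *)

Section Points.
Variables (k : fieldType) (m0 : nat).
Local Notation m := m0.+1.
Local Notation n := m0.+4.
Local Notation K := (ratfun k n).
Local Notation brK := (@brK k m0).
Local Notation ffield := (@ffield k m0).
Local Notation cr_ring := (@cr_ring k m0).
Local Notation open_vals := (@open_vals k m0).
Local Notation constK := (@ratC k n : {rmorphism k -> K}).
Local Notation pv := (@pv k m0).
Local Notation chart := (@chart k m0).
Local Notation cval := (@cval k m0).
Local Notation cu := (@cu k m0).
Local Notation cr := (@cross_ratio k n).
Local Notation RR := (RR brK).
Implicit Types (O : set K) (s : 'S_n).

Lemma chart_min s (L : set K) : is_subring L -> (forall c, L (constK c)) ->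
  (forall a b c d : nat, sorted4 m0 a b c d -> L (pv s (RR a b c d))) -> chart s `<=` L.
Proof.
move=> sL Lc LR x Ax; rewrite -[x](pvKV s).
have : dih_ring constK brK (pv s^-1%g x) by exact: Ax.
move: (pv s^-1%g x); apply: (@gen_sub _ _ constK _ (pv s @^-1` L)).
- exact: preim_subring.
- by move=> c; rewrite /preimage /= pvC; exact: Lc.
by move=> _ [a [b [c [d [S ->]]]]]; exact: LR.
Qed.
Lemma perm_uniq4 s (a b c d : 'I_n) : uniq [:: s a; s b; s c; s d] = uniq [:: a; b; c; d].
Proof. exact: (map_inj_uniq (@perm_inj _ s) [:: a; b; c; d]). Qed.
Lemma chart_RR s a b c d : sorted4 m0 a b c d -> chart s (pv s (RR a b c d)).
Proof. by move=> S; rewrite /chart /preimage /= pvVK; exact: dih_ring_RR. Qed.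
Lemma pv_RR s (a b c d : nat) : sorted4 m0 a b c d ->
  let q := (s (pt m0 a), s (pt m0 d), s (pt m0 b), s (pt m0 c)) in
  distinct4 q /\ pv s (RR a b c d) = cr q.
Proof.
move=> S; have U4 : uniq [:: pt m0 a; pt m0 d; pt m0 b; pt m0 c].
  by move: S; rewrite /sorted4 => S; apply: uniq_pt; rewrite /= ?inE; lia.
split; first by rewrite -(perm_uniq4 s) in U4.
rewrite (RR_mon (@brK_anti k m0) (@brK_neq0 k m0) S) mon_cr //; last exact: brK_neq0.
by rewrite fmorph_div !rmorphM !pv_br cross_ratioE.
Qed.
Lemma cr_chart s (a b c d : 'I_n) : uniq [:: a; b; c; d] ->
  exists x, [/\ chart s x, x != 0, 1 - x != 0 & cr (a, b, c, d) \in six x].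
Proof.
move=> U4; have [|w [x [y [z [S H]]]]] := CR_cases (@brK_anti k m0) (@brK_neq0 k m0) (@brK_pluecker k m0)
  (ltn_ord (s^-1%g a)) (ltn_ord (s^-1%g b)) (ltn_ord (s^-1%g c)) (ltn_ord (s^-1%g d)).
  by rewrite (map_inj_uniq val_inj [:: _; _; _; _]) perm_uniq4.
exists (pv s (RR w x y z)); split.
- exact: chart_RR.
- by have [U' ->] := pv_RR s S; rewrite cross_ratio_mon //; apply: mon_neq0; exact: brK_neq0.
- rewrite -(rmorph1 (pv s)) -rmorphB (RR_ZY (@brK_neq0 k m0) (@brK_pluecker k m0) (wsorted_sorted S)).
  by rewrite fmorph_eq0; apply: (ZY_neq0 (@brK_neq0 k m0)); exact: wsorted_sorted.
have -> : cr (a, b, c, d) = pv s (CR brK (s^-1%g a) (s^-1%g b) (s^-1%g c) (s^-1%g d)).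
  by rewrite /CR /B !pt_ord fmorph_div !rmorphM !pv_br !permKV cross_ratioE.
by rewrite -six_map; exact: map_f.
Qed.

Definition chart_alg (t : 'I_n * 'I_n * 'I_n * 'I_n -> bool) : set K :=
  algebra_gen (@ratC k n) [set (if t q then cr q else (cr q)^-1) | q in @distinct4 n].

Lemma crV (a b c d : 'I_n) : (cr (a, b, c, d))^-1 = cr (a, b, d, c).
Proof. by rewrite !cross_ratioE invf_div. Qed.
Lemma ptsP_M0n O : M0nbar_pts O -> [/\ local_ring O, (forall c, O (constK c)),
  (forall a b c d : 'I_n, uniq [:: a; b; c; d] -> O (cr (a, b, c, d)) \/ O (cr (a, b, d, c)))
  & exists t, [/\ chart_alg t `<=` O & O = localization (chart_alg t) (chart_alg t `&` maxid O)]].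
Proof.
move=> [t _ AO]; have sA : is_subring (chart_alg t) by exact: gen_subring.
have [lO sub OE] := Aff_local sA AO; split=> //.
- by move=> c; apply: sub; exact: gen_const.
- move=> a b c d U4; rewrite -(crV a b c d).
  have : chart_alg t (if t (a, b, c, d) then cr (a, b, c, d) else (cr (a, b, c, d))^-1).
    by apply: gen_mem; exists (a, b, c, d).
  by case: ifP => _ /sub; [left|right].
by exists t.
Qed.
(** A cross-ratio regular at [O] is one of the six values of an element of the chart, so by
    [six_local] the ring of the product of lines at [O] maps into the localization of [chart s]. *)
Lemma pts_chart O s : M0nbar_pts O -> chart s `<=` O -> Aff (chart s) O.
Proof.
move=> /ptsP_M0n[lO Oc Ocr [t [AO OE]]] sub; have sB := @chart_subring k m0 s.
apply: (local_eq lO OE AO sB sub).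
have [sO _] := lO; have sL := is_subring_localization sB (maxid_prime lO sB sub).
apply: gen_sub => //; first by move=> c; apply: localization_sub => //; exact: chart_const.
have crL a b c d : uniq [:: a; b; c; d] -> O (cr (a, b, c, d)) ->
    localization (chart s) (chart s `&` maxid O) (cr (a, b, c, d)).
  move=> U4; have [x [Ax x0 x1 H]] := cr_chart s U4.
  have [_] := six_local lO sL (localization_sub O sB Ax)
    (fun z => @localizationV _ O _ z lO sB sub) (sub _ Ax) x0 x1 H.
  exact.
move=> _ [[[[a b] c] d] U4 <-].
have : chart_alg t (if t (a, b, c, d) then cr (a, b, c, d) else (cr (a, b, c, d))^-1).
  by apply: gen_mem; exists (a, b, c, d).
move/AO; case: ifP => _; first exact: crL.
rewrite crV; apply: crL; move: U4; rewrite /distinct4 /= !inE.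
by rewrite (eq_sym d c) !negb_or => /and4P[/and3P[-> -> ->] /andP[-> ->] -> _].
Qed.
Lemma chart_pts O s : Aff (chart s) O -> M0nbar_pts O.
Proof.
move=> AO; have sB := @chart_subring k m0 s; have [lO sub OE] := Aff_local sB AO.
pose t q := `[< O (cr q) >]; exists t => //.
have sA : is_subring (chart_alg t) by exact: gen_subring.
have [sO _] := lO.
have crO a b c d : uniq [:: a; b; c; d] -> O (cr (a, b, c, d)) \/ O (cr (a, b, c, d))^-1.
  move=> U4; have [x [Ax x0 x1 H]] := cr_chart s U4.
  by have [] := six_local lO sO (sub _ Ax) (fun z _ => fun u : runit O z => let: And3 _ _ v := u in v)
    (sub _ Ax) x0 x1 H.
have AO' : chart_alg t `<=` O.
  apply: gen_sub => //; first by move=> c; apply: sub; exact: chart_const.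
  move=> _ [[[[a b] c] d] U4 <-]; case: ifPn => [/asboolP//|/asboolPn N].
  by have [] := crO a b c d U4.
apply: (local_eq lO OE sub sA AO').
have sL := is_subring_localization sA (maxid_prime lO sA AO').
apply: chart_min => //; first by move=> c; apply: localization_sub => //; exact: gen_const.
move=> a b c d S; have OR := sub _ (chart_RR s S).
have [U4 E] := pv_RR s S; rewrite E in OR *; set q := (_, _, _, _) in U4 E OR *.
apply: localization_sub => //; apply: gen_mem; exists q => //.
by rewrite /t asboolT.
Qed.

Lemma cr_split (a b c d e : 'I_n) : uniq [:: a; b; c; d; e] ->
  cr (a, b, c, d) = cr (a, b, c, e) * cr (a, b, e, d).
Proof.
move=> U5; rewrite !cross_ratioE.
have [ae be] : a != e /\ b != e by move: U5; rewrite /= !inE !negb_or => /and5P[/and4P[_ _ _ ->] /and3P[_ _ ->] _ _ _].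
have [ad bc] : a != d /\ b != c by move: U5; rewrite /= !inE !negb_or => /and5P[/and4P[_ _ -> _] /and3P[-> _ _] _ _ _].
by apply: cr_split_alg; apply: brK_neq0; assumption.
Qed.
Lemma cr_swap (a b c d : 'I_n) : uniq [:: a; b; c; d] ->
  [/\ cr (b, d, a, c) = - (cr (a, d, b, c) / (1 - cr (a, d, b, c))) , cr (a, d, b, c) != 0
    & 1 - cr (a, d, b, c) != 0].
Proof.
move=> U4; have [[ab ac ad] [bc bd cd]] : [/\ a != b, a != c & a != d] /\ [/\ b != c, b != d & c != d].
  by move: U4; rewrite /= !inE !negb_or => /and4P[/and3P[-> -> ->] /andP[-> ->] -> _].
have nz := @brK_neq0 k m0.
have := cr_swap_alg (nz _ _ ab) (nz _ _ ac) (nz _ _ ad) (nz _ _ bc) (nz _ _ bd) (nz _ _ cd)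
  (brK_pluecker k a b c d).
by rewrite (cross_ratioE k a) (cross_ratioE k b) (brK_anti k a b) (brK_anti k a d) (brK_anti k b d) (brK_anti k c d).
Qed.

(** With the last marked point as root, the cross-ratios vanishing at [O] are the triples of a
    rooted tree. In a planar ordering of its leaves, every generator of the dihedral chart is
    regular at [O]. *)
Lemma pts_chart_exists O : M0nbar_pts O -> exists s, chart s `<=` O.
Proof.
move=> /ptsP_M0n[lO Oc Ocr _]; have [sO lO'] := lO.
pose oo : 'I_n := ord_max.
(* The points a and b collide relative to c and the root. *)
pose T a b c := uniq [:: a; b; c; oo] /\ maxid O (cr (a, oo, b, c)).
have mO := maxid_prime lO sO (@subset_refl _ O).
have U4 a b c : uniq [:: a; b; c; oo] -> uniq [:: a; oo; b; c].
  by rewrite /= !inE !negb_or !(eq_sym oo) => /and4P[/and3P[-> -> ->] /andP[-> ->] -> _].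
have maxV x : x != 0 -> O x \/ O x^-1 -> ~ maxid O x -> O x^-1.
  move=> x0 [Ox|//] Nx; have : runit O x by apply: contra_notP Nx => Nx; split.
  by case.
have cr0 a b c : uniq [:: a; b; c; oo] -> cr (a, oo, b, c) != 0.
  by move=> U; rewrite cross_ratio_mon; [apply: mon_neq0; exact: brK_neq0|exact: U4].
have T_uniq a b c : T a b c -> uniq [:: a; b; c].
  by case; rewrite /= !inE !negb_or => /and4P[/and3P[-> -> _] /andP[-> _] _ _].
have T_sym a b c : T a b c -> T b a c.
  move=> [U [Oy Ny]]; have [E y0 y1] := cr_swap U.
  have u1 : runit O (1 - cr (a, oo, b, c)) by case: (lO' _ Oy).
  split.
    by move: U; rewrite /= !inE !negb_or (eq_sym b a) => /and4P[/and3P[-> -> ->] /andP[-> ->] -> _].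
  rewrite E -mulNr mulrC; apply: maxid_mul => //; first by case: u1.
  split; first exact: (subringN sO).
  by move=> /(runitN sO)/Ny.
have T_excl a b c : T a b c -> T a c b -> False.
  move=> [U [Oy Ny]] [_ [Oz _]]; apply: Ny; split=> //; first exact: cr0.
  by rewrite crV.
have T_trans a b c e : (e != oo) -> T a b c -> e \notin [:: a; b; c] -> T a b e \/ T a e c.
  move=> eo [U [Oy Ny]]; rewrite !inE !negb_or => /and3P[ea eb ec].
  have [U1 U2 U5] : [/\ uniq [:: a; e; c; oo], uniq [:: a; b; e; oo] & uniq [:: a; oo; b; c; e]].
    move: U; rewrite /= !inE !negb_or !(eq_sym oo) !(eq_sym _ e) ea eb ec eo.
    by move=> /and4P[/and3P[-> -> ->] /andP[-> ->] -> _].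
  have [Te|Te] := pselect (maxid O (cr (a, oo, e, c))); first by right.
  left; split=> //.
  have -> : cr (a, oo, b, e) = (cr (a, oo, e, c))^-1 * cr (a, oo, b, c).
    by rewrite (cr_split U5) mulrCA mulVf ?mulr1 //; exact: cr0.
  apply: maxid_mul => //; apply: maxV => //; first exact: cr0.
  by rewrite crV; apply: Ocr; exact: U4.
have [||l lP lT] := @tree_order _ T [pred x | x != oo] T_uniq T_sym T_excl T_trans
    [seq x <- enum 'I_n | x != oo].
- by rewrite filter_uniq ?enum_uniq.
- by move=> x; rewrite mem_filter => /andP[].
have Ul : uniq l by rewrite (perm_uniq lP) filter_uniq ?enum_uniq.
have lx x : (x \in l) = (x != oo) by rewrite (perm_mem lP) mem_filter mem_enum inE andbT.
have sl : size l = n.-1.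
  have -> : n.-1 = #|predC1 oo| by rewrite cardC1 card_ord.
  by rewrite -(card_uniqP Ul); apply: eq_card => x; rewrite lx !inE.
(* [l] omits the root and has n-1 entries, so the default value of [nth] puts the root in the last
   place. *)
pose f (i : 'I_n) := nth oo l i.
have f_inj : injective f.
  move=> i j fij; apply/val_inj => /=; apply/eqP.
  have Ur : uniq (rcons l oo) by rewrite rcons_uniq lx eqxx.
  have fE (x : 'I_n) : nth oo (rcons l oo) x = f x.
    by rewrite nth_rcons; case: ltnP => // H; rewrite /f nth_default // if_same.
  by rewrite -(nth_uniq oo _ _ Ur) ?size_rcons ?sl // !fE fij.
pose s : 'S_n := perm f_inj; exists s.
have sE x : (x < n)%N -> s (pt m0 x) = nth oo l x by move=> xn; rewrite permE /f ptE modn_small.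
have s_oo : s (pt m0 n.-1) = oo by rewrite sE // nth_default ?sl.
(* This generator is the inverse of the cross-ratio for the triple a, c, b, which does not vanish at
   [O] because the ordering is planar. *)
have O_oo a b c : (a < b)%N -> (b < c)%N -> (c < n.-1)%N -> O (pv s (RR a b c n.-1)).
  move=> ab bc cn; have [|Uq ->] := @pv_RR s a b c n.-1; first by rewrite /sorted4; lia.
  rewrite s_oo in Uq *.
  have Uq' : uniq [:: s (pt m0 a); s (pt m0 c); s (pt m0 b); oo].
    move: Uq; rewrite /distinct4 /= !inE !negb_or !(eq_sym oo).
    by move=> /and4P[/and3P[-> -> ->] /andP[-> ->] h _]; rewrite (eq_sym (s (pt m0 c))) h.
  rewrite -crV; apply: maxV; first exact: cr0.
    by rewrite crV; apply: Ocr; exact: U4.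
  move=> H; apply: (lT (s (pt m0 a)) (s (pt m0 b)) (s (pt m0 c))); last by split.
    by rewrite !sE; [apply: before_nth; rewrite ?sl| |]; lia.
  by rewrite !sE; [apply: before_nth; rewrite ?sl| |]; lia.
apply: chart_min => // a b c d S; move: (S); rewrite /sorted4 => S'.
have [->|dn] := eqVneq d n.-1; first by apply: O_oo; lia.
(* An arbitrary generator reduces to two whose last point is the root, one of them through
   [ZY = 1 - RR]. *)
rewrite (RR_split_oo (@brK_neq0 k m0) _ S); last by lia.
rewrite rmorphM -(RR_ZY (@brK_neq0 k m0) (@brK_pluecker k m0)); last by rewrite /wsorted4; lia.
rewrite rmorphB rmorph1; apply: (subringM sO); last by apply: O_oo; lia.
by apply: (subringB sO); [exact: (subring1 sO)|apply: O_oo; lia].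
Qed.
End Points.

(** The inclusion of valuation rings makes [v'] equal to [v] times [v' p]; as [v'] takes the value
    1, the factor is 1. *)
Lemma divval_eq (K : fieldType) (E : set K) (v v' : K -> int) p q : is_subfield E ->
  divval E v -> divval E v' -> E p -> p != 0 -> v p = 1 -> E q -> q != 0 -> v' q = 1 ->
  (forall x, E x -> x != 0 -> 0 <= v x -> 0 <= v' x) -> v = v'.
Proof.
move=> sE dv dv' Ep p0 vp Eq q0 vq H.
have v0 x : E x -> x != 0 -> v x = 0 -> v' x = 0.
  move=> Ex x0 vx; apply/eqP; rewrite eq_le -[X in X && _]oppr_ge0 -(divvalV _ sE dv').
  by rewrite !H ?invr_eq0 ?(divvalV _ sE dv) ?vx //; exact: subfieldV.
have E' x : E x -> x != 0 -> v' x = v x * v' p.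
  move=> Ex x0; have Epx := subfieldXz (v x) sE Ep.
  have px0 : p ^ v x != 0 by rewrite expfz_neq0.
  have := v0 (x / p ^ v x) (subfieldM sE Ex (subfieldV sE Epx)).
  rewrite mulf_neq0 ?invr_eq0 // (divvalF sE dv) // (divvalF sE dv') //.
  rewrite (divvalXz _ sE dv) // (divvalXz _ sE dv') // vp mul1r subrr => /(_ isT erefl)/eqP.
  by rewrite subr_eq0 => /eqP->; rewrite mulrC.
have vp1 : v' p = 1.
  have := E' q Eq q0; rewrite vq; have : 0 <= v' p by apply: H; rewrite ?vp.
  move=> p_ge0 h; have : (v' p %| v q * v' p)%Z by exact: dvdz_mull.
  by rewrite -h dvdz1; lia.
apply/funext => x; have [[v00 vN _] [v'0 v'N _]] := (dv, dv').
have [->|x0] := eqVneq x 0; first by rewrite v00 v'0.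
have [Ex|Ex] := pselect (E x); last by rewrite vN ?v'N.
by rewrite E' // vp1 mulr1.
Qed.

(** A localization of a Krull ring is the intersection of the valuation rings containing it. A
    valuation ring not containing it yields a denominator outside [P] of positive value, and powers
    of these clear the finitely many poles of [x]. *)
Lemma localization_vals (K : fieldType) (E A P : set K) V x : factorial E A V ->
  is_subring A -> prime_ideal A P -> E x -> x != 0 ->
  (forall v, V v -> localization A P `<=` vring E v -> 0 <= v x) -> localization A P x.
Proof.
move=> fac sA pP Ex x0 Hx; have sE := fac_field fac.
have [PA [P0 P1] PB PM Pp] := pP.
have A0 y : A y -> y != 0 -> forall v, V v -> 0 <= v y.
  by move=> Ay y0; apply/(fac_ring fac) => //; exact: (fac_sub fac).
have [s sP] := fac_fin fac Ex x0.
have den v : v \in s -> exists d, [/\ A d, ~ P d, d != 0 & (V v -> v x < 0 -> 0 < v d)].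
  move=> vs; have [[Vv vx]|N] := pselect (V v /\ v x < 0); last first.
    exists 1; split; rewrite ?oner_neq0 //; first exact: (subring1 sA).
    by move=> Vv vx; case: N.
  have : ~ localization A P `<=` vring E v.
    by move=> /(Hx _ Vv) h; move: vx; rewrite ltNge h.
  move/existsNP => [y /not_implyP[[a [b [Aa Ab Pb yE]]] Ny]].
  have b0 : b != 0 by apply/eqP => b0; apply: Pb; rewrite b0.
  exists b; split=> // _ _; rewrite lt_neqAle A0 // andbT; apply/eqP => vb; apply: Ny.
  split; first by rewrite yE; apply: subfieldM => //; [|apply: subfieldV => //]; exact: (fac_sub fac).
  have [a0|a0] := eqVneq a 0; first by left; rewrite yE a0 mul0r.
  right; rewrite yE (divvalF sE (fac_val fac Vv)) -?vb ?subr0 //; try exact: (fac_sub fac).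
  exact: A0.
have [d [Ad Pd d0 dP]] : exists d, [/\ A d, ~ P d, d != 0
    & forall v, v \in s -> V v -> v x < 0 -> `|v x|%N%:Z <= v d].
  elim: s {sP} den => [|w s IH] den; first by exists 1; split; rewrite ?oner_neq0 //; exact: (subring1 sA).
  have [|d [Ad Pd d0 dP]] := IH; first by move=> v vs; apply: den; rewrite inE vs orbT.
  have [|b [Ab Pb b0 bP]] := den w; first by rewrite inE eqxx.
  have Abx j : A (b ^+ j) by exact: (subringX sA).
  have Pbx j : ~ P (b ^+ j).
    elim: j => [|j IHj]; first by rewrite expr0.
    by rewrite exprS => /(Pp _ _ Ab (Abx j))[].
  exists (b ^+ `|w x|%N * d); split.
  - exact: (subringM sA).
  - by move/(Pp _ _ (Abx _) Ad) => -[/Pbx|].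
  - by rewrite mulf_neq0 // expf_neq0.
  move=> v; have [Vv vs _ vx|//] := pselect (V v).
  have bx0 : b ^+ `|w x|%N != 0 by rewrite expf_neq0.
  have Eb := fac_sub fac Ab.
  rewrite (divvalM (fac_val fac Vv)) //; try exact: (fac_sub fac).
  have dge := A0 _ Ad d0 v Vv; have bge := A0 _ (Abx `|w x|%N) bx0 v Vv.
  move: vs; rewrite inE => /orP[/eqP vw|vs]; last by have := dP v vs Vv vx; lia.
  rewrite (divvalX _ sE (fac_val fac Vv)) // {2}vw.
  have := bP; rewrite -vw => /(_ Vv vx) vb; rewrite -mulr_natr; nia.
exists (x * d), d; split=> //; last by rewrite mulfK.
apply/(fac_ring fac); rewrite ?mulf_neq0 //; first by apply: subfieldM => //; exact: (fac_sub fac).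
move=> v Vv; rewrite (divvalM (fac_val fac Vv)) //; last exact: (fac_sub fac).
have dge := A0 _ Ad d0 v Vv; have [vx|vx] := leP 0 (v x); first by rewrite addr_ge0.
have vs : v \in s by apply: sP => //; rewrite lt_eqF.
by have := dP v vs Vv vx; lia.
Qed.

(** The centre of [v] lies in the chart but not in the open part, because the inverse of [q] is in
    [C]; hence some [u c] is positive at [v]. A denominator that is a unit at [v] is not divisible
    by [u c], so regularity at [v] implies regularity at [w c], and the two valuations agree. *)
Lemma center_chart (K : fieldType) (I : finType) (E A C : set K) V (u : I -> K) (w : I -> K -> int)
    (v : K -> int) q : factorial E A (V `|` range w) -> is_subring A ->
  (forall c, A (u c)) -> (forall c, u c != 0) ->
  (forall c x, A x -> x != 0 -> 0 < w c x -> A (x / u c)) -> (forall c, w c (u c) = 1) ->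
  (forall x, C x -> exists f : I -> nat, A (x * \prod_c u c ^+ f c)) ->
  divval E v -> local_ring (vring E v) -> A `<=` vring E v ->
  vring E v = localization A (A `&` maxid (vring E v)) ->
  E q -> q != 0 -> v q = 1 -> C q^-1 -> exists c, v = w c.
Proof.
move=> fac sA Au u0 red wu loc dv lO sub OE Eq q0 vq Cq.
have sE := fac_field fac; have AE := fac_sub fac.
have dw c : divval E (w c) by apply: (fac_val fac); right; exists c.
have vge x : A x -> x != 0 -> 0 <= v x by move=> /sub[_ [->|//]]; rewrite eqxx.
have wge c x : A x -> x != 0 -> 0 <= w c x.
  by move=> Ax x0; apply: ((fac_ring fac (AE _ Ax) x0).1 Ax); right; exists c.
have [[c vc]|N] := pselect (exists c, 0 < v (u c)).
  exists c; apply: (divval_eq sE dv (dw c) Eq q0 vq (AE _ (Au c)) (u0 c) (wu c)) => x Ex x0 vx.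
  have : vring E v x by split=> //; right.
  rewrite OE => -[a [b [Aa Ab Nb xE]]].
  have b0 : b != 0.
    apply/eqP => b0; apply: Nb; rewrite b0; split; first exact: (subring0 sA).
    by split; [exact: (subring0 (proj1 lO))|case; rewrite eqxx].
  have a0 : a != 0 by apply: contraNneq x0 => a0; rewrite xE a0 mul0r.
  have ub : runit (vring E v) b.
    by apply: contra_notP Nb => Nb; split=> //; split=> //; exact: sub.
  have vb : v b = 0.
    have := vge b Ab b0; case: ub => _ _ [_ [/eqP|]]; first by rewrite invr_eq0 (negPf b0).
    by rewrite (divvalV _ sE dv); lia.
  rewrite xE (divvalF sE (dw c)) //; try exact: AE.
  have := wge c a Aa a0; have := wge c b Ab b0.
  have [cb _|] := ltP 0 (w c b); last by lia.
  have : 0 <= v (b / u c) by apply: vge; rewrite ?mulf_neq0 ?invr_eq0 //; exact: red.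
  by rewrite (divvalF sE dv) // ?vb; [lia|exact: AE|exact: AE].
have vu c : v (u c) = 0.
  by apply/eqP; rewrite eq_le vge // andbT leNgt; apply/negP => vc; apply: N; exists c.
have [f Hf] := loc _ Cq.
have [P0 EP vP] : [/\ \prod_c u c ^+ f c != 0, E (\prod_c u c ^+ f c)
    & v (\prod_c u c ^+ f c) = 0].
  apply: (big_ind (fun x => [/\ x != 0, E x & v x = 0])).
  - by split; [exact: oner_neq0|exact: subfield1|exact: (divval1 sE dv)].
  - move=> x y [x0 Ex vx] [y0 Ey vy]; split; [exact: mulf_neq0|exact: subfieldM|].
    by rewrite (divvalM dv) // vx vy.
  move=> c _; have Euc := AE _ (Au c); split; [by rewrite expf_neq0|exact: subfieldX|].
  by rewrite (divvalX _ sE dv) ?vu ?mul0rn.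
have := vge _ Hf; rewrite mulf_neq0 ?invr_eq0 // (divvalM dv) ?invr_eq0 //; last exact: subfieldV.
by rewrite (divvalV _ sE dv) vq vP => /(_ isT).
Qed.

(** * Boundary divisors *)

Section Boundary.
Variables (k : fieldType) (m0 : nat).
Local Notation n := m0.+4.
Local Notation K := (ratfun k n).
Local Notation brK := (@brK k m0).
Local Notation ffield := (@ffield k m0).
Local Notation cr_ring := (@cr_ring k m0).
Local Notation open_vals := (@open_vals k m0).
Local Notation pv := (@pv k m0).
Local Notation chart := (@chart k m0).
Local Notation cval := (@cval k m0).
Local Notation cu := (@cu k m0).
Local Notation vr := (vring ffield).
Implicit Types (O : set K) (s : 'S_n) (c : chordT m0) (v : K -> int).

Definition bdry_vals : set (K -> int) := [set v | exists s c, v = cval s c].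

Let sE : is_subfield ffield. Proof. exact: ffield_subfield. Qed.
Let fac s := @chart_factorial k m0 s.
Lemma chart_ffield s : chart s `<=` ffield. Proof. exact: fac_sub (fac s). Qed.
Lemma cu_ffield s c : ffield (cu s c). Proof. by apply: (@chart_ffield s); exact: chart_cu. Qed.
Lemma cval_div s c : divval ffield (cval s c).
Proof. by apply: (fac_val (fac s)); right; exists c. Qed.
Lemma bdry_div v : bdry_vals v -> divval ffield v.
Proof. by case=> s [c ->]; exact: cval_div. Qed.
Lemma open_div v : open_vals v -> divval ffield v.
Proof. by move=> Vv; exact: (fac_val (open_factorial k m0) Vv). Qed.
Lemma chart_vr s c : chart s `<=` vr (cval s c).
Proof.
move=> x Ax; have Ex := chart_ffield Ax; split=> //.
have [|x0] := eqVneq x 0; [by left|right].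
by apply: ((fac_ring (fac s) Ex x0).1 Ax); right; exists c.
Qed.
Lemma vr_aff s v : (open_vals `|` range (cval s)) v -> Aff (chart s) (vr v).
Proof.
move=> Vv; exists (vcenter (chart s) v); last first.
  exact: (localization_vcenter (fac s) (@chart_subring k m0 s) Vv).
exact: (vcenter_prime (fac s) (@chart_subring k m0 s) Vv).
Qed.
Lemma bdry_pts v : bdry_vals v -> M0nbar_pts (vr v).
Proof. by case=> s [c ->]; apply: (@chart_pts k m0 _ s); apply: vr_aff; right; exists c. Qed.
Lemma open_pts v : open_vals v -> M0nbar_pts (vr v).
Proof. by move=> Vv; apply: (@chart_pts k m0 _ 1%g); apply: vr_aff; left. Qed.

(** The divisor may have been defined from another chart; its equation there has order 1 and is
    inverted on the open part, as [center_chart] requires. *)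
Lemma bdry_chart v s : bdry_vals v -> chart s `<=` vr v -> exists c, v = cval s c.
Proof.
move=> Bv sub; case: (Bv) => s1 [c1 v1].
have [lO _ OE] := Aff_local (@chart_subring k m0 s) (pts_chart (bdry_pts Bv) sub).
have wu c : cval s c (cu s c) = 1 by rewrite cval_u eqxx.
have vq : v (cu s1 c1) = 1 by rewrite v1 cval_u eqxx.
exact: (@center_chart _ _ ffield (chart s) cr_ring open_vals (cu s) (cval s) v (cu s1 c1) (fac s)
  (@chart_subring k m0 s) (@chart_cu k m0 s) (@cu_neq0 k m0 s)
  (@cval_reduce k m0 s) wu (@cr_ring_loc k m0 s) (bdry_div Bv) lO sub OE
  (cu_ffield s1 c1) (@cu_neq0 k m0 s1 c1) vq (@cr_ring_cuV k m0 s1 c1)).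
Qed.

Lemma chart_sub_vr s v : bdry_vals v ->
  (forall a b c d : nat, sorted4 m0 a b c d -> 0 <= v (pv s (RR brK a b c d))) -> chart s `<=` vr v.
Proof.
move=> Bv H; have [lO Oc _ _] := ptsP_M0n (bdry_pts Bv).
apply: chart_min; [by case: lO|exact: Oc|].
move=> a b c d S; split; last by right; exact: H.
by apply: (@chart_ffield s); exact: chart_RR.
Qed.
Lemma pv_RR_mon s (a b c d : nat) : sorted4 m0 a b c d ->
  exists2 e, balanced e & pv s (RR brK a b c d) = mon brK e.
Proof.
move=> S; have [U4 ->] := pv_RR k s S; rewrite cross_ratio_mon //.
by eexists; [apply: balanced_cr; exact: U4|].
Qed.
(** The generators of a chart are monomials, so the values on monomials show that both divisors meet
    the same chart, and there the equations [cu] tell the divisors apart. *)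
Lemma bdry_mon_eq v v' : bdry_vals v -> bdry_vals v' ->
  (forall e, balanced e -> v (mon brK e) = v' (mon brK e)) -> v = v'.
Proof.
move=> Bv Bv' vv'; case: (Bv) => s [c vE].
have [|c' v'E] := @bdry_chart v' s Bv'.
  apply: chart_sub_vr => // a b c' d S; have [e be E] := pv_RR_mon s S.
  rewrite E -vv' // -E vE; have [_ [|//]] := chart_vr c (@chart_RR k m0 s _ _ _ _ S).
  by move=> H; exfalso; move: (mon_neq0 (@brK_neq0 k m0) e); rewrite -E H eqxx.
have [e be uE] := cu_mon k s c.
have := vv' e be; rewrite -uE vE v'E !cval_u eqxx.
case: (eqVneq c' c) => [-> _|_ /eqP]; [exact: erefl|by rewrite oner_eq0].
Qed.

(** Normality of the compactification, inherited from a factorial chart through the point. *)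
Lemma pts_local O x : M0nbar_pts O -> ffield x -> x != 0 ->
  (forall v, open_vals v \/ bdry_vals v -> O `<=` vr v -> 0 <= v x) -> O x.
Proof.
move=> XO Ex x0 H; have [s sub] := pts_chart_exists XO.
have [P pP OE] := pts_chart XO sub; rewrite -OE in H *.
apply: (localization_vals (fac s) (@chart_subring k m0 s) pP Ex x0) => v Vv; apply: H.
by case: Vv => [|[c _ <-]]; [left|right; exists s, c].
Qed.
Lemma pts_unit O x : M0nbar_pts O -> ffield x -> x != 0 ->
  (unit_at O x <-> forall v, open_vals v \/ bdry_vals v -> O `<=` vr v -> v x = 0).
Proof.
move=> XO Ex x0; split=> [[Ox Oxv] v Vv sub|H].
  have dv : divval ffield v by case: Vv; [exact: open_div|exact: bdry_div].
  have [[_ vx] [_ vxv]] := (sub _ Ox, sub _ Oxv).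
  case: vx => [/eqP|vx]; first by rewrite (negPf x0).
  case: vxv => [/eqP|]; first by rewrite invr_eq0 (negPf x0).
  by rewrite (divvalV _ sE dv); lia.
split; apply: pts_local; rewrite ?invr_eq0 //; try exact: subfieldV.
  by move=> v Vv sub; rewrite H.
move=> v Vv sub; rewrite (divvalV _ sE) ?H //.
by case: Vv; [exact: open_div|exact: bdry_div].
Qed.
Lemma pts_ffield O : M0nbar_pts O -> O `<=` ffield.
Proof.
move=> XO; have [s sub] := pts_chart_exists XO.
have [P pP <-] := pts_chart XO sub; have [PA _ _ _ _] := pP.
move=> _ [a [b [Aa Ab _ ->]]].
have [Ea Eb] := (@chart_ffield s _ Aa, @chart_ffield s _ Ab).
exact: (subfieldM sE Ea (subfieldV sE Eb)).
Qed.
End Boundary.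

(** * The Picard group *)

Section FieldFacts.
Variables (K : fieldType) (E : set K).
Hypothesis sE : is_subfield E.
Lemma divf_neq0 (x y : K) : x != 0 -> y != 0 -> x / y != 0.
Proof. by move=> x0 y0; rewrite mulf_neq0 ?invr_eq0. Qed.
Lemma subfield_div x y : E x -> E y -> E (x / y).
Proof. by move=> Ex Ey; apply: (subfieldM sE Ex); exact: subfieldV. Qed.
Lemma val_div_eq0 v x y : divval E v -> E x -> E y -> x != 0 -> y != 0 ->
  (v (x / y) = 0 <-> v x = v y).
Proof.
move=> dv Ex Ey x0 y0; rewrite (divvalF sE dv) //.
by split=> [/eqP|->]; rewrite ?subrr // subr_eq0 => /eqP.
Qed.
Lemma val_prod (I : finType) (u : I -> K) (z : I -> int) :
  (forall c, E (u c)) -> (forall c, u c != 0) ->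
  [/\ E (\prod_c u c ^ z c), \prod_c u c ^ z c != 0
  & forall v, divval E v -> v (\prod_c u c ^ z c) = \sum_c z c * v (u c)].
Proof.
move=> Eu u0.
have Ec c : E (u c ^ z c) by exact: (subfieldXz _ sE).
have c0 c : u c ^ z c != 0 by rewrite expfz_neq0.
elim: (index_enum I) => [|c r [IH1 IH2 IH3]].
  rewrite !big_nil; split; [exact: subfield1|exact: oner_neq0|].
  by move=> v dv; rewrite big_nil (divval1 sE dv).
rewrite !big_cons; split; [exact: subfieldM|exact: mulf_neq0|].
by move=> v dv; rewrite big_cons (divvalM dv) // (divvalXz _ sE dv) // IH3 // mulrC.
Qed.
Lemma val_unit_const v c : divval E v -> vring E v c -> vring E v c^-1 -> c != 0 -> v c = 0.
Proof.
move=> dv [_ h1] [_ h2] c0; case: h1 => [/eqP|h1]; first by rewrite (negPf c0).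
case: h2 => [/eqP|]; first by rewrite invr_eq0 (negPf c0).
by rewrite (divvalV _ sE dv); lia.
Qed.
Lemma val_not_vring v x : divval E v -> E x -> x != 0 -> ~ vring E v x -> v x != 0.
Proof. by move=> dv Ex x0 N; apply: contra_notN N => /eqP vx; split=> //; right; rewrite vx. Qed.
End FieldFacts.

Lemma prime_zero (K : fieldType) (A : set K) : is_subring A -> prime_ideal A [set 0].
Proof.
move=> sA; split.
- by move=> _ ->; exact: (subring0 sA).
- by split=> // /eqP; rewrite oner_eq0.
- by move=> _ _ -> ->; rewrite /= subrr.
- by move=> a _ _ ->; rewrite /= mulr0.
by move=> x y _ _ /eqP; rewrite mulf_eq0 => /orP[] /eqP; [left|right].
Qed.
Lemma localization0 (K : fieldType) (A : set K) : is_subring A ->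
  [/\ is_subfield (localization A [set 0]), A `<=` localization A [set 0]
    & forall L, is_subfield L -> A `<=` L -> localization A [set 0] `<=` L].
Proof.
move=> sA; have pA := prime_zero sA; have A1 := subring1 sA.
have one_nz : ~ [set 0] (1 : K) by move=> /eqP; rewrite oner_eq0.
split; first split; first exact: is_subring_localization.
- move=> _ [a [b [Aa Ab b0 ->]]]; have [->|a0] := eqVneq a 0.
    by exists 0, 1; split=> //; [exact: (subring0 sA)|rewrite mul0r invr0 mul0r].
  by exists b, a; split=> //; [apply/eqP|rewrite invf_div].
- by move=> x Ax; exists x, 1; split=> //; rewrite divr1.
by move=> L sL AL _ [a [b [Aa Ab _ ->]]]; apply: (subfield_div sL); exact: AL.
Qed.

(** * Cartier divisors as functions on valuations *)

Section PicardGroup.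
Variables (k : fieldType) (m0 : nat).
Local Notation n := m0.+4.
Local Notation K := (ratfun k n).
Local Notation X := (M0nbar k n).
Local Notation brK := (@brK k m0).
Local Notation ffield := (@ffield k m0).
Local Notation open_vals := (@open_vals k m0).
Local Notation bdry_vals := (@bdry_vals k m0).
Local Notation pv := (@pv k m0).
Local Notation chart := (@chart k m0).
Local Notation cval := (@cval k m0).
Local Notation cu := (@cu k m0).
Local Notation vr := (vring ffield).
Implicit Types (O : set K) (s g : 'S_n) (v : K -> int) (b : (K -> int) -> int).

Let sE : is_subfield ffield. Proof. exact: ffield_subfield. Qed.

Definition div_vals : set (K -> int) := [set v | open_vals v \/ bdry_vals v].
Lemma div_div v : div_vals v -> divval ffield v.
Proof. by case; [exact: open_div|exact: bdry_div]. Qed.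
Lemma div_pts v : div_vals v -> M0nbar_pts (vr v).
Proof. by case; [exact: open_pts|exact: bdry_pts]. Qed.

Lemma chart_frac s : localization (chart s) [set 0] = ffield.
Proof.
have sA := @chart_subring k m0 s; have fac := @chart_factorial k m0 s.
have pP := prime_zero sA; have [sL AL minL] := localization0 sA; apply/seteqP; split=> x.
  by apply: minL => //; exact: chart_ffield.
move=> Ex; have [->|x0] := eqVneq x 0; first exact: subfield0 sL.
apply: (localization_vals fac sA pP Ex x0) => v Vv sub; exfalso.
have [p up] := fac_par fac Vv; have Ap := uniformizer_ring fac Vv up.
have [Ep p0 vp _] := up.
have : vr v p^-1.
  by apply: sub; apply: (subfieldV sL); exact: AL.
move=> [_ [/eqP|]]; first by rewrite invr_eq0 (negPf p0).
by rewrite (divvalV _ sE (fac_val fac Vv)) vp.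
Qed.
Lemma generic_point : M0nbar_pts ffield.
Proof.
apply: (@chart_pts k m0 _ 1%g); exists [set 0]; last exact: chart_frac.
exact/prime_zero/chart_subring.
Qed.

Lemma funfieldE : funfield X = ffield.
Proof.
apply/seteqP; split=> x.
  by move=> H; apply: H; split=> // y [O XO Oy]; exact: (pts_ffield XO Oy).
by move=> Ex A [_ sub]; apply: sub; exists ffield; [exact: generic_point|].
Qed.

Lemma vr_pv g v : pv g @^-1` vr v = vr (v \o pv g).
Proof.
apply/seteqP; split=> x; rewrite /preimage /= => -[Ex vx]; split; rewrite /=.
- by rewrite -(pvVK g x); exact: pv_ffield.
- by case: vx => [/eqP|]; [rewrite fmorph_eq0 => /eqP; left|right].
- exact: pv_ffield.
by case: vx => [->|]; [left; rewrite rmorph0|right].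
Qed.
Lemma bdry_pv g v : bdry_vals v -> bdry_vals (v \o pv g).
Proof.
move=> [s [c ->]]; exists (s * g^-1)%g, c; apply/funext => x.
rewrite -[LHS]/(chord_val pv (@contr_w k m0) c (pv s^-1%g (pv g x))).
rewrite -[RHS]/(chord_val pv (@contr_w k m0) c (pv (s * g^-1)^-1%g x)).
by congr (chord_val _ _ _ _); rewrite invMg invgK; exact: esym (pvM _ _ _).
Qed.

(** The multiplicity of the divisor along [v], read off from its local equation at the generic point
    [vr v]. *)
Definition mult (D : set K -> nonzero K) v : int := v (nzval (D (vr v))).

Lemma nz_ffield (D : cartier_div X) O : M0nbar_pts O -> ffield (nzval (D O)).
Proof. by move=> XO; have /asboolP/(_ O XO)[] := valP D; rewrite funfieldE. Qed.

Lemma pts_unit_div O (x y : K) : M0nbar_pts O -> ffield x -> ffield y -> x != 0 -> y != 0 ->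
  (unit_at O (x / y) <-> forall v, div_vals v -> O `<=` vr v -> v x = v y).
Proof.
move=> XO Ex Ey x0 y0; rewrite (pts_unit XO (subfield_div sE Ex Ey) (divf_neq0 x0 y0)).
split=> H v Vv sub.
  exact: ((val_div_eq0 sE (div_div Vv) Ex Ey x0 y0).1 (H v Vv sub)).
exact: ((val_div_eq0 sE (div_div Vv) Ex Ey x0 y0).2 (H v Vv sub)).
Qed.

(** An open set containing [O] contains the generic point of every divisor through [O], so the
    equation at [O] computes these multiplicities. *)
Lemma mult_spec (D : cartier_div X) O v : M0nbar_pts O -> div_vals v -> O `<=` vr v ->
  mult D v = v (nzval (D O)).
Proof.
move=> XO Vv sub; have /asboolP/(_ O XO)[_ [U [[UX Uo] UO HU]]] := valP D.
have [t [tO tU]] := Uo O UO.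
have Uv : U (vr v) by apply: tU; [exact: div_pts|exact: subset_trans tO sub].
have Xv := div_pts Vv; have dv := div_div Vv.
have u := HU _ Uv; exact: ((pts_unit_div Xv (nz_ffield D Xv) (nz_ffield D XO) (nzvalP _) (nzvalP _)).1 u v Vv
  (@subset_refl _ _)).
Qed.

Lemma multB (D E : cartier_div X) v : div_vals v -> mult (D - E) v = mult D v - mult E v.
Proof.
move=> Vv; have Xv := div_pts Vv; rewrite /mult.
rewrite (_ : cdiv (D - E) (vr v) = cdiv D (vr v) - cdiv E (vr v)) // nzvalB.
by rewrite (divvalF sE (div_div Vv)) ?nzvalP //; exact: nz_ffield.
Qed.

Lemma principal_mult (D : cartier_div X) :
  D \in principal X <-> exists f, [/\ ffield f, f != 0 & forall v, div_vals v -> mult D v = v f].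
Proof.
split=> [/asboolP[f [Ff Df]]|[f [Ef f0 fv]]].
  rewrite funfieldE in Ff; exists (nzval f); split; [exact: Ff|exact: nzvalP|].
  move=> v Vv; have Xv := div_pts Vv.
  exact: ((pts_unit_div Xv (nz_ffield D Xv) Ff (nzvalP _) (nzvalP _)).1 (Df _ Xv) v Vv
    (@subset_refl _ _)).
apply/asboolP; exists (Nonzero f0); split; first by rewrite funfieldE.
move=> O XO; apply/(pts_unit_div XO (nz_ffield D XO) Ef (nzvalP _) f0) => v Vv sub.
by rewrite -(mult_spec D XO Vv sub); exact: fv.
Qed.

(** On the factorial open part every divisor is principal; finiteness of the support comes from a
    neighbourhood of the generic point on which a single equation is valid. *)
Lemma open_mult (D : cartier_div X) :
  exists y, [/\ ffield y, y != 0 & forall v, open_vals v -> v y = mult D v].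
Proof.
have fac := open_factorial k m0; have XE := generic_point.
have /asboolP/(_ _ XE)[_ [U [[UX Uo] UE HU]]] := valP D.
have [t [tE tU]] := Uo _ UE; pose f := nzval (D ffield).
have [f0 Ef] : f != 0 /\ ffield f by split; [exact: nzvalP|exact: nz_ffield].
(* Lists the valuations where [f] has a zero or a pole, or where one of the functions defining the
   neighbourhood has a pole. *)
have [r rP] : exists r : seq (K -> int), forall v, open_vals v ->
    v f != 0 \/ (exists2 x, x \in t & ~ vr v x) -> v \in r.
  elim: t tE {tU} => [|x t IH] tE.
    have [r rP] := fac_fin fac Ef f0; exists r => v Vv [|[]//]; exact: rP.
  have [|r rP] := IH; first by move=> y yt; apply: tE; rewrite /= inE yt orbT.
  have Ex : ffield x by apply: tE; rewrite /= inE eqxx.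
  have [x0|x0] := eqVneq x 0.
    exists r => v Vv [vf|[y]]; first by apply: rP => //; left.
    rewrite inE => /orP[/eqP->|yt] Ny; last by apply: rP => //; right; exists y.
    by case: Ny; split=> //; left.
  have [r' r'P] := fac_fin fac Ex x0; exists (r' ++ r) => v Vv; rewrite mem_cat.
  case=> [vf|[y]]; first by rewrite (rP v Vv) ?orbT //; left.
  rewrite inE => /orP[/eqP->|yt] Ny; last by rewrite (rP v Vv) ?orbT //; right; exists y.
  by rewrite (r'P v Vv (val_not_vring (open_div Vv) Ex x0 Ny)).
have mD v : open_vals v -> v \notin r -> mult D v = 0.
  move=> Vv vr'.
  have sub : forall x, x \in t -> vr v x.
    by move=> x xt; apply: contra_notP (negP vr') => Nx; apply: rP => //; right; exists x.
  have Xv := open_pts Vv; have Uv : U (vr v) by exact: tU.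
  have := (pts_unit_div Xv (nz_ffield D Xv) Ef (nzvalP _) f0).1 (HU _ Uv) v (or_introl Vv)
    (@subset_refl _ _).
  rewrite /mult => ->; apply/eqP; apply: contraNT vr' => vf; apply: rP => //; by left.
pose r1 := [seq v <- undup r | `[< open_vals v >]].
have [||y [Ey y0 yv _]] := fac_realize_seq fac (mult D) (s := r1).
- by rewrite filter_uniq ?undup_uniq.
- by move=> v; rewrite mem_filter => /andP[/asboolP].
exists y; split=> // v Vv; rewrite yv // mem_filter mem_undup (asboolT Vv) /=.
by case: ifPn => // /(mD v Vv).
Qed.

Definition chart_gens s : seq K := [seq pv s (RR brK q.1.1 q.1.2 q.2.1 q.2.2) |
  q : ('I_n * 'I_n) * ('I_n * 'I_n) <-
    [seq q : ('I_n * 'I_n) * ('I_n * 'I_n) <- enum {: ('I_n * 'I_n) * ('I_n * 'I_n)} | sorted4 m0 q.1.1 q.1.2 q.2.1 q.2.2]].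
Lemma chart_gens_chart s : [set` chart_gens s] `<=` chart s.
Proof.
move=> _ /= /mapP[q + ->]; rewrite mem_filter => /andP[S _].
exact: chart_RR.
Qed.
Lemma chart_gens_min s L : is_subring L -> (forall c, L (ratC n c)) ->
  [set` chart_gens s] `<=` L -> chart s `<=` L.
Proof.
move=> sL Lc sub; apply: chart_min => // a b c d S; apply: sub; apply/mapP; move: (S); rewrite /sorted4 => S'.
have [an bn cn dn] : [/\ a < n, b < n, c < n & d < n]%N by split; lia.
exists ((Ordinal an, Ordinal bn), (Ordinal cn, Ordinal dn)) => //.
by rewrite mem_filter mem_enum andbT; exact: S.
Qed.
Lemma chart_gens_sub s O : M0nbar_pts O -> [set` chart_gens s] `<=` O -> chart s `<=` O.
Proof. by move=> /ptsP_M0n[[sO _] Oc _ _]; exact: chart_gens_min. Qed.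
Lemma chart_affine s : affine_open (@ratC k n) (pts X) (chart s).
Proof.
split; last by move=> O; exact: chart_pts.
exists (chart_gens s); apply/seteqP; split.
  by apply: chart_gens_min; [exact: gen_subring|exact: gen_const|exact: gen_mem].
by apply: gen_sub; [exact: chart_subring|exact: chart_const|exact: chart_gens_chart].
Qed.

Definition chart_of O : 'S_n :=
  if pselect (exists s, chart s `<=` O) is left e then sval (cid e) else 1%g.
Lemma chart_ofP O : M0nbar_pts O -> chart (chart_of O) `<=` O.
Proof.
move=> XO; rewrite /chart_of; case: pselect => [e|[]]; last exact: pts_chart_exists.
exact: (svalP (cid e)).
Qed.

(** An equation on the chart [s] of the boundary divisor with multiplicities [b]. *)
Definition loc_eq b s : K := \prod_c cu s c ^ b (cval s c).
Lemma loc_eqP b s : [/\ ffield (loc_eq b s), loc_eq b s != 0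
  & forall v, divval ffield v -> v (loc_eq b s) = \sum_c b (cval s c) * v (cu s c)].
Proof. by apply: (val_prod sE) => c; [exact: cu_ffield|exact: cu_neq0]. Qed.
Lemma open_cu v s c : open_vals v -> v (cu s c) = 0.
Proof. by move=> Vv; have [e be ->] := cu_mon k s c; exact: cr_ring_unit_mon. Qed.
Lemma loc_eq_open b s v : open_vals v -> v (loc_eq b s) = 0.
Proof.
move=> Vv; have [_ _ ->] := loc_eqP b s; last exact: open_div.
by rewrite big1 // => c _; rewrite open_cu ?mulr0.
Qed.
Lemma loc_eq_bdry b s v : bdry_vals v -> chart s `<=` vr v -> v (loc_eq b s) = b v.
Proof.
move=> Bv sub; have [c0 ->] := bdry_chart Bv sub.
have [_ _ ->] := loc_eqP b s; last exact: cval_div.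
under eq_bigr do rewrite cval_u eq_sym.
rewrite (bigD1 c0) //= eqxx mulr1 big1 ?addr0 // => c /negPf ->.
by rewrite mulr0.
Qed.
(** The chart through each point is an arbitrary choice; at a point of two charts the two equations
    differ by a unit, having the same orders along all divisors through the point. *)
Definition bdry_fun b : set K -> nonzero K := fun O =>
  Nonzero (let: And3 _ H _ := loc_eqP b (chart_of O) in H).
Fact bdry_fun_cartier b : bdry_fun b \in cartier X.
Proof.
apply/asboolP => O XO; have [EO O0 _] := loc_eqP b (chart_of O).
split; first by rewrite funfieldE.
exists [set O' | M0nbar_pts O' /\ chart (chart_of O) `<=` O']; split.
- split=> [O' []//|O' [XO' sub]]; exists (chart_gens (chart_of O)); split.
    exact: subset_trans (@chart_gens_chart _) sub.
  by move=> O'' XO'' sub'; split=> //; exact: chart_gens_sub.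
- by split=> //; exact: chart_ofP.
move=> O' [XO' sub]; have [EO' O'0 _] := loc_eqP b (chart_of O'); rewrite /bdry_fun /=.
apply/(pts_unit_div XO' EO' EO O'0 O0) => v Vv Ov.
case: Vv => Vv; first exact: etrans (loc_eq_open b _ Vv) (esym (loc_eq_open b _ Vv)).
exact: etrans (loc_eq_bdry b Vv (subset_trans (chart_ofP XO') Ov))
  (esym (loc_eq_bdry b Vv (subset_trans sub Ov))).
Qed.
Definition bdry_divisor b : cartier_div X := CartierDiv (bdry_fun_cartier b).
Lemma mult_bdry b v : bdry_vals v -> mult (bdry_divisor b) v = b v.
Proof.
move=> Bv; rewrite /mult /= loc_eq_bdry //; exact: chart_ofP (bdry_pts Bv).
Qed.
Lemma mult_open b v : open_vals v -> mult (bdry_divisor b) v = 0.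
Proof. by move=> Vv; rewrite /mult /= loc_eq_open. Qed.

Local Notation cls D := (\pi_({ideal_quot principal X})%qT D).
Lemma cls_eq (D E : cartier_div X) : cls D = cls E <->
  exists f, [/\ ffield f, f != 0 & forall v, div_vals v -> mult D v = mult E v + v f].
Proof.
split=> [/eqP|[f [Ef f0 fv]]].
  rewrite -Quotient.idealrBE => /principal_mult[f [Ef f0 fv]]; exists f; split=> // v Vv.
  by rewrite -fv // multB // addrC subrK.
apply/eqP; rewrite -Quotient.idealrBE; apply/principal_mult; exists f; split=> // v Vv.
by rewrite multB // fv // addrC addKr.
Qed.
Definition bcls b : Pic X := cls (bdry_divisor b).
(** Subtracting the function that represents the divisor on the open part leaves multiplicities on
    the boundary only. *)
Lemma bcls_surj (x : Pic X) : exists b, x = bcls b.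
Proof.
elim/quotW: x => D; have [y [Ey y0 yv]] := open_mult D.
exists (fun v => mult D v - v y); apply/cls_eq; exists y; split=> // v Vv.
case: (Vv) => Hv; last by rewrite mult_bdry // subrK.
by rewrite mult_open // add0r yv.
Qed.
(** A function whose divisor is supported on the boundary is a unit of the open part, hence a
    monomial up to a constant. *)
Lemma bcls_eq b b' : bcls b = bcls b' <->
  exists2 e, balanced e & forall v, bdry_vals v -> b v = b' v + v (mon brK e).
Proof.
split=> [/cls_eq[f [Ef f0 fv]]|[e be ev]]; last first.
  apply/cls_eq; exists (mon brK e); split; [exact: ffield_mon|exact/mon_neq0/brK_neq0|].
  move=> v [Vv|Vv]; last by rewrite !mult_bdry // ev.
  by rewrite !mult_open // cr_ring_unit_mon.
have [|c [e [c0 be fE]]] := unit_mon Ef f0.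
  by move=> v Vv; have := fv v (or_introl Vv); rewrite !mult_open // add0r.
exists e => // v Bv; have := fv v (or_intror Bv); rewrite !mult_bdry // => ->.
congr (_ + _); have dv := bdry_div Bv; rewrite fE (divvalM dv).
- have [[sO _] Oc _ _] := ptsP_M0n (bdry_pts Bv).
  have c0' : ratC n c != 0 by rewrite fmorph_eq0.
  by rewrite (val_unit_const sE dv (Oc c) _ c0') ?add0r // -fmorphV; exact: Oc.
- exact: ffield_const.
- exact: ffield_mon.
- by rewrite fmorph_eq0.
exact/mon_neq0/brK_neq0.
Qed.
Lemma bcls_ext b b' : (forall v, bdry_vals v -> b v = b' v) -> bcls b = bcls b'.
Proof.
move=> E; apply/bcls_eq; exists (fun=> 0).
  by move=> i; rewrite /degree big1.
by move=> v Bv; rewrite E // mon0 (divval1 sE (bdry_div Bv)) addr0.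
Qed.
Lemma bclsB b b' : bcls (fun v => b v - b' v) = bcls b - bcls b'.
Proof.
rewrite /bcls -[RHS]raddfB; apply/cls_eq; exists 1; split; [exact: subfield1|exact: oner_neq0|].
move=> v Vv; rewrite (divval1 sE (div_div Vv)) addr0 multB //.
by case: Vv => Vv; [rewrite !(mult_open _ Vv) subrr|rewrite !(mult_bdry _ Vv)].
Qed.
Lemma bcls_act g b : pic_act (M0nbar_aut k g) (bcls b) = bcls (fun v => b (v \o pv g)).
Proof.
rewrite /bcls pic_act_pi; apply/cls_eq; exists 1; split; [exact: subfield1|exact: oner_neq0|].
move=> v Vv; rewrite (divval1 sE (div_div Vv)) addr0.
have -> : mult (aut_cartier (M0nbar_aut k g) (bdry_divisor b)) v =
    mult (bdry_divisor b) (v \o pv g).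
  by rewrite /mult -vr_pv.
case: Vv => Vv.
  transitivity (0 : int); first exact: (mult_open b (open_vals_stable g Vv)).
  exact: (esym (mult_open (fun v0 => b (v0 \o pv g)) Vv)).
transitivity (b (v \o pv g)); first exact: (mult_bdry b (bdry_pv g Vv)).
exact: (esym (mult_bdry (fun v0 => b (v0 \o pv g)) Vv)).
Qed.
End PicardGroup.

(** * Cohomology of the Klein group *)

(** Built orbit by orbit. A free orbit is cut into {v, s v} and {t v, s (t v)}: [mu] is 0 on the
    half of the chosen representative and [- th] on the other. Where s (t v) = v, the two conditions
    force [mu = - th / 2], whence the parity hypothesis. On the other orbits [th] vanishes, and so
    does [mu]. *)
Lemma klein_split (V : choiceType) (s t : V -> V) (th : V -> int) :
  involutive s -> involutive t -> (forall v, s (t v) = t (s v)) ->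
  (forall v, th (s v) = - th v) -> (forall v, th (t v) = - th v) ->
  (forall v, s (t v) = v -> (2 %| th v)%Z) ->
  exists mu : V -> int, [/\ forall v, mu (s v) = - mu v, forall v, mu (t v) - mu v = th v
    & forall v, th v = 0 -> mu v = 0].
Proof.
move=> sK tK st ths tht even_th.
pose orb v w := w \in [:: v; s v; t v; s (t v)].
pose rep v := choose (orb v) v.
have orb_refl v : orb v v by rewrite /orb inE eqxx.
have orbs v : orb (s v) =1 orb v.
  move=> w; rewrite /orb !inE sK -!st sK.
  by case: (w == v); case: (w == s v); case: (w == t v); case: (w == s (t v)).
have orbt v : orb (t v) =1 orb v.
  move=> w; rewrite /orb !inE tK.
  by case: (w == v); case: (w == s v); case: (w == t v); case: (w == s (t v)).
have reps v : rep (s v) = rep v.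
  rewrite /rep (eq_choose (orbs v)); apply: choose_id => //.
  by rewrite /orb !inE eqxx orbT.
have rept v : rep (t v) = rep v.
  rewrite /rep (eq_choose (orbt v)); apply: choose_id => //.
  by rewrite /orb !inE eqxx !orbT.
have rep_orb v : orb v (rep v) by exact: chooseP.
pose low v := (v == rep v) || (v == s (rep v)).
pose mu v : int := if s (t v) == v then - (th v %/ 2)%Z else if low v then 0 else - th v.
have mu0 v : th v = 0 -> mu v = 0.
  by move=> v0; rewrite /mu v0 div0z oppr0; case: ifP => //; case: ifP.
have lows v : low (s v) = low v.
  by rewrite /low reps -(inj_eq (inv_inj sK)) sK (inj_eq (inv_inj sK)) orbC.
have lowt v : th v != 0 -> s (t v) != v -> low (t v) = ~~ low v.
  move=> v0 stv; rewrite /low rept.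
  have tv : t v != v by apply: contraNneq v0 => tv; have := tht v; rewrite tv; lia.
  have sv : s v != v by apply: contraNneq v0 => sv; have := ths v; rewrite sv; lia.
  have tsv : t v != s v by apply: contraNneq stv => ->; rewrite sK.
  have := rep_orb v; rewrite /orb !inE => /or4P[] /eqP ->; rewrite ?sK ?eqxx ?orbT /=.
  - by rewrite (negPf tv) (negPf tsv).
  - by rewrite (negPf tv) (negPf tsv).
  - by rewrite (eq_sym v) (negPf tv) (eq_sym v) (negPf stv).
  by rewrite (eq_sym v) (negPf stv) (eq_sym v) (negPf tv).
exists mu; split=> // v.
- have [v0|v0] := eqVneq (th v) 0; first by rewrite !mu0 ?ths ?v0 ?oppr0.
  rewrite /mu -st (inj_eq (inv_inj sK)) lows ths; case: ifP => [/eqP/even_th|_]; last by case: ifP; rewrite ?oppr0.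
  by move/dvdzP => [q ->]; rewrite -mulNr !mulzK.
have [v0|v0] := eqVneq (th v) 0; first by rewrite !mu0 ?tht ?v0 ?oppr0 ?subr0.
have E : (s (t (t v)) == t v) = (s (t v) == v) by rewrite tK -(inj_eq (inv_inj sK)) sK eq_sym.
rewrite /mu E tht; case: ifPn => [/eqP/even_th/dvdzP[q ->]|stv].
  by rewrite -mulNr !mulzK //; lia.
by rewrite lowt //; case: (low v) => /=; lia.
Qed.

(** Integer-valued functions on a G-set have no first cohomology. The sum [W] of the cocycle over
    the group satisfies W (h x) = W x - |G| c_h (x), so rounding W / |G| down splits the cocycle
    exactly, up to sign. *)
Lemma floor_splitting (gT : finGroupType) (X : Type) (act : gT -> X -> X) (c : gT -> X -> int) :
  (forall g h x, c (g * h)%g x = c g (act h x) + c h x) ->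
  exists V : X -> int, forall g x, c g x = V (act g x) - V x.
Proof.
move=> cM; pose W x := \sum_g c g x.
have N0 : #|gT|%:Z != 0 by rewrite -lt0n; apply/card_gt0P; exists 1%g.
have WE h x : W (act h x) = - c h x * #|gT|%:Z + W x.
  rewrite /W [in RHS](reindex_inj (mulIg h)) /=.
  under [in RHS]eq_bigr do rewrite cM.
  rewrite [in RHS]big_split /= sumr_const -mulr_natr natz; ring.
exists (fun x => - (W x %/ #|gT|%:Z)%Z) => g x.
by rewrite WE divzMDl //; lia.
Qed.

Section CocycleShift.
Variables (gT : finGroupType) (M : zmodType) (act : gT -> {additive M -> M}).
Hypothesis actM : forall g h x, act (g * h)%g x = act h (act g x).
Lemma cocycle_shift (c : gT -> M) y : (forall g h, c (g * h)%g = act h (c g) + c h) ->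
  forall g h, c (g * h)%g - (act (g * h)%g y - y) = act h (c g - (act g y - y)) + (c h - (act h y - y)).
Proof.
move=> cM g h; rewrite cM actM [act h (c g - _)]raddfB [act h (act g y - y)]raddfB.
have E : act h (act g y) - act h y + (act h y - y) = act h (act g y) - y by rewrite addrA subrK.
by rewrite [RHS]addrACA -opprD E.
Qed.
Lemma cocycle_unshift g (z x y : M) : z - (act g y - y) = act g x - x ->
  z = act g (x + y) - (x + y).
Proof. by move=> E; rewrite raddfD -[LHS](subrK (act g y - y)) E opprD addrACA. Qed.
End CocycleShift.

Section H1Order2.
Variables (gT : finGroupType) (M : zmodType) (act : gT -> {additive M -> M}).
Local Notation cob := (@coboundary gT M act).
Hypothesis nontrivial : exists c0 : cocycles act, c0 \notin cob.
Hypothesis index2 : forall c e : cocycles act, c \notin cob -> e \notin cob ->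
  c - e \in cob.
Local Notation cls c := (\pi_({ideal_quot cob})%qT c).

Lemma cls_eq0 (c : cocycles act) : (cls c == 0 :> H1 act) = (c \in cob).
Proof. by rewrite -(raddf0 (\pi_({ideal_quot cob})%qT)) -Quotient.idealrBE subr0. Qed.

Definition H1_sign (x : H1 act) : 'Z_2 := (x != 0)%:R.
Lemma H1_sub (x y : H1 act) : x != 0 -> y != 0 -> x - y = 0.
Proof.
elim/quotW: x => c; elim/quotW: y => e; rewrite !cls_eq0 => Nc Ne.
by apply/eqP; rewrite -raddfB cls_eq0; exact: index2.
Qed.
Fact H1_sign_zmod : zmod_morphism H1_sign.
Proof.
move=> x y; rewrite /H1_sign.
have [->|x0] := eqVneq x 0; have [->|y0] := eqVneq y 0.
- by rewrite subr0 eqxx subrr.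
- by rewrite sub0r oppr_eq0 y0 /=; apply/val_inj.
- by rewrite !subr0 x0.
by rewrite H1_sub // eqxx subrr.
Qed.
HB.instance Definition _ := GRing.isZmodMorphism.Build _ _ H1_sign H1_sign_zmod.

Lemma H1_bij : exists f : {additive H1 act -> 'Z_2}, bijective f.
Proof.
have [c0 Nc0] := nontrivial; exists H1_sign.
have nz : (cls c0 : H1 act) != 0 by rewrite cls_eq0.
have sE x : (H1_sign x == 0) = (x == 0) by rewrite /H1_sign; case: (eqVneq x 0).
exists (fun z : 'Z_2 => if z == 0 then 0 else cls c0 : H1 act) => [x|z].
  rewrite -[X in X == 0]/(H1_sign x) sE; have [->//|x0] := eqVneq x 0.
  by apply/esym/eqP; rewrite -subr_eq0; apply/eqP/H1_sub.
rewrite -[LHS]/(H1_sign _); have [->|z0] := eqVneq z 0; first by apply/eqP; rewrite sE.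
by rewrite /H1_sign nz; apply/val_inj; case: z z0 => -[|[|z]].
Qed.
End H1Order2.

Section KleinGroup.
Variables (gT : finGroupType) (s t : gT).
Hypotheses (s2 : (s * s = 1)%g) (t2 : (t * t = 1)%g) (st : (s * t = t * s)%g).
Hypotheses (s1 : s != 1%g) (t1 : t != 1%g) (neq_st : s != t).
Definition klein_set : {set gT} := [set 1%g; s; t; (s * t)%g].
Fact klein_group_set : group_set klein_set.
Proof.
have tst : (t * (s * t) = s)%g by rewrite st mulgA t2 mul1g.
have sst : (s * (s * t) = t)%g by rewrite mulgA s2 mul1g.
have sts : (s * t * s = t)%g by rewrite -mulgA -st sst.
have stt : (s * t * t = s)%g by rewrite -mulgA t2 mulg1.
have stst : (s * t * (s * t) = 1)%g by rewrite -mulgA tst s2.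
apply/group_setP; split; first by rewrite !inE eqxx.
move=> x y; rewrite !inE -!orbA => /or4P[] /eqP -> /or4P[] /eqP ->;
  by rewrite ?mul1g ?mulg1 ?s2 ?t2 -?st ?tst ?sst ?sts ?stt ?stst ?eqxx ?orbT.
Qed.
Definition klein : {group gT} := Group klein_group_set.
Lemma klein_cases g : g \in klein -> [\/ g = 1%g, g = s, g = t | g = (s * t)%g].
Proof. by rewrite !inE -!orbA => /or4P[] /eqP ->; [constructor 1|constructor 2|constructor 3|constructor 4]. Qed.
Lemma klein_s : s \in klein. Proof. by rewrite !inE eqxx orbT. Qed.
Lemma klein_t : t \in klein. Proof. by rewrite !inE eqxx !orbT. Qed.
Lemma neq_st1 : (s * t)%g != 1%g.
Proof. by apply: contra_neq neq_st => E; rewrite -[s]mulg1 -t2 mulgA E mul1g. Qed.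
Lemma neq_sts : (s * t)%g != s.
Proof. by apply: contra_neq t1 => E; apply: (mulgI s); rewrite E mulg1. Qed.
Lemma neq_stt : (s * t)%g != t.
Proof. by apply: contra_neq s1 => E; apply: (mulIg t); rewrite E mul1g. Qed.
Lemma card_klein : #|klein| = 4%N.
Proof.
have U : uniq [:: 1%g; s; t; (s * t)%g].
  rewrite /= !inE !negb_or !(eq_sym 1%g) s1 t1 neq_st1 neq_st !(eq_sym _ (s * t)%g).
  by rewrite neq_sts neq_stt.
by rewrite -[4%N]/(size [:: 1%g; s; t; (s * t)%g]) -(card_uniqP U);
  apply: eq_card => x; rewrite !inE -!orbA.
Qed.
Lemma klein_abelem : (2.-abelem klein)%g.
Proof.
rewrite abelemE //; apply/andP; split.
  apply/centsP => x /klein_cases Hx y /klein_cases Hy; rewrite /commute.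
  case: Hx => ->; case: Hy => ->; rewrite ?mul1g ?mulg1 -?st //.
  - by rewrite -mulgA -st.
  - by rewrite st -!mulgA st.
  - by rewrite -mulgA -st.
  by rewrite {1}st -mulgA.
apply/exponentP => x /klein_cases[] ->; rewrite expgS expg1 ?mulg1 //.
by rewrite -mulgA (mulgA t) -st -mulgA t2 mulg1.
Qed.
Lemma Z2Z2_abelem : (2.-abelem [set: 'Z_2 * 'Z_2]%SET)%g.
Proof.
rewrite abelemE //; apply/andP; split.
  by apply/centsP => -[a b] _ [c d] _; rewrite /commute; congr pair; exact: addrC.
by apply/exponentP => -[a b] _; apply/eqP; move: a b; do 2![case; case=> [|[|?]] ?].
Qed.
Lemma klein_isog : (klein \isog [set: 'Z_2 * 'Z_2]%SET)%g.
Proof.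
have := isog_abelem_card [set: 'Z_2 * 'Z_2]%G klein_abelem.
by rewrite Z2Z2_abelem card_klein cardsT card_prod !card_ord eqxx => ->.
Qed.

Section Crossed.
Variables (M : zmodType) (act : gT -> {additive M -> M}).
Hypothesis act1 : forall x, act 1%g x = x.
Hypothesis actM : forall g h x, act (g * h)%g x = act h (act g x).
Variables cs ct : M.
Hypotheses (cs0 : act s cs + cs = 0) (ct0 : act t ct + ct = 0).
Hypothesis cst : act t cs + ct = act s ct + cs.
(** The cocycle with prescribed values on the two generators; [cs0], [ct0] and [cst] express the
    relations s^2 = 1, t^2 = 1 and s t = t s. *)
Definition klein_cocycle (g : gT) : M :=
  if g == s then cs else if g == t then ct else if g == (s * t)%g then act t cs + ct else 0.
Lemma klein_cocycleE : [/\ klein_cocycle 1%g = 0, klein_cocycle s = cs, klein_cocycle t = ct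
  & klein_cocycle (s * t)%g = act t cs + ct].
Proof.
rewrite /klein_cocycle !eqxx !(eq_sym 1%g) (eq_sym t s) (negPf s1) (negPf t1) (negPf neq_st1).
by rewrite (negPf neq_sts) (negPf neq_stt) (negPf neq_st).
Qed.
Lemma klein_cocycleP g h : g \in klein -> h \in klein ->
  klein_cocycle (g * h)%g = act h (klein_cocycle g) + klein_cocycle h.
Proof.
have [e1 es et est] := klein_cocycleE.
have tst : (t * (s * t) = s)%g by rewrite st mulgA t2 mul1g.
have sst : (s * (s * t) = t)%g by rewrite mulgA s2 mul1g.
have sts : (s * t * s = t)%g by rewrite -mulgA -st sst.
have stt : (s * t * t = s)%g by rewrite -mulgA t2 mulg1.
have stst : (s * t * (s * t) = 1)%g by rewrite -mulgA tst s2.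
have ass x : act s (act s x) = x by rewrite -actM s2 act1.
have att x : act t (act t x) = x by rewrite -actM t2 act1.
have ats x : act s (act t x) = act t (act s x) by rewrite -!actM st.
have ics : act s cs = - cs by apply/eqP; rewrite -addr_eq0 cs0.
have ict : act t ct = - ct by apply/eqP; rewrite -addr_eq0 ct0.
have ict' : act s ct = act t cs + ct - cs by rewrite cst addrK.
have asu : act s (act t cs) = - act t cs by rewrite ats ics raddfN.
have asum : act s (act t cs + ct) = ct - cs by rewrite raddfD asu ict' -!addrA addKr.
move=> /klein_cases[]-> /klein_cases[]->; rewrite ?mul1g ?mulg1 ?e1 ?es ?et ?est ?raddf0 ?add0r ?act1 ?addr0 //.
- by rewrite s2 e1 cs0.
- by rewrite sst et actM ics raddfN addrA addNr add0r.
- by rewrite -st est cst.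
- by rewrite t2 e1 ct0.
- by rewrite tst es actM ict' raddfB raddfD att ict -[cs - ct - _]addrA -opprD (addrC ct) subrK.
- by rewrite sts et asum subrK.
- by rewrite stt es raddfD att ict subrK.
by rewrite stst e1 actM asum raddfB ict -opprD (addrC ct) addNr.
Qed.
End Crossed.
End KleinGroup.

(** * The degree of a class and of a cocycle *)

Section Degree.
Variables (k : fieldType) (m0 : nat).
Hypothesis m0_gt1 : (1 < m0)%N.
Local Notation n := m0.+4.
Local Notation K := (ratfun k n).
Local Notation X := (M0nbar k n).
Local Notation brK := (@brK k m0).
Local Notation bdry_vals := (@bdry_vals k m0).
Local Notation pv := (@pv k m0).
Local Notation cval := (@cval k m0).
Local Notation bcls := (@bcls k m0).
Implicit Types (s : 'S_n) (v : K -> int) (b : (K -> int) -> int) (e : 'I_n * 'I_n -> int).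

Let chord02 : chord m0 (inord 0 : 'I_n) (inord 2 : 'I_n).
Proof. by rewrite /chord !inordK //; lia. Qed.
(** The chord cutting off the points 1 and 2; permutations move its divisor to those where any two
    given points collide. *)
Definition c02 : chordT m0 := exist _ (inord 0, inord 2) chord02.
Lemma inside_c02 (x : 'I_n) : inside c02 x = (x == inord 1) || (x == inord 2).
Proof. by rewrite /inside /= -!val_eqE /= !inordK //; lia. Qed.
Definition pair_perm (i j : 'I_n) : 'S_n :=
  (tperm (inord 1) i * tperm (tperm (inord 1) i (inord 2)) j)%g.
Lemma pair_permP i j : i != j -> pair_perm i j (inord 1) = i /\ pair_perm i j (inord 2) = j.
Proof.
move=> ij; have p12 : (inord 1 : 'I_n) != inord 2 by rewrite -val_eqE /= !inordK.
rewrite /pair_perm !permM tpermL; split; last by rewrite tpermL.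
apply: tpermD; last by rewrite eq_sym.
by rewrite -[X in _ != X](tpermL (inord 1) i) (inj_eq perm_inj) eq_sym.
Qed.
Lemma ev_mon_subproof i j e : i != j -> balanced e ->
  cval (pair_perm i j) c02 (mon brK e) = e (i, j) + e (j, i).
Proof.
move=> ij be; rewrite cval_mon //; have [s1 s2] := pair_permP ij; set s := pair_perm i j in s1 s2 *.
have inE' x : inside c02 (s^-1%g x) = (x == i) || (x == j).
  by rewrite inside_c02 -s1 -s2 -!(inj_eq (@perm_inj _ s) (s^-1%g x)) !permKV.
under eq_bigr do rewrite !inE'.
rewrite (bigD1 (i, j)) //= (bigD1 (j, i)) /=; last by rewrite eq_sym ij xpair_eqE (negPf ij) andbF.
rewrite !eqxx !orbT !mulr1 big1 ?addr0 // => -[x y] /= /andP[/andP[xy]].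
rewrite !xpair_eqE => N1 N2.
have [xi|xi] := eqVneq x i; have [xj|xj] := eqVneq x j; have [yi|yi] := eqVneq y i;
  have [yj|yj] := eqVneq y j; rewrite ?mulr0 //;
  move: N1 N2 xy; rewrite ?xi ?xj ?yi ?yj ?eqxx ?(negPf ij) ?(eq_sym j) ?(negPf ij) //=.
Qed.
Lemma ev_exists : exists f : 'I_n -> 'I_n -> K -> int, (forall i j, bdry_vals (f i j)) /\
  forall i j e, i != j -> balanced e -> f i j (mon brK e) = e (i, j) + e (j, i).
Proof.
exists (fun i j => cval (pair_perm i j) c02); split; last exact: ev_mon_subproof.
by move=> i j; exists (pair_perm i j), c02.
Qed.
(** The order along the boundary divisor D_ij where just the points i and j collide. *)
Definition ev i j : K -> int := sval (cid ev_exists) i j.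
Lemma ev_bdry i j : bdry_vals (ev i j). Proof. by have [H _] := svalP (cid ev_exists); exact: H. Qed.
Lemma ev_mon i j e : i != j -> balanced e -> ev i j (mon brK e) = e (i, j) + e (j, i).
Proof. by have [_ H] := svalP (cid ev_exists); exact: H. Qed.
Lemma ev_pv i j (g : 'S_n) : i != j -> ev i j \o pv g = ev (g^-1%g i) (g^-1%g j).
Proof.
move=> ij; have gij : g^-1%g i != g^-1%g j by rewrite (inj_eq perm_inj).
apply: bdry_mon_eq; [exact: bdry_pv (ev_bdry i j)|exact: ev_bdry|].
move=> e be; rewrite ev_mon // -[LHS]/(ev i j (pv g (mon brK e))) pv_mon ev_mon //.
exact: balanced_perm.
Qed.
Lemma ev_sym i j : i != j -> ev i j = ev j i.
Proof.
move=> ij; apply: bdry_mon_eq; [exact: ev_bdry|exact: ev_bdry|].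
by move=> e be; rewrite !ev_mon // 1?addrC // eq_sym.
Qed.
Lemma ev_inj i j i' j' : i != j -> i' != j' -> ev i j = ev i' j' ->
  (i = i' /\ j = j') \/ (i = j' /\ j = i').
Proof.
move=> ij ij' E.
(* Two further points exist because n is at least 6. The cross-ratio of i, x, j, y has order 1 along
   D_ij, and order 0 along the divisor of the pair i', j' unless the two pairs agree. *)
have [x [y [U1 U2]]] : exists x y, uniq [:: i; x; j; y] /\
    [/\ x != i', x != j', y != i' & y != j'].
  have fresh (l : seq 'I_n) : (size l < n)%N -> exists x, x \notin l.
    move=> sl; apply/existsP; rewrite -[[exists _, _]]negbK negb_exists; apply/negP => /forallP H.
    have := subset_leq_card (_ : [set: 'I_n]%SET \subset l); rewrite cardsT card_ord => /(_ _)/leq_trans => H'.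
    have : (n <= size l)%N by apply: H' (card_size l); apply/fintype.subsetP => x _; rewrite -[_ \in _]negbK.
    by rewrite leqNgt sl.
  have [|x] := fresh [:: i; j; i'; j']; first by rewrite /=; lia.
  rewrite !inE !negb_or => /and4P[xi xj xi' xj'].
  have [|y] := fresh [:: i; j; i'; j'; x]; first by rewrite /=; lia.
  rewrite !inE !negb_or => /and5P[yi yj yi' yj' yx].
  exists x, y; split; last by split.
  by rewrite /= !inE !negb_or ij !(eq_sym i) xi yi xj (eq_sym x) yx (eq_sym j) yj.
have be := balanced_cr U1.
have H : cr_exp (i, x, j, y) (i', j') + cr_exp (i, x, j, y) (j', i') =
    cr_exp (i, x, j, y) (i, j) + cr_exp (i, x, j, y) (j, i).
  exact: etrans (esym (ev_mon ij' be)) (etrans (esym (congr1 (fun v => v _) E)) (ev_mon ij be)).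
move: H U2; rewrite /cr_exp /edge !xpair_eqE => + [xi' xj' yi' yj'].
rewrite !(eq_sym _ x) !(eq_sym _ y) (negPf xi') (negPf xj') (negPf yi') (negPf yj') /=.
move: U1; rewrite /= !inE !negb_or => /and4P[/and3P[ix _ iy] /andP[xj xy] jy _].
rewrite (eq_sym x i) (eq_sym y i) (eq_sym y j) (negPf ix) (negPf xj) (negPf iy) (negPf jy).
rewrite !eqxx (eq_sym j i) (negPf ij) /= ?andbF /=.
have [/andP[/eqP-> /eqP->] _|_] := boolP ((i' == i) && (j' == j)); first by left.
by have [/andP[/eqP-> /eqP->] _|_] := boolP ((j' == i) && (i' == j)); first by right.
Qed.

(** Extends the degree from monomials to boundary divisors: a unit has order [e (i, j) + e (j, i)]
    along D_ij, so its degrees vanish and [deg] is defined on classes. *)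
Definition deg b i : int := \sum_(j | j != i) b (ev i j).
Lemma degB b b' i : deg (fun v => b v - b' v) i = deg b i - deg b' i.
Proof. by rewrite /deg sumrB. Qed.
Definition deg_exp b : 'I_n * 'I_n -> int :=
  fun p => if (p.1 < p.2)%N then b (ev p.1 p.2) else 0.
Lemma deg_exp_edge b i j : i != j -> deg_exp b (i, j) + deg_exp b (j, i) = b (ev i j).
Proof.
rewrite /deg_exp /= -val_eqE /=; case: ltngtP => // ij _; rewrite ?addr0 ?add0r //.
by rewrite ev_sym // -val_eqE /= ltn_eqF.
Qed.
Lemma degree_deg_exp b i : degree (deg_exp b) i = deg b i.
Proof. by apply: eq_bigr => j ji; rewrite deg_exp_edge // eq_sym. Qed.
Lemma deg_even b : (2 %| \sum_i deg b i)%Z.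
Proof.
under eq_bigr do rewrite -degree_deg_exp.
rewrite sum_degree; set S := \sum_(p | _) _.
by rewrite mulr2n; apply/dvdzP; exists S; lia.
Qed.
Lemma deg_eq b b' : bcls b = bcls b' -> deg b = deg b'.
Proof.
move=> /bcls_eq[e be E]; apply/funext => i; rewrite /deg.
rewrite (eq_bigr (fun j => b' (ev i j) + ev i j (mon brK e))) => [|j _]; last exact/E/ev_bdry.
rewrite big_split /= [X in _ + X](_ : _ = 0) ?addr0 // -[RHS](be i).
by apply: eq_bigr => j ji; rewrite ev_mon // eq_sym.
Qed.
Lemma deg_pv b (g : 'S_n) i : deg (fun v => b (v \o pv g)) i = deg b (g^-1%g i).
Proof.
rewrite /deg [RHS](reindex_inj (@perm_inj _ g^-1%g)) /=.
by apply: eq_big => [j|j ji]; [rewrite (inj_eq perm_inj)|rewrite ev_pv // eq_sym].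
Qed.
Definition degP (x : Pic X) : 'I_n -> int := deg (sval (cid (bcls_surj x))).
Lemma degP_cls b : degP (bcls b) = deg b.
Proof. by apply: deg_eq; rewrite -(svalP (cid (bcls_surj (bcls b)))). Qed.
Lemma degPB x y i : degP (x - y) i = degP x i - degP y i.
Proof.
have [[b ->] [b' ->]] := (bcls_surj x, bcls_surj y).
by rewrite -bclsB !degP_cls degB.
Qed.
Lemma degP_act (g : 'S_n) x i : degP (pic_act (M0nbar_aut k g) x) i = degP x (g^-1%g i).
Proof. by have [b ->] := bcls_surj x; rewrite bcls_act !degP_cls deg_pv. Qed.

Definition edge_fun (i j : 'I_n) v : int := `[< v = ev i j >]%:R.
Lemma deg_edge_fun i j l : i != j -> deg (edge_fun i j) l = (l == i)%:R + (l == j)%:R.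
Proof.
move=> ij; rewrite -degree_edge // -(degree_deg_exp (edge_fun i j)).
rewrite degree_deg_exp /degree /deg; apply: eq_bigr => x xl.
rewrite /edge_fun /edge !xpair_eqE; case: asboolP => [/ev_inj|N].
  by rewrite eq_sym => /(_ xl ij)[[-> ->]|[-> ->]]; rewrite !eqxx ?(negPf ij) ?(eq_sym j) ?(negPf ij) /=.
have [/andP[/eqP li /eqP xj]|_] := boolP ((l == i) && (x == j)); first by case: N; rewrite li xj.
have [/andP[/eqP xi /eqP lj]|//] := boolP ((x == i) && (l == j)).
by case: N; rewrite xi lj ev_sym // eq_sym.
Qed.
Lemma deg_surj (V : 'I_n -> int) : (2 %| \sum_i V i)%Z -> exists b, deg b = V.
Proof.
move=> /dvdzP[q qE]; pose o0 : 'I_n := inord 0; pose o1 : 'I_n := inord 1; pose o2 : 'I_n := inord 2.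
have [n01 n02 n12] : [/\ o0 != o1, o0 != o2 & o1 != o2] by split; rewrite -val_eqE /= !inordK; lia.
(* The star at 0 gives the right degree at every other point. The combination 01 + 02 - 12 has
   degree 2 at 0 and 0 elsewhere, and [r] copies of it correct the degree at 0. *)
pose r := V o0 - q.
pose b v := \sum_(i | i != o0) V i * edge_fun o0 i v +
  r * (edge_fun o0 o1 v + edge_fun o0 o2 v - edge_fun o1 o2 v).
exists b; apply/funext => l; rewrite /deg /b big_split /= exchange_big /=.
under eq_bigr do rewrite -mulr_sumr -/(deg (edge_fun o0 _) l).
rewrite -mulr_sumr sumrB big_split /= -!/(deg _ l) !deg_edge_fun //.
under eq_bigr => i i0 do rewrite deg_edge_fun 1?eq_sym // mulrDr.
rewrite big_split /= -mulr_suml.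
have S : \sum_(i | i != o0) V i = q * 2 - V o0 by rewrite -qE [in RHS](bigD1 o0) //= addrAC subrr add0r.
rewrite S; have [->|l0] := eqVneq l o0.
  rewrite big1 ?(negPf n01) ?(negPf n02) /= => [|i i0]; last by rewrite eq_sym (negPf i0) mulr0.
  by rewrite /r; lia.
rewrite (bigD1 l) //= eqxx big1 => [|i /andP[_ il]]; last by rewrite eq_sym (negPf il) mulr0.
by case: (l == o1); case: (l == o2) => /=; lia.
Qed.

Lemma pic_actM (g h : 'S_n) (x : Pic X) :
  pic_act (M0nbar_aut k (g * h)%g) x = pic_act (M0nbar_aut k h) (pic_act (M0nbar_aut k g) x).
Proof.
have [b ->] := bcls_surj x; rewrite !bcls_act; apply: bcls_ext => v _; congr b.
by apply/funext => z; rewrite -[LHS]/(v (pv (g * h)%g z)) pvM.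
Qed.
Lemma degPD x y i : degP (x + y) i = degP x i + degP y i.
Proof.
have E : x + y = x - (0 - y) by rewrite sub0r opprK.
by rewrite E !degPB; have := degPB 0 0 i; rewrite subr0; lia.
Qed.

Section CocycleDegree.
Variables (G : {group 'S_n}) (c : [subg G] -> Pic X).
Hypothesis cM : forall g h : [subg G],
  c (g * h)%g = pic_act (M0nbar_aut k (sgval h)) (c g) + c h.

Lemma cocycle_degree : exists V : 'I_n -> int,
  forall g i, degP (c g) i = V ((sgval g)^-1%g i) - V i.
Proof.
apply: (@floor_splitting _ _ (fun (g : [subg G]) (i : 'I_n) => (sgval g)^-1%g i)
  (fun g i => degP (c g) i)) => g h i.
by rewrite cM degPD degP_act.
Qed.

(** Such a monomial is a product of powers of ratios [brK i j / brK j i], that is, a sign. *)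
Lemma mon_antisym_val v e : bdry_vals v -> balanced e ->
  (forall i j, i != j -> e (i, j) + e (j, i) = 0) -> v (mon brK e) = 0.
Proof.
move=> [s [ch ->]] be eN; rewrite cval_mon //; set S := \sum_(p | _) _.
have SE : S = \sum_(p : 'I_n * 'I_n | p.1 != p.2) e (p.2, p.1) *
    (inside ch (s^-1%g p.1) && inside ch (s^-1%g p.2))%:R.
  have hinj : injective (fun p : 'I_n * 'I_n => (p.2, p.1)) by move=> [x y] [x' y'] [-> ->].
  rewrite /S (reindex_inj hinj) /=; apply: eq_big => [p|p _]; first by rewrite eq_sym.
  by rewrite andbC.
suff : S + S = 0 by lia.
rewrite {2}SE -big_split /= big1 // => -[x y] /= xy.
by rewrite -mulrDl eN // mul0r.
Qed.

(** A class of degree 0 has a representative vanishing on every D_ij, and only one, as a unit of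
    order 0 along all the D_ij has trivial divisor. With these representatives the cocycle identity
    holds for functions on the boundary divisors, where [floor_splitting] applies. *)
Lemma degree0_coboundary : (forall g i, degP (c g) i = 0) ->
  exists x : Pic X, forall g, c g = pic_act (M0nbar_aut k (sgval g)) x - x.
Proof.
move=> c0.
have /choice[b bP] : forall g, exists b, [/\ c g = bcls b, forall i j, i != j -> b (ev i j) = 0
    & forall v, ~ bdry_vals v -> b v = 0].
  move=> g; have [b bE] := bcls_surj (c g).
  have be : balanced (deg_exp b) by move=> i; rewrite degree_deg_exp -degP_cls -bE c0.
  exists (fun v => if `[< bdry_vals v >] then b v - v (mon brK (deg_exp b)) else 0); split.
  - rewrite bE; apply/bcls_eq; exists (deg_exp b) => // v Bv.
    by rewrite (asboolT Bv) subrK.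
  - move=> i j ij; rewrite (asboolT (ev_bdry i j)).
    by rewrite ev_mon // deg_exp_edge // subrr.
  by move=> v Nv; rewrite asboolF.
have bM g h v : b (g * h)%g v = b g (v \o pv (sgval h)) + b h v.
  have [cgh egh bgh] := bP (g * h)%g; have [cg eg bg] := bP g; have [ch eh bh] := bP h.
  have [Bv|Nv] := pselect (bdry_vals v); last first.
    rewrite bgh // bg ?bh ?addr0 // => /(@bdry_pv _ _ (sgval h)^-1%g) H; apply: Nv.
    by move: H; congr bdry_vals; apply/funext => x /=; rewrite pvKV.
  have E : bcls (b (g * h)%g) = bcls (fun v => b g (v \o pv (sgval h)) - (- b h v)).
    rewrite bclsB -bcls_act -cg -cgh cM; congr (_ + _); rewrite ch.
    rewrite -[LHS]subr0 -[LHS]opprB; congr (- _).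
    have -> : (0 : Pic X) = bcls (fun=> 0).
      by rewrite -[LHS](subrr (bcls (fun=> 0))) -bclsB; apply: bcls_ext => ? _; rewrite subr0.
    by rewrite -bclsB; apply: bcls_ext => ? _; rewrite sub0r.
  have [e be Ev] := (bcls_eq _ _).1 E; rewrite Ev // opprK mon_antisym_val ?addr0 // => i j ij.
  have := Ev _ (ev_bdry i j); rewrite egh // ev_pv // eg ?(inj_eq perm_inj) // eh // oppr0 subr0 add0r.
  by rewrite ev_mon.
have [B BE] := @floor_splitting _ _ (fun (g : [subg G]) v => v \o pv (sgval g)) b bM.
exists (bcls B) => g; have [-> _ _] := bP g.
by rewrite bcls_act -bclsB; apply: bcls_ext => v _; rewrite BE.
Qed.

End CocycleDegree.

(** A vector of even sum is the degree of some class; subtracting the coboundary of that class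
    reduces to degree 0. *)
Lemma even_coboundary (G : {group 'S_n}) (c : [subg G] -> Pic X) (V : 'I_n -> int) :
  (forall g h : [subg G], c (g * h)%g = pic_act (M0nbar_aut k (sgval h)) (c g) + c h) ->
  (forall g i, degP (c g) i = V ((sgval g)^-1%g i) - V i) -> (2 %| \sum_i V i)%Z ->
  exists x : Pic X, forall g, c g = pic_act (M0nbar_aut k (sgval g)) x - x.
Proof.
move=> cM cV /deg_surj[b bV]; pose y := bcls b.
have yV i : degP y i = V i by rewrite degP_cls bV.
pose act (g : [subg G]) := @pic_M0nbar_act k n G g.
have actM g h x : act (g * h)%g x = act h (act g x) by exact: pic_actM.
have [||x xE] := @degree0_coboundary G (fun g => c g - (act g y - y)).
- by move=> g h; exact: (@cocycle_shift _ _ act actM c y cM g h).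
- by move=> g i; rewrite !degPB degP_act !yV cV subrr.
by exists (x + y) => g; exact: (cocycle_unshift (act := act) (xE g)).
Qed.
(** [V] and the degree of [x] differ by an invariant vector, and both invariant vectors and degrees
    of classes have even sum. *)
Lemma coboundary_even (G : {group 'S_n}) (c : [subg G] -> Pic X) (V : 'I_n -> int) x :
  (forall W : 'I_n -> int, (forall g i, g \in G -> W (g i) = W i) -> (2 %| \sum_i W i)%Z) ->
  (forall g i, degP (c g) i = V ((sgval g)^-1%g i) - V i) ->
  (forall g, c g = pic_act (M0nbar_aut k (sgval g)) x - x) -> (2 %| \sum_i V i)%Z.
Proof.
move=> GP cV cx.
have E : (2 %| \sum_i (V i - degP x i))%Z.
  apply: GP => g i gG; have := cV (subg G g) (g i); rewrite cx degPB degP_act subgK // permK; lia.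
have [b bx] := bcls_surj x; have := deg_even b; rewrite -degP_cls -bx => D.
by have := rpredD E D; rewrite -big_split /=; under eq_bigr do rewrite subrK.
Qed.
End Degree.

(** * The Klein group acting on the marked points *)

Section KleinAction.
Variable m0 : nat.
Hypotheses (m0_gt1 : (1 < m0)%N) (m0_even : ~~ odd m0).
Local Notation n := m0.+4.
(** Exchanges 2 j and 2 j + 1, so it stays within 0, ..., n-1 when n is even. *)
Definition flip_nat (i : nat) : nat := if odd i then i.-1 else i.+1.
Lemma odd_flip_nat i : odd (flip_nat i) = ~~ odd i.
Proof.
rewrite /flip_nat; case: i => //= j.
by case: (boolP (odd j)) => [oj|/negPf oj] /=; rewrite ?oj.
Qed.
Lemma flip_lt (i : 'I_n) : (flip_nat i < n)%N.
Proof.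
rewrite /flip_nat; have il := ltn_ord i; case: ifP => oi; first by lia.
rewrite ltn_neqAle il andbT; apply/eqP => E; have : odd i.+1 = odd n by rewrite E.
by rewrite /= oi !negbK (negPf m0_even).
Qed.
Definition flip (i : 'I_n) : 'I_n := Ordinal (flip_lt i).
Lemma flipK : involutive flip.
Proof.
move=> i; apply/val_inj; rewrite /= /flip_nat.
case: (boolP (odd i)) => oi; last by rewrite /= oi.
by case: (nat_of_ord i) oi => //= j /negPf->.
Qed.
Definition below4 : pred 'I_n := fun i => (i < 4)%N.
Definition outside23 : pred 'I_n := fun i => (i < 2)%N || (4 <= i)%N.
Lemma below4_flip i : below4 (flip i) = below4 i.
Proof. by rewrite /below4 /= /flip_nat; case: (nat_of_ord i) => [|[|[|[|[|j]]]]] //=; case: ifP; lia. Qed.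
Lemma outside23_flip i : outside23 (flip i) = outside23 i.
Proof.
rewrite /outside23 /= /flip_nat.
by case: (nat_of_ord i) => [|[|[|[|[|j]]]]] //=; case: ifP; lia.
Qed.
Definition part (A : pred 'I_n) (i : 'I_n) : 'I_n := if A i then flip i else i.
Lemma partK A : (forall i, A (flip i) = A i) -> involutive (part A).
Proof. by move=> Af i; have [h|/negPf h] := boolP (A i); rewrite /part h ?Af h ?flipK. Qed.
Lemma part_comm A A' i : (forall i, A (flip i) = A i) -> (forall i, A' (flip i) = A' i) ->
  part A (part A' i) = part A' (part A i).
Proof.
move=> Af Af'; have [h|/negPf h] := boolP (A i); have [h'|/negPf h'] := boolP (A' i);
  by rewrite /part h h' ?Af ?Af' ?h ?h'.
Qed.
(** Both generators are [flip] cut down to a stable set, whence their commutation; the two sets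
    cover all the points, so an invariant vector is constant on the pairs exchanged by [flip]. *)
Definition sg : 'S_n := perm (inv_inj (partK below4_flip)).
Definition tg : 'S_n := perm (inv_inj (partK outside23_flip)).
Lemma sg2 : (sg * sg = 1)%g. Proof. by apply/permP => i; rewrite permM !permE partK //; exact: below4_flip. Qed.
Lemma tg2 : (tg * tg = 1)%g. Proof. by apply/permP => i; rewrite permM !permE partK //; exact: outside23_flip. Qed.
Lemma sgtg : (sg * tg = tg * sg)%g.
Proof. by apply/permP => i; rewrite !permM !permE part_comm //; [exact: outside23_flip|exact: below4_flip]. Qed.
Definition pt_ (i : nat) : 'I_n := inord i.
Lemma pt_E i : (i < 6)%N -> pt_ i = i :> nat. Proof. by move=> i6; rewrite /pt_ inordK; lia. Qed.
Lemma pt_eq_ i j : (i < 6)%N -> (j < 6)%N -> (pt_ i == pt_ j) = (i == j).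
Proof. by move=> i6 j6; rewrite -val_eqE /= !pt_E. Qed.
Lemma sgE i : (i < 6)%N -> sg (pt_ i) = pt_ (if (i < 4)%N then flip_nat i else i).
Proof.
move=> i6; apply/val_inj; rewrite permE /part /below4 pt_E //; case: ifP => i4 /=; rewrite ?pt_E //.
by case: i i4 {i6} => [|[|[|[|]]]].
Qed.
Lemma tgE i : (i < 6)%N -> tg (pt_ i) = pt_ (if (i < 2)%N || (4 <= i)%N then flip_nat i else i).
Proof.
move=> i6; apply/val_inj; rewrite permE /part /outside23 pt_E //; case: ifP => i4 /=; rewrite ?pt_E //.
by case: i i4 i6 => [|[|[|[|[|[|]]]]]].
Qed.
Lemma sg_o : (((sg (pt_ 0) = pt_ 1) * (sg (pt_ 1) = pt_ 0) * (sg (pt_ 2) = pt_ 3)) *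
  ((sg (pt_ 3) = pt_ 2) * (sg (pt_ 4) = pt_ 4) * (sg (pt_ 5) = pt_ 5)))%type.
Proof. by do !split; rewrite sgE. Qed.
Lemma tg_o : (((tg (pt_ 0) = pt_ 1) * (tg (pt_ 1) = pt_ 0) * (tg (pt_ 2) = pt_ 2)) *
  ((tg (pt_ 3) = pt_ 3) * (tg (pt_ 4) = pt_ 5) * (tg (pt_ 5) = pt_ 4)))%type.
Proof. by do !split; rewrite tgE. Qed.
Lemma perm_neq (s t : 'S_n) i : s i != t i -> s != t. Proof. by apply: contra_neq => ->. Qed.
Lemma sg1 : sg != 1%g. Proof. by apply: (perm_neq (i := pt_ 0)); rewrite perm1 sgE // pt_eq_. Qed.
Lemma tg1 : tg != 1%g. Proof. by apply: (perm_neq (i := pt_ 0)); rewrite perm1 tgE // pt_eq_. Qed.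
Lemma sg_neq_tg : sg != tg.
Proof. by apply: (perm_neq (i := pt_ 2)); rewrite sgE // tgE // pt_eq_. Qed.
Definition Gkl : {group 'S_n} := klein sg2 tg2 sgtg.
Lemma flip_inv_even (W : 'I_n -> int) : (forall g i, g \in Gkl -> W (g i) = W i) ->
  (2 %| \sum_i W i)%Z.
Proof.
move=> Wg; have Wf i : W (flip i) = W i.
  have [i4|i4] := ltnP i 4.
    by rewrite -[RHS](Wg sg) ?klein_s // permE /part /below4 i4.
  by rewrite -[RHS](Wg tg) ?klein_t // permE /part /outside23 i4 orbT.
rewrite (bigID (fun i : 'I_n => odd i)) /= [X in _ + X](reindex_inj (inv_inj flipK)) /=.
under [X in _ + X]eq_bigl do rewrite odd_flip_nat negbK.
under [X in _ + X]eq_bigr do rewrite Wf.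
by apply/dvdzP; eexists; set S := \sum_(i | _) _; rewrite [S + S](_ : _ = S * 2); [exact: erefl|lia].
Qed.
End KleinAction.

Lemma addrKA' (x y z : int) : x + y - (z + y) = x - z. Proof. by lia. Qed.
Lemma subrKA' (x y z : int) : x - y + (y - z) = x - z. Proof. by lia. Qed.
Lemma subrACA' (x y z t : int) : x - y - (z - t) = x - z - (y - t). Proof. by lia. Qed.
Lemma odd_sub (x y : int) : ~~ (2 %| x)%Z -> ~~ (2 %| y)%Z -> (2 %| x - y)%Z. Proof. by lia. Qed.

(** * The nontrivial class *)

Section OddClass.
Variables (k : fieldType) (m0 : nat).
Hypotheses (m0_gt1 : (1 < m0)%N) (m0_even : ~~ odd m0).
Local Notation n := m0.+4.
Local Notation K := (ratfun k n).
Local Notation X := (M0nbar k n).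
Local Notation brK := (@brK k m0).
Local Notation bdry_vals := (@bdry_vals k m0).
Local Notation pv := (@pv k m0).
Local Notation bcls := (@bcls k m0).
Local Notation sg := (sg m0_gt1 m0_even).
Local Notation tg := (tg m0_gt1 m0_even).
Local Notation G := (Gkl m0_gt1 m0_even).
Local Notation o := (pt_ m0).
Local Notation ev := (@ev k m0 m0_gt1).
Local Notation edge_fun := (@edge_fun k m0 m0_gt1).
Local Notation degP := (@degP k m0 m0_gt1).
Local Notation deg := (@deg k m0 m0_gt1).
Implicit Types (v : K -> int) (b : (K -> int) -> int).

Lemma bcls0 : bcls (fun=> 0) = 0.
Proof. by rewrite -(subrr (bcls (fun=> 0))) -bclsB; apply: bcls_ext => v _; rewrite subr0. Qed.
Lemma bclsN b : bcls (fun v => - b v) = - bcls b.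
Proof. by rewrite -[RHS]sub0r -bcls0 -bclsB; apply: bcls_ext => v _; rewrite sub0r. Qed.
Lemma bclsD b b' : bcls (fun v => b v + b' v) = bcls b + bcls b'.
Proof. by rewrite -[bcls b']opprK -bclsN -bclsB; apply: bcls_ext => v _; rewrite opprK. Qed.

Lemma edge_fun_pv (i j : 'I_n) (g : 'S_n) v : i != j ->
  edge_fun i j (v \o pv g) = edge_fun (g i) (g j) v.
Proof.
move=> ij; congr (_%:R); congr nat_of_bool; apply/asboolP/asboolP => [E|->]; last first.
  by rewrite ev_pv ?(inj_eq perm_inj) // !permK.
have -> : ev (g i) (g j) = ev i j \o pv g^-1%g by rewrite ev_pv // invgK.
by rewrite -E; apply/funext => x; rewrite -[RHS]/(v (pv g (pv g^-1%g x))) pvKV.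
Qed.
Lemma edge_fun_ev (a b i j : 'I_n) : a != b -> i != j ->
  edge_fun a b (ev i j) = edge a b (i, j) + edge a b (j, i).
Proof.
move=> ab ij; rewrite /edge_fun /edge !xpair_eqE; case: asboolP => [/ev_inj|N].
  by move=> /(_ ij ab)[[-> ->]|[-> ->]]; rewrite !eqxx (eq_sym b) (negPf ab) ?andbF /=.
have [/andP[/eqP li /eqP xj]|_] := boolP ((i == a) && (j == b)); first by case: N; rewrite li xj.
have [/andP[/eqP xi /eqP lj]|//] := boolP ((j == a) && (i == b)).
by case: N; rewrite xi lj ev_sym // eq_sym.
Qed.

(** The alternating sum by which [edge_sg] and [edge_tg] fail the cocycle relation, see
    [edge_crossed]. On exponents it gives the unit Theta, on the divisors D_ij the function
    [theta0]. *)
Definition sq (f : 'I_n -> 'I_n -> int) : int :=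
  f (o 0) (o 4) + f (o 0) (o 5) + f (o 1) (o 2) + f (o 1) (o 3)
  - f (o 1) (o 4) - f (o 1) (o 5) - f (o 0) (o 2) - f (o 0) (o 3).
Definition theta_exp (p : 'I_n * 'I_n) : int := sq (fun i j => edge i j p).
(** Half of the terms of [theta_exp], chosen so that s t carries them to the other half. *)
Definition rho_exp (p : 'I_n * 'I_n) : int := cr_exp (o 0, o 1, o 5, o 2) p.
Lemma edge_perm (g : 'S_n) (a b : 'I_n) p : edge a b (g^-1%g p.1, g^-1%g p.2) = edge (g a) (g b) p.
Proof.
case: p => x y; rewrite /edge !xpair_eqE /=.
by rewrite -(inj_eq (@perm_inj _ g)) permKV -[X in _ && X](inj_eq (@perm_inj _ g)) permKV.
Qed.
Lemma theta_exp_sg p : theta_exp (sg^-1%g p.1, sg^-1%g p.2) = - theta_exp p.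
Proof. by rewrite /theta_exp /sq !edge_perm !sg_o; lia. Qed.
Lemma theta_exp_tg p : theta_exp (tg^-1%g p.1, tg^-1%g p.2) = - theta_exp p.
Proof. by rewrite /theta_exp /sq !edge_perm !tg_o; lia. Qed.
Lemma theta_rho p : theta_exp p = rho_exp p + rho_exp ((sg * tg)^-1%g p.1, (sg * tg)^-1%g p.2).
Proof.
rewrite /theta_exp /sq /rho_exp /cr_exp !edge_perm !permM !sg_o !tg_o; lia.
Qed.
Lemma balanced_rho : balanced rho_exp.
Proof. by apply: balanced_cr; rewrite /= !inE !pt_eq_. Qed.
Lemma balanced_theta : balanced theta_exp.
Proof.
move=> i; rewrite -[RHS](balancedD balanced_rho (balanced_perm (sg * tg)^-1%g balanced_rho) i).
by rewrite /degree; apply: eq_bigr => j _; rewrite !theta_rho.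
Qed.
Definition theta0 v : int := sq (fun i j => edge_fun i j v).
(** [theta0] corrected by the divisor of Theta: the class is unchanged, but the multiplicities along
    all the D_ij become 0, so that a splitting of it does not alter degrees. *)
Definition theta v : int := if `[< bdry_vals v >] then theta0 v - v (mon brK theta_exp) else 0.
Lemma theta0_sg v : theta0 (v \o pv sg) = - theta0 v.
Proof. by rewrite /theta0 /sq !edge_fun_pv ?pt_eq_ // !sg_o; lia. Qed.
Lemma theta0_tg v : theta0 (v \o pv tg) = - theta0 v.
Proof. by rewrite /theta0 /sq !edge_fun_pv ?pt_eq_ // !tg_o; lia. Qed.
Lemma bdry_pvE (g : 'S_n) v : bdry_vals (v \o pv g) <-> bdry_vals v.
Proof.
split; last exact: bdry_pv.
move=> /(@bdry_pv _ _ g^-1%g); congr bdry_vals; apply/funext => x.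
by rewrite -[LHS]/(v (pv g (pv g^-1%g x))) pvKV.
Qed.
Lemma val_monN v e : bdry_vals v -> v (mon brK (fun p => - e p)) = - v (mon brK e).
Proof.
move=> Bv; rewrite monN (divvalV _ (ffield_subfield k m0) (bdry_div Bv)) //.
Qed.
Lemma val_pv_mon v (g : 'S_n) e : (v \o pv g) (mon brK e) = v (mon brK (fun p => e (g^-1%g p.1, g^-1%g p.2))).
Proof. by rewrite -[LHS]/(v (pv g (mon brK e))) pv_mon. Qed.
Lemma neg_sub_neg (x y : int) : - x - - y = - (x - y). Proof. by rewrite opprK opprB addrC. Qed.
Lemma theta_sg v : theta (v \o pv sg) = - theta v.
Proof.
rewrite /theta; case: asboolP => [B'|N]; last by rewrite asboolF ?oppr0 // => B'; apply: N; apply/bdry_pvE.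
have Bv := (bdry_pvE _ _).1 B'.
rewrite asboolT // theta0_sg val_pv_mon (_ : (fun p => _) = fun p => - theta_exp p).
  by rewrite (val_monN _ Bv); exact: neg_sub_neg.
by apply/funext => p; exact: theta_exp_sg.
Qed.
Lemma theta_tg v : theta (v \o pv tg) = - theta v.
Proof.
rewrite /theta; case: asboolP => [B'|N]; last by rewrite asboolF ?oppr0 // => B'; apply: N; apply/bdry_pvE.
have Bv := (bdry_pvE _ _).1 B'.
rewrite asboolT // theta0_tg val_pv_mon (_ : (fun p => _) = fun p => - theta_exp p).
  by rewrite (val_monN _ Bv); exact: neg_sub_neg.
by apply/funext => p; exact: theta_exp_tg.
Qed.
Lemma theta_ev (i j : 'I_n) : i != j -> theta (ev i j) = 0.
Proof.
move=> ij; rewrite /theta (asboolT (@ev_bdry k m0 m0_gt1 i j)) (@ev_mon k m0 m0_gt1 _ _ _ ij balanced_theta) /theta0 /theta_exp /sq.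
have ef (a c : 'I_n) : a != c -> edge_fun a c (ev i j) = edge a c (i, j) + edge a c (j, i).
  by move=> ac; exact: edge_fun_ev.
do 8! (rewrite ef; last by rewrite pt_eq_).
by apply/eqP; rewrite subr_eq0; apply/eqP; ring.
Qed.
(** Along a divisor fixed by s t, the order of Theta = rho * st(rho) is twice that of rho; [theta]
    is 0 on the D_ij, and [theta0] is 0 off them. *)
Lemma theta_even v : (v \o pv tg) \o pv sg = v -> (2 %| theta v)%Z.
Proof.
move=> Ev; have Est : v \o pv (sg * tg)%g = v.
  rewrite -[RHS]Ev; apply/funext => x.
  by rewrite -[LHS]/(v (pv (sg * tg)%g x)) pvM.
have [[[i j] ij vE]|N] := pselect (exists2 p : 'I_n * 'I_n, p.1 != p.2 & v = ev p.1 p.2).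
  by rewrite vE theta_ev.
have e0 i j : i != j -> edge_fun i j v = 0.
  by move=> ij; rewrite /edge_fun asboolF // => E; apply: N; exists (i, j).
rewrite /theta; case: asboolP => // Bv.
have -> : theta0 v = 0 by rewrite /theta0 /sq !e0 ?pt_eq_.
have -> : v (mon brK theta_exp) = v (mon brK rho_exp) + v (mon brK rho_exp).
  rewrite (_ : theta_exp = fun p => rho_exp p + rho_exp ((sg * tg)^-1%g p.1, (sg * tg)^-1%g p.2));
    last by apply/funext => p; exact: theta_rho.
  rewrite (monD (@brK_neq0 k m0)) (divvalM (bdry_div Bv)); try exact: (mon_neq0 (@brK_neq0 k m0)).
  - by rewrite -(val_pv_mon v) Est.
  - exact/ffield_mon/balanced_rho.
  exact/ffield_mon/(balanced_perm (sg * tg)^-1%g)/balanced_rho.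
by apply/dvdzP; exists (- v (mon brK rho_exp)); lia.
Qed.

(** Each edge joins 0 to a point fixed by the generator concerned, 4 by s and 2 by t, so [edge_sg]
    and [edge_tg] have the degrees of the coboundary of delta_0. *)
Definition edge04 := edge_fun (o 0) (o 4).
Definition edge02 := edge_fun (o 0) (o 2).
Definition edge_sg v : int := edge04 (v \o pv sg) - edge04 v.
Definition edge_tg v : int := edge02 (v \o pv tg) - edge02 v.
Lemma square_sum_alg (x02 x03 x04 x05 x12 x13 x14 x15 : int) :
  x05 - x15 + (x12 - x02) = x03 - x13 + (x14 - x04) + (x04 + x05 + x12 + x13 - x14 - x15 - x02 - x03).
Proof. by lia. Qed.
Lemma edge_crossed v : edge_sg (v \o pv tg) + edge_tg v =
  edge_tg (v \o pv sg) + edge_sg v + theta0 v.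
Proof.
have neq i j : (i < 6)%N -> (j < 6)%N -> i != j -> o i != o j by move=> *; rewrite pt_eq_.
have vt : edge04 (v \o pv tg) = edge_fun (o 1) (o 5) v.
  by rewrite /edge04 edge_fun_pv ?neq // !tg_o.
have vs : edge04 (v \o pv sg) = edge_fun (o 1) (o 4) v.
  by rewrite /edge04 edge_fun_pv ?neq // !sg_o.
have wt : edge02 (v \o pv tg) = edge_fun (o 1) (o 2) v.
  by rewrite /edge02 edge_fun_pv ?neq // !tg_o.
have ws : edge02 (v \o pv sg) = edge_fun (o 1) (o 3) v.
  by rewrite /edge02 edge_fun_pv ?neq // !sg_o.
have vst : edge04 ((v \o pv tg) \o pv sg) = edge_fun (o 0) (o 5) v.
  by rewrite /edge04 edge_fun_pv ?neq // !sg_o edge_fun_pv ?neq // !tg_o.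
have wst : edge02 ((v \o pv sg) \o pv tg) = edge_fun (o 0) (o 3) v.
  by rewrite /edge02 edge_fun_pv ?neq // !tg_o edge_fun_pv ?neq // !sg_o.
have -> : edge_sg (v \o pv tg) = edge_fun (o 0) (o 5) v - edge_fun (o 1) (o 5) v.
  by rewrite -vst -vt.
have -> : edge_tg (v \o pv sg) = edge_fun (o 0) (o 3) v - edge_fun (o 1) (o 3) v.
  by rewrite -wst -ws.
have -> : edge_sg v = edge_fun (o 1) (o 4) v - edge04 v by rewrite -vs.
have -> : edge_tg v = edge_fun (o 1) (o 2) v - edge02 v by rewrite -wt.
exact: square_sum_alg.
Qed.
Lemma deg_edge_sg i : deg edge_sg i = (sg^-1%g i == o 0)%:R - (i == o 0)%:R.
Proof.
rewrite /edge_sg degB deg_pv !deg_edge_fun ?pt_eq_ //.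
rewrite (_ : (sg^-1%g i == o 4) = (i == o 4)); first exact: addrKA'.
by rewrite -(inj_eq (@perm_inj _ sg)) permKV !sg_o.
Qed.
Lemma deg_edge_tg i : deg edge_tg i = (tg^-1%g i == o 0)%:R - (i == o 0)%:R.
Proof.
rewrite /edge_tg degB deg_pv !deg_edge_fun ?pt_eq_ //.
rewrite (_ : (tg^-1%g i == o 2) = (i == o 2)); first exact: addrKA'.
by rewrite -(inj_eq (@perm_inj _ tg)) permKV !tg_o.
Qed.
Lemma pv_involutive (g : 'S_n) v : (g * g = 1)%g -> (v \o pv g) \o pv g = v.
Proof.
move=> gg; have gV : g^-1%g = g by apply: (mulgI g); rewrite mulgV gg.
by apply/funext => x; rewrite -[LHS]/(v (pv g (pv g x))) -{1}gV pvVK.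
Qed.
Lemma pv_sgK v : (v \o pv sg) \o pv sg = v. Proof. by apply: pv_involutive; exact: sg2. Qed.
Lemma pv_tgK v : (v \o pv tg) \o pv tg = v. Proof. by apply: pv_involutive; exact: tg2. Qed.
Lemma pv_sgtg v : (v \o pv tg) \o pv sg = (v \o pv sg) \o pv tg.
Proof.
apply/funext => x; rewrite -[LHS]/(v (pv tg (pv sg x))) -[RHS]/(v (pv sg (pv tg x))).
by rewrite -!pvM sgtg.
Qed.
Lemma odd_cocycle_alg (p q r s t m mt w : int) : p + q = r + s + t -> mt - m = t - w ->
  p - mt + q = r + (s - m) + w.
Proof. by lia. Qed.
(** Subtracting the [mu] of [klein_split] from [edge_sg] absorbs [theta] in the mixed relation and
    preserves the relation s^2 = 1 and the degrees; what remains of the mixed relation is the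
    divisor of Theta, trivial in Pic. *)
Lemma odd_cocycle : exists c : 'S_n -> Pic X,
  (forall g h, g \in G -> h \in G -> c (g * h)%g = pic_act (M0nbar_aut k h) (c g) + c h) /\
  forall g i, g \in G -> degP (c g) i = (g^-1%g i == o 0)%:R - (i == o 0)%:R.
Proof.
have [mu [mu_s mu_t mu0]] := klein_split (V := K -> int) (s := fun v => v \o pv sg)
  (t := fun v => v \o pv tg) pv_sgK pv_tgK pv_sgtg theta_sg theta_tg theta_even.
pose fs v := edge_sg v - mu v; pose ft := edge_tg.
have act_bcls (g : 'S_n) f : pic_act (M0nbar_aut k g) (bcls f) = bcls (fun v => f (v \o pv g)).
  exact: bcls_act.
have cs0 : pic_act (M0nbar_aut k sg) (bcls fs) + bcls fs = 0.
  rewrite act_bcls -bclsD -bcls0; apply: bcls_ext => v _; rewrite /fs /edge_sg pv_sgK mu_s; lia.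
have ct0 : pic_act (M0nbar_aut k tg) (bcls ft) + bcls ft = 0.
  rewrite act_bcls -bclsD -bcls0; apply: bcls_ext => v _; rewrite /ft /edge_tg pv_tgK; lia.
have cst : pic_act (M0nbar_aut k tg) (bcls fs) + bcls ft =
    pic_act (M0nbar_aut k sg) (bcls ft) + bcls fs.
  rewrite !act_bcls -!bclsD; apply/bcls_eq; exists theta_exp; first exact: balanced_theta.
  move=> v Bv; have := mu_t v; rewrite /theta asboolT //.
  exact: odd_cocycle_alg (edge_crossed v).
pose act (g : 'S_n) : {additive Pic X -> Pic X} := pic_act (M0nbar_aut k g).
have act1 x : act 1%g x = x.
  have [f ->] := bcls_surj x; rewrite /act /= act_bcls; apply: bcls_ext => v _; congr f.
  apply: funext => y; rewrite -[LHS]/(v (pv 1%g y)); congr (v _).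
  by apply: (fmorph_inj (pv 1%g)); rewrite -pvM mulg1.
have actM (g h : 'S_n) x : act (g * h)%g x = act h (act g x) by exact: pic_actM.
pose c := klein_cocycle sg tg act (bcls fs) (bcls ft).
have cP := @klein_cocycleP _ _ _ (sg2 m0_gt1 m0_even) (tg2 m0_gt1 m0_even) (sgtg m0_gt1 m0_even) (sg1 m0_gt1 m0_even)
  (tg1 m0_gt1 m0_even) (sg_neq_tg m0_gt1 m0_even) _ act act1 actM _ _ cs0 ct0 cst.
have [c1 c_s c_t c_st] := klein_cocycleE (tg2 m0_gt1 m0_even) (sg1 m0_gt1 m0_even)
  (tg1 m0_gt1 m0_even) (sg_neq_tg m0_gt1 m0_even) act (bcls fs) (bcls ft).
exists c; split; first exact: cP.
have deg_mu i : deg mu i = 0.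
  by rewrite /deg big1 // => j ji; rewrite mu0 // theta_ev // eq_sym.
have dfs i : degP (bcls fs) i = (sg^-1%g i == o 0)%:R - (i == o 0)%:R.
  by rewrite degP_cls /fs degB deg_mu subr0 deg_edge_sg.
have dft i : degP (bcls ft) i = (tg^-1%g i == o 0)%:R - (i == o 0)%:R.
  by rewrite degP_cls deg_edge_tg.
move=> g i /klein_cases[]->.
- rewrite /c c1 invg1 perm1 subrr -(subrr (bcls fs)) degPB subrr; exact: erefl.
- by rewrite /c c_s dfs.
- by rewrite /c c_t dft.
rewrite /c c_st degPD degP_act dfs dft invMg permM; exact: subrKA'.
Qed.

(** The class of [odd_cocycle] belongs to the vector delta_0 of sum 1, hence is not trivial; two
    classes with vectors of odd sum differ by one with a vector of even sum, hence by a trivial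
    one. *)
Theorem H1_klein : exists f : {additive H1 (@pic_M0nbar_act k n G) -> 'Z_2}, bijective f.
Proof.
have cocP (c : cocycles (@pic_M0nbar_act k n G)) (g h : [subg G]) :
    c (g * h)%g = pic_act (M0nbar_aut k (sgval h)) (c g) + c h.
  by have /forallP/(_ g)/forallP/(_ h)/eqP := valP c.
apply: H1_bij.
  have [c [cM cdeg]] := odd_cocycle.
  pose c' : {ffun [subg G] -> Pic X} := [ffun g => c (sgval g)].
  have c'P : c' \in cocycle (@pic_M0nbar_act k n G).
    apply/forallP => g; apply/forallP => h; rewrite !ffunE; apply/eqP.
    exact: (cM _ _ (subgP g) (subgP h)).
  exists (Cocycle c'P); apply/negP => /asboolP[x xE].
  have := @coboundary_even k m0 m0_gt1 G c' (fun i => (i == o 0)%:R) x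
    (@flip_inv_even m0 m0_gt1 m0_even).
  rewrite (bigD1 (o 0)) //= big1 => [|i /negPf->//]; rewrite eqxx addr0 => H.
  suff : (2 %| (1 : int))%Z by [].
  by apply: H => [g i|g]; [rewrite ffunE; exact: (cdeg _ _ (subgP g))|exact: xE].
move=> c e cN eN.
have [V VE] := cocycle_degree m0_gt1 (cocP c).
have [W WE] := cocycle_degree m0_gt1 (cocP e).
have Vodd : ~~ (2 %| \sum_i V i)%Z.
  by apply: contra cN => h; apply/asboolP; exact: (even_coboundary (cocP c) VE h).
have Wodd : ~~ (2 %| \sum_i W i)%Z.
  by apply: contra eN => h; apply/asboolP; exact: (even_coboundary (cocP e) WE h).
apply/asboolP; apply: (even_coboundary (V := fun i => V i - W i) (m0_gt1 := m0_gt1) (cocP (c - e))).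
  move=> g i; rewrite (_ : cocycle_val (c - e) g = c g - e g); last by rewrite !ffunE.
  by rewrite degPB VE WE; exact: subrACA'.
by rewrite sumrB; exact: odd_sub.
Qed.
End OddClass.

(** * The unit without splitting *)

(** The rounding argument with the four values 0, p v, q v and p (t v) + q v of the cocycle written
    out. *)
Lemma klein_floor (V : Type) (s t : V -> V) (p q : V -> int) :
  involutive s -> involutive t -> (forall v, s (t v) = t (s v)) ->
  (forall v, p (s v) = - p v) -> (forall v, q (t v) = - q v) ->
  (forall v, p (t v) + q v = q (s v) + p v) ->
  exists e : V -> int, forall v, p v = e (s v) - e v /\ q v = e (t v) - e v.
Proof.
move=> sK tK st ps qt pq; exists (fun v => - ((p v + q v + (p (t v) + q v)) %/ 4)%Z) => v.
have floor4 (x y z : int) : y = x - z * 4 -> z = - (y %/ 4)%Z - - (x %/ 4)%Z by lia.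
split; apply: floor4.
  by have := pq v; rewrite -st !ps; lia.
by rewrite tK qt; lia.
Qed.

Lemma factorial_stable (K : fieldType) (E A : set K) (V : set (K -> int)) (f : {rmorphism K -> K}) :
  involutive f -> (forall x, E x -> E (f x)) -> (forall x, A x -> A (f x)) ->
  factorial E A V -> forall v, V v -> V (v \o f).
Proof.
move=> fK Ef Af fac v Vv; have H := factorial_transport fK fK Ef Ef fac.
have -> : V = [set v \o f | v in V]; last by exists v.
apply: (factorial_unique fac); move: H; congr factorial.
by apply/seteqP; split=> x; rewrite /preimage /=; [move/Af; rewrite fK|exact: Af].
Qed.

Section Semilinear.
Variables (k : fieldType) (m0 : nat).
Local Notation n := m0.+4.
Local Notation K := (ratfun k n).
Local Notation brK := (@brK k m0).
Local Notation ffield := (@ffield k m0).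
Local Notation cr_ring := (@cr_ring k m0).
Local Notation open_vals := (@open_vals k m0).
Variables (f : {rmorphism K -> K}) (g : 'S_n).
Hypothesis fC : forall c, exists c', f (ratC n c) = ratC n c'.
Hypothesis fbr : forall i j, f (brK i j) = brK (g i) (g j).
Hypothesis fK : involutive f.

Lemma semilinear_mon e : f (mon brK e) = mon brK (fun p => e (g^-1%g p.1, g^-1%g p.2)).
Proof. exact: mon_perm. Qed.
Lemma semilinear_ffield x : ffield x -> ffield (f x).
Proof.
move: x; have [sr sv] := ffield_subfield k m0; apply: (@ffield_min _ _ (f @^-1` ffield)).
- split; first exact: preim_subring.
  by move=> x; rewrite /preimage /= fmorphV; exact: sv.
- by move=> c; rewrite /preimage /=; have [c' ->] := fC c; exact: ffield_const.
move=> a b c d U4; rewrite /preimage /= fmorph_div !rmorphM !fbr -mon_cr.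
- by apply/ffield_mon/balanced_cr; rewrite (map_inj_uniq (@perm_inj _ g) [:: a; b; c; d]).
- exact: brK_neq0.
by rewrite (map_inj_uniq (@perm_inj _ g) [:: a; b; c; d]).
Qed.
Lemma semilinear_cr_ring x : cr_ring x -> cr_ring (f x).
Proof.
move: x; apply: (@cr_ring_min _ _ (f @^-1` cr_ring)).
- by apply: preim_subring; exact: gen_subring.
- by move=> c; rewrite /preimage /=; have [c' ->] := fC c; exact: gen_const.
move=> a b c d U4; rewrite /preimage /= fmorph_div !rmorphM !fbr.
by apply: cr_ring_br; rewrite (map_inj_uniq (@perm_inj _ g) [:: a; b; c; d]).
Qed.
Lemma semilinear_open_vals v : open_vals v -> open_vals (v \o f).
Proof.
exact: (factorial_stable fK semilinear_ffield semilinear_cr_ring (open_factorial k m0)).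
Qed.
End Semilinear.

Lemma neg_diff_alg (x y z : int) : x - y - - z = - (y - x - z). Proof. by lia. Qed.
Lemma neg_diff_alg' (x y z : int) : x - y + - z = - (y - x + z). Proof. by lia. Qed.
Lemma cross_alg (p q r s th a at_ b bs : int) : p + q = r + s + th -> at_ + bs = a + th + b ->
  p - at_ + (q + b) = r + bs + (s - a).
Proof. by lia. Qed.
Lemma invariant_alg (x y a b : int) : x - y = a - b -> x - a = y - b. Proof. by lia. Qed.
Lemma even_odd_alg (x : int) : (2 %| x)%Z -> (2 %| x - 1)%Z -> False. Proof. by lia. Qed.
Lemma half_alg (x : int) : x + - (x %/ 2)%Z - - ((- x) %/ 2)%Z = 0. Proof. by lia. Qed.
Lemma twist_S_alg (E : fieldType) (m sm q sq : E) : q != 0 -> sq != 0 ->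
  m * q / sq * (sm * sq / q) = m * sm.
Proof. by move=> q0 sq0; field; rewrite q0 sq0. Qed.
Lemma twist_T_alg (E : fieldType) (q tq : E) : q != 0 -> tq != 0 -> tq / q * (q / tq) = 1.
Proof. by move=> q0 sq0; field; rewrite q0 sq0. Qed.
Lemma twist_ST_alg (E : fieldType) (m tm q sq tq stq th : E) : m != 0 -> th != 0 -> q != 0 ->
  sq != 0 -> tq != 0 -> stq != 0 ->
  tm * tq / stq * (stq / sq) / (m * q / sq * th * (tq / q)) = tm / (m * th).
Proof. by move=> m0 th0 q0 sq0 tq0 stq0; field; rewrite m0 th0 q0 sq0 tq0 stq0. Qed.

(** On the open part the order of [mu] changes sign under S and is preserved by T. Let [q] have
    minus half that order, rounded down. Then mu q / S q and T q / q are units there, and the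
    factors involving [q] cancel in the relations, which become relations between orders at the
    boundary. *)
Lemma splitting_units (K : fieldType) (E A : set K) (V : set (K -> int)) (C : set K)
    (S T : {rmorphism K -> K}) (th mu : K) : factorial E A V ->
  involutive S -> involutive T -> (forall x, S (T x) = T (S x)) ->
  (forall x, E x -> E (S x)) -> (forall x, E x -> E (T x)) ->
  (forall v, V v -> V (v \o S)) -> (forall v, V v -> V (v \o T)) ->
  E th -> th != 0 -> (forall v, V v -> v th = 0) -> (forall v x, V v -> C x -> v x = 0) ->
  E mu -> mu != 0 -> C (mu * S mu) -> C (T mu / (mu * th)) ->
  exists m u, [/\ [/\ E m, m != 0, E u & u != 0], forall v, V v -> v m = 0 /\ v u = 0
    & forall w, divval E w -> (forall x, C x -> w x = 0) ->
      [/\ w (S m) = - w m, w (T u) = - w u & w (T m) + w (S u) = w m + w th + w u]].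
Proof.
move=> fac SK TK STC FS FT oS oT Fth th0 vth oC Fmu mu0 cS cT.
have sE := fac_field fac; have dV v : V v -> divval E v by exact: fac_val fac v.
have [q [Fq q0 qv _]] := fac_realize fac (fun v => - (v mu %/ 2)%Z) Fmu mu0.
have qE v : V v -> v q = - (v mu %/ 2)%Z by move=> Vv; rewrite qv //; case: eqP => // ->.
have S0 x : x != 0 -> S x != 0 by rewrite fmorph_eq0.
have T0 x : x != 0 -> T x != 0 by rewrite fmorph_eq0.
have EM x y : E x -> E y -> E (x * y) by exact: subfieldM.
have ED x y : E x -> E y -> E (x / y) by exact: subfield_div.
have D0 (x y : K) : x != 0 -> y != 0 -> x / y != 0 by exact: divf_neq0.
have M0 (x y : K) : x != 0 -> y != 0 -> x * y != 0 by exact: mulf_neq0.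
have vS v : V v -> v (S mu) = - v mu.
  move=> Vv; have := oC v _ Vv cS; rewrite (divvalM (dV v Vv)); auto.
  by move/eqP; rewrite addrC addr_eq0 => /eqP.
have vT v : V v -> v (T mu) = v mu.
  move=> Vv; have := oC v _ Vv cT; rewrite (divvalF sE (dV v Vv)) ?(divvalM (dV v Vv)); auto.
  by rewrite vth // addr0 => /eqP; rewrite subr_eq0 => /eqP.
exists (mu * q / S q), (T q / q); split; first by split; auto.
  move=> v Vv; have dv := dV v Vv; split.
    rewrite (divvalF sE dv) ?(divvalM dv); auto.
    rewrite qE // -[v (S q)]/((v \o S) q) qE; last exact: oS.
    by rewrite -[(v \o S) mu]/(v (S mu)) vS //; exact: half_alg.
  rewrite (divvalF sE dv); auto.
  rewrite qE // -[v (T q)]/((v \o T) q) qE; last exact: oT.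
  by rewrite -[(v \o T) mu]/(v (T mu)) vT // subrr.
move=> w dw wC; set m := mu * q / S q; set u := T q / q.
have Fm : E m by rewrite /m; auto.
have m1 : m != 0 by rewrite /m; auto.
have Fu : E u by rewrite /u; auto.
have u1 : u != 0 by rewrite /u; auto.
split.
- have Em : m * S m = mu * S mu by rewrite /m fmorph_div rmorphM SK; apply: twist_S_alg; auto.
  have := wC _ cS; rewrite -Em (divvalM dw); auto.
  by move=> /eqP; rewrite addrC addr_eq0 => /eqP.
- have Eu : u * T u = 1 by rewrite /u fmorph_div TK; apply: twist_T_alg; auto.
  have := divval1 sE dw; rewrite -Eu (divvalM dw); auto.
  by move=> /eqP; rewrite addrC addr_eq0 => /eqP.
have Emu : T m * S u / (m * th * u) = T mu / (mu * th).
  by rewrite /m /u !fmorph_div rmorphM -STC; apply: twist_ST_alg; auto.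
have := wC _ cT; rewrite -Emu (divvalF sE dw); auto.
have [{}Fm {}Fu Sm Tm] : [/\ E m, E u, E (S u) & E (T m)] by split; auto.
have [Sm0 Tm0] : S u != 0 /\ T m != 0 by split; auto.
clear Emu; clearbody m u.
by rewrite !(divvalM dw); auto => /eqP; rewrite subr_eq0 => /eqP.
Qed.

Definition is_const (k : fieldType) (n : nat) (x : ratfun k n) :=
  exists2 c, c != 0 & x = ratC n c.

Section NoSplitting.
Variables (k : fieldType) (m0 : nat).
Hypotheses (m0_gt1 : (1 < m0)%N) (m0_even : ~~ odd m0).
Local Notation n := m0.+4.
Local Notation K := (ratfun k n).
Local Notation brK := (@brK k m0).
Local Notation ffield := (@ffield k m0).
Local Notation open_vals := (@open_vals k m0).
Local Notation bdry_vals := (@bdry_vals k m0).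
Local Notation pv := (@pv k m0).
Local Notation sg := (sg m0_gt1 m0_even).
Local Notation tg := (tg m0_gt1 m0_even).
Local Notation ev := (@ev k m0 m0_gt1).
Local Notation deg := (@deg k m0 m0_gt1).
Local Notation theta_exp := (@theta_exp m0).
Variables (S T : {rmorphism K -> K}).
Hypotheses (SC : forall c, exists c', S (ratC n c) = ratC n c')
  (TC : forall c, exists c', T (ratC n c) = ratC n c').
Hypotheses (Sbr : forall i j, S (brK i j) = brK (sg i) (sg j))
  (Tbr : forall i j, T (brK i j) = brK (tg i) (tg j)).
Hypotheses (SK : involutive S) (TK : involutive T) (STC : forall x, S (T x) = T (S x)).
Let sE : is_subfield ffield. Proof. exact: ffield_subfield. Qed.

Lemma bdry_const v x : bdry_vals v -> is_const x -> v x = 0.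
Proof.
move=> Bv [c c0 ->]; have [[sO _] Oc _ _] := ptsP_M0n (bdry_pts Bv).
have c0' : ratC n c != 0 by rewrite fmorph_eq0.
by apply: (val_unit_const sE (bdry_div Bv) (Oc c) _ c0'); rewrite -fmorphV; exact: Oc.
Qed.
Lemma bdry_Cmon v c e : bdry_vals v -> c != 0 -> balanced e ->
  v (ratC n c * mon brK e) = v (mon brK e).
Proof.
move=> Bv c0 be; rewrite (divvalM (bdry_div Bv)); [|exact: ffield_const|exact: ffield_mon| |].
- by rewrite (bdry_const Bv) ?add0r //; exists c.
- by rewrite fmorph_eq0.
exact/mon_neq0/brK_neq0.
Qed.
Lemma bdry_semilinear (f : {rmorphism K -> K}) (g : 'S_n) v c e :
  (forall c, exists c', f (ratC n c) = ratC n c') ->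
  (forall i j, f (brK i j) = brK (g i) (g j)) -> bdry_vals v -> c != 0 -> balanced e ->
  v (f (ratC n c * mon brK e)) = v (pv g (mon brK e)).
Proof.
move=> fC fbr Bv c0 be; rewrite rmorphM (semilinear_mon fbr) pv_mon; have [c' c'E] := fC c.
rewrite c'E bdry_Cmon //; last exact: balanced_perm.
by have : f (ratC n c) != 0; [rewrite !fmorph_eq0|rewrite c'E fmorph_eq0].
Qed.

Definition is_edge (v : K -> int) := exists2 p : 'I_n * 'I_n, p.1 != p.2 & v = ev p.1 p.2.
Lemma is_edge_pv (g : 'S_n) v : is_edge (v \o pv g) <-> is_edge v.
Proof.
have H (h : 'S_n) w : is_edge w -> is_edge (w \o pv h).
  move=> [[i j] /= ij ->]; exists (h^-1%g i, h^-1%g j); first by rewrite (inj_eq perm_inj).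
  exact: ev_pv.
split; last exact: H.
move=> /(H g^-1%g); congr is_edge; apply/funext => x.
by rewrite -[LHS]/(v (pv g (pv g^-1%g x))) pvKV.
Qed.
Definition edge_val e (v : K -> int) : int := if `[< is_edge v >] then v (mon brK e) else 0.
Lemma edge_valE e v : is_edge v -> edge_val e v = v (mon brK e).
Proof. by move=> Ev; rewrite /edge_val asboolT. Qed.
Lemma edge_val0 e v : ~ is_edge v -> edge_val e v = 0.
Proof. by move=> Ev; rewrite /edge_val asboolF. Qed.
Lemma deg_edge_val e i : balanced e -> deg (edge_val e) i = 0.
Proof.
move=> be; rewrite -[RHS](be i); apply: eq_bigr => j ji.
rewrite /edge_val asboolT; first by rewrite ev_mon // eq_sym.
by exists (i, j) => //; rewrite eq_sym.
Qed.
Lemma theta0_edge v : is_edge v -> theta0 m0_gt1 v = v (mon brK theta_exp).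
Proof.
move=> [[i j] ij ->]; have := @theta_ev k m0 m0_gt1 m0_even _ _ ij.
by rewrite /theta asboolT; [move/eqP; rewrite subr_eq0 => /eqP|exact: ev_bdry].
Qed.
Lemma theta0_nonedge v : ~ is_edge v -> theta0 m0_gt1 v = 0.
Proof.
move=> N; have e0 (i j : 'I_n) : i != j -> edge_fun m0_gt1 i j v = 0.
  by move=> ij; rewrite /edge_fun asboolF // => E; apply: N; exists (i, j).
by rewrite /theta0 /sq !e0 ?pt_eq_.
Qed.

(** Along the D_ij the orders of the two monomials have the same defect as [edge_sg] and [edge_tg],
    so the corrected pair [p], [q] is a cocycle of functions, the coboundary of some [e]. Then deg e
    - delta_0 is G-invariant, hence of even sum; but deg e also has even sum, and delta_0 has sum
    1. *)
Lemma no_edge_splitting e1 e2 : balanced e1 -> balanced e2 ->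
  (forall v, is_edge v -> v (pv sg (mon brK e1)) = - v (mon brK e1)) ->
  (forall v, is_edge v -> v (pv tg (mon brK e2)) = - v (mon brK e2)) ->
  (forall v, is_edge v -> v (pv tg (mon brK e1)) + v (pv sg (mon brK e2)) =
    v (mon brK e1) + v (mon brK theta_exp) + v (mon brK e2)) -> False.
Proof.
move=> be1 be2 R1 R2 R3; pose al := edge_val e1; pose be := edge_val e2.
have als v : al (v \o pv sg) = - al v.
  rewrite /al /edge_val; have [Ev|N] := pselect (is_edge v).
    by rewrite !asboolT ?is_edge_pv // -R1.
  by rewrite !asboolF ?is_edge_pv // oppr0.
have bet v : be (v \o pv tg) = - be v.
  rewrite /be /edge_val; have [Ev|N] := pselect (is_edge v).
    by rewrite !asboolT ?is_edge_pv // -R2.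
  by rewrite !asboolF ?is_edge_pv // oppr0.
have cross v : al (v \o pv tg) + be (v \o pv sg) = al v + theta0 m0_gt1 v + be v.
  rewrite /al /be; have [Ev|N] := pselect (is_edge v).
    have [Es Et] := ((is_edge_pv sg v).2 Ev, (is_edge_pv tg v).2 Ev).
    have [E1 E2] := (edge_valE e1 Et, edge_valE e2 Es).
    have [E3 E4] := (edge_valE e1 Ev, edge_valE e2 Ev).
    by rewrite E1 E2 E3 E4 (theta0_edge Ev); exact: R3.
  have Ns : ~ is_edge (v \o pv sg) by move/is_edge_pv.
  have Nt : ~ is_edge (v \o pv tg) by move/is_edge_pv.
  have [E1 E2] := (edge_val0 e1 Nt, edge_val0 e2 Ns).
  have [E3 E4] := (edge_val0 e1 N, edge_val0 e2 N).
  by rewrite E1 E2 E3 E4 (theta0_nonedge N).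
pose p v := edge_sg m0_gt1 m0_even v - al v; pose q v := edge_tg m0_gt1 m0_even v + be v.
have ps v : p (v \o pv sg) = - p v by rewrite /p als /edge_sg pv_sgK; exact: neg_diff_alg.
have qt v : q (v \o pv tg) = - q v by rewrite /q bet /edge_tg pv_tgK; exact: neg_diff_alg'.
have pq v : p (v \o pv tg) + q v = q (v \o pv sg) + p v.
  exact: cross_alg (edge_crossed m0_gt1 m0_even v) (cross v).
have [e eP] := klein_floor (@pv_sgK k m0 m0_gt1 m0_even) (@pv_tgK k m0 m0_gt1 m0_even)
  (@pv_sgtg k m0 m0_gt1 m0_even) ps qt pq.
pose W i := deg e i - (i == pt_ m0 0)%:R.
have Wg (g : 'S_n) (r : (K -> int) -> int) : (forall v, r v = e (v \o pv g) - e v) ->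
    (forall i, deg r i = (g^-1%g i == pt_ m0 0)%:R - (i == pt_ m0 0)%:R) ->
    forall i, W (g^-1%g i) = W i.
  move=> re dr i; have := dr i; rewrite /W -(deg_pv m0_gt1 e g).
  rewrite (_ : r = fun v => e (v \o pv g) - e v) ?degB; last exact/funext.
  exact: invariant_alg.
have Ws : forall i, W (sg^-1%g i) = W i.
  apply: (Wg _ _ (fun v => (eP v).1)) => i.
  by rewrite degB deg_edge_val // subr0 deg_edge_sg.
have Wt : forall i, W (tg^-1%g i) = W i.
  apply: (Wg _ _ (fun v => (eP v).2)) => i.
  have := degB m0_gt1 q be i; rewrite deg_edge_val // subr0 => <-.
  rewrite (_ : (fun v => q v - be v) = edge_tg m0_gt1 m0_even) ?deg_edge_tg //.
  by apply/funext => v; rewrite /q addrK.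
have := @flip_inv_even m0 m0_gt1 m0_even W.
have Winv g i : g \in Gkl m0_gt1 m0_even -> W (g i) = W i.
  have H1 j : W (sg j) = W j by rewrite -[RHS](congr1 W (permK sg j)) Ws.
  have H2 j : W (tg j) = W j by rewrite -[RHS](congr1 W (permK tg j)) Wt.
  by case/klein_cases=> ->; rewrite ?perm1 ?permM ?H1 ?H2 ?H1.
move=> /(_ Winv); rewrite /W sumrB (bigD1 (pt_ m0 0) (F := fun i => (i == _)%:R)) //= eqxx.
rewrite [X in true%:R + X](_ : _ = 0) ?addr0; last by apply: big1 => i /negPf->.
exact: even_odd_alg (deg_even m0_gt1 e).
Qed.

(** [S] and [T] may act on the constants as well, so that the result applies to the permutation
    action and to its twist by the Galois group. *)
Theorem no_splitting mu : ffield mu -> mu != 0 -> is_const (mu * S mu) ->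
  is_const (T mu / (mu * mon brK theta_exp)) -> False.
Proof.
move=> Fmu mu0 cS cT.
have FS x : ffield x -> ffield (S x) by exact: semilinear_ffield.
have FT x : ffield x -> ffield (T x) by exact: semilinear_ffield.
have Th0 : mon brK theta_exp != 0 by exact/mon_neq0/brK_neq0.
have FTh : ffield (mon brK theta_exp) by exact/ffield_mon/balanced_theta.
have oS v : open_vals v -> open_vals (v \o S) by exact: semilinear_open_vals.
have oT v : open_vals v -> open_vals (v \o T) by exact: semilinear_open_vals.
have oC v x : open_vals v -> is_const x -> v x = 0.
  move=> Vv [c c0 ->]; have [[sO _] Oc _ _] := ptsP_M0n (open_pts Vv).
  have c0' : ratC n c != 0 by rewrite fmorph_eq0.
  by apply: (val_unit_const sE (open_div Vv) (Oc c) _ c0'); rewrite -fmorphV; exact: Oc.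
have [m [u [[Fm m1 Fu u1] mV vals]]] := splitting_units (open_factorial k m0) SK TK STC FS FT oS oT
  FTh Th0 (cr_ring_unit_mon (@balanced_theta m0 m0_gt1 m0_even)) oC Fmu mu0 cS cT.
have [c1 [e1 [c10 be1 mE]]] := unit_mon Fm m1 (fun v Vv => (mV v Vv).1).
have [c2 [e2 [c20 be2 uE]]] := unit_mon Fu u1 (fun v Vv => (mV v Vv).2).
have eb v : is_edge v -> bdry_vals v by move=> [[i j] _ ->]; exact: ev_bdry.
have vm v : bdry_vals v -> v m = v (mon brK e1) by move=> Bv; rewrite mE bdry_Cmon.
have vu v : bdry_vals v -> v u = v (mon brK e2) by move=> Bv; rewrite uE bdry_Cmon.
have vSm v : bdry_vals v -> v (S m) = v (pv sg (mon brK e1)).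
  by move=> Bv; rewrite mE (bdry_semilinear SC Sbr).
have vTm v : bdry_vals v -> v (T m) = v (pv tg (mon brK e1)).
  by move=> Bv; rewrite mE (bdry_semilinear TC Tbr).
have vSu v : bdry_vals v -> v (S u) = v (pv sg (mon brK e2)).
  by move=> Bv; rewrite uE (bdry_semilinear SC Sbr).
have vTu v : bdry_vals v -> v (T u) = v (pv tg (mon brK e2)).
  by move=> Bv; rewrite uE (bdry_semilinear TC Tbr).
apply: (no_edge_splitting be1 be2) => v /eb Bv;
  have [R1 R2 R3] := vals v (bdry_div Bv) (fun x => bdry_const Bv).
- by rewrite -vSm // -vm.
- by rewrite -vTu // -vu.
by rewrite -vTm // -vSu // -vm // -vu.
Qed.
End NoSplitting.

(** * Stable linearizations *)

Lemma subfield_smallest (K : fieldType) (S : set K) : is_subfield (smallest (@is_subfield K) S).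
Proof.
split; first split; first by move=> A [[[A1 _ _] _] _].
- move=> x y Sx Sy A AS; exact: (subfieldB AS.1 (Sx A AS) (Sy A AS)).
- move=> x y Sx Sy A AS; exact: (subfieldM AS.1 (Sx A AS) (Sy A AS)).
by move=> x Sx A AS; exact: (subfieldV AS.1 (Sx A AS)).
Qed.
Lemma subfield_min (K : fieldType) (S L : set K) :
  is_subfield L -> S `<=` L -> smallest (@is_subfield K) S `<=` L.
Proof. by move=> sL SL x; apply. Qed.
Lemma subfield_gen (K : fieldType) (S : set K) : S `<=` smallest (@is_subfield K) S.
Proof. by move=> x Sx A [_]; apply. Qed.

Lemma Aff_sub (K : fieldType) (A O L : set K) : is_subfield L -> A `<=` L -> Aff A O -> O `<=` L.
Proof. by move=> sL AL [P _ <-] _ [a [b [Aa Ab _ ->]]]; apply: (subfield_div sL); exact: AL. Qed.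

Lemma ratio_alg (K : fieldType) (x y z : K) : z != 0 -> x / y = (x / z) / (y / z).
Proof. by move=> z0; rewrite invf_div mulrA divfK. Qed.

(** * The function field of a product with projective space *)

Section GenericTimesProj.
Variables (k K : fieldType) (i : {rmorphism k -> K}) (X : set (set K)) (F A0 : set K) (r : nat).
Hypotheses (sF : is_subfield F) (XF : forall O, X O -> O `<=` F).
Hypotheses (A0X : affine_open i X A0) (A0F : localization A0 [set 0] = F).
Local Notation E := (ratfun K r.+1).
Definition tp_field : set E := smallest (@is_subfield _)
  (@ratC K r.+1 @` F `|` range (fun p : 'I_r.+1 * 'I_r.+1 => ratX K p.1 / ratX K p.2)).
Lemma tp_subfield : is_subfield tp_field. Proof. exact: subfield_smallest. Qed.
Lemma tp_const x : F x -> tp_field (ratC r.+1 x).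
Proof. by move=> Fx; apply: subfield_gen; left; exists x. Qed.
Lemma tp_ratio j l : tp_field (ratX K j / ratX K l).
Proof. by apply: subfield_gen; right; exists (j, l). Qed.
Lemma tp_sub O : times_proj i X r O -> O `<=` tp_field.
Proof.
move=> [A [fgA AX] [l _ AO]]; apply: Aff_sub AO; first exact: tp_subfield.
move=> x; apply; split; first by case: tp_subfield.
have sA : is_subring A by have [s ->] := fgA; exact: gen_subring.
have [_ AL _] := localization0 sA.
move=> y [[a Aa <-]|[j _ <-]]; last exact: tp_ratio.
have XA : X (localization A [set 0]) by apply: AX; exists [set 0] => //; exact: prime_zero.
by apply: tp_const; apply: (XF XA); exact: AL.
Qed.
Lemma tp_generic : times_proj i X r tp_field.
Proof.
exists A0 => //; exists ord0 => //; set B := smallest _ _.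
have sB : is_subring B by exact: is_subring_smallest.
exists [set 0]; first exact: prime_zero.
have [sL BL minL] := localization0 sB; apply/seteqP; split.
  apply: minL; first exact: tp_subfield.
  move=> x; apply; split; first by case: tp_subfield.
  move=> y [[a Aa <-]|[j _ <-]]; last exact: tp_ratio.
  have sA : is_subring A0 by have [[s ->] _] := A0X; exact: gen_subring.
  by apply: tp_const; rewrite -A0F; have [_ AL _] := localization0 sA; exact: AL.
apply: subfield_min => // y [[a Fa <-]|[[j l] _ <-]] /=.
  move: Fa; rewrite -A0F => -[b [c [Ab Ac _ ->]]]; rewrite fmorph_div.
  by apply: (subfield_div sL); apply: BL => A [_]; apply; left; [exists b|exists c].
have t0 : ratX K (ord0 : 'I_r.+1) != 0.
  by rewrite -[0](rmorph0 (@ratC K r.+1)); exact: ratX_neqC.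
rewrite (_ : _ / _ = (ratX K j / ratX K ord0) / (ratX K l / ratX K ord0)).
  by apply: (subfield_div sL); apply: BL => A [_]; apply; right; [exists j|exists l].
exact: ratio_alg.
Qed.
Lemma tp_open U : zopen (times_proj i X r) U -> U !=set0 -> U tp_field.
Proof.
move=> [UX Uo] [O UO]; have [s [sO sU]] := Uo _ UO; apply: sU; first exact: tp_generic.
by move=> x /sO; exact: tp_sub (UX _ UO) x.
Qed.
End GenericTimesProj.

Lemma mul2z_alg (x : int) : 2 * x = x + x. Proof. by lia. Qed.
Lemma split_T_alg (x y : int) : x - (y + (x - y)) = 0. Proof. by lia. Qed.
(** [klein_split] is applied to the orders of [th]: its form rho * ST(rho) gives evenness at the
    valuations fixed by the composite, and factoriality realizes the resulting orders by an
    element. *)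
Lemma splitting_lift (K : fieldType) (E A : set K) (V : set (K -> int)) (S T : {rmorphism K -> K})
    (rho th : K) : factorial E A V ->
  involutive S -> involutive T -> (forall x, S (T x) = T (S x)) ->
  (forall x, E x -> E (S x)) -> (forall x, E x -> E (T x)) ->
  (forall v, V v -> V (v \o S)) -> (forall v, V v -> V (v \o T)) ->
  E rho -> rho != 0 -> th = rho * S (T rho) -> S th = th^-1 -> T th = th^-1 ->
  exists mu, [/\ E mu, mu != 0,
    (forall v, V v -> v (mu * S mu) = 0 /\ v (T mu / (mu * th)) = 0)
    & forall P : K -> Prop, P 1 -> (forall a b, P a -> P b -> P (a * b)) ->
      (forall a, P a -> P a^-1) ->
      (forall v p, V v -> v th != 0 -> uniformizer E V v p -> P p) -> P mu].
Proof.
move=> fac SK TK STC ES ET VS VT Erho rho0 thE Sth Tth.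
have sE := fac_field fac; have dV v : V v -> divval E v by exact: fac_val fac v.
have S0 x : x != 0 -> S x != 0 by rewrite fmorph_eq0.
have T0 x : x != 0 -> T x != 0 by rewrite fmorph_eq0.
have EM x y : E x -> E y -> E (x * y) by exact: subfieldM.
have ED x y : E x -> E y -> E (x / y) by exact: subfield_div.
have M0 (x y : K) : x != 0 -> y != 0 -> x * y != 0 by exact: mulf_neq0.
have Eth : E th by rewrite thE; auto.
have th0 : th != 0 by rewrite thE; auto.
have comp (f : {rmorphism K -> K}) (v : K -> int) : involutive f -> (v \o f) \o f = v.
  by move=> fK; apply/funext => x; rewrite /= fK.
have VSE v : V (v \o S) <-> V v by split; [move/VS; rewrite comp|exact: VS].
have VTE v : V (v \o T) <-> V v by split; [move/VT; rewrite comp|exact: VT].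
pose t v : int := if `[< V v >] then v th else 0.
have tE v : V v -> t v = v th by move=> Vv; rewrite /t asboolT.
have t0 v : ~ V v -> t v = 0 by move=> Vv; rewrite /t asboolF.
have ts v : t (v \o S) = - t v.
  have [Vv|N] := pselect (V v); last by rewrite !t0 ?oppr0 // => /VSE.
  by rewrite !tE /= ?Sth ?(divvalV _ sE (dV v Vv)) //; exact: VS.
have tt v : t (v \o T) = - t v.
  have [Vv|N] := pselect (V v); last by rewrite !t0 ?oppr0 // => /VTE.
  by rewrite !tE /= ?Tth ?(divvalV _ sE (dV v Vv)) //; exact: VT.
have even v : (v \o T) \o S = v -> (2 %| t v)%Z.
  move=> Ev; have [Vv|N] := pselect (V v); last by rewrite t0.
  have Er : v (S (T rho)) = v rho by rewrite STC -[RHS](congr1 (fun w => w rho) Ev).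
  rewrite tE // thE (divvalM (dV v Vv)) ?Er //; auto.
  by apply/dvdzP; exists (v rho); rewrite mulrC mul2z_alg.
have STV (v : K -> int) : (v \o T) \o S = (v \o S) \o T by apply/funext => x; rewrite /= STC.
have [mu [mu_s mu_t mu0]] := klein_split (V := K -> int) (s := fun v => v \o S)
  (t := fun v => v \o T) (fun v => comp S v SK) (fun v => comp T v TK) STV ts tt even.
have [x [Ex x0 xv Px]] := fac_realize fac mu Eth th0.
have xE v : V v -> v x = mu v.
  by move=> Vv; rewrite xv //; case: eqP => //= v0; rewrite mu0 // tE.
exists x; split => // v Vv; have dv := dV v Vv; split.
  rewrite (divvalM dv); auto; rewrite -[v (S x)]/((v \o S) x) !xE ?mu_s ?subrr //; exact: VS.
rewrite (divvalF sE dv) ?(divvalM dv); auto.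
by rewrite -[v (T x)]/((v \o T) x) !xE -?tE // -?mu_t //; [exact: split_T_alg|exact: VT].
Qed.

Lemma mpoly_rmorph_ext (k : nzRingType) n (S : pzRingType) (f g : {rmorphism {mpoly k[n]} -> S}) :
  (forall c, f c%:MP = g c%:MP) -> (forall i, f 'X_i = g 'X_i) -> f =1 g.
Proof.
move=> fC fX p; rewrite [p]mpolyE !rmorph_sum; apply: eq_bigr => m _.
rewrite -mul_mpolyC !rmorphM fC; congr (_ * _); rewrite mpolyXE_id !rmorph_prod.
by apply: eq_bigr => i _; rewrite !rmorphXn fX.
Qed.

Lemma graded_mul_alg (R : comNzRingType) (a b : R) (M N : nat) :
  a *: 'X^M * (b *: 'X^N) = (a * b) *: 'X^(M + N) :> {poly R}.
Proof. by rewrite -scalerAl -scalerAr scalerA exprD. Qed.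
Lemma graded_sub_alg (R : comNzRingType) (a b a' b' : R) (M N : nat) :
  a *: 'X^M * (b' *: 'X^N) - a' *: 'X^N * (b *: 'X^M) = (a * b' - a' * b) *: 'X^(M + N) :> {poly R}.
Proof. by rewrite !graded_mul_alg scalerBl (addnC N). Qed.
Lemma frac_const_alg (E : fieldType) (p q sp sq c : E) : q != 0 -> sq != 0 ->
  p / q * (sp / sq) = c -> p * sp = c * (q * sq).
Proof. by move=> q0 sq0 <-; field; rewrite q0 sq0. Qed.
Lemma frac_const_algV (E : fieldType) (p q sp sq c : E) : q != 0 -> sq != 0 ->
  p * sp = c * (q * sq) -> p / q * (sp / sq) = c.
Proof. by move=> q0 sq0 H; rewrite mulf_div H mulfK // mulf_neq0. Qed.
Lemma frac_twist_alg (E : fieldType) (p q tp tq a b c : E) : p != 0 -> q != 0 -> a != 0 ->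
  b != 0 -> tq != 0 -> tp / tq / (p / q * (a / b)) = c -> tp * q * b = c * (p * tq * a).
Proof. by move=> p0 q0 a0 b0 tq0 <-; field; rewrite p0 q0 a0 b0 tq0. Qed.
Lemma frac_twist_algV (E : fieldType) (p q tp tq a b c : E) : p != 0 -> q != 0 -> a != 0 ->
  b != 0 -> tq != 0 -> tp * q * b = c * (p * tq * a) -> tp / tq / (p / q * (a / b)) = c.
Proof.
move=> p0 q0 a0 b0 tq0 H; apply: (@mulIf _ (p * tq * a)); rewrite ?mulf_neq0 // -H.
by field; rewrite p0 q0 a0 b0 tq0.
Qed.
Lemma size_prod_alg (R : idomainType) (p sp q sq c : {poly R}) : p != 0 -> q != 0 ->
  size c = 1%N -> size sp = size p -> size sq = size q -> p * sp = c * (q * sq) -> size p = size q.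
Proof.
rewrite -!size_poly_gt0 => p0 q0 c1 spE sqE /(congr1 (fun r : {poly R} => size r)).
have nz (r : {poly R}) : (0 < size r)%N -> r != 0 by rewrite size_poly_gt0.
have [sp0 sq0] : sp != 0 /\ sq != 0 by split; apply: nz; rewrite ?spE ?sqE.
rewrite !size_mul ?mulf_neq0 ?nz ?c1 ?spE ?sqE //; lia.
Qed.

(** * Top forms and the function field of projective space *)

Section HomogeneousField.
Variables (k : fieldType) (d : nat).
Local Notation R := {mpoly k[d.+1]}.
Local Notation E := (ratfun k d.+1).
Local Notation "x %:F" := (@FracField.tofrac R x).
(** Multiplies each variable by X, so that the coefficient of X^i is the homogeneous component of
    degree i. *)
Definition graded : R -> {poly R} := mmap (polyC \o @mpolyC d.+1 k) (fun l => 'X_l *: 'X).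
HB.instance Definition _ := GRing.RMorphism.on graded.
Lemma gradedC c : graded c%:MP = (c%:MP)%:P. Proof. exact: mmapC. Qed.
Lemma gradedX l : graded 'X_l = 'X_l *: 'X. Proof. by rewrite /graded mmapX mmap1U. Qed.
Lemma gradedM p q : graded (p * q) = graded p * graded q. Proof. exact: rmorphM. Qed.
Lemma gradedB p q : graded (p - q) = graded p - graded q. Proof. exact: rmorphB. Qed.
Lemma graded_horner p : (graded p).[1] = p.
Proof.
apply: (mpoly_rmorph_ext (f := horner_eval (1 : R) \o graded) (g := idfun)) => [c|l] /=.
  by rewrite gradedC /horner_eval hornerC.
by rewrite gradedX /horner_eval hornerZ hornerX mulr1.
Qed.
Lemma graded_eq0 p : (graded p == 0) = (p == 0).
Proof.
by apply/eqP/eqP => [E0|->]; rewrite ?rmorph0 // -(graded_horner p) E0 horner0.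
Qed.
Definition lead_form p := lead_coef (graded p).
Lemma lead_form_eq0 p : (lead_form p == 0) = (p == 0).
Proof. by rewrite /lead_form lead_coef_eq0 graded_eq0. Qed.
Lemma lead_formM p q : lead_form (p * q) = lead_form p * lead_form q.
Proof. by rewrite /lead_form rmorphM lead_coefM. Qed.
Lemma lead_formC c : lead_form c%:MP = c%:MP.
Proof. by rewrite /lead_form gradedC lead_coefC. Qed.
Lemma lead_form_id p N : graded p = p *: 'X^N -> lead_form p = p.
Proof. by rewrite /lead_form => ->; rewrite lead_coefZ lead_coefXn mulr1. Qed.

Fact omega_exists : exists O : set E, O = @tp_field k setT d. Proof. by exists (@tp_field k setT d). Qed.
Definition omega : set E := sval (cid omega_exists).
Lemma omegaE : omega = @tp_field k setT d. Proof. exact: svalP (cid omega_exists). Qed.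
Lemma omega_subfield : is_subfield omega. Proof. by rewrite omegaE; exact: tp_subfield. Qed.
Lemma omega_const c : omega (ratC d.+1 c). Proof. by rewrite omegaE; exact: tp_const. Qed.
Lemma omega_ratio j l : omega (ratX k j / ratX k l). Proof. by rewrite omegaE; exact: tp_ratio. Qed.
Local Notation t0 := ((mpolyX k U_(ord0 : 'I_d.+1)%MM)%:F).
Let t00 : t0 != 0.
Proof. by rewrite -[0](rmorph0 (@ratC k d.+1)); exact: ratX_neqC. Qed.
(** Homogeneity of the i-th coefficient in degree i, expressed by its quotient by the i-th power of
    a coordinate. *)
Definition degreewise (q : {poly R}) := forall i, omega ((q`_i)%:F / t0 ^+ i).
Lemma degreewiseD p q : degreewise p -> degreewise q -> degreewise (p + q).
Proof.
move=> dp dq i; have [sO _] := omega_subfield.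
by rewrite coefD tofracD mulrDl; apply: (subringD sO).
Qed.
Lemma degreewiseM p q : degreewise p -> degreewise q -> degreewise (p * q).
Proof.
move=> dp dq i; have [sO _] := omega_subfield; rewrite coefM.
rewrite (raddf_sum (@FracField.tofrac R)) mulr_suml.
apply: (subring_sum sO) => j _; rewrite -[X in X / _]/((p`_j * q`_(i - j))%:F).
rewrite tofracM (_ : t0 ^+ i = t0 ^+ j * t0 ^+ (i - j)) -?mulf_div; last by rewrite -exprD subnKC // -ltnS.
by apply: (subringM sO); [exact: dp|exact: dq].
Qed.
Lemma degreewiseC c : degreewise (c%:MP)%:P.
Proof.
move=> [|i]; rewrite coefC /= ?expr0 ?divr1 ?rmorph0 ?mul0r; first exact: omega_const.
by have [sO _] := omega_subfield; exact: (subring0 sO).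
Qed.
Lemma degreewise0 : degreewise 0.
Proof.
by move=> i; have [sO _] := omega_subfield; rewrite coef0 tofrac0 mul0r; exact: (subring0 sO).
Qed.
Lemma degreewise_graded p : degreewise (graded p).
Proof.
have dsum (I : eqType) (r : seq I) (F : I -> {poly R}) :
    (forall i, degreewise (F i)) -> degreewise (\sum_(i <- r) F i).
  by move=> dF; apply: big_ind => //; [exact: degreewise0|exact: degreewiseD].
apply: dsum => m; apply: degreewiseM; first exact: degreewiseC.
apply: big_ind => [||l _]; [rewrite -polyC1 -mpolyC1; exact: degreewiseC|exact: degreewiseM|].
elim: (m l) => [|e IH]; first by rewrite expr0 -polyC1 -mpolyC1; exact: degreewiseC.
rewrite exprS; apply: degreewiseM => // i; rewrite coefZ coefX.
have [->|_] := eqVneq i 1%N; first by rewrite mulr1 expr1; exact: omega_ratio.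
by have [sO _] := omega_subfield; rewrite mulr0 rmorph0 mul0r; exact: (subring0 sO).
Qed.
Lemma lead_form_omega p q : q != 0 -> size (graded p) = size (graded q) ->
  omega ((lead_form p)%:F / (lead_form q)%:F).
Proof.
move=> q0 spq; rewrite (ratio_alg _ _ (expf_neq0 (size (graded q)).-1 t00)).
apply: (subfield_div omega_subfield); last exact: degreewise_graded.
by rewrite -spq; exact: degreewise_graded.
Qed.

Lemma omega_fraction x : omega x -> exists a b N, [/\ b != 0, x = a%:F / b%:F,
  graded a = a *: 'X^N & graded b = b *: 'X^N].
Proof.
rewrite omegaE; move: x; apply: subfield_min.
  split; first split.
  - exists 1, 1, 0%N; rewrite oner_neq0 divr1 rmorph1 expr0 alg_polyC rmorph1.
    by split=> //; rewrite /graded rmorph1.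
  - move=> _ _ [a [b [N [b0 -> ga gb]]]] [a' [b' [N' [b0' -> ga' gb']]]].
    exists (a * b' - a' * b), (b * b'), (N + N')%N; split; first by rewrite mulf_neq0.
    + rewrite -mulNr addf_div ?tofrac_eq0 // mulNr -!tofracM -tofracB; exact: erefl.
    + rewrite gradedB !gradedM ga gb ga' gb'; exact: graded_sub_alg.
    by rewrite gradedM gb gb'; exact: graded_mul_alg.
  - move=> _ _ [a [b [N [b0 -> ga gb]]]] [a' [b' [N' [b0' -> ga' gb']]]].
    exists (a * a'), (b * b'), (N + N')%N; split; first by rewrite mulf_neq0.
    + by rewrite mulf_div -!tofracM.
    + by rewrite gradedM ga ga'; exact: graded_mul_alg.
    by rewrite gradedM gb gb'; exact: graded_mul_alg.
  move=> _ [a [b [N [b0 -> ga gb]]]]; have [->|a0] := eqVneq a 0.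
    exists 0, 1, 0%N; split; [exact: oner_neq0|by rewrite tofrac0 !mul0r invr0| |].
      by rewrite /graded rmorph0 scale0r.
    by rewrite /graded rmorph1 expr0 alg_polyC.
  by exists b, a, N; rewrite invf_div.
move=> _ [[c _ <-]|[[j l] _ <-]] /=.
  exists c%:MP, 1, 0%N; rewrite oner_neq0 rmorph1 divr1 expr0 alg_polyC rmorph1.
  by split; rewrite ?gradedC ?alg_polyC ?rmorph1.
exists 'X_j, 'X_l, 1%N; rewrite !gradedX expr1; split=> //.
have : (mpolyX k U_(l)%MM)%:F != 0 by rewrite -[0](rmorph0 (@ratC k d.+1)); exact: ratX_neqC.
by rewrite tofrac_eq0.
Qed.

Section Equivariance.
Variable L : {rmorphism R -> R}.
Hypotheses (LC : forall c, L c%:MP = c%:MP) (LX : forall l, graded (L 'X_l) = L 'X_l *: 'X).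
Hypothesis L_inj : injective L.
Lemma graded_linear p : graded (L p) = map_poly L (graded p).
Proof.
apply: (mpoly_rmorph_ext (f := graded \o L) (g := map_poly L \o graded)) => [c|l] /=.
  by rewrite LC !gradedC map_polyC /= LC.
by rewrite LX gradedX map_polyZ map_polyX.
Qed.
Lemma lead_form_linear p : lead_form (L p) = L (lead_form p).
Proof. by rewrite /lead_form graded_linear lead_coef_map_inj ?rmorph0. Qed.
Lemma size_graded_linear p : size (graded (L p)) = size (graded p).
Proof. by rewrite graded_linear size_map_inj_poly ?rmorph0. Qed.
End Equivariance.

(** A fraction of polynomials need not have degree 0. Numerator and denominator are replaced by
    their top forms, with which linear substitutions commute, so both relations persist; the first
    one forces the two degrees to be equal. *)
Lemma omega_splitting (S T : {rmorphism E -> E}) (LS LT : {rmorphism R -> R}) mu th :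
  (forall p, S p%:F = (LS p)%:F) -> (forall p, T p%:F = (LT p)%:F) ->
  injective LS -> injective LT ->
  (forall c, LS c%:MP = c%:MP) -> (forall l, graded (LS 'X_l) = LS 'X_l *: 'X) ->
  (forall c, LT c%:MP = c%:MP) -> (forall l, graded (LT 'X_l) = LT 'X_l *: 'X) ->
  mu != 0 -> omega th -> th != 0 -> is_const (mu * S mu) -> is_const (T mu / (mu * th)) ->
  exists mu1, [/\ mu1 != 0, omega mu1, is_const (mu1 * S mu1) & is_const (T mu1 / (mu1 * th))].
Proof.
move=> SL TL Si Ti SC SX TC TX mu0 Oth th0 [c c0 cE] [e e0 eE].
have [p [q [q0 muE]]] := fracE mu.
have [a [b [N [b0 thE ga gb]]]] := omega_fraction Oth.
have p0 : p != 0 by apply: contraNneq mu0 => p0; rewrite muE p0 rmorph0 mul0r.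
have a0 : a != 0 by apply: contraNneq th0 => a0; rewrite thE a0 rmorph0 mul0r.
have F0 (x : R) : x != 0 -> x%:F != 0 by rewrite tofrac_eq0.
have S0 x : x != 0 -> LS x != 0 by rewrite -(inj_eq Si) rmorph0.
have T0 x : x != 0 -> LT x != 0 by rewrite -(inj_eq Ti) rmorph0.
have cP : p * LS p = c%:MP * (q * LS q).
  apply/eqP; rewrite -tofrac_eq !tofracM -!SL; apply/eqP.
  apply: (frac_const_alg (F0 _ q0)); first by rewrite fmorph_eq0; exact: F0.
  by rewrite -fmorph_div -muE cE.
have eP : LT p * q * b = e%:MP * (p * LT q * a).
  apply/eqP; rewrite -tofrac_eq !tofracM -!TL; apply/eqP.
  apply: (frac_twist_alg (F0 _ p0) (F0 _ q0) (F0 _ a0) (F0 _ b0)); first by rewrite fmorph_eq0; exact: F0.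
  by rewrite -fmorph_div -muE -thE eE.
have lF0 x : x != 0 -> (lead_form x)%:F != 0 by rewrite tofrac_eq0 lead_form_eq0.
have Sdiv x y : S (x%:F / y%:F) = (LS x)%:F / (LS y)%:F.
  by rewrite -!SL; exact: fmorph_div.
have Tdiv x y : T (x%:F / y%:F) = (LT x)%:F / (LT y)%:F.
  by rewrite -!TL; exact: fmorph_div.
have lS0 : (LS (lead_form q))%:F != 0 by apply/F0/S0; rewrite lead_form_eq0.
have lT0 : (LT (lead_form q))%:F != 0 by apply/F0/T0; rewrite lead_form_eq0.
exists ((lead_form p)%:F / (lead_form q)%:F); split.
- by apply: divf_neq0; exact: lF0.
- apply: (lead_form_omega q0).
  have := congr1 graded cP; rewrite !gradedM gradedC.
  have gp : graded p != 0 by rewrite graded_eq0.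
  have gq : graded q != 0 by rewrite graded_eq0.
  have sc : size (c%:MP : R)%:P = 1%N by rewrite size_polyC mpolyC_eq0 c0.
  exact: (size_prod_alg gp gq sc (size_graded_linear SC SX Si p) (size_graded_linear SC SX Si q)).
- exists c => //; have := congr1 lead_form cP.
  rewrite !lead_formM lead_formC !(lead_form_linear SC SX Si) => E1.
  rewrite Sdiv; apply: (frac_const_algV (lF0 _ q0) lS0).
  by have := congr1 (fun x => x%:F) E1; rewrite !tofracM; apply.
exists e => //; have := congr1 lead_form eP.
rewrite !lead_formM lead_formC !(lead_form_linear TC TX Ti) (lead_form_id ga) (lead_form_id gb) => E1.
rewrite Tdiv thE; apply: (frac_twist_algV (lF0 _ p0) (lF0 _ q0) (F0 _ a0) (F0 _ b0) lT0).
by have := congr1 (fun x => x%:F) E1; rewrite !tofracM; apply.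
Qed.
End HomogeneousField.

Lemma mleadcM_id (K : fieldType) r (p q : {mpoly K[r]}) : mleadc (p * q) = mleadc p * mleadc q.
Proof.
have [->|p0] := eqVneq p 0; first by rewrite mul0r !mleadc0 mul0r.
have [->|q0] := eqVneq q 0; first by rewrite mulr0 !mleadc0 mulr0.
by apply: mleadcM_proper; rewrite mulf_neq0 ?mleadc_eq0.
Qed.

(** * Actions on coefficients, leading coefficients *)

Section CoefficientAction.
Variables (K K' : fieldType) (r : nat) (f : {rmorphism K -> K'}).
Local Notation R := {mpoly K[r]}.
Local Notation R' := {mpoly K'[r]}.
Local Notation E := (ratfun K r).
Local Notation E' := (ratfun K' r).
Local Notation "x %:F" := (@FracField.tofrac _ x).
Definition coef_map : R -> R' := mmap (@mpolyC r K' \o f) (fun l => 'X_l).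
HB.instance Definition _ := GRing.RMorphism.on coef_map.
Lemma coef_mapE p m : (coef_map p)@_m = f p@_m.
Proof.
rewrite [in RHS](mpolyE p) /coef_map /mmap !raddf_sum; apply: eq_bigr => m' _ /=.
by rewrite mcoeffCM mmap1_id mcoeffZ !mcoeffX rmorphM rmorph_nat.
Qed.
Lemma coef_map_inj : injective coef_map.
Proof.
move=> p q pq; apply/mpolyP => m; apply: (fmorph_inj f); rewrite -!coef_mapE pq; exact: erefl.
Qed.
Lemma mlead_coef_map p : mlead (coef_map p) = mlead p.
Proof.
rewrite /mlead; apply: perm_big; apply: uniq_perm; [exact: msupp_uniq|exact: msupp_uniq|move=> m].
by rewrite !mcoeff_msupp coef_mapE fmorph_eq0.
Qed.
Lemma tofrac_coef_map p : (coef_map p)%:F = mmap (@ratC K' r \o f) (@ratX K' r) p.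
Proof.
apply: (mpoly_rmorph_ext (f := @FracField.tofrac R' \o coef_map) (g := mmap (@ratC K' r \o f) (@ratX K' r)));
  by move=> x; rewrite /= /coef_map ?mmapC ?mmapX ?mmap1U.
Qed.
Lemma coef_frac_inj : injective (mmap (@ratC K' r \o f) (@ratX K' r) : R -> E').
Proof.
move=> p q; rewrite -!tofrac_coef_map => /eqP; rewrite tofrac_eq => /eqP; exact: coef_map_inj.
Qed.
Definition coef_frac : {rmorphism E -> E'} := frac_lift coef_frac_inj.
Lemma coef_fracE : ratsubst (@ratC K' r \o f) (@ratX K' r) =1 coef_frac.
Proof. by move=> x; exact: ratsubstE. Qed.
Lemma coef_frac_tofrac p : coef_frac p%:F = (coef_map p)%:F.
Proof. by rewrite tofrac_coef_map; exact: frac_liftE. Qed.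
Lemma coef_fracC c : coef_frac (ratC r c) = ratC r (f c).
Proof. by rewrite coef_frac_tofrac /coef_map mmapC. Qed.
Lemma coef_fracX l : coef_frac (ratX K l) = ratX K' l.
Proof. by rewrite coef_frac_tofrac /coef_map mmapX mmap1U. Qed.

Lemma mleadc_coef_map (p : R) : mleadc (coef_map p) = f (mleadc p).
Proof. by rewrite mlead_coef_map coef_mapE. Qed.
End CoefficientAction.

Section LeadingCoefficient.
Variables (K : fieldType) (r : nat) (F : set K).
Hypothesis sF : is_subfield F.
Local Notation R := {mpoly K[r.+1]}.
Local Notation E := (ratfun K r.+1).
Local Notation "x %:F" := (@FracField.tofrac R x).
Definition coefs_in (p : R) := forall m, F p@_m.
Lemma coefs_inB p q : coefs_in p -> coefs_in q -> coefs_in (p - q).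
Proof. by move=> cp cq m; rewrite mcoeffB; exact: (subfieldB sF). Qed.
Lemma coefs_inM p q : coefs_in p -> coefs_in q -> coefs_in (p * q).
Proof.
move=> cp cq m; rewrite mcoeffM; have [sr _] := sF.
by apply: (subring_sum sr) => i _; exact: (subfieldM sF).
Qed.
Lemma coefs_inX (m : 'X_{1..r.+1}) : coefs_in 'X_[m].
Proof.
by move=> m'; rewrite mcoeffX; case: (m == m'); [exact: subfield1|exact: subfield0].
Qed.
Lemma coefs_in1 : coefs_in 1. Proof. by rewrite -mpolyX0; exact: coefs_inX. Qed.
Lemma tp_fraction x : tp_field F x -> exists p q,
  [/\ q != 0, x = p%:F / q%:F, coefs_in p & coefs_in q].
Proof.
move: x; apply: subfield_min; first split; first split.
- by exists 1, 1; rewrite oner_neq0 divr1 rmorph1; split=> //; exact: coefs_in1.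
- move=> _ _ [a [b [b0 -> ca cb]]] [a' [b' [b0' -> ca' cb']]].
  exists (a * b' - a' * b), (b * b'); split; first by rewrite mulf_neq0.
  + rewrite -mulNr addf_div ?tofrac_eq0 // mulNr -!tofracM -tofracB; exact: erefl.
  + by apply: coefs_inB; exact: coefs_inM.
  exact: coefs_inM.
- move=> _ _ [a [b [b0 -> ca cb]]] [a' [b' [b0' -> ca' cb']]].
  exists (a * a'), (b * b'); split; first by rewrite mulf_neq0.
  + by rewrite mulf_div -!tofracM.
  + exact: coefs_inM.
  exact: coefs_inM.
- move=> _ [a [b [b0 -> ca cb]]]; have [->|a0] := eqVneq a 0.
    exists 0, 1; split; [exact: oner_neq0|by rewrite tofrac0 !mul0r invr0| |exact: coefs_in1].
    by move=> m; rewrite mcoeff0; exact: subfield0.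
  by exists b, a; rewrite invf_div.
move=> _ [[c Fc <-]|[[j l] _ <-]] /=.
  exists c%:MP, 1; rewrite oner_neq0 rmorph1 divr1; split=> //; last exact: coefs_in1.
  by move=> m; rewrite mcoeffC; apply: (subfieldM sF) => //; case: (m == 0%MM); [exact: subfield1|exact: subfield0].
exists 'X_j, 'X_l; split=> //; try exact: coefs_inX.
have : (mpolyX K U_(l)%MM)%:F != 0 by rewrite -[0](rmorph0 (@ratC K r.+1)); exact: ratX_neqC.
by rewrite tofrac_eq0.
Qed.

(** Eliminates the variables of the trivial factor P^r: the action is on coefficients only, so
    leading coefficients for the monomial order inherit both relations. *)
Lemma leading_splitting (f g : {rmorphism K -> K}) nu th c e : tp_field F nu -> nu != 0 ->
  F th -> th != 0 -> nu * coef_frac r.+1 f nu = ratC r.+1 c ->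
  coef_frac r.+1 g nu / (nu * ratC r.+1 th) = ratC r.+1 e ->
  exists nu0, [/\ F nu0, nu0 != 0, nu0 * f nu0 = c & g nu0 / (nu0 * th) = e].
Proof.
move=> Fnu nu0 Fth th0 cE eE; have [p [q [q0 nuE cp cq]]] := tp_fraction Fnu.
have p0 : p != 0 by apply: contraNneq nu0 => p0; rewrite nuE p0 tofrac0 mul0r.
have F0 (x : R) : x != 0 -> x%:F != 0 by rewrite tofrac_eq0.
have c0 (h : {rmorphism K -> K}) (x : R) : x != 0 -> coef_map h x != 0.
  by apply: contra_neq => hx; apply: (@coef_map_inj _ _ _ h); rewrite hx /coef_map rmorph0.
have divE (h : {rmorphism K -> K}) x y :
    coef_frac r.+1 h (x%:F / y%:F) = (coef_map h x)%:F / (coef_map h y)%:F.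
  by rewrite -!coef_frac_tofrac; exact: fmorph_div.
have th1 : (th%:MP : R) != 0 by rewrite mpolyC_eq0.
have cP : p * coef_map f p = c%:MP * (q * coef_map f q).
  apply/eqP; rewrite -tofrac_eq !tofracM; apply/eqP.
  apply: (frac_const_alg (F0 _ q0) (F0 _ (c0 f _ q0))).
  by rewrite -divE -nuE.
have eP : coef_map g p * q * 1 = e%:MP * (p * coef_map g q * th%:MP).
  apply/eqP; rewrite -tofrac_eq !tofracM; apply/eqP.
  apply: (frac_twist_alg (F0 _ p0) (F0 _ q0) (F0 _ th1) (F0 _ (oner_neq0 R)) (F0 _ (c0 g _ q0))).
  by rewrite -divE -nuE tofrac1 divr1.
have l0 (x : R) : x != 0 -> mleadc x != 0 by rewrite mleadc_eq0.
have h0 (h : {rmorphism K -> K}) x : x != 0 -> h x != 0 by rewrite fmorph_eq0.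
exists (mleadc p / mleadc q); split.
- exact: (subfield_div sF).
- by apply: divf_neq0; exact: l0.
- have := congr1 (fun x => mleadc x) cP; rewrite !mleadcM_id mleadc_coef_map mleadcC mleadc_coef_map.
  move=> E1; rewrite fmorph_div; apply: (frac_const_algV (l0 _ q0) (h0 f _ (l0 _ q0))).
  exact: E1.
have := congr1 (fun x => mleadc x) eP.
rewrite !mleadcM_id !mleadc_coef_map !mleadcC => E1.
rewrite fmorph_div -[th]divr1.
exact: (frac_twist_algV (l0 _ p0) (l0 _ q0) th0 (oner_neq0 K) (h0 g _ (l0 _ q0))).
Qed.
End LeadingCoefficient.

(** * Linear representations as substitutions *)

Section LinearAction.
Variables (k : fieldType) (d : nat).
Local Notation R := {mpoly k[d.+1]}.
Local Notation E := (ratfun k d.+1).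
Local Notation "x %:F" := (@FracField.tofrac R x).
Definition lin_subst (A : 'M[k]_d.+1) : R -> R :=
  mmap (@mpolyC d.+1 k) (fun l => \sum_j (A l j)%:MP * 'X_j).
HB.instance Definition _ A := GRing.RMorphism.on (lin_subst A).
Lemma lin_substC A c : lin_subst A c%:MP = c%:MP. Proof. exact: mmapC. Qed.
Lemma lin_substX A l : lin_subst A 'X_l = \sum_j (A l j)%:MP * 'X_j.
Proof. by rewrite /lin_subst mmapX mmap1U. Qed.
Lemma lin_substM A B p : lin_subst A (lin_subst B p) = lin_subst (B *m A) p.
Proof.
apply: (mpoly_rmorph_ext (f := lin_subst A \o lin_subst B)) => [c|l] /=; first by rewrite !lin_substC.
have SX i : lin_subst A ((B l i)%:MP * 'X_i) = \sum_j (B l i * A i j)%:MP * 'X_j.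
  rewrite /lin_subst rmorphM -!/(lin_subst A _) [X in X * _]lin_substC [X in _ * X]lin_substX.
  by rewrite mulr_sumr; apply: eq_bigr => j _; rewrite mpolyCM mulrA.
have -> : lin_subst A (lin_subst B 'X_l) = \sum_i \sum_j (B l i * A i j)%:MP * 'X_j.
  by rewrite lin_substX (raddf_sum (lin_subst A)); apply: eq_bigr => i _; exact: SX.
rewrite lin_substX.
rewrite exchange_big; apply: eq_bigr => j _; rewrite mxE rmorph_sum mulr_suml.
by apply: eq_bigr => i _.
Qed.
Lemma lin_subst1 p : lin_subst 1%:M p = p.
Proof.
apply: (mpoly_rmorph_ext (g := idfun)) => [c|l] /=; first exact: lin_substC.
rewrite lin_substX (bigD1 l) //= big1 => [|j jl]; rewrite mxE ?eqxx ?mul1r ?addr0 //.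
by rewrite eq_sym (negPf jl) mul0r.
Qed.
Lemma lin_subst_inj A B : A *m B = 1%:M -> injective (lin_subst A).
Proof. by move=> AB; apply: (can_inj (g := lin_subst B)) => p; rewrite lin_substM AB lin_subst1. Qed.
Lemma graded_lin_subst A l : graded (lin_subst A 'X_l) = lin_subst A 'X_l *: 'X.
Proof.
rewrite lin_substX (raddf_sum (@graded k d)) scaler_suml; apply: eq_bigr => j _.
by rewrite -[LHS]/(graded _) gradedM gradedC gradedX mul_polyC scalerA.
Qed.
Lemma lin_act_morph (gT : finGroupType) (G : {group gT}) (rV : mx_representation k G d.+1) g :
  g \in G -> exists S : {rmorphism E -> E}, S =1 lin_act rV g /\
    forall p, S p%:F = (lin_subst (rV g) p)%:F.
Proof.
move=> Gg; have inj : injective (lin_subst (rV g)).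
  by apply: (@lin_subst_inj _ (rV g^-1%g)); rewrite -repr_mxM ?groupV // mulgV repr_mx1.
pose v l := \sum_(j < d.+1) ratC d.+1 (rV g l j) * ratX k j.
have subE p : mmap (@ratC k d.+1) v p = (lin_subst (rV g) p)%:F.
  apply: (mpoly_rmorph_ext (g := @FracField.tofrac R \o lin_subst (rV g))) => [c|l] /=.
    by rewrite mmapC lin_substC.
  rewrite mmapX mmap1U lin_substX /v raddf_sum; apply: eq_bigr => j _.
  by rewrite -[RHS]/((_ * _)%:F) tofracM.
have injE : injective (mmap (@ratC k d.+1) v : R -> E).
  by move=> p q; rewrite !subE => /eqP; rewrite tofrac_eq => /eqP; exact: inj.
exists (frac_lift injE); split=> [x|p]; last by rewrite -subE; exact: frac_liftE.
by rewrite /lin_act (ratsubstE injE).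
Qed.
End LinearAction.

(** * Transport of the relations along a birational map *)

Section ConjugateFields.
Variables (E E' : fieldType) (H : set E) (W : set E') (phi : E' -> E) (psi : E -> E').
Hypotheses (sH : is_subfield H) (sW : is_subfield W).
Hypotheses (phiH : forall y, W y -> H (phi y)) (psiW : forall x, H x -> W (psi x)).
Hypotheses (phi1 : phi 1 = 1) (phiM : forall x y, W x -> W y -> phi (x * y) = phi x * phi y).
Hypothesis phi0 : phi 0 = 0.
Hypotheses (phiK : forall y, W y -> psi (phi y) = y) (psiK : forall x, H x -> phi (psi x) = x).
Lemma conj_inj x y : W x -> W y -> phi x = phi y -> x = y.
Proof. by move=> Wx Wy e; rewrite -(phiK Wx) e phiK. Qed.
Lemma conj_neq0 x : W x -> x != 0 -> phi x != 0.
Proof. by move=> Wx; apply: contra_neq => e; apply: conj_inj => //; [exact: subfield0|rewrite e]. Qed.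
Lemma conjV x : W x -> phi x^-1 = (phi x)^-1.
Proof.
move=> Wx; have [->|x0] := eqVneq x 0; first by rewrite invr0 phi0 invr0.
apply: (mulfI (conj_neq0 Wx x0)); rewrite -phiM ?mulfV ?conj_neq0 //.
exact: subfieldV.
Qed.
Lemma conj_psi_neq0 x : H x -> x != 0 -> psi x != 0.
Proof. by move=> Hx; apply: contra_neq => e; rewrite -(psiK Hx) e. Qed.
Variables (S T : E' -> E') (A B : E -> E).
Hypotheses (SW : forall x, W x -> W (S x)) (TW : forall x, W x -> W (T x)).
Hypotheses (phiS : forall x, W x -> phi (S x) = A (phi x)) (phiT : forall x, W x -> phi (T x) = B (phi x)).
Variables (rho th : E).
Hypotheses (Hrho : H rho) (Hth : H th) (thE : th = rho * A (B rho)).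
Hypotheses (Ath : A th = th^-1) (Bth : B th = th^-1).
Lemma conj_theta : [/\ psi th = psi rho * S (T (psi rho)), S (psi th) = (psi th)^-1
  & T (psi th) = (psi th)^-1].
Proof.
have WM x y : W x -> W y -> W (x * y) by exact: subfieldM.
have WV x : W x -> W x^-1 by exact: subfieldV.
by split; apply: conj_inj; auto; rewrite ?phiM ?conjV ?phiS ?phiT ?psiK; auto.
Qed.
Lemma conj_splitting mu : W mu -> mu != 0 ->
  [/\ H (phi mu), phi mu != 0, phi mu * A (phi mu) = phi (mu * S mu)
    & B (phi mu) / (phi mu * th) = phi (T mu / (mu * psi th))].
Proof.
have WM x y : W x -> W y -> W (x * y) by exact: subfieldM.
have WV x : W x -> W x^-1 by exact: subfieldV.
by move=> Wm m0; split; [auto|exact: conj_neq0|..]; rewrite ?phiM ?conjV ?phiM ?phiS ?phiT ?psiK; auto.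
Qed.
End ConjugateFields.

Lemma mpoly_unit_const (k : fieldType) d (u v : {mpoly k[d]}) : u * v = 1 ->
  exists2 c, c != 0 & u = c%:MP.
Proof.
move=> uv; have /andP[/eqP uE _] := mpoly_intro_unit (etrans (mulrC v u) uv).
exists (u@_0)%MM => //; apply/eqP => u0; move: uv; rewrite uE u0 mpolyC0 mul0r => /eqP.
by rewrite eq_sym oner_eq0.
Qed.

Lemma fmorph_neq0 (E E' : fieldType) (f : {rmorphism E -> E'}) x : x != 0 -> f x != 0.
Proof. by rewrite fmorph_eq0. Qed.

Section PolynomialSplitting.
Variables (K : fieldType) (d : nat).
Local Notation R := {mpoly K[d]}.
Local Notation E := (ratfun K d).
Local Notation "x %:F" := (@FracField.tofrac R x).
Lemma poly_unit_const (x : E) : x != 0 ->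
  (forall v, (exists2 p : R, prime_elt p & v = frac_ord p) -> v x = 0) -> is_const x.
Proof.
move=> x0 vx; have fac := ufd_factorial (@ufd_mpoly K d).
have [[p _ pE] [q _ qE]] := (fac_unit fac (x := x) I x0).2 vx.
have pq : p * q = 1.
  by apply/eqP; rewrite -tofrac_eq tofracM pE qE tofrac1; apply/eqP; exact: mulfV.
have [c c0 pc] := mpoly_unit_const pq.
by exists c => //; rewrite -pE pc.
Qed.
(** The last clause places [mu] in every group containing the constants and the prime factors of
    [th]; for a retraction it makes [mu] a unit at the point considered. *)
Lemma poly_splitting (S T : {rmorphism E -> E}) (rho th : E) :
  (forall p, exists q, S p%:F = q%:F) -> (forall p, exists q, T p%:F = q%:F) ->
  involutive S -> involutive T -> (forall x, S (T x) = T (S x)) ->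
  rho != 0 -> th = rho * S (T rho) -> S th = th^-1 -> T th = th^-1 ->
  exists mu, [/\ mu != 0, is_const (mu * S mu), is_const (T mu / (mu * th))
    & forall P : E -> Prop, (forall c, c != 0 -> P (ratC d c)) ->
      (forall a b, P a -> P b -> P (a * b)) -> (forall a, P a -> P a^-1) ->
      (forall p, prime_elt p -> frac_ord p th != 0 -> P p%:F) -> P mu].
Proof.
move=> Sp Tp SK TK ST rho0 thE Sth Tth; have fac := ufd_factorial (@ufd_mpoly K d).
have AS x : range (@FracField.tofrac R) x -> range (@FracField.tofrac R) (S x).
  by move=> [p _ <-]; have [q ->] := Sp p; exists q.
have AT x : range (@FracField.tofrac R) x -> range (@FracField.tofrac R) (T x).
  by move=> [p _ <-]; have [q ->] := Tp p; exists q.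
have th0 : th != 0.
  by rewrite thE mulf_eq0 !fmorph_eq0 orbb.
have [mu [_ mu0 muv Pmu]] := splitting_lift fac SK TK ST (fun _ _ => I) (fun _ _ => I)
  (factorial_stable SK (fun _ _ => I) AS fac) (factorial_stable TK (fun _ _ => I) AT fac)
  I rho0 thE Sth Tth.
have Smu0 : S mu != 0 := @fmorph_neq0 _ _ S _ mu0.
have Tmu0 : T mu != 0 := @fmorph_neq0 _ _ T _ mu0.
exists mu; split.
- exact: mu0.
- exact: (poly_unit_const (mulf_neq0 mu0 Smu0) (fun v Vv => (muv v Vv).1)).
- exact: (poly_unit_const (divf_neq0 Tmu0 (mulf_neq0 mu0 th0)) (fun v Vv => (muv v Vv).2)).
move=> P PC PM PV Pp; apply: Pmu => //; first by rewrite -[1](rmorph1 (@ratC K d)); apply: PC; exact: oner_neq0.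
move=> v u [p pp vE] vth [_ u0 vu wu].
have p0 : p%:F != 0 by rewrite tofrac_eq0; case: pp.
have [c c0 cE] : is_const (u / p%:F).
  apply: (poly_unit_const (divf_neq0 u0 p0)) => w [q qp wE].
  have Vw : [set v | exists2 p : R, prime_elt p & v = frac_ord p] w by exists q.
  have dw := fac_val fac Vw.
  have [_ _ vp wp] := prime_uniformizer (@ufd_mpoly K d) pp.
  apply/(val_div_eq0 (E := setT) _ dw I I u0 p0); first by [].
  have [->|N] := eqVneq w v; first by rewrite vu vE vp.
  by rewrite wu // wp // -vE.
rewrite -(divfK p0 u) cE; apply: PM; first exact: PC.
by apply: Pp => //; rewrite -vE.
Qed.
End PolynomialSplitting.

(** * Failure of stable linearizability *)

Section NotStablyLinearizable.
Variables (k : fieldType) (m0 : nat).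
Hypotheses (m0_gt1 : (1 < m0)%N) (m0_even : ~~ odd m0).
Local Notation n := m0.+4.
Local Notation K := (ratfun k n).
Local Notation X := (M0nbar k n).
Local Notation brK := (@brK k m0).
Local Notation ffield := (@ffield k m0).
Local Notation pv := (@pv k m0).
Local Notation sg := (sg m0_gt1 m0_even).
Local Notation tg := (tg m0_gt1 m0_even).
Local Notation Theta := (mon brK (@theta_exp m0)).
Local Notation Rho := (mon brK (@rho_exp m0)).

Lemma pv_Theta_sg : pv sg Theta = Theta^-1.
Proof.
rewrite pv_mon -(monN brK); congr (mon brK _); apply/funext => p; exact: theta_exp_sg.
Qed.
Lemma pv_Theta_tg : pv tg Theta = Theta^-1.
Proof.
rewrite pv_mon -(monN brK); congr (mon brK _); apply/funext => p; exact: theta_exp_tg.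
Qed.
Lemma Theta_Rho : Theta = Rho * pv sg (pv tg Rho).
Proof.
rewrite -pvM -sgtg pv_mon -(monD (@brK_neq0 k m0)); congr (mon brK _); apply/funext => p.
exact: theta_rho.
Qed.
Lemma ffield_Theta : ffield Theta. Proof. exact/ffield_mon/balanced_theta. Qed.
Lemma ffield_Rho : ffield Rho. Proof. exact/ffield_mon/balanced_rho. Qed.
Lemma Theta_neq0 : Theta != 0. Proof. exact/mon_neq0/brK_neq0. Qed.
Lemma Rho_neq0 : Rho != 0. Proof. exact/mon_neq0/brK_neq0. Qed.
Lemma pv1 x : pv 1%g x = x.
Proof. by apply: (fmorph_inj (pv 1%g)); rewrite -pvM mulg1. Qed.
Lemma pv_sg_involutive : involutive (pv sg).
Proof. by move=> x; rewrite -pvM sg2; exact: pv1. Qed.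
Lemma pv_tg_involutive : involutive (pv tg).
Proof. by move=> x; rewrite -pvM tg2; exact: pv1. Qed.
Lemma pv_sg_tgC x : pv sg (pv tg x) = pv tg (pv sg x).
Proof. by rewrite -!pvM sgtg. Qed.

Lemma omega_lin_subst d (S : {rmorphism ratfun k d.+1 -> ratfun k d.+1}) (A : 'M[k]_d.+1) :
  (forall p, S (FracField.tofrac p) = FracField.tofrac (lin_subst A p)) ->
  forall x, omega x -> omega (S x).
Proof.
move=> SE; have sO := omega_subfield k d; have [sr _] := sO.
suff : @omega k d `<=` S @^-1` @omega k d by [].
rewrite [X in X `<=` _]omegaE; apply: subfield_min.
  split; first exact: preim_subring.
  by move=> x; rewrite /preimage /= fmorphV; exact: subfieldV.
have t0 : ratX k (ord0 : 'I_d.+1) != 0.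
  by rewrite -[0](rmorph0 (@ratC k d.+1)); exact: ratX_neqC.
have SX l : omega (S (ratX k l) / ratX k ord0).
  rewrite SE lin_substX (raddf_sum (@FracField.tofrac {mpoly k[d.+1]})) mulr_suml.
  apply: (subring_sum sr) => j _; rewrite -[X in X / _]/(FracField.tofrac (_ * _)) tofracM -mulrA.
  by apply: (subringM sr); [exact: omega_const|exact: omega_ratio].
move=> _ [[c _ <-]|[[j l] _ <-]].
  by rewrite /preimage /= SE lin_substC; exact: omega_const.
rewrite /preimage /= fmorph_div (ratio_alg _ _ t0).
by apply: (subfield_div sO); exact: SX.
Qed.

Theorem not_stably_linearizable (H : {group 'S_n}) : Gkl m0_gt1 m0_even \subset H ->
  ~ stably_linearizable (@ratC k n) H (@perm_vars k n) (pts X).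
Proof.
move=> /fintype.subsetP GH [r [d [rV [U [W [f [f' [[oU nU stU] [oW nW stW] [mf mf'] [rf rf'] eqv]]]]]]]].
have Hs : sg \in H by apply/GH/klein_s.
have Ht : tg \in H by apply/GH/klein_t.
pose eta := @tp_field K ffield r.
have sFf := ffield_subfield k m0.
have seta : is_subfield eta by exact: tp_subfield.
have Ueta : U eta.
  exact: (@tp_open k K (@ratC k n) (pts X) ffield (chart 1%g) r (@pts_ffield k m0)
    (@chart_affine k m0 1%g) (@chart_frac k m0 1%g) _ oU nU).
have A0X : affine_open (@idfun k) [set setT] (setT : set k).
  split.
    by exists [::]; apply/seteqP; split=> // x _; exact: gen_const.
  move=> O [P [_ [_ P1] _ _ _] <-]; apply/seteqP; split=> // x _.
  by exists x, 1; rewrite divr1.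
have A0F : localization (setT : set k) [set 0] = setT.
  by apply/seteqP; split=> // x _; exists x, 1; rewrite divr1; split=> //; exact/eqP/oner_neq0.
have Womega : W (@omega k d).
  rewrite omegaE; apply: (@tp_open k k idfun [set setT] setT setT d _ A0X A0F W oW nW).
  by move=> O ->.
have [mf1 mf2 mfC _] := mf; have [mf1' mf2' _ _] := mf'.
set om := @omega k d in Womega; have som : is_subfield om by exact: omega_subfield.
(* [f'] sends the generic point of P(V) to a point [Q] of [U] that [f] sends back, so the comorphism
   of [f] carries [om] into [Q], hence into [eta]. Symmetrically for [f']; the two comorphisms are
   inverse to each other between these fields. *)
set Q := on_points f' om; have UQ : U Q by exact: mf1'.
have [fQ psi_phi] := rf' _ Womega; rewrite -/Q in fQ.
have [phiQ phi1 phiB phiM _] := mf2 _ UQ; rewrite fQ in phiQ phiB phiM.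
have [f'R phi_psi] := rf _ Ueta.
have [psiR _ _ _ _] := mf2' _ (mf1 _ Ueta); rewrite f'R in psiR.
have Qeta : Q `<=` eta.
  exact: (@tp_sub k K (@ratC k n) (pts X) ffield r (@pts_ffield k m0) Q (oU.1 _ UQ)).
have Rom : on_points f eta `<=` om.
  rewrite /om omegaE; apply: (@tp_sub k k idfun [set setT] setT d _ _ (oW.1 _ (mf1 _ Ueta))).
  by move=> O ->.
have phi_eta y : om y -> eta (comor f y) by move=> oy; exact: (Qeta _ (phiQ _ (ex_intro2 _ _ y oy erefl))).
have psi_om x : eta x -> om (comor f' x) by move=> ex; exact: (Rom _ (psiR _ (ex_intro2 _ _ x ex erefl))).
have phi0 : comor f 0 = 0.
  by move: (phiB _ _ (subfield1 som) (subfield1 som)); rewrite !subrr.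
have [S [SE SL]] := lin_act_morph rV Hs; have [T [TE TL]] := lin_act_morph rV Ht.
have Som y : om y -> om (S y) by exact: omega_lin_subst SL y.
have Tom y : om y -> om (T y) by exact: omega_lin_subst TL y.
pose A := coef_frac r.+1 (pv sg); pose B := coef_frac r.+1 (pv tg).
have eqvg g (S' : {rmorphism ratfun k d.+1 -> ratfun k d.+1}) : g \in H -> S' =1 lin_act rV g ->
    (forall y, om y -> om (S' y)) ->
    forall y, om y -> comor f (S' y) = coef_frac r.+1 (pv g) (comor f y).
  move=> Hg S'E S'om y oy; have [pE] := eqv g Q Hg UQ; rewrite pE fQ.
  move=> /(_ y); rewrite /preimage /= -S'E => /(_ (S'om _ oy)) ->; exact: coef_fracE.
have phiS := eqvg _ _ Hs SE Som; have phiT := eqvg _ _ Ht TE Tom.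
have A_C x : A (ratC r.+1 x) = ratC r.+1 (pv sg x) by exact: coef_fracC.
have B_C x : B (ratC r.+1 x) = ratC r.+1 (pv tg x) by exact: coef_fracC.
pose th := ratC r.+1 Theta; pose rho := ratC r.+1 Rho.
have Hth : eta th by apply: tp_const; exact: ffield_Theta.
have Hrho : eta rho by apply: tp_const; exact: ffield_Rho.
have th0 : th != 0.
  exact: (@fmorph_neq0 _ _ (@ratC K r.+1) _ Theta_neq0).
have rho0 : rho != 0.
  exact: (@fmorph_neq0 _ _ (@ratC K r.+1) _ Rho_neq0).
have thE : th = rho * A (B rho).
  exact: (etrans (congr1 (@ratC K r.+1) Theta_Rho) (etrans (rmorphM (@ratC K r.+1) _ _)
    (congr1 (fun z => rho * z) (esym (etrans (congr1 A (B_C Rho)) (A_C _)))))).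
have Ath : A th = th^-1.
  exact: (etrans (A_C _) (etrans (congr1 (@ratC K r.+1) pv_Theta_sg) (fmorphV _ _))).
have Bth : B th = th^-1.
  exact: (etrans (B_C _) (etrans (congr1 (@ratC K r.+1) pv_Theta_tg) (fmorphV _ _))).
have [thE' Sth Tth] := conj_theta som psi_om phi1 phiM phi0 psi_phi phi_psi
  Som Tom phiS phiT Hrho Hth thE Ath Bth.
have rV2 g h : g \in H -> h \in H -> rV g *m rV h = rV (g * h)%g by move=> *; rewrite repr_mxM.
have ext (S1 S2 : {rmorphism ratfun k d.+1 -> ratfun k d.+1}) :
    (forall p, S1 (FracField.tofrac p) = S2 (FracField.tofrac p)) -> S1 =1 S2.
  by move=> E12; apply: rat_morph_ext => ?; exact: E12.
have SK : involutive S.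
  apply: (ext (S \o S) idfun) => p; rewrite /= !SL lin_substM rV2 // sg2 repr_mx1; exact: congr1 (lin_subst1 _).
have TK : involutive T.
  apply: (ext (T \o T) idfun) => p; rewrite /= !TL lin_substM rV2 // tg2 repr_mx1; exact: congr1 (lin_subst1 _).
have ST x : S (T x) = T (S x).
  apply: (ext (S \o T) (T \o S)) => p; rewrite /= TL !SL TL !lin_substM !rV2 // sgtg; exact: erefl.
have Sp p : exists q, S (FracField.tofrac p) = FracField.tofrac q by exists (lin_subst (rV sg) p).
have Tp p : exists q, T (FracField.tofrac p) = FracField.tofrac q by exists (lin_subst (rV tg) p).
have prho0 : comor f' rho != 0 by exact: (conj_psi_neq0 phi0 phi_psi Hrho rho0).
have pth0 : comor f' th != 0 by exact: (conj_psi_neq0 phi0 phi_psi Hth th0).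
have [mu [mu0 cS cT _]] := poly_splitting Sp Tp SK TK ST prho0 thE' Sth Tth.
have inj g : g \in H -> injective (lin_subst (rV g)).
  by move=> Hg; apply: (@lin_subst_inj _ _ _ (rV g^-1%g)); rewrite rV2 ?groupV // mulgV repr_mx1.
(* Three descents: top forms bring [mu] into the function field of P(V), the comorphism into that of
   the product with P^r, and leading coefficients into that of M_(0,n). *)
have [mu1 [mu10 Omu1 [c c0 cS1] [e e0 cT1]]] := omega_splitting SL TL (inj _ Hs) (inj _ Ht)
  (lin_substC _) (graded_lin_subst _) (lin_substC _) (graded_lin_subst _) mu0 (psi_om _ Hth) pth0 cS cT.
have [Hnu nu0 nuS nuT] := conj_splitting som phi_eta psi_om phi1 phiM phi0 psi_phi phi_psi
  Som Tom phiS phiT Hth Omu1 mu10.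
rewrite cS1 mfC in nuS; rewrite cT1 mfC in nuT.
have [nu1 [Fnu1 nu10 nuS1 nuT1]] := leading_splitting sFf Hnu nu0 ffield_Theta Theta_neq0 nuS nuT.
have pvC' g c' : exists c'', pv g (ratC n c') = ratC n c'' by exists c'; rewrite pvC.
have cS2 : is_const (nu1 * pv sg nu1) by exists c.
have cT2 : is_const (pv tg nu1 / (nu1 * Theta)) by exists e.
exact (@no_splitting k m0 m0_gt1 m0_even (pv sg) (pv tg) (pvC' sg) (pvC' tg) (@pv_br k m0 sg) (@pv_br k m0 tg)
  pv_sg_involutive pv_tg_involutive pv_sg_tgC nu1 Fnu1 nu10 cS2 cT2).
Qed.
End NotStablyLinearizable.

(** * Galois descent *)

Section SubfieldType.
Variables (E : fieldType) (S : set E).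
Definition subfield_pred (sS : is_subfield S) : {pred E} := fun x => `[< S x >].
Fact subfield_pred_closed (sS : is_subfield S) : divring_closed (subfield_pred sS).
Proof.
have [[S1 SB SM] SV] := sS; split; first exact/asboolP.
  by move=> x y /asboolP Sx /asboolP Sy; apply/asboolP; exact: SB.
by move=> x y /asboolP Sx /asboolP Sy; apply/asboolP; apply: SM => //; exact: SV.
Qed.
HB.instance Definition _ sS :=
  GRing.isDivringClosed.Build E (subfield_pred sS) (subfield_pred_closed sS).
Record subfield_type (sS : is_subfield S) :=
  SubfieldElt { subfield_val :> E; _ : subfield_val \in subfield_pred sS }.
Variable sS : is_subfield S.
HB.instance Definition _ := [isSub for @subfield_val sS].
HB.instance Definition _ := [Choice of subfield_type sS by <:].
HB.instance Definition _ := [SubChoice_isSubComUnitRing of subfield_type sS by <:].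
HB.instance Definition _ := [SubComUnitRing_isSubIntegralDomain of subfield_type sS by <:].
HB.instance Definition _ := [SubIntegralDomain_isSubField of subfield_type sS by <:].
Definition subfield_incl : {rmorphism subfield_type sS -> E} := val.
Lemma subfield_inclP y : S (subfield_incl y).
Proof. by have /asboolP := valP y. Qed.
Definition to_subfield (x : E) : subfield_type sS := insubd 0 x.
Lemma to_subfieldK x : S x -> subfield_incl (to_subfield x) = x.
Proof. by move=> Sx; rewrite /subfield_incl /to_subfield /= insubdK //; exact/asboolP. Qed.
End SubfieldType.

(** L over F through a basis [e] and its dual [e'] for the trace form. The two duality relations say
    that the matrices of the conjugates of [e] and of [e'] are inverse to each other, on either
    side. *)
Record galois_data (F L : fieldType) (iF : F -> L) (gT : finGroupType)
    (act : gT -> {rmorphism L -> L}) (N : nat) (e e' : 'I_N -> L) : Prop := GaloisData {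
  gd_M : forall g h x, act (g * h)%g x = act h (act g x);
  gd_F : forall g c, act g (iF c) = iF c;
  gd_fix : forall x, (forall g, act g x = x) -> exists c, x = iF c;
  gd_dual : forall g, \sum_i act g (e i) * e' i = (g == 1%g)%:R;
  gd_dual' : forall i j, \sum_g act g (e i * e' j) = (i == j)%:R }.

Section GaloisDescent.
Variables (F L : fieldType) (iF : {rmorphism F -> L}) (gT : finGroupType).
Variables (act : gT -> {rmorphism L -> L}) (N : nat) (e e' : 'I_N -> L).
Hypothesis gd : galois_data iF act e e'.

Lemma gd_act1 x : act 1%g x = x.
Proof. by apply: (fmorph_inj (act 1%g)); rewrite -(gd_M gd) mulg1. Qed.
Lemma gd_dualV g : \sum_i e i * act g (e' i) = (g == 1%g)%:R.
Proof.
rewrite -[RHS](rmorph_nat (act g)) -(inj_eq invg_inj) invg1 -(gd_dual gd g^-1%g) rmorph_sum.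
by apply: eq_bigr => i _; rewrite rmorphM -(gd_M gd) mulVg gd_act1.
Qed.
Lemma gd_dual1 : \sum_i e i * e' i = 1.
Proof.
have E := gd_dual gd 1%g; rewrite eqxx in E; apply: etrans E.
by apply: eq_bigr => i _; rewrite gd_act1.
Qed.
Lemma gd_trF x : exists c, \sum_g act g x = iF c.
Proof.
apply: (gd_fix gd) => h; rewrite rmorph_sum [RHS](reindex_inj (mulIg h)).
by apply: eq_bigr => g _; rewrite (gd_M gd).
Qed.

Section OneField.
Variables (E : fieldType) (l : {rmorphism L -> E}) (a : gT -> {rmorphism E -> E}).
Hypotheses (aM : forall g h x, a (g * h)%g x = a h (a g x))
  (al : forall g x, a g (l x) = l (act g x)).
Definition invariant x := forall g, a g x = x.
Definition tr x : E := \sum_g a g x.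
Lemma a1 x : a 1%g x = x.
Proof. by apply: (fmorph_inj (a 1%g)); rewrite -aM mulg1. Qed.
Lemma tr_inv x : invariant (tr x).
Proof.
move=> h; rewrite /tr rmorph_sum [RHS](reindex_inj (mulIg h)).
by apply: eq_bigr => g _; rewrite aM.
Qed.
Lemma tr_mulr x y : invariant y -> tr (x * y) = tr x * y.
Proof. by move=> iy; rewrite /tr mulr_suml; apply: eq_bigr => g _; rewrite rmorphM iy. Qed.
Lemma tr_sum I (r : seq I) (G : I -> E) : tr (\sum_(i <- r) G i) = \sum_(i <- r) tr (G i).
Proof. by rewrite exchange_big; apply: eq_bigr => g _; rewrite rmorph_sum. Qed.
Lemma tr_l x : tr (l x) = l (\sum_g act g x).
Proof. by rewrite rmorph_sum; apply: eq_bigr => g _; rewrite al. Qed.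
(** Galois descent in coordinates: the traces against the dual basis are the invariant coordinates
    on the basis. *)
Lemma tr_expand x : x = \sum_i l (e i) * tr (l (e' i) * x).
Proof.
under eq_bigr do rewrite /tr mulr_sumr.
rewrite exchange_big /= (bigD1 1%g) //= [X in _ + X]big1 => [|g g1].
  rewrite addr0 -[LHS]mul1r -(rmorph1 l) -gd_dual1 rmorph_sum mulr_suml.
  by apply: eq_bigr => i _; rewrite rmorphM a1 mulrA.
under eq_bigr do rewrite rmorphM al mulrA -rmorphM.
by rewrite -mulr_suml -rmorph_sum gd_dualV (negPf g1) rmorph0 mul0r.
Qed.
Lemma tr_coord (c : 'I_N -> E) j : (forall i, invariant (c i)) ->
  tr (l (e' j) * \sum_i l (e i) * c i) = c j.
Proof.
move=> ic; rewrite mulr_sumr tr_sum (bigD1 j) //= big1 => [|i ij]; last first.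
  by rewrite mulrA -rmorphM tr_mulr // tr_l mulrC mulrC (mulrC (e' j)) (gd_dual' gd) (negPf ij) rmorph0 mul0r.
by rewrite addr0 mulrA -rmorphM tr_mulr // tr_l (mulrC (e' j)) (gd_dual' gd) eqxx rmorph1 mul1r.
Qed.
Lemma prod_inv x : invariant (\prod_g a g x).
Proof.
move=> h; rewrite rmorph_prod [RHS](reindex_inj (mulIg h)).
by apply: eq_bigr => g _; rewrite aM.
Qed.

Variables (E0 : fieldType) (u : {rmorphism E0 -> E}) (i0 : {rmorphism F -> E0}).
Hypotheses (u_inv : forall c, invariant (u c)) (ui0 : forall c, u (i0 c) = l (iF c)).
Section Span.
Variable R0 : set E0.
Hypotheses (sR0 : is_subring R0) (R0F : forall c, R0 (i0 c)).
(** The extension of scalars of [R0] to L, realized inside [E]; coordinates on [e] are unique by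
    [tr_coord]. *)
Definition lspan : set E :=
  [set x | exists2 c : 'I_N -> E0, forall i, R0 (c i) & x = \sum_i l (e i) * u (c i)].
Lemma lspan_scale x c : R0 c -> lspan (l x * u c).
Proof.
move=> Rc; pose f i := sval (cid (gd_trF (e' i * x))).
have fE i : \sum_g act g (e' i * x) = iF (f i) by exact: svalP (cid (gd_trF (e' i * x))).
exists (fun i => i0 (f i) * c); first by move=> i; apply: (subringM sR0).
rewrite [X in X * _](tr_expand (l x)) mulr_suml; apply: eq_bigr => i _.
by rewrite rmorphM ui0 mulrA -fE -rmorphM tr_l.
Qed.
Lemma lspanB x y : lspan x -> lspan y -> lspan (x - y).
Proof.
move=> [c Rc ->] [d Rd ->]; exists (fun i => c i - d i) => [i|]; first exact: (subringB sR0).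
by rewrite -sumrB; apply: eq_bigr => i _; rewrite rmorphB mulrBr.
Qed.
Lemma lspan_l x : lspan (l x).
Proof. by rewrite -[l x]mulr1 -(rmorph1 u); apply: lspan_scale; exact: (subring1 sR0). Qed.
Lemma lspan_u c : R0 c -> lspan (u c).
Proof. by rewrite -[u c]mul1r -(rmorph1 l); exact: lspan_scale. Qed.
Lemma lspan0 : lspan 0. Proof. by rewrite -(rmorph0 l); exact: lspan_l. Qed.
Lemma lspanD x y : lspan x -> lspan y -> lspan (x + y).
Proof.
by move=> Lx Ly; rewrite -[y]opprK; apply: lspanB => //; rewrite -sub0r; apply: lspanB => //; exact: lspan0.
Qed.
Lemma lspan_sum I (r : seq I) (G : I -> E) : (forall i, lspan (G i)) -> lspan (\sum_(i <- r) G i).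
Proof. by move=> LG; apply: big_ind => //; [exact: lspan0|exact: lspanD]. Qed.
Lemma lspan_subring : is_subring lspan.
Proof.
split; [by rewrite -(rmorph1 l); exact: lspan_l|exact: lspanB|].
move=> _ _ [c Rc ->] [d Rd ->]; rewrite mulr_suml; apply: lspan_sum => i.
rewrite mulr_sumr; apply: lspan_sum => j; rewrite mulrACA -!rmorphM.
by apply: lspan_scale; exact: (subringM sR0).
Qed.
Lemma lspan_act g x : lspan x -> lspan (a g x).
Proof.
move=> [c Rc ->]; rewrite rmorph_sum; apply: lspan_sum => i.
by rewrite rmorphM al u_inv; exact: lspan_scale.
Qed.
(** The coordinates of [u y] are the traces of the [e' i] times [u y]; they come from [R0], and some
    trace is a nonzero element of F. *)
Lemma lspan_fixed y : lspan (u y) -> R0 y.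
Proof.
move=> [c Rc uE].
have cE i : u (c i) = l (\sum_g act g (e' i)) * u y.
  rewrite -[LHS](tr_coord (c := fun i => u (c i))) // -uE tr_mulr // tr_l; exact: erefl.
have [i ti] : exists i, \sum_g act g (e' i) != 0.
  apply: contrapT => N0; have /eqP := oner_neq0 L; apply.
  apply: (fmorph_inj l); rewrite rmorph0 rmorph1 [LHS]tr_expand.
  apply: big1 => i _; rewrite mulr1 tr_l (_ : \sum_g _ = 0) ?rmorph0 ?mulr0 //.
  by apply: contrapT => /eqP ti; apply: N0; exists i.
have [f fE] := gd_trF (e' i); rewrite fE in ti; have := cE i; rewrite fE -ui0 -rmorphM.
move=> /fmorph_inj ciE; have i0f : i0 f != 0.
  by rewrite fmorph_eq0; apply: contraNneq ti => ->; rewrite rmorph0.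
rewrite -[y](mulKf i0f) -ciE -fmorphV.
by apply: (subringM sR0).
Qed.
End Span.
(** The inverse is the product of the other conjugates divided by the norm, which is invariant. *)
Lemma lspan_subfield R0 : is_subfield R0 -> (forall c, R0 (i0 c)) ->
  (forall x, lspan R0 x -> invariant x -> range u x) -> is_subfield (lspan R0).
Proof.
move=> [sR0 R0V] R0F uinv; have sL := lspan_subring sR0 R0F; split=> // x Lx.
have [->|x0] := eqVneq x 0; first by rewrite invr0; exact: (subring0 sL).
have Lp : lspan R0 (\prod_g a g x) by apply: (subring_prod sL) => g _; exact: lspan_act.
have [y _ yE] := uinv _ Lp (prod_inv x); have Ly : lspan R0 (u y) by rewrite yE.
have y0 : u y != 0 by rewrite yE; apply/prodf_neq0 => g _; rewrite fmorph_eq0.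
have -> : x^-1 = (\prod_(g | g != 1%g) a g x) * u y^-1.
  rewrite fmorphV; apply: (mulIf y0); rewrite divfK // yE (bigD1 1%g) //= a1 mulKf //.
apply: (subringM sL); first by apply: (subring_prod sL) => g _; exact: lspan_act.
by apply: lspan_u => //; apply: R0V; exact: (lspan_fixed sR0 R0F Ly).
Qed.
End OneField.

Section Lift.
Variables (E0 E1 E2 : fieldType) (i0 : {rmorphism F -> E0}) (R0 : set E0).
Variables (l1 : {rmorphism L -> E1}) (a1 : gT -> {rmorphism E1 -> E1}) (u : {rmorphism E0 -> E1}).
Variables (l2 : {rmorphism L -> E2}) (a2 : gT -> {rmorphism E2 -> E2}) (w : E0 -> E2).
Hypotheses (a1M : forall g h x, a1 (g * h)%g x = a1 h (a1 g x))
  (al1 : forall g x, a1 g (l1 x) = l1 (act g x)) (al2 : forall g x, a2 g (l2 x) = l2 (act g x)).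
Hypotheses (u_inv : forall c, invariant a1 (u c)) (ui0 : forall c, u (i0 c) = l1 (iF c)).
Hypotheses (w_inv : forall c, R0 c -> invariant a2 (w c)) (wi0 : forall c, w (i0 c) = l2 (iF c)).
Hypotheses (sR0 : is_subring R0) (R0F : forall c, R0 (i0 c)).
Hypotheses (wB : forall x y, R0 x -> R0 y -> w (x - y) = w x - w y)
  (wM : forall x y, R0 x -> R0 y -> w (x * y) = w x * w y).
Local Notation span := (lspan l1 u R0).
(** Extends [w] by L-linearity. [w] respects the operations on [R0] only, as does the comorphism of
    a morphism that need not be dominant. *)
Definition lift (x : E1) : E2 :=
  if pselect (exists c : 'I_N -> E0, (forall i, R0 (c i)) /\ x = \sum_i l1 (e i) * u (c i)) is left H
  then \sum_i l2 (e i) * w (sval (cid H) i) else 0.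
Lemma lift_coords (c d : 'I_N -> E0) :
  \sum_i l1 (e i) * u (c i) = \sum_i l1 (e i) * u (d i) -> c = d.
Proof.
move=> E; apply/funext => j; apply: (fmorph_inj u).
rewrite -[LHS](tr_coord al1 (c := fun i => u (c i))) // E.
exact: (tr_coord al1 (c := fun i => u (d i))).
Qed.
Lemma liftE c : (forall i, R0 (c i)) ->
  lift (\sum_i l1 (e i) * u (c i)) = \sum_i l2 (e i) * w (c i).
Proof.
move=> Rc; rewrite /lift; case: pselect => [H|[]]; last by exists c.
by have [_ /lift_coords <-] := svalP (cid H).
Qed.
Lemma lift_scale x c : R0 c -> lift (l1 x * u c) = l2 x * w c.
Proof.
move=> Rc; pose f i := sval (cid (gd_trF (e' i * x))).
have fE i : \sum_g act g (e' i * x) = iF (f i) by exact: svalP (cid (gd_trF (e' i * x))).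
have -> : l1 x * u c = \sum_i l1 (e i) * u (i0 (f i) * c).
  rewrite [X in X * _](tr_expand a1M al1 (l1 x)) mulr_suml; apply: eq_bigr => i _.
  by rewrite rmorphM ui0 mulrA -fE -rmorphM (tr_l al1).
rewrite liftE => [|i]; last by apply: (subringM sR0).
have xE : x = \sum_i e i * iF (f i).
  apply: (fmorph_inj l1); rewrite [LHS](tr_expand a1M al1) rmorph_sum.
  by apply: eq_bigr => i _; rewrite rmorphM -fE -(tr_l al1) rmorphM.
rewrite [in RHS]xE rmorph_sum mulr_suml; apply: eq_bigr => i _.
by rewrite wM // wi0 mulrA rmorphM.
Qed.
Lemma lift0 : lift 0 = 0.
Proof. by have := lift_scale 0 (subring0 sR0); rewrite !rmorph0 !mul0r. Qed.
Lemma liftB x y : span x -> span y -> lift (x - y) = lift x - lift y.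
Proof.
move=> [c Rc ->] [d Rd ->]; rewrite !liftE // -sumrB.
have -> : \sum_i (l1 (e i) * u (c i) - l1 (e i) * u (d i)) = \sum_i l1 (e i) * u (c i - d i).
  by apply: eq_bigr => i _; rewrite rmorphB mulrBr.
rewrite liftE => [|i]; last exact: (subringB sR0).
by rewrite -sumrB; apply: eq_bigr => i _; rewrite wB // mulrBr.
Qed.
Let sS : is_subring span. Proof. exact: (lspan_subring a1M al1). Qed.
Lemma liftD x y : span x -> span y -> lift (x + y) = lift x + lift y.
Proof.
move=> Sx Sy; have S0 := subring0 sS; have Ny : span (0 - y) by exact: (subringB sS).
rewrite -[in LHS](opprK y) -(sub0r y) liftB // liftB // lift0 sub0r opprK; exact: erefl.
Qed.
Lemma lift_sum I (r : seq I) (G : I -> E1) : (forall i, span (G i)) ->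
  lift (\sum_(i <- r) G i) = \sum_(i <- r) lift (G i).
Proof.
move=> SG; elim: r => [|i r IH]; first by rewrite !big_nil lift0.
rewrite !big_cons liftD ?IH //; exact: (subring_sum sS).
Qed.
Lemma liftM x y : span x -> span y -> lift (x * y) = lift x * lift y.
Proof.
have Ssc z c0 : R0 c0 -> span (l1 z * u c0) by move=> Rc0; apply: lspan_scale; eauto.
move=> [c Rc ->] [d Rd ->]; rewrite !liftE // mulr_suml [RHS]mulr_suml lift_sum => [|i]; last first.
  rewrite mulr_sumr; apply: (subring_sum sS) => j _; rewrite mulrACA -!rmorphM.
  by apply: Ssc; exact: (subringM sR0).
apply: eq_bigr => i _; rewrite mulr_sumr [RHS]mulr_sumr lift_sum => [|j]; last first.
  by rewrite mulrACA -!rmorphM; apply: Ssc; exact: (subringM sR0).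
apply: eq_bigr => j _; rewrite mulrACA -!rmorphM lift_scale; last exact: (subringM sR0).
by rewrite wM // rmorphM mulrACA.
Qed.
Lemma lift_act g x : span x -> lift (a1 g x) = a2 g (lift x).
Proof.
have Ssc z c0 : R0 c0 -> span (l1 z * u c0) by move=> Rc0; apply: lspan_scale; eauto.
move=> [c Rc ->]; rewrite liftE // !rmorph_sum lift_sum => [|i]; last first.
  by rewrite rmorphM al1 u_inv; exact: Ssc.
by apply: eq_bigr => i _; rewrite rmorphM al1 u_inv lift_scale // rmorphM al2 w_inv.
Qed.
Lemma lift_l x : w 1 = 1 -> lift (l1 x) = l2 x.
Proof.
move=> w1; have := lift_scale x (subring1 sR0).
by rewrite w1 rmorph1 !mulr1.
Qed.
End Lift.
End GaloisDescent.

Lemma pole_alg (E : fieldType) (f c y : E) : f != c -> f != 0 -> y = (f - c)^-1 ->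
  [/\ f = c + y^-1, 1 + c * y != 0, f^-1 = y / (1 + c * y), 1 - c * f^-1 = (1 + c * y)^-1
    & y = f^-1 / (1 - c * f^-1)].
Proof.
rewrite -subr_eq0 => fc f0 ->.
have H : 1 + c * (f - c)^-1 = f * (f - c)^-1 by field; rewrite fc.
have H0 : f * (f - c)^-1 != 0 by rewrite mulf_neq0 ?invr_eq0.
rewrite H; split=> //; first by rewrite invrK addrC subrK.
- by field; rewrite f0 fc.
- by field; rewrite f0 fc.
by field; rewrite f0 fc.
Qed.
Lemma pole_split_alg (E : fieldType) (f c d : E) : c != d ->
  1 - (f - c) / (d - c) = (d - f) / (d - c).
Proof. by rewrite eq_sym -subr_eq0 => dc; field; rewrite dc. Qed.

(** * Charts where the cross-ratios avoid a value *)

Section PoleCharts.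
Variables (k : fieldType) (m0 : nat).
Hypothesis m0_gt1 : (1 < m0)%N.
Local Notation n := m0.+4.
Local Notation K := (ratfun k n).
Local Notation brK := (@brK k m0).
Local Notation cr := (@cross_ratio k n).
Local Notation constK := (@ratC k n : {rmorphism k -> K}).
Implicit Types (O : set K) (c : k) (q : 'I_n * 'I_n * 'I_n * 'I_n).
Lemma cr_neq_const q c : @distinct4 n q -> cr q != constK c.
Proof.
move=> Dq; apply/eqP => E; case: q Dq E => -[[i1 i2] i3] i4 Dq E.
have cc : c != 0.
  apply: contra_eq_neq E => ->; rewrite rmorph0 cross_ratio_mon //; exact/mon_neq0/brK_neq0.
move: (Dq); rewrite /distinct4 /= !inE !negb_or => /and4P[/and3P[n12 n13 n14] /andP[n23 n24] n34 _].
have := bdry_const (@ev_bdry k m0 m0_gt1 i1 i3) (ex_intro2 _ _ c cc erefl).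
rewrite -E cross_ratio_mon // ev_mon //; last exact: balanced_cr.
rewrite /cr_exp /edge !xpair_eqE !eqxx (eq_sym i3 i1) (eq_sym i3 i2).
by rewrite (negPf n12) (negPf n13) (negPf n23) (negPf n34).
Qed.
Lemma cr_neq0 q : @distinct4 n q -> cr q != 0.
Proof. by move=> /(@cr_neq_const _ 0); rewrite rmorph0. Qed.
Definition pole c q : K := (cr q - constK c)^-1.
(** The affine open set where no cross-ratio takes the value c. Unlike a dihedral chart it is stable
    under all permutations of the points, so it can be descended. *)
Definition pole_ring c : set K := algebra_gen constK [set pole c q | q in @distinct4 n].
Lemma pole_ringP c q : @distinct4 n q -> pole_ring c (pole c q).
Proof. by move=> Dq; apply: gen_mem; exists q. Qed.
Lemma pole_ring_subring c : is_subring (pole_ring c). Proof. exact: gen_subring. Qed.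
Lemma poleE c q : @distinct4 n q -> [/\ cr q = constK c + (pole c q)^-1, 1 + constK c * pole c q != 0,
  (cr q)^-1 = pole c q / (1 + constK c * pole c q),
  1 - constK c * (cr q)^-1 = (1 + constK c * pole c q)^-1
  & pole c q = (cr q)^-1 / (1 - constK c * (cr q)^-1)].
Proof. by move=> Dq; exact: (pole_alg (cr_neq_const c Dq) (cr_neq0 Dq) erefl). Qed.
Lemma pole_neq0 c q : @distinct4 n q -> pole c q != 0.
Proof. by move=> Dq; rewrite invr_eq0 subr_eq0; exact: cr_neq_const. Qed.

(** Where the pole function y is a unit the cross-ratio is regular; where it is not, 1 + c y is a
    unit of the local ring and the inverse of the cross-ratio is regular. *)
Lemma pole_chart_pts O c : Aff (pole_ring c) O -> M0nbar_pts O.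
Proof.
move=> AO; have sB := pole_ring_subring c; have [lO sub OE] := Aff_local sB AO.
have [sO loc] := lO; have Oc x : O (constK x) by apply: sub; exact: gen_const.
pose t q := `[< runit O (pole c q) >]; exists t => //.
have sC : is_subring (@chart_alg k m0 t) by exact: gen_subring.
have Op q : @distinct4 n q -> O (pole c q) by move=> Dq; apply: sub; exact: pole_ringP.
have unit1 q : @distinct4 n q -> ~~ t q -> runit O (1 + constK c * pole c q).
  move=> Dq /asboolP nt; have Ocp : O (- (constK c * pole c q)).
    by apply: (subringN sO); apply: (subringM sO); [exact: Oc|exact: Op].
  have [r|] := loc _ Ocp; last by rewrite opprK.
  case: nt; move: r => /(runitN sO); rewrite mulrC; apply: runit_factor => //; exact: Op.
have CO : @chart_alg k m0 t `<=` O.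
  apply: gen_sub => // _ [q Dq <-]; have [fE nz gE _ _] := poleE c Dq.
  case: ifP => tq; first by rewrite fE; apply: (subringD sO) => //; have /asboolP[] := tq.
  by rewrite gE; apply: (subringM sO); [exact: Op|have [] := unit1 q Dq (negbT tq)].
apply: (local_eq lO OE sub sC CO); have pC := maxid_prime lO sC CO.
apply: gen_sub; first exact: is_subring_localization pC.
  by move=> x; apply: localization_sub => //; exact: gen_const.
move=> _ [q Dq <-]; have [fE nz gE hE yE] := poleE c Dq.
have Ctq : @chart_alg k m0 t (if t q then cr q else (cr q)^-1) by apply: gen_mem; exists q.
case: ifP Ctq => tq Ctq.
  have Cf : @chart_alg k m0 t (cr q - constK c) by apply: (subringB sC) => //; exact: gen_const.
  apply: (localizationV lO sC CO); first exact: localization_sub.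
  by rewrite -[cr q - _]invrK; apply: runitV; exact/asboolP.
have Cg : @chart_alg k m0 t (1 - constK c * (cr q)^-1).
  by apply: (subringB sC); [exact: (subring1 sC)|apply: (subringM sC) => //; exact: gen_const].
have sl := is_subring_localization sC pC.
rewrite yE; apply: (subringM sl); first exact: localization_sub.
apply: (localizationV lO sC CO); first exact: localization_sub.
by rewrite hE; apply: runitV; apply: unit1 => //; rewrite tq.
Qed.
Lemma pole_chart O c : M0nbar_pts O -> (forall q, @distinct4 n q -> O (pole c q)) ->
  Aff (pole_ring c) O.
Proof.
move=> XO Op; have [lO Oc _ [t [sub OE]]] := ptsP_M0n XO; have [sO loc] := lO.
have sB := pole_ring_subring c.
have BO : pole_ring c `<=` O by apply: gen_sub => // _ [q Dq <-]; exact: Op.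
have pB := maxid_prime lO sB BO; have sl := is_subring_localization sB pB.
apply: (local_eq lO OE sub sB BO); apply: gen_sub => //.
  by move=> x; apply: localization_sub => //; exact: gen_const.
move=> _ [q Dq <-]; have [fE nz gE hE yE] := poleE c Dq.
have Otq : O (if t q then cr q else (cr q)^-1) by apply: sub; apply: gen_mem; exists q.
have Bp := @pole_ringP c q Dq.
case: ifP Otq => tq Otq.
  rewrite fE; apply: (subringD sl); first by apply: localization_sub => //; exact: gen_const.
  apply: (localizationV lO sB BO); first exact: localization_sub.
  split; [exact: pole_neq0|exact: Op|].
  by rewrite invrK; apply: (subringB sO).
rewrite gE; apply: (subringM sl); first exact: localization_sub.
apply: (localizationV lO sB BO).
  apply: localization_sub => //; apply: (subringD sB); first exact: (subring1 sB).
  by apply: (subringM sB) => //; exact: gen_const.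
split=> //; last by rewrite -hE; apply: (subringB sO); [exact: (subring1 sO)|exact: (subringM sO)].
by apply: (subringD sO); [exact: (subring1 sO)|apply: (subringM sO) => //; exact: Op].
Qed.
(** A cross-ratio f has a single value at a point. If f is regular, one of (f - c) / (c' - c) and
    (c' - f) / (c' - c) is a unit; if only its inverse is regular, no pole function of f can fail to
    be regular. *)
Lemma pole_unique O c c' q : M0nbar_pts O -> @distinct4 n q -> ~ O (pole c q) -> ~ O (pole c' q) ->
  c = c'.
Proof.
move=> XO Dq Np Np'; apply: contrapT => /eqP cc'; have [[sO loc] Oc Ocr _] := ptsP_M0n XO.
have [Of|NOf] := pselect (O (cr q)).
  have dc : constK c != constK c' by rewrite (inj_eq (fmorph_inj _)).
  have cc0 : c' - c != 0 by rewrite subr_eq0 eq_sym.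
  have unit_part x : runit O (x / constK (c' - c)) -> O x^-1.
    move=> [_ _]; rewrite invf_div => H.
    have -> : x^-1 = constK (c' - c)^-1 * (constK (c' - c) / x).
      by rewrite fmorphV mulKf ?fmorph_eq0.
    exact: (subringM sO).
  have Ox : O ((cr q - constK c) / (constK c' - constK c)).
    rewrite -rmorphB -fmorphV; apply: (subringM sO) => //; exact: (subringB sO).
  have [|] := loc _ Ox.
    by rewrite -rmorphB => /unit_part.
  rewrite pole_split_alg // -rmorphB => /unit_part H; apply: Np'.
  by rewrite /pole -opprB invrN; apply: (subringN sO).
have Og : O (cr q)^-1.
  case: q Dq NOf {Np Np'} => -[[i1 i2] i3] i4 Dq NOf; rewrite crV.
  by have [] := Ocr i1 i2 i3 i4 Dq.
have [_ _ _ _ yE] := poleE c Dq.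
have Ocg : O (constK c * (cr q)^-1) by exact: (subringM sO).
have [|[_ _ H]] := loc _ Ocg.
  by rewrite mulrC => /(runit_factor sO Og (Oc c))[_ _]; rewrite invrK.
by apply: Np; rewrite yE; exact: (subringM sO).
Qed.
(** Pigeonhole: a bad constant is the value at [O] of some cross-ratio, and each cross-ratio
    accounts for at most one constant. *)
Lemma pole_exists O (s : seq k) : M0nbar_pts O -> uniq s ->
  (#|{: 'I_n * 'I_n * 'I_n * 'I_n}| < size s)%N ->
  exists2 c, c \in s & forall q, @distinct4 n q -> O (pole c q).
Proof.
move=> XO us sz; apply: contrapT => N.
have bad c : c \in s -> exists2 q, @distinct4 n q & ~ O (pole c q).
  move=> cs; apply: contrapT => Nq; apply: N; exists c => // q Dq.
  by apply: contrapT => Nc; apply: Nq; exists q.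
have [h hP] : exists h : k -> 'I_n * 'I_n * 'I_n * 'I_n, forall c, c \in s ->
    @distinct4 n (h c) /\ ~ O (pole c (h c)).
  have H c : {q | c \in s -> @distinct4 n q /\ ~ O (pole c q)}.
    apply: cid; case: (boolP (c \in s)) => cs; last by exists (ord0, ord0, ord0, ord0).
    by have [q Dq Nq] := bad c cs; exists q.
  by exists (fun c => sval (H c)) => c; exact: (svalP (H c)).
have : uniq (map h s).
  rewrite map_inj_in_uniq // => c c' cs cs' hc; have [D1 N1] := hP _ cs; have [D2 N2] := hP _ cs'.
  by apply: (pole_unique XO D1 N1); rewrite hc.
move=> /card_uniqP; rewrite size_map => szE.
by move: sz; rewrite -szE ltnNge max_card.
Qed.
End PoleCharts.

(** * The twisted form *)

Lemma preimage_subring (E E' : fieldType) (f : {rmorphism E -> E'}) (A : set E') :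
  is_subring A -> is_subring (f @^-1` A).
Proof.
move=> [A1 AB AM]; split; rewrite /preimage /=; first by rewrite rmorph1.
  by move=> x y Ax Ay; rewrite rmorphB; exact: AB.
by move=> x y Ax Ay; rewrite rmorphM; exact: AM.
Qed.
(** [g i j] is the function on the i-th chart whose inversion gives the j-th one. If a valuation
    ring dominates a point of each, [g i j] is invertible in it, hence in the first local ring,
    which then contains the ring of the other chart. *)
Lemma affine_cover_separated (K : fieldType) (I : Type) (B : I -> set K) (g : I -> I -> K) :
  (forall i, is_subring (B i)) -> (forall i j, B i (g i j)) -> (forall i j, g i j * g j i = 1) ->
  (forall i j y, B j y -> exists M, B i (y * g i j ^+ M)) ->
  separated (\bigcup_i Aff (B i)).
Proof.
move=> sB Bg g1 Bloc; have half O O' V : (\bigcup_i Aff (B i)) O -> (\bigcup_i Aff (B i)) O' ->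
    valuation_ring V -> dominates O V -> dominates O' V -> O' `<=` O.
  move=> [i _ AO] [j _ AO'] vV [OV dO] [OV' dO'].
  have [[sO _] BO _] := Aff_local (sB i) AO; have [_ BO' _] := Aff_local (sB j) AO'.
  have g0 : g i j != 0 by apply: contra_eq_neq (g1 i j) => ->; rewrite mul0r eq_sym oner_neq0.
  have gV : g j i = (g i j)^-1 by apply: (mulfI g0); rewrite g1 mulfV.
  have Og : O (g i j)^-1 by apply: dO; [exact: BO|rewrite -gV; apply: OV'; exact: BO'].
  have BjO y : B j y -> O y.
    move=> /Bloc-/(_ i)[M ByM]; rewrite -[y](mulfK (expf_neq0 M g0)).
    apply: (subringM sO); first exact: BO.
    by have := subringX sO M Og; rewrite exprVn.
  case: AO' => P' pP' O'E; move=> x; rewrite -O'E => -[a [b [Ba Bb Nb ->]]].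
  apply: (subringM sO); first exact: BjO.
  apply: dO; first exact: BjO.
  apply: OV'; rewrite -O'E; exists 1, b; split=> //; [exact: (subring1 (sB j))|by rewrite mul1r].
by move=> O O' V XO XO' vV dO dO'; apply/seteqP; split; [exact: half dO' dO|exact: half dO dO'].
Qed.

Lemma trans_alg (E : fieldType) (f c d : E) : f - c != 0 ->
  (f - d) * (f - c)^-1 = 1 + (c - d) * (f - c)^-1.
Proof. by move=> fc; field. Qed.

Lemma trans_inv_alg (E : fieldType) (a b : E) : a != 0 -> b != 0 -> a * b^-1 * (b * a^-1) = 1.
Proof. by move=> a0 b0; field; rewrite a0 b0. Qed.

Section TwistedForm.
Variables (F L : fieldType) (iF : {rmorphism F -> L}) (m0 : nat).
Hypothesis m0_gt1 : (1 < m0)%N.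
Local Notation n := m0.+4.
Variables (G : {group 'S_n}) (act : [subg G] -> {rmorphism L -> L}) (N : nat) (e e' : 'I_N -> L).
Hypothesis gd : galois_data iF act e e'.
Local Notation KL := (ratfun L n).
Local Notation brK := (@brK L m0).
Local Notation ffield := (@ffield L m0).
Local Notation pv := (@pv L m0).
Local Notation cr := (@cross_ratio L n).
Local Notation constL := (@ratC L n : {rmorphism L -> KL}).
Implicit Types (g : [subg G]) (q : 'I_n * 'I_n * 'I_n * 'I_n) (c d : F).
(** The twisted action: Galois on the coefficients and the permutation of the points at once. *)
Definition tw g : {rmorphism KL -> KL} := coef_frac n (act g) \o pv (sgval g).
Lemma twC g x : tw g (constL x) = constL (act g x).
Proof. by rewrite -[LHS]/(coef_frac n (act g) (pv (sgval g) (constL x))) pvC coef_fracC. Qed.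
Lemma twX g l : tw g (ratX L l) = ratX L (sgval g l).
Proof.
by rewrite -[LHS]/(coef_frac n (act g) (perm_vars _ (ratX L l))) perm_varsX coef_fracX.
Qed.
Lemma twM g h x : tw (g * h)%g x = tw h (tw g x).
Proof.
apply: (rat_morph_ext (f := tw (g * h)%g) (g := tw h \o tw g)) => [y|l].
  by rewrite -[RHS]/(tw h (tw g (constL y))) !twC (gd_M gd).
by rewrite -[RHS]/(tw h (tw g (ratX L l))) !twX permM.
Qed.
Lemma tw_br g i j : tw g (brK i j) = brK (sgval g i) (sgval g j).
Proof. by rewrite /brK rmorphB !twX. Qed.
Lemma tw_ffield g x : ffield x -> ffield (tw g x).
Proof.
apply: (semilinear_ffield (g := sgval g)); last exact: tw_br.
by move=> y; exists (act g y); exact: twC.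
Qed.
Definition quad_act g q := let: (a, b, c, d) := q in (sgval g a, sgval g b, sgval g c, sgval g d).
Lemma quad_act_distinct g q : @distinct4 n (quad_act g q) <-> @distinct4 n q.
Proof.
case: q => -[[a b] c] d; rewrite /distinct4 /= !inE.
by rewrite !(inj_eq perm_inj).
Qed.
Lemma tw_cr g q : tw g (cr q) = cr (quad_act g q).
Proof. by case: q => -[[a b] c] d; rewrite !cross_ratioE fmorph_div !rmorphM !tw_br. Qed.
Local Notation pl := (fun c => @pole L m0 (iF c)).
Local Notation PR := (fun c => @pole_ring L m0 (iF c)).
Lemma tw_pole g c q : tw g (pl c q) = pl c (quad_act g q).
Proof. by rewrite /pole fmorphV rmorphB tw_cr twC (gd_F gd). Qed.

Definition fixed : set KL := [set x | ffield x /\ forall g, tw g x = x].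
Let sff : is_subfield ffield. Proof. exact: ffield_subfield. Qed.
Lemma fixed_subfield : is_subfield fixed.
Proof.
split; first split.
- by split=> [|g]; [exact: subfield1|rewrite rmorph1].
- move=> x y [Fx ix] [Fy iy]; split=> [|g]; first exact: (subfieldB sff).
  by rewrite rmorphB ix iy.
- move=> x y [Fx ix] [Fy iy]; split=> [|g]; first exact: (subfieldM sff).
  by rewrite rmorphM ix iy.
by move=> x [Fx ix]; split=> [|g]; [exact: (subfieldV sff)|rewrite fmorphV ix].
Qed.
Definition tfield : fieldType := subfield_type fixed_subfield.
Definition tval : {rmorphism tfield -> KL} := subfield_incl fixed_subfield.
Lemma tval_fixed y : fixed (tval y). Proof. exact: subfield_inclP. Qed.
Lemma tval_inv y : invariant tw (tval y). Proof. by have [] := tval_fixed y. Qed.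
Lemma tval_ffield y : ffield (tval y). Proof. by have [] := tval_fixed y. Qed.
Lemma fixed_tval x : fixed x -> exists y, x = tval y.
Proof. by move=> Fx; exists (to_subfield fixed_subfield x); rewrite /tval to_subfieldK. Qed.
Definition tof (x : KL) : tfield := to_subfield fixed_subfield x.
Lemma tofK x : fixed x -> tval (tof x) = x. Proof. exact: to_subfieldK. Qed.
Lemma fixed_const c : fixed (constL (iF c)).
Proof. by split=> [|g]; [exact: ffield_const|rewrite twC (gd_F gd)]. Qed.
Definition tconst c : tfield := tof (constL (iF c)).
Lemma tconstE c : tval (tconst c) = constL (iF c). Proof. exact/tofK/fixed_const. Qed.
Fact tconst_zmod : zmod_morphism tconst.
Proof. by move=> c d; apply: (fmorph_inj tval); rewrite rmorphB !tconstE !rmorphB. Qed.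
Fact tconst_monoid : monoid_morphism tconst.
Proof.
split; first by apply: (fmorph_inj tval); rewrite tconstE !rmorph1.
by move=> c d; apply: (fmorph_inj tval); rewrite rmorphM !tconstE !rmorphM.
Qed.
HB.instance Definition _ := GRing.isZmodMorphism.Build F tfield tconst tconst_zmod.
HB.instance Definition _ := GRing.isMonoidMorphism.Build F tfield tconst tconst_monoid.
Definition tconst_morph : {rmorphism F -> tfield} := tconst.

Lemma pole_ffield x q : @distinct4 n q -> ffield (@pole L m0 x q).
Proof.
move=> Dq; apply: (subfieldV sff); apply: (subfieldB sff); last exact: ffield_const.
by rewrite cross_ratio_mon //; case: q Dq => -[[a b] c] d Dq; exact/ffield_mon/balanced_cr.
Qed.
Lemma tr_fixed x : ffield x -> fixed (tr tw x).
Proof.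
move=> Fx; split; last by apply: tr_inv; exact: twM.
have [sr _] := sff; apply: (subring_sum sr) => g _; exact: tw_ffield.
Qed.
(** By [tr_expand] these traces are the coordinates of the functions [pole c q] on the basis [e]. *)
Definition tgen c (p : ('I_n * 'I_n * 'I_n * 'I_n) * 'I_N) : tfield :=
  tof (tr tw (constL (e' p.2) * pl c p.1)).
Lemma tgenE c p : @distinct4 n p.1 -> tval (tgen c p) = tr tw (constL (e' p.2) * pl c p.1).
Proof.
by move=> Dp; apply/tofK/tr_fixed/(subfieldM sff); [exact: ffield_const|exact: pole_ffield].
Qed.
(** The invariants of [pole_ring], by [tring_pole] and [pole_tring]; the presentation by traces
    makes them of finite type. *)
Definition tring c : set tfield :=
  algebra_gen tconst [set tgen c p | p in [set p | @distinct4 n p.1]].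
Lemma tring_subring c : is_subring (tring c). Proof. exact: gen_subring. Qed.
Lemma tring_const c d : tring c (tconst d). Proof. exact: gen_const. Qed.
Lemma tring_pole c y : tring c y -> PR c (tval y).
Proof.
have sP := @pole_ring_subring L m0 (iF c).
apply: (@gen_sub _ _ tconst _ (tval @^-1` PR c)); first exact: preimage_subring.
  by move=> d; suff : PR c (tval (tconst d)) by []; rewrite tconstE; exact: gen_const.
move=> _ [[q i] /= Dq <-]; suff : PR c (tval (tgen c (q, i))) by [].
rewrite tgenE //; apply: (subring_sum sP) => g _.
rewrite rmorphM twC tw_pole; apply: (subringM sP); first exact: gen_const.
by apply: pole_ringP; apply/quad_act_distinct.
Qed.
Local Notation span := (lspan e constL tval).
Let span_subring := lspan_subring gd twM twC tconstE.
Let span_l := lspan_l gd twM twC tconstE.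
Lemma pole_span c : PR c `<=` span (tring c).
Proof.
apply: gen_sub.
- by apply: span_subring; [exact: tring_subring|exact: tring_const].
- by move=> x; apply: span_l; [exact: tring_subring|exact: tring_const].
move=> _ [q Dq <-]; exists (fun i => tgen c (q, i)); first by move=> i; apply: gen_mem; exists (q, i).
by rewrite [LHS](tr_expand gd twM twC); apply: eq_bigr => i _; rewrite tgenE.
Qed.
Lemma pole_tring c y : PR c (tval y) -> tring c y.
Proof.
move=> /pole_span; apply: (lspan_fixed gd twM twC tval_inv tconstE); [exact: tring_subring|exact: tring_const].
Qed.
Lemma span_frac (R0 : set tfield) c : is_subfield R0 -> tring c `<=` R0 -> ffield `<=` span R0.
Proof.
move=> sR0 cR0; have [sr0 _] := sR0; have R0c d : R0 (tconst d) by apply: cR0; exact: tring_const.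
have sS : is_subring (span R0) by exact: span_subring.
have Sff : span R0 `<=` ffield.
  move=> _ [x Rx ->]; have [sr _] := sff; apply: (subring_sum sr) => i _; apply: (subringM sr).
    exact: ffield_const.
  exact: tval_ffield.
have sF : is_subfield (span R0).
  apply: (lspan_subfield gd twM twC tval_inv tconstE) => // x Sx ix.
  have [|y ->] := @fixed_tval x; last by exists y.
  by split; [exact: Sff|].
apply: ffield_min => // [x|i1 i2 i3 i4 D]; first exact: span_l.
have D4 : @distinct4 n (i1, i2, i3, i4) := D.
rewrite -cross_ratioE; have [-> _ _ _ _] := poleE m0_gt1 (iF c) D4.
apply: (subringD sS); first exact: span_l.
apply: (subfieldV sF); have : span (tring c) (pl c (i1, i2, i3, i4)) by apply: pole_span; exact: pole_ringP.
by move=> [z Rz ->]; exists z => // i; exact: cR0.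
Qed.
Lemma tring_frac c : localization (tring c) [set 0] = setT.
Proof.
have sB := tring_subring c; have [sL BL _] := localization0 sB.
apply/seteqP; split=> // y _; apply: (lspan_fixed gd twM twC tval_inv tconstE); [by case: sL|..].
  by move=> d; apply: BL; exact: tring_const.
by apply: (@span_frac _ c) => //; exact: tval_ffield.
Qed.

Definition qdist q : bool := let: (a, b, c, d) := q in uniq [:: a; b; c; d].
Lemma qdistP q : qdist q <-> @distinct4 n q. Proof. by case: q => -[[a b] c] d. Qed.
Lemma qdist_act g q : qdist (quad_act g q) = qdist q.
Proof. by case: q => -[[a b] c] d; exact: (map_inj_uniq (@perm_inj _ (sgval g)) [:: a; b; c; d]). Qed.
(** The product over all quadruples is invariant. It vanishes where some cross-ratio takes the value
    d, that is, off the chart of d. *)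
Definition trans c d : KL := \prod_(q | qdist q) ((cr q - constL (iF d)) * pl c q).
Lemma quad_act_bij g : bijective (quad_act g).
Proof.
by exists (quad_act g^-1%g) => -[[[a b] c] d] /=; rewrite ?permK ?permKV.
Qed.
Lemma trans_fixed c d : fixed (trans c d).
Proof.
have [sr _] := sff; split.
  apply: (subring_prod sr) => q /qdistP Dq; apply: (subringM sr); last exact: pole_ffield.
  rewrite -[_ - _]invrK; apply: (subfieldV sff); exact: pole_ffield.
move=> g; rewrite (rmorph_prod (tw g)) [RHS](reindex (quad_act g)) /=; last exact/onW_bij/quad_act_bij.
apply: eq_big => [q|q _]; first by rewrite qdist_act.
by rewrite -[LHS]/(tw g _) rmorphM rmorphB tw_cr twC (gd_F gd) tw_pole.
Qed.
Definition ttrans c d : tfield := tof (trans c d).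
Lemma ttransE c d : tval (ttrans c d) = trans c d. Proof. exact/tofK/trans_fixed. Qed.
Lemma transM c d : trans c d * trans d c = 1.
Proof.
rewrite /trans -big_split; apply: big1 => q /qdistP Dq /=.
by apply: trans_inv_alg; rewrite subr_eq0; exact: cr_neq_const.
Qed.
Lemma trans_factor c d q : @distinct4 n q ->
  (cr q - constL (iF d)) * pl c q = 1 + constL (iF (c - d)) * pl c q.
Proof.
move=> Dq; have P0 : cr q - constL (iF c) != 0 by rewrite subr_eq0; exact: cr_neq_const.
by rewrite /pole !rmorphB; exact: trans_alg.
Qed.
Lemma factor_pole_ring c d q : @distinct4 n q -> PR c ((cr q - constL (iF d)) * pl c q).
Proof.
move=> Dq; rewrite trans_factor //; have sP := @pole_ring_subring L m0 (iF c).
apply: (subringD sP); first exact: (subring1 sP).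
by apply: (subringM sP); [exact: gen_const|exact: pole_ringP].
Qed.
Lemma ttrans_tring c d : tring c (ttrans c d).
Proof.
apply: pole_tring; rewrite ttransE; have sP := @pole_ring_subring L m0 (iF c).
by apply: (subring_prod sP) => q /qdistP; exact: factor_pole_ring.
Qed.
Lemma tring_trans c d y : tring d y -> exists M, tring c (y * ttrans c d ^+ M).
Proof.
have sP := @pole_ring_subring L m0 (iF c).
have PT : PR c (trans c d) by rewrite -ttransE; apply: tring_pole; exact: ttrans_tring.
have PTX M : PR c (trans c d ^+ M) by exact: (subringX sP).
pose S : set KL := [set x | exists M, PR c (x * trans c d ^+ M)].
have sS : is_subring S.
  split.
  - by exists 0%N; rewrite mulr1; exact: (subring1 sP).
  - move=> x z [M HM] [M' HM']; exists (M + M')%N; rewrite exprD mulrBl mulrA (mulrC (_ ^+ M)) mulrA.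
    by apply: (subringB sP); apply: (subringM sP).
  move=> x z [M HM] [M' HM']; exists (M + M')%N; rewrite exprD mulrACA.
  exact: (subringM sP).
move=> /tring_pole dy; have : S (tval y).
  move: (tval y) dy; apply: gen_sub => // [x|_ [q Dq <-]].
    by exists 0%N; rewrite mulr1; exact: gen_const.
  exists 1%N; rewrite expr1 /trans (bigD1 q) /=; last exact/qdistP.
  rewrite !mulrA mulVf ?subr_eq0; last exact: cr_neq_const.
  rewrite mul1r; apply: (subringM sP); first exact: pole_ringP.
  by apply: (subring_prod sP) => q' /andP[/qdistP Dq' _]; exact: factor_pole_ring.
by move=> [M HM]; exists M; apply: pole_tring; rewrite rmorphM rmorphXn ttransE.
Qed.

Section Cover.
Variables (m : nat) (cs : 'I_m.+1 -> F).
Definition tmodel : set (set tfield) := \bigcup_l Aff (tring (cs l)).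
Lemma tring_fg c : fg_algebra tconst (tring c).
Proof.
exists [seq tgen c p | p : ('I_n * 'I_n * 'I_n * 'I_n) * 'I_N <- enum {: ('I_n * 'I_n * 'I_n * 'I_n) * 'I_N} & qdist p.1].
rewrite /tring; congr (algebra_gen _ _); apply/seteqP; split.
  move=> _ [p Dp <-]; apply/mapP; exists p => //.
  by rewrite mem_filter mem_enum andbT; apply/qdistP.
move=> y /mapP[p pin ->]; move: pin; rewrite mem_filter => /andP[/qdistP Dp _].
by exists p.
Qed.
Lemma tmodel_variety : is_variety tconst tmodel.
Proof.
split.
  apply: (@affine_cover_separated _ _ (fun l => tring (cs l)) (fun l l' => ttrans (cs l) (cs l'))).
  - by move=> l; exact: tring_subring.
  - by move=> l l'; exact: ttrans_tring.
  - by move=> l l'; apply: (fmorph_inj tval); rewrite rmorphM !ttransE transM rmorph1.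
  by move=> l l' y; exact: tring_trans.
exists m, (fun l => tring (cs l)); split=> // l.
by split; [exact: tring_fg|exact: tring_frac].
Qed.
End Cover.
End TwistedForm.

(** * Extension of a retraction to L *)

Section RetractionLift.
Variables (F L : fieldType) (iF : {rmorphism F -> L}) (gT : finGroupType).
Variables (act : gT -> {rmorphism L -> L}) (N : nat) (e e' : 'I_N -> L).
Hypothesis gd : galois_data iF act e e'.
Variables (D1 D2 E1 E2 : fieldType) (j1 : {rmorphism F -> D1}) (j2 : {rmorphism F -> D2}).
Variables (l1 : {rmorphism L -> E1}) (a1 : gT -> {rmorphism E1 -> E1}) (u1 : {rmorphism D1 -> E1}).
Variables (l2 : {rmorphism L -> E2}) (a2 : gT -> {rmorphism E2 -> E2}) (u2 : {rmorphism D2 -> E2}).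
Hypotheses (a1M : forall g h x, a1 (g * h)%g x = a1 h (a1 g x))
  (a2M : forall g h x, a2 (g * h)%g x = a2 h (a2 g x))
  (al1 : forall g x, a1 g (l1 x) = l1 (act g x)) (al2 : forall g x, a2 g (l2 x) = l2 (act g x)).
Hypotheses (u1_inv : forall c, invariant a1 (u1 c)) (u2_inv : forall c, invariant a2 (u2 c))
  (uj1 : forall c, u1 (j1 c) = l1 (iF c)) (uj2 : forall c, u2 (j2 c) = l2 (iF c)).
Variables (R : set D2) (f : D2 -> D1) (g : D1 -> D2).
Hypotheses (sR : is_subring R) (Rj : forall c, R (j2 c)) (Rg : forall x, R (g x)).
Hypotheses (g1 : g 1 = 1) (gB : forall x y, g (x - y) = g x - g y)
  (gM : forall x y, g (x * y) = g x * g y) (gj : forall c, g (j1 c) = j2 c).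
Hypotheses (f1 : f 1 = 1) (fB : forall x y, R x -> R y -> f (x - y) = f x - f y)
  (fM : forall x y, R x -> R y -> f (x * y) = f x * f y) (fj : forall c, f (j2 c) = j1 c).
Hypothesis fg : forall x, f (g x) = x.
Local Notation span1 := (lspan e l1 u1 setT).
Local Notation span2 := (lspan e l2 u2 R).
(** Both comorphisms extend by L-linearity to equivariant maps; [f] respects the operations on the
    local ring [R] only, so [be] is controlled only on its extension of scalars. *)
Lemma retraction_lift : exists (al : E1 -> E2) (be : E2 -> E1),
  [/\ [/\ forall x, span1 x -> span2 (al x), forall x, span1 x -> be (al x) = x,
        al 1 = 1, forall x y, span1 x -> span1 y -> al (x * y) = al x * al y
      & forall h x, span1 x -> al (a1 h x) = a2 h (al x)],
    [/\ forall y, span2 y -> span1 (be y), forall c, be (l2 c) = l1 c,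
        forall x y, span2 x -> span2 y -> be (x * y) = be x * be y
      & forall h y, span2 y -> be (a2 h y) = a1 h (be y)]
    & is_subring span2].
Proof.
have sT : is_subring (setT : set D1) by [].
pose w1 x := u2 (g x); pose w2 x := u1 (f x).
have w1B x y : setT x -> setT y -> w1 (x - y) = w1 x - w1 y by move=> _ _; rewrite /w1 gB rmorphB.
have w1M x y : setT x -> setT y -> w1 (x * y) = w1 x * w1 y by move=> _ _; rewrite /w1 gM rmorphM.
have w2B x y : R x -> R y -> w2 (x - y) = w2 x - w2 y by move=> Rx Ry; rewrite /w2 fB // rmorphB.
have w2M x y : R x -> R y -> w2 (x * y) = w2 x * w2 y by move=> Rx Ry; rewrite /w2 fM // rmorphM.
have w1_inv c : setT c -> invariant a2 (w1 c) by move=> _; exact: u2_inv.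
have w2_inv c : R c -> invariant a1 (w2 c) by move=> _; exact: u1_inv.
have wj1 c : w1 (j1 c) = l2 (iF c) by rewrite /w1 gj uj2.
have wj2 c : w2 (j2 c) = l1 (iF c) by rewrite /w2 fj uj1.
have Tj c : setT (j1 c) by [].
pose al := lift e setT l1 u1 l2 w1; pose be := lift e R l2 u2 l1 w2.
have alE c : al (\sum_i l1 (e i) * u1 (c i)) = \sum_i l2 (e i) * u2 (g (c i)).
  exact: (liftE gd l2 w1 al1 u1_inv (fun _ => I)).
have beE c : (forall i, R (c i)) -> be (\sum_i l2 (e i) * u2 (c i)) = \sum_i l1 (e i) * u1 (f (c i)).
  exact: (liftE gd l1 w2 al2 u2_inv).
exists al, be; split; last exact: (lspan_subring gd a2M al2 uj2 sR Rj); split.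
- by move=> _ [c _ ->]; rewrite alE; exists (fun i => g (c i)).
- move=> _ [c _ ->]; rewrite alE beE //; apply: eq_bigr => i _; by rewrite fg.
- rewrite -(rmorph1 l1) -[RHS](rmorph1 l2).
  by apply: (lift_l gd a1M al1 u1_inv uj1 wj1 sT Tj w1M); rewrite /w1 g1 rmorph1.
- exact: (liftM gd a1M al1 u1_inv uj1 wj1 sT Tj w1B w1M).
- exact: (lift_act gd a1M al1 al2 u1_inv uj1 w1_inv wj1 sT Tj w1B w1M).
- by move=> _ [c Rc ->]; rewrite beE //; exists (fun i => f (c i)).
- by move=> c; apply: (lift_l gd a2M al2 u2_inv uj2 wj2 sR Rj w2M); rewrite /w2 f1 rmorph1.
- exact: (liftM gd a2M al2 u2_inv uj2 wj2 sR Rj w2B w2M).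
exact: (lift_act gd a2M al2 al1 u2_inv uj2 w2_inv wj2 sR Rj w2B w2M).
Qed.
End RetractionLift.

Lemma common_den_alg (E : fieldType) (y z s t : E) : (y - z) * (s * t) = y * s * t - z * t * s.
Proof. by ring. Qed.
Lemma inv_den_alg (E : fieldType) (x s t : E) : x != 0 -> x * s * (x^-1 * t) = s * t.
Proof. by move=> x0; field. Qed.
Lemma inv_factor_alg (E : fieldType) (p q : E) : p != 0 -> q != 0 -> p^-1 = q * (q * p)^-1.
Proof. by move=> p0 q0; field; rewrite p0 q0. Qed.

(** * Local rings of affine space after extension of scalars *)

Section PolynomialDenominators.
Variables (F L : fieldType) (iF : {rmorphism F -> L}) (gT : finGroupType).
Variables (act : gT -> {rmorphism L -> L}) (N : nat) (e e' : 'I_N -> L) (r : nat).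
Hypothesis gd : galois_data iF act e e'.
Local Notation D := (ratfun F r).
Local Notation E := (ratfun L r).
Local Notation "x %:F" := (@FracField.tofrac _ x).
Definition ct g : {rmorphism E -> E} := coef_frac r (act g).
Definition ci : {rmorphism D -> E} := coef_frac r iF.
Lemma ctC g x : ct g (ratC r x) = ratC r (act g x). Proof. exact: coef_fracC. Qed.
Lemma ctM g h x : ct (g * h)%g x = ct h (ct g x).
Proof.
apply: (rat_morph_ext (f := ct (g * h)%g) (g := ct h \o ct g)) => [y|l].
  by rewrite -[RHS]/(ct h (ct g (ratC r y))) !ctC (gd_M gd).
by rewrite -[RHS]/(ct h (ct g (ratX L l))) /ct !coef_fracX.
Qed.
Lemma ci_inv c : invariant ct (ci c).
Proof.
move=> g; apply: (rat_morph_ext (f := ct g \o ci) (g := ci)) => [y|l].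
  by rewrite -[LHS]/(ct g (ci (ratC r y))) /ci coef_fracC ctC (gd_F gd).
by rewrite -[LHS]/(ct g (ci (ratX F l))) /ci /ct !coef_fracX.
Qed.
Lemma ciC c : ci (ratC r c) = ratC r (iF c). Proof. exact: coef_fracC. Qed.
Lemma ct_poly g p : exists q, ct g p%:F = q%:F.
Proof. by exists (coef_map (act g) p); exact: coef_frac_tofrac. Qed.

Variable Q : set D.
Local Notation A := (range (@FracField.tofrac {mpoly F[r]})).
Hypothesis pQ : prime_ideal A Q.
Local Notation O := (localization A Q).
Local Notation span := (lspan e (@ratC L r : {rmorphism L -> E}) ci O).
Lemma tofrac_subring : is_subring A.
Proof.
split; first by exists 1 => //; exact: rmorph1.
  by move=> _ _ [p _ <-] [q _ <-]; exists (p - q) => //; exact: rmorphB.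
by move=> _ _ [p _ <-] [q _ <-]; exists (p * q) => //; exact: rmorphM.
Qed.
Let sO : is_subring O. Proof. exact: (is_subring_localization tofrac_subring). Qed.
Let polyO p : O p%:F.
Proof.
have [_ [_ Q1] _ _ _] := pQ; exists p%:F, 1; split; [by exists p|by exists 1; [|exact: rmorph1]|exact: Q1|].
by rewrite divr1.
Qed.
Let OC c : O (ratC r c). Proof. exact: polyO. Qed.
Lemma span_subring : is_subring span. Proof. exact: (lspan_subring gd ctM ctC ciC sO OC). Qed.
Lemma span_const x : span (ratC r x). Proof. exact: (lspan_l gd ctM ctC ciC sO OC). Qed.
Lemma span_poly p : span p%:F.
Proof.
rewrite -mmap_tofrac; apply: (subring_mmap span_subring); first exact: span_const.
move=> l; rewrite -[ratX L l](coef_fracX iF l); apply: (lspan_u gd ctM ctC ciC sO OC).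
exact: polyO.
Qed.
Definition den (s : {mpoly F[r]}) := ~ Q s%:F.
Lemma denM s t : den s -> den t -> den (s * t).
Proof.
have [_ _ _ _ Qp] := pQ; rewrite /den tofracM => ns nt H.
by have [] := Qp s%:F t%:F (ex_intro2 _ _ s I erefl) (ex_intro2 _ _ t I erefl) H.
Qed.
Lemma den_neq0 s : den s -> (coef_map iF s)%:F != 0.
Proof.
have [_ [Q0 _] _ _ _] := pQ; move=> ns; rewrite tofrac_eq0; apply/eqP => s0; apply: ns.
rewrite (_ : s = 0) ?tofrac0 //; apply: (@coef_map_inj _ _ _ iF).
by rewrite s0 /coef_map rmorph0.
Qed.
Lemma den_inv s : den s -> span ((coef_map iF s)%:F)^-1.
Proof.
move=> ns; rewrite -coef_frac_tofrac -fmorphV; apply: (lspan_u gd ctM ctC ciC sO OC).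
by exists 1, s%:F; split; [exists 1; [|exact: rmorph1]|exists s|exact: ns|rewrite mul1r].
Qed.
Lemma span_den x : span x -> exists a s, den s /\ x * (coef_map iF s)%:F = a%:F.
Proof.
pose S : set E := [set x | exists a s, den s /\ x * (coef_map iF s)%:F = a%:F].
have den1 : den 1 by have [_ [_ Q1] _ _ _] := pQ; rewrite /den tofrac1.
have cm1 : (coef_map iF (1 : {mpoly F[r]}))%:F = 1.
  exact: etrans (congr1 _ (rmorph1 (@coef_map F L r iF))) (tofrac1 _).
have cmM s t : (coef_map iF (s * t))%:F = (coef_map iF s)%:F * (coef_map iF t)%:F.
  by rewrite /coef_map rmorphM tofracM.
have sS : is_subring S.
  split.
  - by exists 1, 1; rewrite cm1 mulr1 tofrac1.
  - move=> y z [a [s [ns Es]]] [b [t [nt Et]]].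
    exists (a * coef_map iF t - b * coef_map iF s), (s * t); split; first exact: denM.
    by rewrite tofracB !tofracM -Es -Et cmM; exact: common_den_alg.
  move=> y z [a [s [ns Es]]] [b [t [nt Et]]]; exists (a * b), (s * t); split; first exact: denM.
  by rewrite cmM mulrACA Es Et tofracM.
move=> [c Oc ->]; apply: (subring_sum sS) => i _; apply: (subringM sS).
  by exists (e i)%:MP, 1; rewrite cm1 mulr1.
have [_ [_ [[p _ <-] [q _ <-] nq ->]]] := Oc i.
exists (coef_map iF p), q; split=> //; rewrite fmorph_div /ci !coef_frac_tofrac divfK //.
exact: den_neq0.
Qed.
(** Clearing denominators in [x] and in its inverse shows that [p] divides a polynomial over F that
    is invertible at the point. *)
Lemma span_unit_prime x p : span x -> span x^-1 -> x != 0 -> prime_elt p -> frac_ord p x != 0 ->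
  span (p%:F)^-1.
Proof.
move=> Sx Sxv x0 pp ox; have [a [s [ns Es]]] := span_den Sx; have [b [t [nt Et]]] := span_den Sxv.
have ab : a * b = coef_map iF (s * t).
  apply/eqP; rewrite -tofrac_eq tofracM -Es -Et /coef_map rmorphM tofracM; apply/eqP.
  exact: inv_den_alg.
have s0 := den_neq0 ns; have s0' : coef_map iF s != 0 by rewrite tofrac_eq0 in s0.
have xE : x = a%:F / (coef_map iF s)%:F by rewrite -Es mulfK.
have a0 : a != 0.
  by apply: contra_neq x0 => a0; rewrite xE a0 tofrac0 mul0r.
have [q qE] : divides p (coef_map iF (s * t)).
  have [oa|oa] := posnP (ordp p a); last first.
    have [q qE] := proj1 (ordp_gt0 (@ufd_mpoly L r) pp a0) oa.
    by exists (q * b); rewrite -ab qE mulrAC.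
  rewrite /coef_map rmorphM; apply: divides_mulr; apply: (proj1 (ordp_gt0 (@ufd_mpoly L r) pp s0')); rewrite lt0n.
  by apply: contraNneq ox => os; rewrite xE (frac_ordE (@ufd_mpoly L r)) // oa os.
have p0 : p%:F != 0 by rewrite tofrac_eq0; case: pp.
have -> : (p%:F)^-1 = q%:F * ((coef_map iF (s * t))%:F)^-1.
  have q0 : q%:F != 0.
    by apply: contraNneq (den_neq0 (denM ns nt)) => q0; rewrite qE tofracM q0 mul0r.
  by rewrite qE tofracM; exact: (inv_factor_alg p0 q0).
apply: (subringM span_subring); first exact: span_poly.
by apply: den_inv; exact: denM.
Qed.
End PolynomialDenominators.

(** * Failure of retract rationality *)

Section NotRetractRational.
Variables (F L : fieldType) (iF : {rmorphism F -> L}) (m0 : nat).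
Hypotheses (m0_gt1 : (1 < m0)%N) (m0_even : ~~ odd m0).
Local Notation n := m0.+4.
Local Notation G := (Gkl m0_gt1 m0_even).
Local Notation sg := (sg m0_gt1 m0_even).
Local Notation tg := (tg m0_gt1 m0_even).
Variables (act : [subg G] -> {rmorphism L -> L}) (N : nat) (e e' : 'I_N -> L).
Hypothesis gd : galois_data iF act e e'.
Local Notation KL := (ratfun L n).
Local Notation brK := (@brK L m0).
Local Notation ffield := (@ffield L m0).
Local Notation pv := (@pv L m0).
Local Notation constL := (@ratC L n : {rmorphism L -> KL}).
Local Notation tw := (@tw L m0 G act).
Local Notation tfield := (@tfield L m0 G act).
Local Notation tval := (@tval L m0 G act).
Local Notation tconst := (@tconst F L iF m0 G act).
Local Notation Theta := (mon brK (@theta_exp m0)).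
Local Notation Rho := (mon brK (@rho_exp m0)).
Variables (m : nat) (cs : 'I_m.+1 -> F).
Local Notation X := (@tmodel F L iF m0 G act N e' m cs).

Definition gs : [subg G] := subg G sg.
Definition gt : [subg G] := subg G tg.
Lemma gsE : sgval gs = sg. Proof. by rewrite subgK //; exact: klein_s. Qed.
Lemma gtE : sgval gt = tg. Proof. by rewrite subgK //; exact: klein_t. Qed.
Lemma gs2 : (gs * gs = 1)%g.
Proof. by apply: val_inj; rewrite /= gsE; exact: sg2. Qed.
Lemma gt2 : (gt * gt = 1)%g.
Proof. by apply: val_inj; rewrite /= gtE; exact: tg2. Qed.
Lemma gsgt : (gs * gt = gt * gs)%g.
Proof. by apply: val_inj; rewrite /= gsE gtE; exact: sgtg. Qed.
Lemma tw_mon g (x : 'I_n * 'I_n -> int) : tw g (mon brK x) = pv (sgval g) (mon brK x).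
Proof. by rewrite pv_mon; apply: semilinear_mon; exact: tw_br. Qed.
Lemma tw_Theta_gs : tw gs Theta = Theta^-1. Proof. by rewrite tw_mon gsE pv_Theta_sg. Qed.
Lemma tw_Theta_gt : tw gt Theta = Theta^-1. Proof. by rewrite tw_mon gtE pv_Theta_tg. Qed.
Lemma tw_Theta_Rho : Theta = Rho * tw gs (tw gt Rho).
Proof.
rewrite tw_mon gtE pv_mon tw_mon gsE -pv_mon; exact: Theta_Rho.
Qed.
Lemma tw_gsK : involutive (tw gs).
Proof. by move=> x; rewrite -(twM gd) gs2; exact: (a1 (twM gd)). Qed.
Lemma tw_gtK : involutive (tw gt).
Proof. by move=> x; rewrite -(twM gd) gt2; exact: (a1 (twM gd)). Qed.
Lemma tw_gsgt x : tw gs (tw gt x) = tw gt (tw gs x).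
Proof. by rewrite -!(twM gd) gsgt. Qed.
Lemma ffield_span x : ffield x -> lspan e constL tval setT x.
Proof.
move=> Fx; exists (fun i => tof act (tr tw (constL (e' i) * x))) => //.
rewrite [LHS](tr_expand gd (twM gd) (twC act)); apply: eq_bigr => i _; rewrite tofK //.
by apply: (tr_fixed gd); apply: (subfieldM (ffield_subfield L m0)) => //; exact: ffield_const.
Qed.
Lemma span_ffield R x : lspan e constL tval R x -> ffield x.
Proof.
move=> [c _ ->]; have [sr _] := ffield_subfield L m0; apply: (subring_sum sr) => i _.
by apply: (subringM sr); [exact: ffield_const|exact: tval_ffield].
Qed.
Lemma tmodel_generic U : zopen X U -> U !=set0 -> U setT.
Proof.
move=> [UX Uo] [O UO]; have [s [sO sU]] := Uo _ UO; apply: sU => //.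
exists ord0 => //; exists [set 0]; first exact/prime_zero/tring_subring.
exact: (tring_frac m0_gt1 gd).
Qed.

Theorem tmodel_not_retract_rational : ~ retract_rational tconst X.
Proof.
move=> [U [r [V [f [g [[oU nU] [oV nV] mf mg rt]]]]]].
have UT := tmodel_generic oU nU.
have [mf1 mf2 mfC _] := mf; have [mg1 mg2 mgC _] := mg.
set O := on_points f setT; have VO : V O by exact: mf1.
have [gO fg] := rt _ UT; rewrite -/O in gO.
have [_ f1 fB fM _] := mf2 _ UT; rewrite -/O in fB fM.
have [gR g1 gB gM _] := mg2 _ VO; rewrite gO in gR gB gM.
have [Q pQ OE] := oV.1 _ VO.
have sO : is_subring O.
  rewrite -OE; apply: (is_subring_localization _ pQ); exact: tofrac_subring.
have OC c : O (ratC r c).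
  have [_ [_ Q1] _ _ _] := pQ; rewrite -OE; exists (ratC r c), 1; split; last by rewrite divr1.
  - by exists c%:MP.
  - by exists 1; [|exact: rmorph1].
  exact: Q1.
have OgR x : O (comor g x) by apply: gR; exists x.
have ci_i : forall c : ratfun F r, invariant (ct act r) (ci iF r c) by exact: (ci_inv gd).
have RL :=
  @retraction_lift F L iF [subg G] act N e e' gd tfield (ratfun F r) KL (ratfun L r)
   (tconst : {rmorphism F -> tfield}) (@ratC F r) constL tw tval (@ratC L r) (ct act r) (ci iF r)
   (twM gd) (ctM gd) (twC act) (ctC act r) (tval_inv (act:=act)) ci_i (tconstE gd) (ciC iF r)
   O (comor f) (comor g) sO OC OgR g1 (fun x y => gB x y I I) (fun x y => gM x y I I) mgC
   f1 fB fM mfC (fun x => fg x I).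

have [al [be [Hal Hbe sS]]] := RL _ _ _ gd.
case: Hal => alS beal al1 alM alA.
case: Hbe => beS beC beM beA.
clear RL.
have STh := ffield_span (ffield_Theta L m0_gt1 m0_even).
have SRh := ffield_span (ffield_Rho L m0_gt1 m0_even).
have sff := ffield_subfield L m0.
have Th0 := Theta_neq0 L m0; have Rh0 := Rho_neq0 L m0.
have al_neq0 x : ffield x -> x != 0 -> al x * al x^-1 = 1.
  by move=> Fx x0; rewrite -alM ?mulfV //; apply: ffield_span => //; exact: subfieldV.
have al0 x : ffield x -> x != 0 -> al x != 0.
  by move=> Fx x0; apply: contra_eq_neq (al_neq0 x Fx x0) => ->; rewrite mul0r eq_sym; exact: oner_neq0.
have alV x : ffield x -> x != 0 -> al x^-1 = (al x)^-1.
  by move=> Fx x0; apply: (mulfI (al0 x Fx x0)); rewrite al_neq0 // mulfV // al0.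
have Ftw h x : ffield x -> ffield (tw h x) by exact: tw_ffield.
have FRh := ffield_Rho L m0_gt1 m0_even; have FTh := ffield_Theta L m0_gt1 m0_even.
pose S := ct act r gs; pose T := ct act r gt.
have thE : al Theta = al Rho * S (T (al Rho)).
  rewrite [in LHS]tw_Theta_Rho alM //; last by apply: ffield_span; auto.
  by rewrite alA ?alA //; apply: ffield_span; auto.
have Sth : S (al Theta) = (al Theta)^-1 by exact: (etrans (esym (alA gs Theta STh)) (etrans (congr1 al tw_Theta_gs) (alV Theta FTh Th0))).
have Tth : T (al Theta) = (al Theta)^-1 by exact: (etrans (esym (alA gt Theta STh)) (etrans (congr1 al tw_Theta_gt) (alV Theta FTh Th0))).
have cM := ctM gd (r := r).
have SK : involutive S.
  by move=> x; apply: etrans (esym (cM gs gs x)) _; rewrite gs2; exact: (a1 cM x).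
have TK : involutive T.
  by move=> x; apply: etrans (esym (cM gt gt x)) _; rewrite gt2; exact: (a1 cM x).
have ST x : S (T x) = T (S x).
  by apply: etrans (esym (cM gt gs x)) (etrans _ (cM gs gt x)); rewrite gsgt.
have [mu [mu0 [c c0 cS] [d d0 cT] Pmu]] := poly_splitting (ct_poly act (r:=r) gs) (ct_poly act gt) SK TK ST
  (al0 _ FRh Rh0) thE Sth Tth.
(* [mu] is built from constants and prime factors of the unit [al Theta], so it is itself a unit of
   the extended local ring and can be brought back by [be]. *)
have [Smu Smuv] : lspan e (@ratC L r : {rmorphism L -> ratfun L r}) (ci iF r) O mu /\
    lspan e (@ratC L r : {rmorphism L -> ratfun L r}) (ci iF r) O mu^-1.
  apply: (Pmu (fun x => lspan e (@ratC L r : {rmorphism L -> ratfun L r}) (ci iF r) O x /\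
    lspan e (@ratC L r : {rmorphism L -> ratfun L r}) (ci iF r) O x^-1)).
  - by move=> x _; rewrite -fmorphV -OE; split; exact: (span_const gd pQ).
  - by move=> a b [Sa Sav] [Sb Sbv]; rewrite invfM; split; exact: (subringM sS).
  - by move=> a [Sa Sav]; rewrite invrK.
  move=> p pp op; rewrite -OE; split; first exact: (span_poly gd pQ).
  apply: (span_unit_prime gd pQ _ _ (al0 _ FTh Th0) pp op); rewrite OE; first exact: alS.
  rewrite -(alV _ FTh Th0); apply: alS; apply: ffield_span; exact: (subfieldV sff FTh).
pose nu := be mu.
have be1 : be 1 = 1 by rewrite -(rmorph1 (@ratC L r)) beC rmorph1.
have nuV : nu * be mu^-1 = 1.
  exact: (etrans (esym (beM _ _ Smu Smuv)) (etrans (congr1 be (mulfV mu0)) be1)).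
have nu0 : nu != 0.
  by apply: contra_eq_neq nuV => ->; rewrite mul0r eq_sym; exact: oner_neq0.
have Fnu : ffield nu by apply: span_ffield; exact: beS.
have SSmu : lspan e (@ratC L r : {rmorphism L -> ratfun L r}) (ci iF r) O (S mu).
  have -> : S mu = ratC r c * mu^-1 by rewrite -cS mulrC (mulKf mu0).
  by apply: (subringM sS) => //; rewrite -OE; exact: (span_const gd pQ).
have nuS : is_const (nu * tw gs nu).
  by exists c => //; rewrite -beA // -beM // -/S cS beC.
have nuT : is_const (tw gt nu / (nu * Theta)).
  exists d => //; have Tmu : T mu = ratC r d * (mu * al Theta).
    by rewrite -cT divfK; [|exact: (mulf_neq0 mu0 (al0 _ FTh Th0))].
  have Sth' : lspan e (@ratC L r : {rmorphism L -> ratfun L r}) (ci iF r) O (al Theta) by exact: alS.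
  have Sd : lspan e (@ratC L r : {rmorphism L -> ratfun L r}) (ci iF r) O (ratC r d).
    by rewrite -OE; exact: (span_const gd pQ).
  have Smt := subringM sS Smu Sth'.
  rewrite -(beA gt mu Smu) -/T Tmu (beM _ _ Sd Smt) (beM _ _ Smu Sth') (beal _ STh) beC mulfK.
    exact: erefl.
  exact: (mulf_neq0 nu0 Th0).
have twC' h x : exists y, tw h (constL x) = constL y by exists (act h x); exact: twC.
have brs i j : tw gs (brK i j) = brK (sg i) (sg j) by rewrite tw_br gsE.
have brt i j : tw gt (brK i j) = brK (tg i) (tg j) by rewrite tw_br gtE.
exact (@no_splitting L m0 m0_gt1 m0_even (tw gs) (tw gt) (twC' gs) (twC' gt) brs brt
  tw_gsK tw_gtK tw_gsgt nu Fnu nu0 nuS nuT).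
Qed.
End NotRetractRational.

(** * Base change of the form *)

Lemma isomorphic_refl (F K : fieldType) (i : F -> K) (X : set (set K)) : isomorphic i i X X.
Proof.
have idm : is_morphism i i X X (Mor id id).
  split=> //.
    by move=> O XO; split=> // x [y Oy <-].
  move=> W oW; rewrite (_ : X `&` _ = W) //; apply/seteqP; split=> [O []//|O WO].
  by split=> //; apply: oW.1.
by exists (Mor id id), (Mor id id); split=> // O XO; split.
Qed.
Lemma preimage_prime (E E' : fieldType) (f : {rmorphism E -> E'}) (A : set E) (B Q : set E') :
  is_subring A -> prime_ideal B Q -> (forall y, A y -> B (f y)) -> prime_ideal A (A `&` f @^-1` Q).
Proof.
move=> sA [QB [Q0 Q1] Qsub QM Qp] AB; have [A1 AsB AM] := sA; split.
- by move=> x [].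
- split; first by split; [exact: (subring0 sA)|rewrite /preimage /= rmorph0].
  by move=> [_]; rewrite /preimage /= rmorph1.
- by move=> x y [Ax Qx] [Ay Qy]; split; [exact: AsB|rewrite /preimage /= rmorphB; exact: Qsub].
- move=> a x Aa [Ax Qx]; split; first exact: AM.
  by rewrite /preimage /= rmorphM; apply: QM => //; exact: AB.
move=> x y Ax Ay [_]; rewrite /preimage /= rmorphM => Qxy.
by have [Qx|Qy] := Qp _ _ (AB x Ax) (AB y Ay) Qxy; [left|right].
Qed.

Section ScalarExtension.
Variables (K K' : fieldType) (r : nat) (f : {rmorphism K -> K'}).
Local Notation "x %:F" := (@FracField.tofrac _ x).
Lemma common_denominator M (x : 'I_M -> ratfun K r) : exists (D : {mpoly K[r]}) (P : 'I_M -> {mpoly K[r]}),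
  D != 0 /\ forall l, D%:F * x l = (P l)%:F.
Proof.
pose d l := \d_(repr (x l)); have d0 l : d l != 0 by exact: denom_ratioP.
exists (\prod_l d l), (fun l => \n_(repr (x l)) * \prod_(l' | l' != l) d l'); split.
  by apply/prodf_neq0 => l _.
move=> l; rewrite (bigD1 l) //= !tofracM [x l in LHS]frac_repr -/(d l).
have dF : (d l)%:F != 0 by rewrite tofrac_eq0.
by rewrite mulrAC mulrCA mulfV // mulr1.
Qed.
(** After clearing denominators, independence is a rank condition on a matrix of coefficients, and
    ranks do not change under field extension. *)
Lemma coef_frac_disjoint M (x : 'I_M -> ratfun K r) :
  (forall c : 'I_M -> K, \sum_l ratC r (c l) * x l = 0 -> forall l, c l = 0) ->
  forall c : 'I_M -> K', \sum_l ratC r (c l) * coef_frac r f (x l) = 0 -> forall l, c l = 0.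
Proof.
move=> indep c sum0; have [D [P [D0 PE]]] := common_denominator x.
pose s := undup (flatten [seq (msupp (P l) : seq _) | l <- enum 'I_M]).
have coef_s l (m : 'X_{1..r}) : m \notin s -> (P l)@_m = 0.
  move=> ms; apply: memN_msupp_eq0; apply: contra ms => ml.
  by rewrite mem_undup; apply/flattenP; exists (msupp (P l)) => //; apply: map_f; rewrite mem_enum.
pose A : 'M[K]_(M, size s) := \matrix_(l, j) (P l)@_(nth 0%MM s j).
have Afree : row_free A.
  apply: inj_row_free => v vA; suff H l : v 0 l = 0 by apply/rowP => l; rewrite H mxE.
  move: l; apply: indep.
  suff SP : \sum_l (v 0 l)%:MP * P l = 0.
    have DF : D%:F != 0 by rewrite tofrac_eq0.
    apply: (mulfI DF); rewrite mulr0 mulr_sumr -[RHS]tofrac0 -SP rmorph_sum.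
    by apply: eq_bigr => l _; rewrite mulrCA PE; exact: esym (tofracM _ _).
  apply/mpolyP => m; rewrite mcoeff0 raddf_sum /=.
  have [ms|ms] := boolP (m \in s); last first.
    by apply: big1 => l _; rewrite mcoeffCM coef_s // mulr0.
  have /(congr1 (fun w : 'rV_(size s) => w 0 (Ordinal (etrans (index_mem m s) ms)))) := vA.
  rewrite !mxE => E; apply: etrans E; apply: eq_bigr => l _.
  by rewrite mcoeffCM mxE nth_index.
have fAfree : row_free (map_mx f A) by rewrite row_free_map.
have SP : \sum_l (c l)%:MP * coef_map f (P l) = 0.
  apply/eqP; rewrite -tofrac_eq0 rmorph_sum; apply/eqP.
  transitivity (coef_frac r f D%:F * \sum_l ratC r (c l) * coef_frac r f (x l)).
    rewrite mulr_sumr; apply: eq_bigr => l _; rewrite mulrCA -rmorphM PE coef_frac_tofrac.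
    exact: tofracM.
  by rewrite sum0 mulr0.
pose v : 'rV[K']_M := \row_l c l.
have vA : v *m map_mx f A = 0.
  apply/rowP => j; rewrite !mxE.
  have /(congr1 (mcoeff (nth 0%MM s j))) := SP; rewrite mcoeff0 raddf_sum /= => E.
  by apply: etrans E; apply: eq_bigr => l _; rewrite mcoeffCM !mxE coef_mapE.
have v0 : v = 0 by apply: (row_free_inj fAfree); rewrite vA mul0mx.
by move=> l; have /rowP/(_ l) := v0; rewrite !mxE.
Qed.
End ScalarExtension.

Section CoefficientPoles.
Variables (K K' : fieldType) (m0 : nat) (f : {rmorphism K -> K'}).
Local Notation n := m0.+4.
Lemma coef_frac_cr q : coef_frac n f (cross_ratio K q) = cross_ratio K' q.
Proof.
case: q => -[[a b] c] d.
by rewrite /cross_ratio fmorph_div !rmorphM !rmorphB !coef_fracX.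
Qed.
Lemma coef_frac_pole c q : coef_frac n f (@pole K m0 c q) = @pole K' m0 (f c) q.
Proof. by rewrite /pole fmorphV rmorphB coef_frac_cr; congr (_ - _)^-1; exact: coef_fracC. Qed.
Lemma coef_frac_pole_ring c x : @pole_ring K m0 c x -> @pole_ring K' m0 (f c) (coef_frac n f x).
Proof.
have sP := @pole_ring_subring K' m0 (f c).
apply: (@gen_sub _ _ (@ratC K n) _ (coef_frac n f @^-1` @pole_ring K' m0 (f c))).
- exact: preimage_subring.
- move=> d; suff : @pole_ring K' m0 (f c) (coef_frac n f (ratC n d)) by [].
  by rewrite coef_fracC; exact: gen_const.
move=> _ [q Dq <-]; suff : @pole_ring K' m0 (f c) (coef_frac n f (@pole K m0 c q)) by [].
by rewrite coef_frac_pole; exact: pole_ringP.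
Qed.
End CoefficientPoles.

Section FormOfM0nbar.
Variables (F L Fb : fieldType) (iF : {rmorphism F -> L}) (eps : {rmorphism L -> Fb}) (m0 : nat).
Variable sigma : {rmorphism F -> Fb}.
Hypothesis eps_iF : forall c, eps (iF c) = sigma c.
Hypothesis m0_gt1 : (1 < m0)%N.
Local Notation n := m0.+4.
Variables (G : {group 'S_n}) (act : [subg G] -> {rmorphism L -> L}) (N : nat) (e e' : 'I_N -> L).
Hypothesis gd : galois_data iF act e e'.
Local Notation Kb := (ratfun Fb n).
Local Notation KL := (ratfun L n).
Local Notation constL := (@ratC L n : {rmorphism L -> KL}).
Local Notation tw := (@tw L m0 G act).
Local Notation tfield := (@tfield L m0 G act).
Local Notation tval := (@tval L m0 G act).
Local Notation tconst := (@tconst F L iF m0 G act).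
Local Notation tring := (@tring F L iF m0 G act N e').
Local Notation PRb := (@pole_ring Fb m0).
Definition tbase : {rmorphism tfield -> Kb} := coef_frac n eps \o tval.
Lemma tbaseE y : tbase y = coef_frac n eps (tval y). Proof. by []. Qed.
Lemma tbase_const c : tbase (tconst c) = ratC n (sigma c).
Proof. by rewrite tbaseE (tconstE gd) -eps_iF; exact: coef_fracC. Qed.

(** Traces against [e'] turn a relation over L into relations over F, one for each basis vector. *)
Lemma tfield_disjoint M (x : 'I_M -> tfield) :
  (forall c : 'I_M -> F, \sum_l tconst (c l) * x l = 0 -> forall l, c l = 0) ->
  forall c : 'I_M -> L, \sum_l constL (c l) * tval (x l) = 0 -> forall l, c l = 0.
Proof.
move=> indep c sum0.
pose h i l := sval (cid (gd_trF gd (e' i * c l))).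
have hE i l : \sum_g act g (e' i * c l) = iF (h i l) by exact: svalP (cid (gd_trF gd (e' i * c l))).
have h0 i l : h i l = 0.
  move: l; apply: indep; apply: (fmorph_inj tval); rewrite rmorph0 rmorph_sum.
  have /(congr1 (fun y => tr tw (constL (e' i) * y))) := sum0.
  have -> : tr tw (constL (e' i) * 0) = 0 by apply: big1 => g _; rewrite mulr0 rmorph0.
  move=> E; apply: etrans E; rewrite mulr_sumr tr_sum; apply: eq_bigr => l _.
  have ix : invariant tw (tval (x l)) by exact: tval_inv.
  by rewrite rmorphM (tconstE gd) -hE mulrA -rmorphM (tr_mulr _ ix) (tr_l (twC act)).
move=> l; have := tr_expand gd (l := idfun) (a := act) (gd_M gd) (fun g x => erefl) (c l).
move=> ->; apply: big1 => i _; have -> : tr act (idfun (e' i) * c l) = iF (h i l) by exact: hE.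
by rewrite h0 rmorph0 mulr0.
Qed.
Lemma tbase_disjoint : linearly_disjoint tconst (@ratC Fb n) tbase.
Proof.
move=> M x indep; apply: (@coef_frac_disjoint L Fb n eps M (fun l => tval (x l))).
exact: tfield_disjoint.
Qed.
Lemma tbase_tring c : algebra_gen (@ratC Fb n) (tbase @` tring c) = PRb (sigma c).
Proof.
apply/seteqP; split.
  apply: gen_sub; [exact: pole_ring_subring|by move=> d; exact: gen_const|].
  move=> _ [y Ry <-]; rewrite tbaseE -eps_iF; apply: coef_frac_pole_ring.
  exact: (tring_pole gd).
apply: gen_sub; [exact: gen_subring|by move=> d; exact: gen_const|].
move=> _ [q Dq <-]; rewrite -eps_iF -coef_frac_pole.
have [c0 Rc0 ->] := pole_span gd (@pole_ringP L m0 (iF c) q Dq).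
have sG := gen_subring (@ratC Fb n) (tbase @` tring c).
rewrite rmorph_sum; apply: (subring_sum sG) => i _; rewrite rmorphM; apply: (subringM sG).
  have -> : coef_frac n eps (constL (e i)) = ratC n (eps (e i)) by exact: coef_fracC.
  exact: gen_const.
by apply: gen_mem; exists (c0 i).
Qed.

Variables (m : nat) (cs : 'I_m.+1 -> F).
Local Notation X := (@tmodel F L iF m0 G act N e' m cs).
(** The affine open set need not be one of the charts: the point over [Fb] is contracted to a point
    [T] of the form, which lies on some chart, and is then compared with the base change of that
    chart. *)
Lemma base_change_sub A : affine_open tconst X A ->
  Aff (algebra_gen (@ratC Fb n) (tbase @` A)) `<=` @M0nbar_pts Fb n.
Proof.
move=> [[s AE] AX] O; set B := algebra_gen _ _ => BO.
have sA : is_subring A by rewrite AE; exact: gen_subring.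
have sB : is_subring B by exact: gen_subring.
have [lO BsO OE] := Aff_local sB BO; have [sO _] := lO.
have AB y : A y -> B (tbase y) by move=> Ay; apply: gen_mem; exists y.
have pQ := maxid_prime lO sB BsO; have pP := preimage_prime sA pQ AB.
set P := A `&` _ in pP; set T := localization A P.
have [l _ TR] : X T by apply: AX; exists P.
set R := tring (cs l) in TR.
have [lT RT TE] := Aff_local (tring_subring _ _ _ _) TR.
have TO y : T y -> O (tbase y).
  move=> [a [b [Aa Ab Nb ->]]]; rewrite fmorph_div; apply: (subringM sO); first exact: (BsO _ (AB _ Aa)).
  have Bb := AB b Ab; suff [] : runit O (tbase b) by [].
  by apply: contrapT => nb; apply: Nb; split; [exact: Ab|split; [exact: Bb|split; [exact: (BsO _ Bb)|exact: nb]]].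
have PRE : PRb (sigma (cs l)) = algebra_gen (@ratC Fb n) (tbase @` R) by rewrite tbase_tring.
have sPR := @pole_ring_subring Fb m0 (sigma (cs l)).
have OC c : O (ratC n c) by apply: BsO; exact: gen_const.
have PRO : PRb (sigma (cs l)) `<=` O.
  by rewrite PRE; apply: gen_sub => // _ [y Ry <-]; apply: TO; exact: RT.
have RPR y : R y -> PRb (sigma (cs l)) (tbase y).
  by move=> Ry; rewrite PRE; apply: gen_mem; exists y.
apply: (pole_chart_pts m0_gt1 (c := sigma (cs l))); apply: (local_eq lO OE BsO sPR PRO).
apply: gen_sub.
- by apply: (is_subring_localization sPR); exact: maxid_prime.
- by move=> c; apply: localization_sub => //; exact: gen_const.
move=> _ [a Aa <-].
have Ta : T a by exists a, 1; split; [|exact: (subring1 sA)|case: pP => _ []|rewrite divr1].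
rewrite TE in Ta; have [b [t [Rb Rt Nt ->]]] := Ta.
exists (tbase b), (tbase t); split; [exact: RPR|exact: RPR| |exact: fmorph_div].
move=> [_ [_ nt]]; apply: Nt; split=> //; split; first exact: RT.
move=> [t0 Tt Ttv]; apply: nt; split; [by rewrite fmorph_eq0|exact: TO|].
by rewrite -fmorphV; exact: TO.
Qed.
Hypotheses (cs_inj : injective cs) (cs_big : (#|{: 'I_n * 'I_n * 'I_n * 'I_n}| < m.+1)%N).
Lemma base_changeE : base_change tconst (@ratC Fb n) tbase X = @M0nbar_pts Fb n.
Proof.
apply/seteqP; split=> O; first by move=> [A oA AO]; exact: base_change_sub AO.
move=> XO; pose s := [seq sigma (cs l) | l <- enum 'I_m.+1].
have us : uniq s by rewrite map_inj_uniq ?enum_uniq // => x y /fmorph_inj/cs_inj.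
have ss : (#|{: 'I_n * 'I_n * 'I_n * 'I_n}| < size s)%N by rewrite size_map size_enum_ord.
have [c cins cO] := pole_exists m0_gt1 XO us ss.
have [l _ cE] := mapP cins; rewrite cE in cO.
exists (tring (cs l)).
  split; first exact: tring_fg.
  by move=> O' AO'; exists l.
have -> : algebra_gen (@ratC Fb n) (tbase @` tring (cs l)) = PRb (sigma (cs l)) by exact: tbase_tring.
exact: (pole_chart m0_gt1).
Qed.
Theorem tmodel_form : is_form sigma tconst X n.
Proof.
exists Kb, (@ratC Fb n : {rmorphism Fb -> Kb}), tbase; split.
- by move=> c; exact: tbase_const.
- exact: tbase_disjoint.
have -> : base_change tconst (@ratC Fb n : {rmorphism Fb -> Kb}) tbase X = M0nbar Fb n.
  exact: base_changeE.
exact: isomorphic_refl.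
Qed.
End FormOfM0nbar.

(** * Galois extensions: dual bases, embeddings, size of the base field *)

Section DualBasis.
Variables (F L : fieldType) (iF : {rmorphism F -> L}) (gT : finGroupType).
Variables (act : gT -> {rmorphism L -> L}) (N : nat) (gg : 'I_N -> gT) (e : 'I_N -> L).
Hypotheses (actM : forall g h x, act (g * h)%g x = act h (act g x))
  (actF : forall g c, act g (iF c) = iF c)
  (act_fix : forall x, (forall g, act g x = x) -> exists c, x = iF c)
  (gg_bij : bijective gg).
Hypothesis M_unit : \matrix_(i, j) act (gg i) (e j) \in unitmx.
(** [e'] is the column at the identity of the inverse matrix; the second relation holds because a
    one-sided inverse of a square matrix is two-sided. *)
Lemma dual_basis_exists : exists e' : 'I_N -> L, galois_data iF act e e'.
Proof.
pose M : 'M[L]_N := \matrix_(i, j) act (gg i) (e j); have [rk ggK rkK] := gg_bij.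
pose e' j := invmx M j (rk 1%g); exists e'.
have dual g : \sum_i act g (e i) * e' i = (g == 1%g)%:R.
  have /matrixP/(_ (rk g) (rk 1%g)) := mulmxV M_unit; rewrite !mxE.
  have -> : (rk g == rk 1%g) = (g == 1%g) by apply: inj_eq; exact: can_inj rkK.
  by move=> <-; apply: eq_bigr => i _; rewrite mxE rkK.
split=> // i j.
pose E : 'M[L]_N := \matrix_(i, k) act (gg k) (e' i).
have ME : M *m E = 1%:M.
  apply/matrixP => h k; rewrite !mxE.
  have -> : (h == k) = (gg h * (gg k)^-1 == 1)%g.
    by rewrite -eq_mulgV1 (inj_eq (can_inj ggK)).
  rewrite -[RHS](rmorph_nat (act (gg k))) -dual rmorph_sum.
  by apply: eq_bigr => l _; rewrite !mxE rmorphM -actM mulgKV.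
have /matrixP/(_ j i) := mulmx1C ME; rewrite !mxE eq_sym => <-.
rewrite (reindex gg) /=; last exact: onW_bij.
by apply: eq_bigr => k _; rewrite !mxE rmorphM mulrC.
Qed.
End DualBasis.

Lemma galois_data_exists (F : fieldType) (L : splittingFieldType F) (rT : finGroupType)
    (G : {group rT}) : galois 1 {:L} -> ('Gal({:L} / 1) \isog G)%g ->
  exists (act : [subg G] -> {rmorphism L -> L}) (N : nat) (e e' : 'I_N -> L),
    galois_data (GRing.in_alg L : {rmorphism F -> L}) act e e'.
Proof.
move=> gal1; rewrite isog_sym => /isogP[f injf fG].
have [w _ [M_unit _ _]] := gal_matrix 'Gal({:L} / 1)%g.
pose act (g : [subg G]) : {rmorphism L -> L} := f (sgval g).
have fin (g : [subg G]) : f (sgval g) \in 'Gal({:L} / 1)%g.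
  by rewrite -fG; apply: mem_morphim; exact: subgP.
have ivin (x : gal_of {:L}) : x \in 'Gal({:L} / 1)%g -> invm injf x \in G.
  by rewrite -fG => /morphimP[g Gg _ ->]; rewrite invmE.
pose gg (i : 'I_#|'Gal({:L} / 1)%g|) : [subg G] := subg G (invm injf (enum_val i)).
have actgg i x : act (gg i) x = enum_val i x.
  rewrite /act /gg subgK; last exact/ivin/enum_valP.
  by rewrite invmK // fG; exact: enum_valP.
exists act, #|'Gal({:L} / 1)%g|, (fun j => tnth w j).
apply: (@dual_basis_exists _ _ _ _ _ _ gg).
- move=> g h x; have E : f (sgval (g * h)%g) = (f (sgval g) * f (sgval h))%g.
    by apply: (morphM f); exact: subgP.
  by apply: etrans (congr1 (fun y : gal_of {:L} => y x) E) _; exact: galM (memvf x).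
- by move=> g c; rewrite /act; exact: rmorph_alg.
- move=> x fx; have : x \in fixedField 'Gal({:L} / 1)%g.
    apply/fixedFieldP => [|y]; first exact: memvf.
    rewrite -fG => /morphimP[g Gg _ ->]; have := fx (subg G g).
    by rewrite /act subgK.
  by rewrite (elimT galois_fixedField gal1) => /vlineP[c ->]; exists c.
- exists (fun g => enum_rank_in (group1 _) (f (sgval g))).
    move=> i; rewrite /gg subgK; last exact/ivin/enum_valP.
    rewrite invmK; last by rewrite fG; exact: enum_valP.
    exact: enum_valK_in.
  move=> g; rewrite /gg enum_rankK_in; last exact: fin.
  by rewrite invmE ?sgvalK //; exact: subgP.
congr (_ \in unitmx): M_unit; apply/matrixP => i j; rewrite !mxE.
by rewrite actgg.
Qed.

(** The second hypothesis makes the map from q(z) to q(zeta) well defined. *)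
Lemma field_embedding (F L Fb : fieldType) (iF : {rmorphism F -> L}) (sigma : {rmorphism F -> Fb})
    (z : L) (zeta : Fb) :
  (forall y, exists q, y = (map_poly iF q).[z]) ->
  (forall q, (map_poly iF q).[z] = 0 -> (map_poly sigma q).[zeta] = 0) ->
  exists eps : {rmorphism L -> Fb}, forall c, eps (iF c) = sigma c.
Proof.
move=> full z0; pose f y := (map_poly sigma (sval (cid (full y)))).[zeta].
have fE q : f (map_poly iF q).[z] = (map_poly sigma q).[zeta].
  rewrite /f; case: cid => q' /= qE; apply/eqP; rewrite -subr_eq0 -hornerN -hornerD -rmorphB.
  by apply/eqP/z0; rewrite rmorphB hornerD hornerN -qE subrr.
have fB : zmod_morphism f.
  move=> x y; have [p ->] := full x; have [q ->] := full y.
  by rewrite -hornerN -hornerD -rmorphB !fE rmorphB hornerD hornerN.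
have fM : monoid_morphism f.
  split; first by have := fE 1; rewrite !rmorph1 !hornerC.
  move=> x y; have [p ->] := full x; have [q ->] := full y.
  by rewrite -hornerM -rmorphM !fE rmorphM hornerM.
pose mB := GRing.isZmodMorphism.Build _ _ f fB; pose mM := GRing.isMonoidMorphism.Build _ _ f fM.
pose eps : {rmorphism L -> Fb} := HB.pack f mB mM.
exists eps => c; have := fE c%:P; rewrite !map_polyC !hornerC; exact.
Qed.
Lemma galois_embedding (F : fieldType) (L : splittingFieldType F) (Fb : closedFieldType)
    (sigma : {rmorphism F -> Fb}) : galois 1 {:L} ->
  exists eps : {rmorphism L -> Fb}, forall c, eps (GRing.in_alg L c) = sigma c.
Proof.
move=> /and3P[_ sepL _]; pose z := separable_generator 1 {:L}.
have Lz : {:L}%VS = <<1; z>>%VS by apply: eq_adjoin_separable_generator => //; exact: sub1v.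
have /polyOver1P[p pE] := minPolyOver 1 z.
have szp : size (map_poly sigma p) != 1%N.
  by rewrite size_map_poly -(size_map_poly (GRing.in_alg L)) -pE size_minPoly.
have [zeta /rootP zeta0] := closed_rootP _ szp.
apply: (@field_embedding _ _ _ _ _ z zeta).
  move=> y; have yz : y \in <<1; z>>%VS by rewrite -Lz memvf.
  have /polyOver1P[q qE] := Fadjoin_polyOver 1 z y.
  by exists q; rewrite -qE Fadjoin_poly_eq.
move=> q qz; have : minPoly 1 z %| map_poly (GRing.in_alg L) q.
  by apply: minPoly_dvdp; [apply/polyOver1P; exists q|exact/rootP].
rewrite pE dvdp_map => /dvdpP[u ->]; by rewrite rmorphM hornerM zeta0 mulr0.
Qed.

Lemma finFieldType_cyclic (F : finFieldType) (L : splittingFieldType F) : cyclic 'Gal({:L} / 1)%g.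
Proof.
have [a /eqP -> _] := finField_galois_generator (sub1v {:L}%AS).
exact: cycle_cyclic.
Qed.
(** The list of elements equips [F] with the structure of a finite field, over which Galois groups
    are cyclic. *)
Lemma finite_field_cyclic (F : fieldType) (s : seq F) (sP : forall x, x \in s)
  (L : splittingFieldType F) : cyclic 'Gal({:L} / 1)%g.
Proof.
have sK : pcancel (fun x => index x s) (fun i => nth None [seq Some x | x <- s] i).
  by move=> x; rewrite (nth_map x) ?index_mem // nth_index.
have sax : Finite.axiom (undup s) by move=> x; rewrite count_uniq_mem ?undup_uniq // mem_undup sP.
case: F s sP L sK sax => F [c1 c2 c3 c4 c5 c6 c7 c8 c9 c10 c11 c12 c13 c14 c15] s sP L sK sax.
set Fd := GRing.Field.Pack _ in s sP L sK sax *.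
pose cnt := @PCanIsCountable nat Fd _ _ sK.
pose fin := @isFinite.Build Fd (undup s) sax.
pose F' : finFieldType := HB.pack F Fd cnt fin.
exact: (@finFieldType_cyclic F' L).
Qed.

Lemma finite_or_many (T : choiceType) k : (exists s : seq T, forall x, x \in s) \/
  exists s : seq T, uniq s /\ size s = k.
Proof.
elim: k => [|k [IH|[s [us ss]]]]; [by right; exists [::]|by left|].
have [sP|/existsNP[x xs]] := pselect (forall x, x \in s); first by left; exists s.
by right; exists (x :: s); rewrite /= us ss andbT; split=> //; apply/negP.
Qed.

Theorem theorem1 (n : nat) (n_ge6 : (6 <= n)%N) (n_even : ~~ odd n) :
  exists G : {group 'S_n},
    [/\ (G \isog [set: 'Z_2 * 'Z_2]%SET)%g,
        forall k : closedFieldType,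
          exists f : {additive H1 (@pic_M0nbar_act k n G) -> 'Z_2}, bijective f,
        forall (k : closedFieldType) (H : {group 'S_n}), G \subset H ->
          ~ stably_linearizable (@ratC k n) H (@perm_vars k n)
              (pts (M0nbar k n))
      & forall (F : fieldType) (L : splittingFieldType F),
          galois 1 {:L} -> ('Gal({:L} / 1) \isog G)%g ->
          forall (Fb : closedFieldType) (sigma : {rmorphism F -> Fb}),
          (forall x : Fb, algebraicOver sigma x) ->
          exists (K : fieldType) (i : {rmorphism F -> K}) (X : set (set K)),
            [/\ is_variety i X, is_form sigma i X n & ~ retract_rational i X]].
Proof.
case: n n_ge6 n_even => [|[|[|[|m0]]]] // m0_gt1 m0_even4.
have m0_even : ~~ odd m0 by rewrite /= !negbK in m0_even4.
have isoZ : (Gkl m0_gt1 m0_even \isog [set: 'Z_2 * 'Z_2]%SET)%g.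
  exact: (klein_isog _ _ _ (sg1 _ _) (tg1 _ _) (sg_neq_tg _ _)).
exists (Gkl m0_gt1 m0_even); split.
- exact: isoZ.
- by move=> k; exact: H1_klein.
- by move=> k H GH; exact: (not_stably_linearizable GH).
move=> F L gal1 isoG Fb sigma _.
have [act [N [e [e' gd]]]] := galois_data_exists gal1 isoG.
have [eps eps_sigma] := galois_embedding sigma gal1.
(* The charts are indexed by m + 1 constants, one more than there are quadruples; a base field too
   small for that would be finite, with a cyclic Galois group. *)
pose m := #|{: 'I_m0.+4 * 'I_m0.+4 * 'I_m0.+4 * 'I_m0.+4}|.
have [s [us sm]] : exists s : seq F, uniq s /\ size s = m.+1.
  have [[s sP]|//] := @finite_or_many F m.+1; exfalso.
  have := finite_field_cyclic sP L; rewrite (isog_cyclic isoG) (isog_cyclic isoZ).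
  by rewrite (abelem_cyclic Z2Z2_abelem) cardsT card_prod !card_ord.
pose cs (l : 'I_m.+1) : F := s`_l.
have cs_inj : injective cs.
  move=> l l' /eqP; rewrite nth_uniq ?sm // => /eqP; exact: val_inj.
exists (tfield act), (tconst_morph gd), (tmodel (GRing.in_alg L) e' cs); split.
- exact: (tmodel_variety m0_gt1 gd).
- exact: (tmodel_form eps_sigma m0_gt1 gd cs_inj (ltnSn m)).
exact: (tmodel_not_retract_rational gd).
Qed.
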